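(* Let $\kappa\in\mathbb{R}$, $n\ge 1$, and consider the $n$-dimensional weighted Euler-Poisson equations for $\rho$ and $\mathbf{u}(\cdot,t):\mathbb{R}^n\to\mathbb{R}^n$, $$\rho_t+\nabla\cdot(\rho\mathbf{u})=0,\qquad (\rho\mathbf{u})_t+\nabla\cdot(\rho\mathbf{u}\otimes\mathbf{u})=\kappa\rho|\mathbf{x}|^{n-1}\nabla V,\qquad \Delta V=\rho,$$ subject to spherically symmetric initial data $\rho_0(\mathbf{x})\mathbf{u}_0(\mathbf{x}):=\rho_0(|\mathbf{x}|)u_0(|\mathbf{x}|)\frac{\mathbf{x}}{|\mathbf{x}|}$ such that $0\le\rho(\mathbf{x},0)=\rho_0(|\mathbf{x}|)\in L^1(\mathbb{R}^n)$ and $u_0(|\mathbf{x}|)\in C^1(\mathbb{R}_+)$. Let $$E_0(r):=r^{n-1}V_r(|\mathbf{x}|,0)=\int_0^r s^{n-1}\rho_0(s)\,ds,\qquad r=|\mathbf{x}|,$$ $$Q_{r,t}(s):=s+tu_0(s)+\tfrac12\kappa E_0(s)t^2-r,$$ $$y(r,t):=\sup\Big\{y\ \Big|\ y\text{ is a minimizer of } y\mapsto\int_0^yQ_{r,t}(s)s^{n-1}\rho_0(s)\,ds\text{ over } y\ge 0\Big\},$$ and $$R(r,t)=\int_0^{y(r,t)}\rho_0(s)s^{n-1}\,ds,\qquad M(r,t)=\int_0^{y(r,t)}\rho_0(s)\big(u_0(s)+\kappa E_0(s)t\big)s^{n-1}\,ds.$$ Then the system admits a weak radial solution $(\rho,\rho\mathbf{u})$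 of the form $$\rho(\mathbf{x},t)=\frac{1}{r^{n-1}}\frac{\partial R(r,t)}{\partial r},\qquad \rho(\mathbf{x},t)\mathbf{u}(\mathbf{x},t)=\frac{\mathbf{x}}{r}\,\frac{1}{r^{n-1}}\frac{\partial M(r,t)}{\partial r},\qquad r:=|\mathbf{x}|.$$
   Context: Here the potential $V$ is radial. Writing $\rho=\rho(r,t)$, $\mathbf{u}=w(r,t)\,\mathbf{x}/r$, the identity $\Delta V=\rho$ becomes $(r^{n-1}V_r)_r=r^{n-1}\rho$, and $E:=r^{n-1}V_r$ denotes the electric field, so that $|\mathbf{x}|^{n-1}\nabla V=E\,\mathbf{x}/r$. Derivatives $\partial_rR$, $\partial_rM$ are distributional, so $\rho$ and $\rho\mathbf{u}$ may be measures. When $\varsigma:=r^{n-1}\rho$ has Dirac masses, $E$ is given by the average rule $$E(r,t)=\frac12\left(\int_0^{r-}\varsigma(s,t)\,ds+\int_0^{r+}\varsigma(s,t)\,ds\right).$$ The velocity $\mathbf{u}$ is the density of the measure $\rho\mathbf{u}$ with respect to $\rho$, and $\rho\mathbf{u}\otimes\mathbf{u}$ is the corresponding measure. Weak solution means that the equations, with the given initial data, hold in the sense of distributions (tested against smooth compactly supported functions on $\mathbb{R}^n\times[0,\infty)$, with the usual initial-data terms at $t=0$).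
   Formalization: Adds the hypothesis that for all r>0, t≥0 the functional defining y(r,t) has a minimizer over y≥0; without it (e.g. κ=0, u₀(s)=−s², r^{n−1}ρ₀=(1+r)^{−2}) there is none for any t>0, y(r,t) is undefined and the claim fails. *)

(* Defs.v *)
From HB Require Import structures.
From mathcomp Require Import all_boot all_order all_algebra.
From mathcomp Require Import all_classical all_reals all_analysis.
Set Implicit Arguments.
Unset Strict Implicit.
Unset Printing Implicit Defensive.
Import Order.TTheory GRing.Theory Num.Theory.
Import numFieldNormedType.Exports.
Local Open Scope classical_set_scope.
Local Open Scope ring_scope.

Section borel_rV.
Context {R : realType} (n : nat).

Let coor (i : 'I_n) (x : 'rV[R]_n) : measurableTypeR R := x 0 i.

Let rV_set0 : g_sigma_preimage coor set0.
Proof. exact: sigma_algebra0. Qed.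

Let rV_setC A : g_sigma_preimage coor A -> g_sigma_preimage coor (~` A).
Proof. exact: sigma_algebraC. Qed.

Let rV_bigcup (F : (set 'rV[R]_n)^nat) :
  (forall i, g_sigma_preimage coor (F i)) ->
  g_sigma_preimage coor (\bigcup_i (F i)).
Proof. exact: sigma_algebra_bigcup. Qed.

(* The Borel sigma-algebra of R^n, generated by the coordinate functions (as
   the library does for n.-tuple). *)
HB.instance Definition _ := @isMeasurable.Build default_measure_display
  'rV[R]_n (g_sigma_preimage coor) rV_set0 rV_setC rV_bigcup.

Lemma measurable_coor (i : 'I_n) :
  measurable_fun setT (fun x : 'rV[R]_n => x 0 i : measurableTypeR R).
Proof.
move=> _ Y mY; rewrite setTI; apply: sub_sigma_algebra => /=.
rewrite -bigcup_seq/=; exists i => /=; first by rewrite mem_index_enum.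
by exists Y => //; rewrite setTI.
Qed.

Lemma measurable_fun_rV d (T : measurableType d) (f : T -> 'rV[R]_n) :
  (forall i, measurable_fun setT (fun t => f t 0 i : measurableTypeR R)) ->
  measurable_fun setT f.
Proof.
move=> mf _ A mA; rewrite setTI.
have : (g_sigma_preimage (fun i => coor i \o f)) (f @^-1` A).
  by rewrite g_sigma_preimage_comp; exists A => //; rewrite setTI.
apply: smallest_sub; first exact: sigma_algebra_measurable.
rewrite -bigcup_seq/=; apply: bigcup_sub => i _ B [C mC <-].
exact: mf.
Qed.

End borel_rV.

Section lebesgue_rV.
Context {R : realType}.

Definition cons_rV n (p : measurableTypeR R * 'rV[R]_n) : 'rV[R]_n.+1 :=
  \row_(i < n.+1) if unlift ord0 i is Some j then p.2 0 j else p.1.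

Definition uncons_rV n (x : 'rV[R]_n.+1) : measurableTypeR R * 'rV[R]_n :=
  (x 0 ord0, \row_(j < n) x 0 (lift ord0 j)).

Lemma cons_rVK n : cancel (@cons_rV n) (@uncons_rV n).
Proof.
move=> [s x]; rewrite /uncons_rV /cons_rV mxE unlift_none /=; congr pair.
by apply/rowP => j; rewrite !mxE liftK.
Qed.

Lemma measurable_cons_rV n : measurable_fun setT (@cons_rV n).
Proof.
apply: measurable_fun_rV => i.
case: (unliftP ord0 i) => [j ->|->].
- have mj : measurable_fun setT
      ((fun x : 'rV[R]_n => x 0 j : measurableTypeR R) \o
       (snd : measurableTypeR R * 'rV[R]_n -> 'rV[R]_n)).
    by apply: measurableT_comp => //; exact: measurable_coor.
  by apply: eq_measurable_fun mj => p _; rewrite mxE liftK.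
- have mj : measurable_fun setT
    (fst : measurableTypeR R * 'rV[R]_n -> measurableTypeR R) by [].
  by apply: eq_measurable_fun mj => p _; rewrite mxE unlift_none.
Qed.

Lemma measurable_uncons_rV n : measurable_fun setT (@uncons_rV n).
Proof.
apply/measurable_fun_pairP; split; first exact: measurable_coor.
apply: measurable_fun_rV => i.
have := @measurable_coor R n.+1 (lift ord0 i).
by apply: eq_measurable_fun => x _; rewrite /= mxE.
Qed.

Section step.
Variables (n : nat) (mu : {sigma_finite_measure set 'rV[R]_n -> \bar R}).

Definition lebesgue_rV_step : set 'rV[R]_n.+1 -> \bar R :=
  pushforward ((@lebesgue_measure R) \x mu)%E (@cons_rV n).

HB.instance Definition _ := Measure.copy lebesgue_rV_step
  (measure_function_pushforward__canonical__measure_function_Measure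
    ((@lebesgue_measure R) \x mu)%E (@measurable_cons_rV n)).

Let step_sigma_finite : sigma_finite setT lebesgue_rV_step.
Proof.
have /sigma_finiteP[F [TF ndF Foo]] := sigma_finiteT (@lebesgue_measure R).
have /sigma_finiteP[G [TG ndG Goo]] := sigma_finiteT mu.
exists (fun k => @uncons_rV n @^-1` (F k `*` G k)).
  rewrite -preimage_bigcup (_ : \bigcup_k _ = setT) ?preimage_setT//.
  rewrite predeqE => -[x y]; split => // _.
  have [i _ Fi] : (\bigcup_i F i) x by rewrite -TF.
  have [j _ Gj] : (\bigcup_i G i) y by rewrite -TG.
  exists (maxn i j) => //; split.
  - by move: x Fi; exact/subsetPset/ndF/leq_maxl.
  - by move: y Gj; exact/subsetPset/ndG/leq_maxr.
move=> k; have [mF Fk] := Foo k; have [mG Gk] := Goo k; split.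
  rewrite -[X in measurable X]setTI; apply: measurable_uncons_rV => //.
  exact: measurableX.
rewrite /lebesgue_rV_step /pushforward -comp_preimage.
rewrite (_ : _ \o _ = id); last by apply/funext => p /=; rewrite cons_rVK.
rewrite preimage_id product_measure1E// lte_mul_pinfty//.
by rewrite ge0_fin_numE.
Qed.

HB.instance Definition _ := Measure_isSigmaFinite.Build _ _ _
  lebesgue_rV_step step_sigma_finite.

End step.

(* Lebesgue measure on R^n, as the n-fold product of the one on R. *)
Fixpoint lebesgue_rV n : {sigma_finite_measure set 'rV[R]_n -> \bar R} :=
  if n is m.+1 then lebesgue_rV_step (lebesgue_rV m)
  else @dirac _ 'rV[R]_0 0 R.

End lebesgue_rV.

Section test_functions.
Context {R : realType}.

(* f is of class C^k: its iterated directional derivatives up to order k exist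
   and are continuous. *)
Fixpoint Ck (k : nat) (V : normedModType R) (f : V -> R) : Prop :=
  if k is k'.+1 then
    [/\ continuous f, forall x v, derivable f x v & forall v, Ck k' ('D_v f)]
  else continuous f.

Definition test_function (V : normedModType R) (f : V -> R) : Prop :=
  (forall k, Ck k f) /\ compact (closure [set x | f x != 0]).

(* C^1 up to the endpoint 0: f' is only required on ]0, +oo[, but it has a
   continuous extension g to [0, +oo[. *)
Definition C1_halfline (f : R -> R) : Prop :=
  {within `[0, +oo[, continuous f} /\
  exists2 g : R -> R, {within `[0, +oo[, continuous g} &
    forall r : R, 0 < r -> is_derive r (1 : R) f (g r).

Definition partial n (i : 'I_n) (f : 'rV[R]_n -> R) : 'rV[R]_n -> R :=
  'D_(delta_mx 0 i) f.

Definition laplacian n (f : 'rV[R]_n -> R) (x : 'rV[R]_n) : R :=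
  \sum_(i < n) partial i (partial i f) x.

Definition spartial n (i : 'I_n) (phi : 'rV[R]_n * R -> R)
    (x : 'rV[R]_n) (t : R) : R := 'D_(delta_mx 0 i, 0) phi (x, t).

Definition tpartial n (phi : 'rV[R]_n * R -> R) (x : 'rV[R]_n) (t : R) : R :=
  'D_(0, 1) phi (x, t).

End test_functions.

Section radial.
Context {R : realType}.

Definition enorm n (x : 'rV[R]_n) : R := Num.sqrt (\sum_(i < n) x 0 i ^+ 2).

Definition eball n (B : R) : set 'rV[R]_n := [set x | enorm x <= B].

(* x / |x|; since 0^-1 = 0 this is the zero vector at the origin, the only
   value compatible with spherical symmetry. *)
Definition dir n (x : 'rV[R]_n) : 'rV[R]_n := (enorm x)^-1 *: x.

(* The surface measure of the unit sphere, through the volume of cones: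
   |S| = n vol {x in the unit ball | x / |x| in S}. For n = 1 it is the
   counting measure of {-1, 1}. *)
Definition sphere_measure n (S : set 'rV[R]_n) : \bar R :=
  (n%:R%:E * lebesgue_rV n [set x | (0 < enorm x <= 1)%R /\ S (dir x)])%E.

(* The radial measure rho(x)dx = sigma(dr) domega on R^n, i.e. the one with
   sigma = r^(n-1) rho(r)dr as a measure on [0, +oo[; an atom of sigma at 0
   becomes an atom at the origin. *)
Definition polar_measure n (sigma : {measure set (measurableTypeR R) -> \bar R})
    (A : set 'rV[R]_n) : \bar R :=
  (\int[sigma]_(r in `[0%R, +oo[) sphere_measure [set omega | A (r *: omega)])%E.

(* The average rule: int_0^(r-) sigma and int_0^(r+) sigma are the masses of
   [0, r[ and [0, r]. *)
Definition electric_field (sigma : {measure set (measurableTypeR R) -> \bar R})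
    (r : R) : R :=
  (fine (sigma `[0, r[%classic) + fine (sigma `[0, r]%classic)) / 2.

(* The measure g dsigma on [0, +oo[ is the distributional derivative F' on R
   of F extended by 0 to r < 0; thus F(0+) is the mass at 0. *)
Definition distr_derivative (sigma : {measure set (measurableTypeR R) -> \bar R})
    (g F : R -> R) : Prop :=
  forall psi : R -> R, test_function psi ->
  [/\ sigma.-integrable `[0, +oo[ (fun r => (psi r * g r)%:E),
      (@lebesgue_measure R).-integrable `[0, +oo[
        (fun r => (derive1 psi r * F r)%:E) &
      \int[sigma]_(r in `[0, +oo[) (psi r * g r) =
      - \int[@lebesgue_measure R]_(r in `[0, +oo[) (derive1 psi r * F r)].

End radial.

Section euler_poisson.
Context {R : realType} (n : nat) (kappa : R) (rho0 u0 : R -> R).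

Let dx := @lebesgue_rV R n.
Let dt := @lebesgue_measure R.

Definition velocity (w : R -> R -> R) (t : R) (x : 'rV[R]_n) : 'rV[R]_n :=
  w (enorm x) t *: dir x.

Definition spacetime_integral
    (rho : R.-ker (measurableTypeR R) ~> 'rV[R]_n)
    (f : 'rV[R]_n -> R -> R) : R :=
  \int[dt]_(t in `[0, +oo[) \int[rho t]_x f x t.

(* Test functions on R^n x [0, +oo[ are the restrictions of those on R^n x R,
   which need not vanish at t = 0. rho t is the density at time t (a measure on
   R^n), sigma t the radial measure r^(n-1) rho dr, and w the radial velocity;
   the values at t < 0 play no role. *)
Record weak_radial_solution
    (rho : R.-ker (measurableTypeR R) ~> 'rV[R]_n)
    (sigma : R.-ker (measurableTypeR R) ~> (measurableTypeR R))
    (w : R -> R -> R) : Prop := WeakRadialSolution {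
  wrs_radial : forall t : R, 0 <= t -> forall A, measurable A ->
    rho t A = polar_measure (sigma t) A ;
  wrs_measurable : measurable_fun setT
    (fun p : measurableTypeR R * measurableTypeR R =>
       w p.1 p.2 : measurableTypeR R) ;
  (* Local bounds making every integral below absolutely convergent. *)
  wrs_locally_finite : forall B T : R, exists C : R,
    forall t : R, 0 <= t <= T -> (rho t (eball B) <= C%:E)%E ;
  wrs_locally_finite_energy : forall B T : R,
    (\int[dt]_(t in `[0%R, T]) \int[rho t]_(x in eball B)
       ((enorm (velocity w t x) ^+ 2)%:E) < +oo)%E ;
  wrs_mass : forall phi : 'rV[R]_n * R -> R, test_function phi ->
    spacetime_integral rho (fun x t =>
      tpartial phi x t + \sum_(j < n) spartial j phi x t * velocity w t x 0 j)
    + \int[dx]_x (phi (x, 0) * rho0 (enorm x)) = 0 ;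
  wrs_momentum : forall i : 'I_n,
    forall phi : 'rV[R]_n * R -> R, test_function phi ->
    spacetime_integral rho (fun x t =>
      tpartial phi x t * velocity w t x 0 i
      + \sum_(j < n) spartial j phi x t
          * (velocity w t x 0 i * velocity w t x 0 j))
    + \int[dx]_x (phi (x, 0) * (rho0 (enorm x) * u0 (enorm x) * dir x 0 i))
    = - spacetime_integral rho (fun x t =>
          phi (x, t) * (kappa * electric_field (sigma t) (enorm x) * dir x 0 i)) ;
  (* Delta V = rho, with V radial and r^(n-1) V_r = E *)
  wrs_poisson : forall t : R, 0 <= t -> exists V : R -> R,
    (forall a b : R, 0 < a -> a <= b -> V b - V a =
       \int[dt]_(r in `[a, b]) (electric_field (sigma t) r / r ^+ n.-1)) /\
    (forall phi : 'rV[R]_n -> R, test_function phi ->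
       dx.-integrable setT (fun x => (V (enorm x) * laplacian phi x)%:E) /\
       \int[dx]_x (V (enorm x) * laplacian phi x) = \int[rho t]_x phi x)
}.

Definition E0 (r : R) : R := \int[dt]_(s in `[0, r]) (s ^+ n.-1 * rho0 s).

Definition Q (r t s : R) : R :=
  s + t * u0 s + 2^-1 * kappa * E0 s * t ^+ 2 - r.

Definition Q_primitive (r t y : R) : R :=
  \int[dt]_(s in `[0, y]) (Q r t s * (s ^+ n.-1 * rho0 s)).

Definition Q_minimizers (r t : R) : set R :=
  [set y | 0 <= y /\ forall z, 0 <= z -> Q_primitive r t y <= Q_primitive r t z].

(* The supremum is +oo when rho0 vanishes far away and r is large. *)
Definition y_sup (r t : R) : \bar R := ereal_sup (EFin @` Q_minimizers r t).

Definition labels (r t : R) : set R :=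
  [set s | 0 <= s /\ (s%:E <= y_sup r t)%E].

Definition R_fun (t r : R) : R :=
  \int[dt]_(s in labels r t) (rho0 s * s ^+ n.-1).

Definition M_fun (t r : R) : R :=
  \int[dt]_(s in labels r t) (rho0 s * (u0 s + kappa * E0 s * t) * s ^+ n.-1).

End euler_poisson.

(* Main.v *)
Require Import Defs.
From HB Require Import structures.
From mathcomp Require Import all_boot all_order all_algebra.
From mathcomp Require Import all_classical all_reals all_analysis.
From mathcomp Require Import measurable_realfun ring lra.
Set Implicit Arguments.
Unset Strict Implicit.
Unset Printing Implicit Defensive.
Import Order.TTheory GRing.Theory Num.Theory.
Import numFieldNormedType.Exports.
Local Open Scope classical_set_scope.
Local Open Scope ring_scope.

(** Let mu be the initial mass s^(n-1) rho0(s) ds on the half-line of labels s,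
v(t, s) = u0(s) + kappa E0(s) t the velocity that the label s has at time t, and
Y(t, s) = s + t u0(s) + kappa E0(s) t^2 / 2 its position, both in the absence of
collisions.  The field that acts on a label is constant in time because the
mass enclosed by it is.  The function to minimize is F(r, t, y), the integral of
Y(t, .) - r over the labels in [0, y].  Its minimizers are monotone in r, so
that X(s, t), the infimum of the radii r that have a minimizer y >= s, is
nondecreasing in s: it is the position of the label s when colliding labels
stick together.  The solution is the image of mu times the measure of the
sphere under (s, omega) |-> X(s, t) omega.  Labels with a common position form
a block, and the velocity w(r, t) is the mean of v(t, .) over the block at r,
or, where that block has no mass, the value of v(t, .) at its label.

The heart of the matter is the equation dX/dt = w(X, t), for almost every time
and almost every label ([position_derivative]).  Positions are locally Lipschitz
in time, hence differentiable at almost every time; on a block all positions have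
the same slope ([block_slope]).  A minimizer for (r, t) and one for (r', t + h)
enclose an interval of labels over which the integral of
Y(t + h, .) - Y(t, .) - (r' - r) is nonpositive ([two_point]); for r' slightly
beyond the predicted position of the block these intervals shrink to the block,
and the limits h -> 0+ and h -> 0- bound the mean of v from both sides by the
slope ([block_average]).  Off the blocks of positive mass X(., t) is strictly
increasing at almost every label, and the same comparison on a small interval
around the label gives the slope v ([slope_nonatom]).  At the centre the slope
is 0, as X >= 0.

Integrated against a function of the position, w may be replaced by v
([velocity_field_test]) and the average rule for the field by E0
([average_mass_test]): both say that a mean over each block is the right one.
For the field this is the identity int_B mu(B, labels <= s) dmu(s) = mu(B)^2/2,
the reason for the factor 1/2 in the average rule.  For a test function phi the
integrals of phi(X omega, t) and of v phi(X omega, t) omega_i are therefore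
Lipschitz in t, their derivatives are what the equations of mass and of momentum
ask for, and they vanish for large t, so that the derivatives integrate to minus
the initial values ([evolution_identity], [mass_balance], [momentum_balance]).
Mass at the centre has no direction; it does not contribute to the momentum,
because omega_i averages to zero over the sphere ([angular_average]).

Poisson's equation is the superposition of the potentials of the spheres of
radius X(s, t): the fundamental solution cut off inside a sphere satisfies
Green's identity ([green_identity]), and so does its integral over the labels
([potential_laplacian]).  Finally R and M are the distribution functions of mass
and momentum because, up to null sets and to the countably many radii of blocks,
the labels s <= y(r, t) are those with X(s, t) <= r ([label_set_position]). *)

(** * Almost everywhere statements and dominated convergence *)

Lemma aeS d (T : measurableType d) (R : realType)
    (mu : {measure set T -> \bar R}) (P Q : T -> Prop) :
  (forall x, P x -> Q x) -> {ae mu, forall x, P x} -> {ae mu, forall x, Q x}.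
Proof. by move=> PQ; apply: filterS. Qed.

Lemma aeS2 d (T : measurableType d) (R : realType)
    (mu : {measure set T -> \bar R}) (P Q S : T -> Prop) :
  (forall x, P x -> Q x -> S x) ->
  {ae mu, forall x, P x} -> {ae mu, forall x, Q x} -> {ae mu, forall x, S x}.
Proof. by move=> PQS; apply: filterS2. Qed.

Section rdct.
Context d (T : measurableType d) (R : realType).
Variable mu : {measure set T -> \bar R}.

Lemma integrable_le_cst (D : set T) (f : T -> R) (C : R) : measurable D ->
  (mu D < +oo)%E -> measurable_fun D f -> (forall x, D x -> `|f x| <= C) ->
  mu.-integrable D (EFin \o f).
Proof.
move=> mD Dfin mf fC; apply: measurable_bounded_integrable => //.
exists C; split; first exact: num_real.
by move=> M CM x Dx /=; rewrite (le_trans (fC _ Dx))// ltW.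
Qed.

Lemma Rdominated_convergence (D : set T) (f_ : (T -> R)^nat) (f g : T -> R) :
  measurable D -> (forall k, measurable_fun D (f_ k)) -> measurable_fun D f ->
  {ae mu, forall x, D x -> f_ k x @[k --> \oo] --> f x} ->
  mu.-integrable D (EFin \o g) ->
  {ae mu, forall x, forall k, D x -> `|f_ k x| <= g x} ->
  mu.-integrable D (EFin \o f) /\
  \int[mu]_(x in D) f_ k x @[k --> \oo] --> \int[mu]_(x in D) f x.
Proof.
move=> mD mf_ mf f_f ig f_g.
have [] := @dominated_convergence _ _ _ mu _ mD (fun k x => (f_ k x)%:E)
  (EFin \o f) (EFin \o g).
- by move=> k; apply/measurable_EFinP.
- exact/measurable_EFinP.
- apply: filterS f_f => x h Dx; apply/fine_cvgP; split; first exact: nearW.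
  exact: h.
- exact: ig.
- apply: filterS f_g => x h k Dx /=; rewrite lee_fin; exact: h.
move=> intf _ h; split => //.
apply: fine_cvg; rewrite fineK//; exact: integrable_fin_num.
Qed.

End rdct.

(** * Lipschitz functions of one variable *)

Section stieltjes.
Context {R : realType}.
Notation mu := (@lebesgue_measure R).

Lemma lebesgue_stieltjes_oc (f : cumulative R R) (a b : R) : a <= b ->
  lebesgue_stieltjes_measure f `]a, b]%classic = (f b - f a)%:E.
Proof.
move=> ab; rewrite /lebesgue_stieltjes_measure /measure_extension/=.
by rewrite measurable_mu_extE/= ?wlength_itv_bnd//; exact: is_ocitv.
Qed.

Lemma lipschitz_half_continuous (g : R -> R) (L : R) :
  (forall x y, `|g x - g y| <= L * `|x - y|) -> continuous g.
Proof.
move=> gL x; apply/cvgrPdist_lt => e e0.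
have [L0|L0] := leP L 0.
  apply: nearW => y; apply: (le_lt_trans (gL _ _)).
  by apply: le_lt_trans e0; rewrite mulr_le0_ge0.
near=> y; apply: (le_lt_trans (gL _ _)).
rewrite mulrC -ltr_pdivlMr//; near: y.
apply: (@nbhsx_ballx _ _ x).
by rewrite divr_gt0.
Unshelve. all: by end_near. Qed.

Lemma near_shift_derivable (F f : R -> R) (x c : R) :
  (\forall y \near x, F y + c = f y) -> derivable F x 1 -> derivable f x 1.
Proof. by move=> Ff dF; apply: near_eq_derivable Ff _; exact: derivableD. Qed.

(** As f and x - f x are both nondecreasing, their Stieltjes measures exist, and
they add up to the Lebesgue measure; so df is absolutely continuous, and f is the
integral of its density.  The interval is there to make df finite. *)
Lemma nondecreasing_lipschitz_ae_derivable_itv (f : R -> R) (N : R) : 0 < N ->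
  {homo f : x y / x <= y} -> (forall x y, x <= y -> f y - f x <= y - x) ->
  {ae mu, forall x, x \in `]- N, N[ -> derivable f x 1}.
Proof.
move=> N0 fnd f1.
have fL x y : `|f x - f y| <= 1 * `|x - y|.
  rewrite mul1r; wlog xy : x y / x <= y => [h|].
    by have [|/ltW] := leP x y => /h//; rewrite distrC (distrC x y).
  rewrite distrC ger0_norm ?subr_ge0 ?fnd// distrC ger0_norm ?subr_ge0//.
  exact: f1.
have fc := lipschitz_half_continuous fL.
have rc (h : R -> R) : continuous h -> right_continuous h.
  by move=> hc x; apply: cvg_within_filter; exact: hc.
have f2nd : nondecreasing (fun x => x - f x).
  by move=> x y xy; have := f1 _ _ xy; lra.
have f2c : continuous (fun x => x - f x).
  by move=> x; apply: cvgB; [exact: cvg_id|exact: fc].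
pose H1 := isCumulative.Build R _ R f fnd (rc _ fc).
pose c1 : cumulative R R := HB.pack f H1.
pose H2 := isCumulative.Build R _ R (fun x => x - f x) f2nd (rc _ f2c).
pose c2 : cumulative R R := HB.pack (fun x => x - f x) H2.
pose m1 : {measure set (measurableTypeR R) -> \bar R} :=
  lebesgue_stieltjes_measure c1.
pose m2 : {measure set (measurableTypeR R) -> \bar R} :=
  lebesgue_stieltjes_measure c2.
have m1E a b : a <= b -> m1 `]a, b]%classic = (f b - f a)%:E.
  exact: (@lebesgue_stieltjes_oc c1).
have m2E a b : a <= b -> m2 `]a, b]%classic = (b - f b - (a - f a))%:E.
  exact: (@lebesgue_stieltjes_oc c2).
have maddE X : measure_add m1 m2 X = (m1 X + m2 X)%E by exact: measure_addE.
have lebE A : measurable A -> mu A = (m1 A + m2 A)%E.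
  move=> mA; rewrite (@lebesgue_measure_unique _ (measure_add m1 m2))//.
    exact: maddE.
  move=> _ [[a b]] _ <-; rewrite [RHS]maddE.
  have [ab|/ltW ab] := leP a b.
    rewrite /= m1E// m2E// lebesgue_measure_itv/= lte_fin.
    case: ltP => [_|ba]; first by congr EFin => /=; lra.
    have -> : a = b by apply/eqP; rewrite eq_le ab ba.
    by congr EFin => /=; lra.
  by rewrite set_itv_ge ?measure0 ?adde0// bnd_simp -leNgt.
have m1le A : measurable A -> (m1 A <= mu A)%E.
  by move=> mA; rewrite lebE// leeDl.
pose D : set (measurableTypeR R) := `]- N, N]%classic.
have mD : measurable D by exact: measurable_itv.
have Dfin : (m1 D < +oo)%E.
  apply: le_lt_trans (m1le _ mD) _; rewrite /D lebesgue_measure_itv/=.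
  by case: ifP => _; rewrite ?ltry.
pose nu : {finite_measure set (measurableTypeR R) -> \bar R} := mfrestr mD Dfin.
have numu : nu `<< mu.
  apply/null_content_dominatesP => A mA A0.
  apply/eqP; rewrite eq_le measure_ge0 andbT /nu /=/mfrestr/mrestr.
  apply: le_trans (m1le _ _) _; first exact: measurableI.
  by rewrite -A0; apply: le_measure; rewrite ?inE//; exact: measurableI.
have [h [h0 hfin hint hE]] := radon_nikodym_sigma_finite numu.
have hintR : mu.-integrable setT (EFin \o (fine \o h)).
  by apply: eq_integrable hint => //= x _; rewrite /= fineK.
have FE y : - N <= y -> y <= N ->
    \int[mu]_(t in `]- N, y]) (fine \o h) t = f y - f (- N).
  move=> yN1 yN2; rewrite /Rintegral; under eq_integral do rewrite /= fineK//.
  rewrite -hE// /nu/=/mfrestr/mrestr setIidl; last exact: subset_itvl.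
  by rewrite m1E.
have [|//|] := @FTC1 R (fine \o h) (BRight (- N)).
- by move=> y; apply: integrableS hintR.
- apply: open_integrable_locally => //; exact: openT.
move=> A [mA A0 subA]; exists A; split => // x /= nx; apply: subA => /= dx.
apply: nx => /itvP xN; have [] := dx; first by rewrite lte_fin xN.
move=> dF _.
apply: (near_shift_derivable _ dF (c := f (- N))); near=> y.
have yN : y \in `]- N, N[.
  by near: y; apply: near_in_itvoo; rewrite in_itv/= !xN.
by rewrite FE ?subrK// !(itvP yN).
Unshelve. all: by end_near. Qed.

(** Adding a multiple of the identity turns g into a nondecreasing function of
slope at most 1. *)
Lemma lipschitz_ae_derivable_itv (g : R -> R) (L N : R) : 0 < N ->
  (forall x y, `|g x - g y| <= L * `|x - y|) ->
  {ae mu, forall x, x \in `]- N, N[ -> derivable g x 1}.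
Proof.
move=> N0 gL.
have [K K0 gK] : exists2 K, 0 < K & forall x y, `|g x - g y| <= K * `|x - y|.
  exists (Num.max L 1); first by rewrite lt_max ltr01 orbT.
  move=> x y; apply: le_trans (gL _ _) _; rewrite ler_wpM2r// le_max lexx//.
pose f x := (2 * K)^-1 * g x + 2^-1 * x.
have g_le x y : x <= y -> (2 * K)^-1 * `|g y - g x| <= 2^-1 * (y - x).
  move=> xy; rewrite invfM -mulrA ler_pM2l ?invr_gt0//.
  rewrite ler_pdivrMl//; apply: le_trans (gK _ _) _.
  by rewrite ger0_norm// subr_ge0.
have g_le1 x y : x <= y -> (2 * K)^-1 * g y - (2 * K)^-1 * g x <= 2^-1 * (y - x).
  move=> xy; apply: le_trans (g_le _ _ xy); rewrite -mulrBr.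
  by apply: ler_wpM2l; [rewrite invr_ge0 mulr_ge0// ltW|exact: ler_norm].
have g_le2 x y : x <= y -> (2 * K)^-1 * g x - (2 * K)^-1 * g y <= 2^-1 * (y - x).
  move=> xy; apply: le_trans (g_le _ _ xy); rewrite -mulrBr distrC.
  by apply: ler_wpM2l; [rewrite invr_ge0 mulr_ge0// ltW|exact: ler_norm].
have fnd : {homo f : x y / x <= y}.
  by move=> x y xy; rewrite /f; have := g_le2 _ _ xy; lra.
have f1 x y : x <= y -> f y - f x <= y - x.
  by move=> xy; rewrite /f; have := g_le1 _ _ xy; lra.
have := nondecreasing_lipschitz_ae_derivable_itv N0 fnd f1.
apply: aeS => x + xN => /(_ xN) df.
rewrite (_ : g = (2 * K) *: (fun x => f x - 2^-1 * x)).
  have d1 : derivable (fun x => f x - 2^-1 * x) x 1.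
    apply: derivableB => //; exact: derivableM.
  exact: derivableZ.
apply/funext => y; rewrite fctE /f addrK /GRing.scale/= mulrA divff ?mul1r//.
by rewrite mulf_neq0// gt_eqF.
Qed.

Lemma lipschitz_ae_derivable (g : R -> R) (L : R) :
  (forall x y, `|g x - g y| <= L * `|x - y|) ->
  {ae mu, forall x, derivable g x 1}.
Proof.
move=> gL.
have h k : {ae mu, forall x, x \in `]- k.+1%:R, k.+1%:R[ -> derivable g x 1}.
  by apply: lipschitz_ae_derivable_itv gL.
have := ae_foralln h; apply: aeS => x hx.
have [k xk] : exists k : nat, `|x| < k.+1%:R.
  exists (Num.bound `|x|); apply: (lt_le_trans (archi_boundP _)) => //.
  by rewrite ler_nat.
by apply: (hx k); rewrite in_itv/= -ltr_norml.
Qed.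

End stieltjes.

Section affine.
Context {R : realType}.
Notation mu := (@lebesgue_measure R).

Lemma measurable_affine (c b : R) : measurable_fun setT
  (fun x : measurableTypeR R => c * x + b : measurableTypeR R).
Proof.
apply: measurable_funD => //; apply: measurable_funM => //.
Qed.

(** The image measure, rescaled, agrees with the Lebesgue measure on intervals. *)
Lemma lebesgue_affine (c b : R) (A : set (measurableTypeR R)) : c != 0 ->
  measurable A ->
  mu ((fun x : R => c * x + b) @^-1` A) = ((`|c|^-1)%:E * mu A)%E.
Proof.
move=> c0 mA; have nc0 : 0 < `|c| by rewrite normr_gt0.
pose f := fun x : measurableTypeR R => c * x + b : measurableTypeR R.
have mf : measurable_fun setT f := measurable_affine c b.
pose m : {measure set (measurableTypeR R) -> \bar R} :=
  mscale (NngNum (ltW nc0)) (pushforward mu f).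
pose p := measure_function_pushforward__canonical__measure_function_Measure mu mf.
pose m' : {measure set (measurableTypeR R) -> \bar R} := mscale (NngNum (ltW nc0)) p.
have m'E B : m' B = (`|c|%:E * mu (f @^-1` B))%E by [].
rewrite (@lebesgue_measure_unique _ m' _ A mA)//.
  by rewrite m'E muleA -EFinM mulVf ?gt_eqF// mul1e.
move=> _ [[x y]] _ <-; rewrite m'E /=.
have [xy|yx] := ltP x y; last first.
  by rewrite set_itv_ge ?bnd_simp -?leNgt// preimage_set0 !measure0 mule0.
have [cp|cn|c00] := ltgtP c 0; last by rewrite c00 eqxx in c0.
- have -> : f @^-1` `]x, y] = `[(y - b) / c, (x - b) / c[%classic.
    apply/seteqP; split => z /=; rewrite !in_itv/= /f => /andP[z1 z2].
      rewrite ler_ndivrMr// ltr_ndivlMr//; apply/andP; split; lra.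
    move: z1 z2; rewrite ler_ndivrMr// ltr_ndivlMr// => z1 z2.
    apply/andP; split; lra.
  rewrite !lebesgue_measure_itv/= !lte_fin xy ltr_nM2r ?invr_lt0//.
  rewrite ltrD2r xy -!EFinD -EFinM ltr0_norm//; congr EFin.
  by field; exact: ltr0_neq0.
- have -> : f @^-1` `]x, y] = `](x - b) / c, (y - b) / c]%classic.
    apply/seteqP; split => z /=; rewrite !in_itv/= /f => /andP[z1 z2].
      rewrite ler_pdivlMr// ltr_pdivrMr//; apply/andP; split; lra.
    move: z1 z2; rewrite ler_pdivlMr// ltr_pdivrMr// => z1 z2.
    apply/andP; split; lra.
  rewrite !lebesgue_measure_itv/= !lte_fin xy ltr_pM2r ?invr_gt0//.
  rewrite ltrD2r xy -!EFinD -EFinM gtr0_norm//; congr EFin.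
  by field; exact: lt0r_neq0.
Qed.

Lemma integral_shift (D : set (measurableTypeR R)) (G : R -> R) (h : R) :
  measurable D -> measurable_fun setT G ->
  mu.-integrable setT (EFin \o G) ->
  \int[mu]_(t in (fun t => t + h) @^-1` D) G (t + h) = \int[mu]_(t in D) G t.
Proof.
move=> mD mG iG.
pose f := fun x : measurableTypeR R => 1 * x + h : measurableTypeR R.
have mf : measurable_fun setT f := measurable_affine 1 h.
pose p := measure_function_pushforward__canonical__measure_function_Measure mu mf.
have pE A : measurable A -> p A = mu A.
  move=> mA; rewrite [LHS](lebesgue_affine h (@oner_neq0 R) mA).
  by rewrite normr1 invr1 mul1e.
have ipE g B : (\int[p]_(x in B) g x = \int[mu]_(x in B) g x)%E.
  by apply: eq_measure_integral => A mA _; exact: pE.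
have fE : f = (fun x => x + h) by apply/funext => x; rewrite /f mul1r.
have iGf E : measurable E -> mu.-integrable E (EFin \o G \o f).
  move=> mE; apply: integrableS measurableT mE (@subsetT _ _) _.
  apply/integrableP; split.
    by apply: measurableT_comp => //; apply: measurableT_comp => //.
  move/integrableP : (iG) => [_]; apply: le_lt_trans.
  rewrite -[leRHS]ipE ge0_integral_pushforward//; last first.
    by apply: measurableT_comp => //; apply: measurableT_comp => //.
rewrite /Rintegral -[in RHS]ipE (@integral_pushforward _ _ _ _ _ _ mf mu D (EFin \o G))//.
- by rewrite fE.
- exact/measurable_EFinP.
- by apply: iGf; rewrite -[X in measurable X]setTI; apply: (mf measurableT D mD).
Qed.

End affine.

Section lipschitz_ftc.
Context {R : realType}.
Notation mu := (@lebesgue_measure R).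

(** The difference quotients of G integrate over the half-line to minus the means
of G over the shrinking intervals [0, 1/(k+1)[, by translation invariance;
dominated convergence does the rest. *)
Lemma lipschitz_halfline_FTC (G d : R -> R) (L T : R) : 0 <= T -> 0 <= L ->
  (forall t h, 0 <= t -> 0 <= h -> `|G (t + h) - G t| <= L * h) ->
  (forall t, T <= t -> G t = 0) ->
  measurable_fun (`[0, +oo[%classic : set (measurableTypeR R)) d ->
  {ae mu, forall t, 0 < t ->
    k.+1%:R * (G (t + k.+1%:R^-1) - G t) @[k --> \oo] --> d t} ->
  \int[mu]_(t in `[0, +oo[) d t = - G 0.
Proof.
move=> T0 L0 GL GT md Gd.
pose W (t : R) : R := G (Num.max 0 t).
have WE t : 0 <= t -> W t = G t by move=> t0; rewrite /W max_r.
have WL x y : `|W x - W y| <= L * `|x - y|.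
  wlog xy : x y / y <= x => [h|].
    by have [|/ltW] := leP y x => /h//; rewrite distrC (distrC y).
  rewrite /W; set a := Num.max 0 y; set b := Num.max 0 x.
  have ab : a <= b by rewrite /a /b ge_max !le_max lexx xy orbT.
  have -> : b = a + (b - a) by rewrite addrC subrK.
  apply: le_trans (GL _ _ _ _) _; rewrite ?subr_ge0//.
    by rewrite /a le_max lexx.
  rewrite ler_wpM2l// ger0_norm ?subr_ge0//.
  by rewrite /a /b; case: (leP 0 x); case: (leP 0 y) => ? ?; lra.
have Wc : continuous W := lipschitz_half_continuous WL.
have mW : measurable_fun setT W by exact: continuous_measurable_fun.
have WT t : T <= t -> W t = 0.
  by move=> Tt; rewrite WE ?GT//; exact: le_trans Tt.
have iT (C : R) : mu.-integrable setT (EFin \o (fun t => C * \1_(`[- 1, T]%classic : set R) t)).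
  have iI : mu.-integrable setT (EFin \o \1_(`[- 1, T]%classic : set R)).
    exact: (integrable_indic_itv (- 1) T true false).
  exact: (integrableZl measurableT C iI).
pose C : R := `|W 0| + L * (T + 1).
have Wb t : -1 <= t -> `|W t| <= C * \1_(`[- 1, T]%classic : set R) t.
  move=> t1; rewrite indicE mem_setE in_itv/= t1/=.
  have [tT|/ltW/WT->] := leP t T; last by rewrite mulr0 normr0.
  rewrite mulr1 -[W t](subrK (W 0)); apply: le_trans (ler_normD _ _) _.
  rewrite addrC lerD2l; apply: le_trans (WL _ _) _; rewrite subr0 ler_wpM2l//.
  by rewrite ler_norml; apply/andP; split; lra.
(* G extended to the left by its value at 0 is Lipschitz on the whole line; W0
   is what has a finite integral *)
pose W0 (t : R) : R := W t * \1_(`[0, +oo[%classic : set R) t.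
have mW0 : measurable_fun setT W0.
  by apply: measurable_funM => //; exact: measurable_indic.
have iW0 : mu.-integrable setT (EFin \o W0).
  apply: (le_integrable measurableT _ _ (iT C)); first exact/measurable_EFinP.
  move=> t _; rewrite lee_fin; have [t0|t0] := leP 0 t.
    rewrite /W0 indicE mem_setE in_itv/= t0/= mulr1.
    by apply: le_trans (ler_norm _); apply: Wb; lra.
  by rewrite /W0 indicE mem_setE in_itv/= (leNgt 0 t) t0/= mulr0 normr0.
have iW (D : set (measurableTypeR R)) : measurable D -> D `<=` `[0, +oo[ -> mu.-integrable D (EFin \o W).
  move=> mD Dsub; apply: eq_integrable (integrableS measurableT mD (@subsetT _ _) iW0) => //.
  move=> t /set_mem/Dsub; rewrite /= in_itv/= andbT => t0.
  by rewrite /W0 indicE mem_setE in_itv/= t0 mulr1.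
pose h k : R := k.+1%:R^-1.
have h0 k : 0 < h k by rewrite /h.
pose D_ k (t : R) : R := k.+1%:R * (W (t + h k) - W t).
have mWh k : measurable_fun setT (fun t : measurableTypeR R => W (t + h k)).
  apply: continuous_measurable_fun => t; apply: (@continuous_comp _ _ _ (fun t => t + h k) W).
    by apply: cvgD; [exact: cvg_id|exact: cvg_cst].
  exact: Wc.
have intD k : \int[mu]_(t in `[0, +oo[) D_ k t =
    - (k.+1%:R * \int[mu]_(t in `[0, h k[) W t).
  have W0h t : 0 <= t -> W0 (t + h k) = W (t + h k).
    by move=> t0; rewrite /W0 indicE mem_setE in_itv/= addr_ge0 ?mulr1// ltW.
  have iWh : mu.-integrable `[0, +oo[ (EFin \o (fun t => W (t + h k))).
    apply: (le_integrable _ _ _ (integrableS measurableT _ (@subsetT _ _) (iT C))) => //.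
      by apply/measurable_EFinP; exact: measurable_funTS.
    move=> t /=; rewrite in_itv/= andbT => t0; rewrite lee_fin.
    apply: (le_trans (Wb _ _)); first by rewrite (le_trans _ (addr_ge0 t0 (ltW (h0 k))))//.
    apply: le_trans (ler_norm _); rewrite ler_wpM2l ?addr_ge0 ?mulr_ge0 ?addr_ge0//.
    rewrite !indicE !mem_setE !in_itv/=; have := h0 k => hk0.
    have t1 : - 1 <= t by apply: le_trans t0.
    rewrite ler_nat t1 (le_trans t1) ?lerDl ?(ltW hk0)//=.
    by case: (leP (t + h k) T) => //= thT; rewrite (le_trans _ thT)// lerDl ltW.
  rewrite RintegralZl//=; last first.
    rewrite (_ : _ \o _ = (fun t => (W (t + h k))%:E - (W t)%:E)%E)//.
    by apply: integrableB => //; exact: iW.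
  rewrite RintegralB//=; last exact: iW.
  rewrite -mulrN; congr (_ * _).
  have -> : \int[mu]_(t in `[0, +oo[) W (t + h k) = \int[mu]_(t in `[h k, +oo[) W t.
    transitivity (\int[mu]_(t in (fun t => t + h k) @^-1` `[h k, +oo[) W0 (t + h k)).
      rewrite (_ : _ @^-1` _ = `[0, +oo[%classic); last first.
        by apply/seteqP; split => t /=; rewrite !in_itv/= !andbT lerDr.
      apply: eq_Rintegral => t; rewrite inE/= in_itv/= andbT => t0.
      by rewrite W0h.
    rewrite integral_shift//; apply: eq_Rintegral => t.
    rewrite inE/= in_itv/= andbT => ht.
    by rewrite /W0 indicE mem_setE in_itv/= (le_trans _ ht) ?mulr1// ltW.
  rewrite (_ : `[0, +oo[%classic = `[0, h k[ `|` `[h k, +oo[); last first.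
    by rewrite -itv_bndbnd_setU// bnd_simp ltW.
  rewrite Rintegral_setU//.
  - by rewrite opprD addrCA subrr addr0.
  - apply: iW; first exact: measurableU.
    move=> t /= [|]; rewrite !in_itv/= ?andbT; first by case/andP.
    by apply: le_trans; exact: ltW.
  - apply/disj_setPS => t /= []; rewrite !in_itv/= andbT => /andP[_ th] ht.
    by have := lt_le_trans th ht; rewrite ltxx.
have DL k t : `|D_ k t| <= L.
  rewrite /D_ normrM ger0_norm// -ler_pdivlMl//.
  apply: le_trans (WL _ _) _; rewrite addrAC subrr add0r (ger0_norm (ltW (h0 k))).
  by rewrite mulrC.
have [_ lim1] : mu.-integrable `[0, +oo[ (EFin \o d) /\
    \int[mu]_(t in `[0, +oo[) D_ k t @[k --> \oo] --> \int[mu]_(t in `[0, +oo[) d t.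
  apply: (@Rdominated_convergence _ _ _ mu _ D_ d (fun t => L * \1_(`[- 1, T]%classic : set R) t)) => //.
  - move=> k; apply: measurable_funTS; apply: measurable_funM => //.
    exact: measurable_funB.
  - have n0 : {ae mu, forall t : R, t != 0}.
      exists [set 0]; split => //; first exact: lebesgue_measure_set1.
      by move=> t /= /negP; rewrite negbK => /eqP.
    apply: aeS2 Gd n0 => t Gd t0 /=; rewrite in_itv/= andbT => t0'.
    have tp : 0 < t by rewrite lt_neqAle eq_sym t0.
    rewrite (_ : (fun k => D_ k t) = fun k => k.+1%:R * (G (t + k.+1%:R^-1) - G t)); first exact: Gd.
    by apply/funext => k; rewrite /D_ !WE// addr_ge0 ?(ltW (h0 k)).
  - exact: integrableS (iT L).
  - apply: aeW => t k /=; rewrite in_itv/= andbT => t0.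
    rewrite indicE mem_setE in_itv/=.
    have -> : -1 <= t by apply: le_trans t0.
    have [tT|tT] := leP t T; first by rewrite mulr1.
    have Tth : T <= t + h k by rewrite (le_trans (ltW tT))// lerDl ltW.
    by rewrite mulr0 /D_ (WT _ Tth) (WT _ (ltW tT)) subrr mulr0 normr0.
have lim2 : \int[mu]_(t in `[0, +oo[) D_ k t @[k --> \oo] --> - G 0.
  rewrite -(WE _ (lexx 0)); apply/cvgrPdist_le => e e0.
  have : (L * h k) @[k --> \oo] --> L * 0.
    by apply: cvgMr; exact: cvg_harmonic.
  rewrite mulr0 => /cvgrPdist_le /(_ e e0); apply: filterS => k.
  rewrite sub0r normrN ger0_norm ?mulr_ge0 ?(ltW (h0 k))// => Lh.
  apply: le_trans Lh; rewrite intD opprK addrC.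
  have muhE : mu `[0, h k[%classic = (h k)%:E.
    by rewrite lebesgue_measure_itv/= lte_fin h0/= oppr0 addr0.
  have muh : fine (mu `[0, h k[%classic) = h k by rewrite muhE.
  have iWk : mu.-integrable `[0, h k[ (EFin \o W).
    by apply: iW => // t /=; rewrite !in_itv/= andbT => /andP[].
  have ic (c : R) : mu.-integrable `[0, h k[ (EFin \o cst c).
    apply: (@integrable_le_cst _ _ _ mu _ _ `|c|) => //.
    by have := ltry (h k); rewrite -muhE.
  have -> : k.+1%:R * \int[mu]_(t in `[0, h k[) W t - W 0 =
      k.+1%:R * \int[mu]_(t in `[0, h k[) (W t - W 0).
    rewrite RintegralB//; last exact: ic.
    rewrite [\int[mu]_(x in _) W 0]Rintegral_cst// muh mulrBr; congr (_ - _).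
    by rewrite mulrCA mulfV ?mulr1// pnatr_eq0.
  rewrite normrM ger0_norm// -ler_pdivlMl//.
  have iWB : mu.-integrable `[0, h k[ (EFin \o (fun t => W t - W 0)).
    rewrite (_ : _ \o _ = (fun t => (W t)%:E - (cst (W 0) t)%:E)%E)//.
    by apply: integrableB => //; exact: ic.
  apply: (le_trans (le_normr_Rintegral _ _)) => //.
  apply: (@le_trans _ _ (\int[mu]_(t in `[0, h k[) (L * h k))).
    apply: le_Rintegral => //.
    - exact: (integrable_abse iWB).
    - exact: ic.
    move=> t /=; rewrite in_itv/= => /andP[t0 th].
    by apply: le_trans (WL _ _) _; rewrite subr0 ler_wpM2l// ger0_norm// ltW.
  by rewrite Rintegral_cst// muh mulrC lexx.
exact: cvg_unique lim1 lim2.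
Qed.

End lipschitz_ftc.

(** * Measures with a density on the line *)

(** The proofs mf and f0 appear in the body so that the instances below, which
need them, apply to it without side conditions. *)
Section density_measure.
Context {R : realType} (f : R -> R).
Context (mf : measurable_fun setT (f : measurableTypeR R -> R)).
Context (f0 : forall x, 0 <= f x).
Notation mu := (@lebesgue_measure R).

Definition density_measure (A : set (measurableTypeR R)) : \bar R :=
  let _ := (mf, f0) in (\int[mu]_(x in A) (f x)%:E)%E.

Let density0 : density_measure set0 = 0%E.
Proof. by rewrite /density_measure integral_set0. Qed.

Let density_ge0 A : (0 <= density_measure A)%E.
Proof. by apply: integral_ge0 => x _; rewrite lee_fin. Qed.

Let density_sigma_additive : semi_sigma_additive density_measure.
Proof.
apply: (@semi_sigma_additive_nng_induced _ _ _ mu (EFin \o f)).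
  exact/measurable_EFinP.
by move=> x; rewrite lee_fin.
Qed.

HB.instance Definition _ := isMeasure.Build _ _ _ density_measure
  density0 density_ge0 density_sigma_additive.

Lemma density_measureE (A : set (measurableTypeR R)) :
  density_measure A = (\int[mu]_(x in A) (f x)%:E)%E.
Proof. by []. Qed.

Let density_sigma_finite : sigma_finite setT density_measure.
Proof.
pose F k : set (measurableTypeR R) := `[- k%:R, k%:R] `&` [set x | f x <= k%:R].
exists F.
  apply/seteqP; split => // x _.
  exists (Num.bound `|x| + Num.bound `|f x|)%N => //.
  have h (a : R) : a <= (Num.bound `|a|)%:R.
    exact: (le_trans (ler_norm a) (ltW (archi_boundP _))).
  have hN (a : R) : - (Num.bound `|a|)%:R <= a.
    by rewrite lerNl (le_trans _ (ltW (archi_boundP (normr_ge0 a))))// -normrN ler_norm.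
  split => /=; rewrite natrD.
    rewrite in_itv/= opprD; apply/andP; split.
      by apply: le_trans (hN x); rewrite gerDl oppr_le0.
    by apply: le_trans (h x) _; rewrite lerDl.
  by apply: le_trans (h _) _; rewrite lerDr.
move=> k.
have mF : measurable (F k).
  apply: measurableI => //.
  rewrite (_ : [set x | _] = setT `&` f @^-1` `]-oo, k%:R]); last first.
    by rewrite setTI; apply/seteqP; split => x /=; rewrite in_itv.
  exact: mf.
split => //; rewrite density_measureE.
apply: (@le_lt_trans _ _ (\int[mu]_(x in F k) (k%:R)%:E)%E).
  apply: ge0_le_integral => //.
  - by move=> x _; rewrite lee_fin.
  - by apply/measurable_EFinP; exact: measurable_funTS.
  - by move=> x [_ /=]; rewrite lee_fin.
rewrite integral_cst//; apply: lte_mul_pinfty => //.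
apply: (@le_lt_trans _ _ (mu `[- k%:R, k%:R]%classic)).
  by apply: le_measure; rewrite ?inE; [exact: mF|exact: measurable_itv|exact: subIsetl].
by rewrite lebesgue_measure_itv/=; case: ifP => _; rewrite ltry.
Qed.

HB.instance Definition _ := Measure_isSigmaFinite.Build _ _ _ density_measure
  density_sigma_finite.

Import HBNNSimple.

Let ge0_integral_density_nnsfun (g : {nnsfun (measurableTypeR R) >-> R}) :
  (\int[density_measure]_x (g x)%:E = \int[mu]_x ((g x)%:E * (f x)%:E))%E.
Proof.
have mg r : measurable_fun setT
    (fun x => (r * \1_(g @^-1` [set r]) x)%:E : \bar R).
  by apply/measurable_EFinP; exact: measurable_funM.
have gE x : (g x)%:E = (\sum_(r \in range g) (r * \1_(g @^-1` [set r]) x)%:E)%E.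
  by rewrite fsumEFin// -fimfunE.
under eq_integral do rewrite gE.
rewrite ge0_integral_fsum//; last by move=> r x _; exact: nnfun_muleindic_ge0.
have -> : (\int[mu]_x ((g x)%:E * (f x)%:E) = \int[mu]_x
    (\sum_(r \in range g) ((r * \1_(g @^-1` [set r]) x)%:E * (f x)%:E)))%E.
  apply: eq_integral => x _; rewrite gE -ge0_mule_fsuml// => r.
  exact: nnfun_muleindic_ge0.
rewrite ge0_integral_fsum//; last 2 first.
  by move=> r; apply: emeasurable_funM => //; exact/measurable_EFinP.
  by move=> r x _; apply: mule_ge0; [exact: nnfun_muleindic_ge0|rewrite lee_fin].
apply: eq_fsbigr => r /set_mem [x0 _ <-].
have mA : measurable (g @^-1` [set g x0]) by exact: measurable_funPTI.
under eq_integral do rewrite EFinM.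
rewrite ge0_integralZl//; last 2 first.
  by apply/measurable_EFinP; exact: measurable_indic.
  by rewrite lee_fin.
under [RHS]eq_integral do rewrite EFinM -muleA.
rewrite ge0_integralZl//; last 3 first.
  by apply: emeasurable_funM; apply/measurable_EFinP.
  by move=> x _; rewrite mule_ge0 ?lee_fin.
  by rewrite lee_fin.
congr (_ * _)%E; rewrite integral_indic// setIT.
transitivity (\int[mu]_(x in g @^-1` [set g x0]) (f x)%:E)%E => //.
rewrite [LHS]integral_mkcond; apply: eq_integral => x _.
by rewrite patchE indicE; case: ifP => _; rewrite ?mul1e ?mul0e.
Qed.

Lemma ge0_integral_density (g : measurableTypeR R -> \bar R) :
  measurable_fun setT g -> (forall x, 0 <= g x)%E ->
  (\int[density_measure]_x g x = \int[mu]_x (g x * (f x)%:E))%E.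
Proof.
move=> mg g0; pose h := nnsfun_approx measurableT mg.
have hg x : (EFin \o h^~ x) k @[k --> \oo] --> g x.
  by apply: cvg_nnsfun_approx.
have hnd x : {homo (fun k => h k x) : a b / (a <= b)%N >-> a <= b}.
  by move=> a b ab; exact/lefP/nd_nnsfun_approx.
have gE : g = fun x => limn (fun k => (h k x)%:E).
  by apply/funext => x; apply/esym/cvg_lim => //; exact: hg.
transitivity (limn (fun k => \int[density_measure]_x (h k x)%:E)%E).
  rewrite [in LHS]gE; apply: monotone_convergence => //.
  - by move=> k; exact/measurable_EFinP.
  - by move=> k x _; rewrite lee_fin.
  - by move=> x _ a b ab; rewrite lee_fin hnd.
transitivity (\int[mu]_x limn (fun k => (h k x)%:E * (f x)%:E))%E; last first.
  apply: eq_integral => x _; apply/cvg_lim => //.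
  by apply: cvgeZr => //; exact: hg.
under eq_fun do rewrite ge0_integral_density_nnsfun.
apply/esym/monotone_convergence => //.
- move=> k; apply: emeasurable_funM; exact/measurable_EFinP.
- by move=> k x _; rewrite mule_ge0 ?lee_fin.
- by move=> x _ a b ab; rewrite lee_wpmul2r ?lee_fin// hnd.
Qed.

End density_measure.

(** * Real-valued integrals, iterated integrals and kernels *)

Section ae_bounded.
Context d (T : measurableType d) (R : realType) (mu : {measure set T -> \bar R}).

Lemma integrable_ae_bounded (D : set T) (f : T -> R) (C : R) : measurable D ->
  (mu D < +oo)%E -> measurable_fun D f -> {ae mu, forall x, D x -> `|f x| <= C} ->
  mu.-integrable D (EFin \o f).
Proof.
move=> mD Doo mf fC.
have [] := @Rdominated_convergence _ _ _ mu D (fun=> f) f (fun=> C) mD (fun=> mf) mf _ _ _ => //.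
- by apply: aeW => x _; exact: cvg_cst.
- by apply: (@integrable_le_cst _ _ _ mu _ _ `|C|).
- by apply: aeS fC => x hx _; exact: hx.
Qed.

Lemma Rintegral_ae_bounded (D : set T) (f : T -> R) (C : R) :
  0 <= C -> measurable D -> (mu D < +oo)%E -> measurable_fun D f ->
  {ae mu, forall x, D x -> `|f x| <= C} ->
  `|\int[mu]_(x in D) f x| <= C * fine (mu D).
Proof.
move=> C0 mD Doo mf fC; have fi := integrable_ae_bounded mD Doo mf fC.
apply: (le_trans (le_normr_Rintegral _ fi)) => //.
rewrite -Rintegral_cst//.
apply: fine_le.
- exact/integrable_fin_num/integrable_norm.
- apply: integrable_fin_num => //.
  by apply: (@integrable_le_cst _ _ _ mu _ _ `|C|).
apply: ae_ge0_le_integral => //.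
by apply/measurable_EFinP; apply: measurableT_comp.
Qed.

Lemma ae_eq_Rintegral (D : set T) (f g : T -> R) : measurable D -> measurable_fun D f ->
  measurable_fun D g -> {ae mu, forall x, D x -> f x = g x} ->
  \int[mu]_(x in D) f x = \int[mu]_(x in D) g x.
Proof.
move=> mD mf mg fg; rewrite /Rintegral; congr fine.
apply: ae_eq_integral => //; try exact/measurable_EFinP.
by apply: aeS fg => x h Dx; rewrite h.
Qed.

End ae_bounded.

Lemma ae_eq_integrable d (T : measurableType d) (R : realType) (mu : {measure set T -> \bar R})
    (D : set T) (f g : T -> R) : measurable D -> measurable_fun D g ->
  {ae mu, forall x, D x -> f x = g x} -> mu.-integrable D (EFin \o f) ->
  mu.-integrable D (EFin \o g).
Proof.
move=> mD mg fg /integrableP[mf fi]; apply/integrableP; split; first exact/measurable_EFinP.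
move: fi; congr (_ < _)%E; apply: ae_eq_integral => //.
- exact: measurableT_comp.
- by apply: measurableT_comp => //; exact/measurable_EFinP.
- by apply: aeS fg => x h Dx; rewrite /= h.
Qed.

Lemma eq_measure_Rintegral d (T : measurableType d) (R : realType)
    (m1 m2 : {measure set T -> \bar R}) (D : set T) (f : T -> R) :
  (forall A, measurable A -> A `<=` D -> m1 A = m2 A) ->
  \int[m1]_(x in D) f x = \int[m2]_(x in D) f x.
Proof. by move=> E; rewrite /Rintegral (eq_measure_integral m2 E). Qed.

Lemma Rintegral_indicl d (T : measurableType d) (R : realType)
    (mu : {measure set T -> \bar R}) (A : set T) (g : T -> R) :
  \int[mu]_x (\1_A x * g x) = \int[mu]_(x in A) g x.
Proof.
rewrite /Rintegral [in RHS]integral_mkcond; congr fine; apply: eq_integral => x _.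
rewrite patchE indicE; case: ifPn => xA; first by rewrite mul1r.
by rewrite mul0r.
Qed.

Lemma Rintegral_sum (R : realType) d (T : measurableType d) (mu : {measure set T -> \bar R}) (I : Type)
    (r : seq I) (f : I -> T -> R) :
  (forall i, mu.-integrable setT (EFin \o f i)) ->
  mu.-integrable setT (EFin \o (fun x => \sum_(i <- r) f i x)) /\
  \int[mu]_x (\sum_(i <- r) f i x) = \sum_(i <- r) \int[mu]_x f i x.
Proof.
move=> fi; elim: r => [|i r [ih1 ih2]].
  split; last first.
    transitivity (\int[mu]_x (0 : R)); last by rewrite big_nil /Rintegral integral0.
    by apply: eq_Rintegral => x _; rewrite big_nil.
  rewrite (_ : _ \o _ = (fun=> 0%E)); first exact: integrable0.
  by apply/funext => x /=; rewrite big_nil.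
split.
  rewrite (_ : _ \o _ = (fun x => (f i x)%:E + (\sum_(j <- r) f j x)%:E)%E).
    by apply: integrableD => //; exact: fi.
  by apply/funext => x /=; rewrite big_cons.
rewrite big_cons -ih2 -RintegralD//.
by apply: eq_Rintegral => x _; rewrite big_cons.
Qed.

Lemma null_setU d (T : measurableType d) (R : realType) (mu : {measure set T -> \bar R})
    (A B : set T) : measurable A -> measurable B -> mu A = 0%E -> mu B = 0%E ->
  mu (A `|` B) = 0%E.
Proof.
move=> mA mB A0 B0; apply/eqP; rewrite eq_le measure_ge0 andbT.
apply: (@le_trans _ _ (mu A + mu B)%E); first exact: measureU2.
by rewrite A0 B0 adde0.
Qed.

Section parametrized.
Context d1 d2 (T1 : measurableType d1) (T2 : measurableType d2) (R : realType).

Lemma measurable_fun_Rintegral (m2 : {sigma_finite_measure set T2 -> \bar R})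
    (f : T1 * T2 -> R) : measurable_fun setT f ->
  measurable_fun setT (fun x => \int[m2]_y f (x, y)).
Proof.
move=> mf; have mf' : measurable_fun setT (EFin \o f) by exact/measurable_EFinP.
rewrite (_ : (fun x => _) = fine \o (fun x => \int[m2]_y (EFin \o f)^\+ (x, y) -
    \int[m2]_y (EFin \o f)^\- (x, y))%E).
  apply: measurableT_comp => //; apply: emeasurable_funB.
    apply: (@measurable_fun_fubini_tonelli_F _ _ _ _ _ m2 (EFin \o f)^\+%E) => //.
    exact: measurable_funepos.
  apply: (@measurable_fun_fubini_tonelli_F _ _ _ _ _ m2 (EFin \o f)^\-%E) => //.
  exact: measurable_funeneg.
apply/funext => x; rewrite /Rintegral /=; congr fine; rewrite integralE.
congr (_ - _)%E; apply: eq_integral => y _.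
  by rewrite !funeposE.
by rewrite !funenegE.
Qed.

Context (m1 : {sigma_finite_measure set T1 -> \bar R})
  (m2 : {sigma_finite_measure set T2 -> \bar R}).

Lemma ae_fst (Q : T1 -> Prop) : {ae m1, forall x, Q x} ->
  {ae (m1 \x m2)%E, forall p, Q p.1}.
Proof.
move=> [N [mN N0 hN]]; exists (N `*` setT); split.
- exact: measurableX.
- transitivity (m1 N * m2 setT)%E; first exact: product_measure1E.
  by rewrite N0 mul0e.
- by move=> [x y] /= nQ; split => //; exact: hN.
Qed.

Lemma ae_snd (Q : T2 -> Prop) : {ae m2, forall x, Q x} ->
  {ae (m1 \x m2)%E, forall p, Q p.2}.
Proof.
move=> [N [mN N0 hN]]; exists (setT `*` N); split.
- exact: measurableX.
- transitivity (m1 setT * m2 N)%E; first exact: product_measure1E.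
  by rewrite N0 mule0.
- by move=> [x y] /= nQ; split => //; exact: hN.
Qed.

Lemma Rintegral_prod (f : T1 * T2 -> R) : (m1 \x m2)%E.-integrable setT (EFin \o f) ->
  {ae m2, forall y, m1.-integrable setT (EFin \o (fun x => f (x, y)))} /\
  \int[(m1 \x m2)%E]_z f z = \int[m2]_y \int[m1]_x f (x, y).
Proof.
move=> fi; have ae2 := ae_integrable2 fi; split; first exact: ae2.
have mG : measurable_fun setT (fubini_G m1 (EFin \o f)) := measurable_fubini_G fi.
rewrite /Rintegral -(integral21_prod_meas1 fi); congr fine.
apply: ae_eq_integral => //.
- apply/measurable_EFinP.
  by apply: (measurableT_comp (f := @fine R) _ mG).
- apply: aeS ae2 => y iy _; rewrite /fubini_G fineK//.
  exact: integrable_fin_num.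
Qed.

Lemma Rintegral_prod_fst (f : T1 * T2 -> R) : (m1 \x m2)%E.-integrable setT (EFin \o f) ->
  {ae m1, forall x, m2.-integrable setT (EFin \o (fun y => f (x, y)))} /\
  \int[(m1 \x m2)%E]_z f z = \int[m1]_x \int[m2]_y f (x, y).
Proof.
move=> fi; have ae1 := ae_integrable1 fi; split; first exact: ae1.
have mF : measurable_fun setT (fubini_F m2 (EFin \o f)) := measurable_fubini_F fi.
rewrite /Rintegral -(integral12_prod_meas1 fi); congr fine.
apply: ae_eq_integral => //.
- apply/measurable_EFinP.
  by apply: (measurableT_comp (f := @fine R) _ mF).
- apply: aeS ae1 => y iy _; rewrite /fubini_F fineK//.
  exact: integrable_fin_num.
Qed.

End parametrized.

Lemma lebesgue_itv_lty (R : realType) (a b : R) :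
  (@lebesgue_measure R (`[a, b]%classic : set (measurableTypeR R)) < +oo)%E.
Proof. by rewrite lebesgue_measure_itv/=; case: ifP => _; rewrite ?ltry// -EFinB ltry. Qed.

Section pushforward_measure.
Context d d2 (T : measurableType d2) (Y : measurableType d) (R : realType).
Context (P : {measure set T -> \bar R}) (Z : T -> Y) (mZ : measurable_fun setT Z).

Definition pushforward_measure : {measure set Y -> \bar R} :=
  measure_function_pushforward__canonical__measure_function_Measure P mZ.

Lemma Rintegral_pushforward_measure (f : Y -> R) : measurable_fun setT f ->
  \int[pushforward_measure]_y f y = \int[P]_x f (Z x).
Proof.
move=> mf; have mf' : measurable_fun setT (EFin \o f) by exact/measurable_EFinP.
rewrite /Rintegral; congr fine; rewrite integralE [RHS]integralE.
congr (_ - _)%E.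
  rewrite (ge0_integral_pushforward mZ)//; last exact: measurable_funepos.
  by rewrite preimage_setT; apply: eq_integral => y _ /=; rewrite !funeposE.
rewrite (ge0_integral_pushforward mZ)//; last exact: measurable_funeneg.
by rewrite preimage_setT; apply: eq_integral => y _ /=; rewrite !funenegE.
Qed.

Lemma integrable_pushforward_measure (f : Y -> R) :
  pushforward_measure.-integrable setT (EFin \o f) ->
  P.-integrable setT (EFin \o (fun x => f (Z x))).
Proof.
move=> /integrableP[mf fi]; apply/integrableP; split; first exact: (measurableT_comp mf).
by move: fi; rewrite (ge0_integral_pushforward mZ)//; exact: measurableT_comp.
Qed.

End pushforward_measure.

Section density.
Context {R : realType} (f : R -> R).
Context (mf : measurable_fun setT (f : measurableTypeR R -> R)).
Context (f0 : forall x, 0 <= f x).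

Lemma Rintegral_density (h : measurableTypeR R -> R) : measurable_fun setT h ->
  \int[density_measure mf f0]_r h r = \int[@lebesgue_measure R]_r (h r * f r).
Proof.
move=> mh; have mh' : measurable_fun setT (EFin \o h) by exact/measurable_EFinP.
have posM (x w : R) : 0 <= w -> (maxe x%:E 0 * w%:E = maxe (x * w)%:E 0)%E.
  by move=> w0; rewrite -!EFin_max -EFinM maxr_pMl// mul0r.
rewrite /Rintegral; congr fine; rewrite integralE [RHS]integralE; congr (_ - _)%E.
  rewrite ge0_integral_density//; last exact: measurable_funepos.
  by apply: eq_integral => r _; rewrite funeposE [RHS]funeposE; exact: posM.
rewrite ge0_integral_density//; last exact: measurable_funeneg.
apply: eq_integral => r _; rewrite funenegE [RHS]funenegE -!EFinN -mulNr.
exact: posM.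
Qed.

Lemma density_measure_set1 (b : R) : density_measure mf f0 [set b] = 0%E.
Proof. by rewrite density_measureE integral_set1. Qed.

End density.

(** Under its own name the product of two finite measures gets an instance as a
finite measure, hence as a sigma-finite one. *)
Section finite_product.
Context d1 d2 (T1 : measurableType d1) (T2 : measurableType d2) (R : realType).
Context (m1 : {finite_measure set T1 -> \bar R}) (m2 : {finite_measure set T2 -> \bar R}).

Definition finite_product : set (T1 * T2) -> \bar R := (m1 \x m2)%E.

HB.instance Definition _ := Measure.on finite_product.

Lemma finite_product_setT : finite_product setT = (m1 setT * m2 setT)%E.
Proof. by rewrite -setXTT; exact: product_measure1E. Qed.

Lemma finite_product_lty A : measurable A -> (finite_product A < +oo)%E.
Proof.
move=> mA; apply: (@le_lt_trans _ _ (finite_product setT)).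
  by apply: le_measure; rewrite ?inE.
rewrite finite_product_setT; apply: lte_mul_pinfty => //; first by rewrite fin_num_measure.
by rewrite -ge0_fin_numE// fin_num_measure.
Qed.

Let finite_product_fin : fin_num_fun finite_product.
Proof. by move=> A mA; rewrite ge0_fin_numE// finite_product_lty. Qed.

HB.instance Definition _ := Measure_isFinite.Build _ _ _ finite_product finite_product_fin.

Definition finite_product_measure : {finite_measure set (T1 * T2)%type -> \bar R} :=
  finite_product.

End finite_product.

(** The images of one measure under maps that depend on a parameter. *)
Section pushforward_kernel.
Context d d1 d2 (S : measurableType d1) (T : measurableType d2) (Y : measurableType d)
  (R : realType).
Context (P : {sigma_finite_measure set T -> \bar R}) (Z : S -> T -> Y).
Context (mZ : measurable_fun setT (fun p : S * T => Z p.1 p.2)).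

Lemma measurable_slice s : measurable_fun setT (Z s).
Proof. exact: (measurableT_comp mZ (g := fun y => (s, y)) (measurable_pair1 _)). Qed.

Definition pushforward_at (s : S) : set Y -> \bar R := pushforward P (Z s).

HB.instance Definition _ s := Measure.copy (pushforward_at s)
  (measure_function_pushforward__canonical__measure_function_Measure P (measurable_slice s)).

Definition pushforward_family (s : S) : {measure set Y -> \bar R} := pushforward_at s.

Let measurable_pushforward_family (U : set Y) : measurable U ->
  measurable_fun setT (pushforward_family^~ U).
Proof.
move=> mU; have mA : measurable ((fun p : S * T => Z p.1 p.2) @^-1` U).
  by rewrite -[X in measurable X]setTI; exact: mZ.
rewrite (_ : pushforward_family^~ U = P \o xsection ((fun p : S * T => Z p.1 p.2) @^-1` U)).
  exact: measurable_fun_xsection.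
apply/funext => s; rewrite /= /pushforward_family /pushforward_at /pushforward; congr (P _).
by apply/seteqP; split => y; rewrite /xsection /= inE.
Qed.

HB.instance Definition _ := isKernel.Build _ _ S Y R pushforward_family
  measurable_pushforward_family.

Definition pushforward_kernel : R.-ker S ~> Y := pushforward_family.

Lemma pushforward_kernelE s A : pushforward_kernel s A = P (Z s @^-1` A).
Proof. by []. Qed.

Lemma ge0_integral_pushforward_kernel s (f : Y -> \bar R) (D : set Y) :
  measurable D -> measurable_fun setT f ->
  (forall y, 0 <= f y)%E ->
  (\int[pushforward_kernel s]_(y in D) f y = \int[P]_(x in Z s @^-1` D) f (Z s x))%E.
Proof.
move=> mD mf f0; apply: (ge0_integral_pushforward (measurable_slice s)) => //.
exact: measurable_funTS.
Qed.

Lemma Rintegral_pushforward_kernel s (f : Y -> R) (D : set Y) :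
  measurable D -> measurable_fun setT f ->
  \int[pushforward_kernel s]_(y in D) f y = \int[P]_(x in Z s @^-1` D) f (Z s x).
Proof.
move=> mD mf; have mf' : measurable_fun setT (EFin \o f) by exact/measurable_EFinP.
rewrite /Rintegral; congr fine; rewrite integralE [RHS]integralE.
congr (_ - _)%E.
  rewrite ge0_integral_pushforward_kernel//; last exact: measurable_funepos.
  by apply: eq_integral => y _; rewrite !funeposE.
rewrite ge0_integral_pushforward_kernel//; last exact: measurable_funeneg.
by apply: eq_integral => y _; rewrite !funenegE.
Qed.

Lemma integrable_pushforward_kernel s (f : Y -> R) (D : set Y) :
  measurable D -> measurable_fun setT f ->
  P.-integrable (Z s @^-1` D) (EFin \o (fun x => f (Z s x))) ->
  (pushforward_kernel s).-integrable D (EFin \o f).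
Proof.
move=> mD mf fi; apply: (integrable_pushforward (measurable_slice s)) => //.
exact/measurable_EFinP.
Qed.

End pushforward_kernel.

(** * Norm, direction and volume in R^n *)

Section rV_measurability.
Context {R : realType} (n : nat).
Local Notation rV := 'rV[R]_n.

Lemma measurable_enorm : measurable_fun setT (@enorm R n : rV -> measurableTypeR R).
Proof.
rewrite /enorm; apply: (@measurableT_comp _ _ _ _ _ _ (@Num.sqrt R)).
  by apply: continuous_measurable_fun; exact: sqrt_continuous.
apply: measurable_sum => i; apply: measurable_funX; exact: measurable_coor.
Qed.

Lemma measurable_scale d (T : measurableType d) (a : T -> measurableTypeR R) (f : T -> rV) :
  measurable_fun setT a -> measurable_fun setT f ->
  measurable_fun setT (fun t => a t *: f t).
Proof.
move=> ma mf; apply: measurable_fun_rV => i.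
rewrite (_ : (fun t => _) = (fun t => a t * f t 0 i)); last first.
  by apply/funext => t; rewrite mxE.
apply: measurable_funM => //.
by apply: (measurableT_comp (measurable_coor i)).
Qed.

Lemma measurable_inv : measurable_fun setT (@GRing.inv R : measurableTypeR R -> measurableTypeR R).
Proof.
have -> : [set: measurableTypeR R] = [set 0] `|` ~` [set 0] by rewrite setUv.
apply/measurable_funU => //; first exact: measurableC.
split.
  have h : measurable_fun ([set 0] : set (measurableTypeR R))
    (cst 0 : measurableTypeR R -> measurableTypeR R) by exact: measurable_cst.
  by apply: eq_measurable_fun h => x /set_mem ->; rewrite invr0.
apply: open_continuous_measurable_fun.
  by apply: closed_openC; exact: closed_eq.
by move=> x /set_mem /= x0; apply: inv_continuous; apply/eqP.
Qed.

Lemma measurable_dir : measurable_fun setT (@dir R n).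
Proof.
rewrite /dir; apply: measurable_scale => //.
apply: (measurableT_comp measurable_inv measurable_enorm).
Qed.

Lemma enorm_ge0 (x : rV) : 0 <= enorm x.
Proof. exact: sqrtr_ge0. Qed.

Lemma enormZ (c : R) (x : rV) : enorm (c *: x) = `|c| * enorm x.
Proof.
rewrite /enorm; under eq_bigr do rewrite mxE exprMn.
by rewrite -mulr_sumr sqrtrM ?sqr_ge0// sqrtr_sqr.
Qed.

Lemma enorm_eq0 (x : rV) : enorm x = 0 -> x = 0.
Proof.
move/eqP; rewrite /enorm sqrtr_eq0 => h.
have s0 : \sum_(i < n) x 0 i ^+ 2 == 0.
  by rewrite eq_le h sumr_ge0// => i _; exact: sqr_ge0.
apply/rowP => i; rewrite mxE; move: s0; rewrite psumr_eq0 => [|j _]; last exact: sqr_ge0.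
by move=> /allP/(_ i); rewrite mem_index_enum => /(_ isT); rewrite /= sqrf_eq0 => /eqP.
Qed.

Lemma enorm0 : enorm (0 : rV) = 0.
Proof. by rewrite -(scale0r (0 : rV)) enormZ normr0 mul0r. Qed.

Lemma enorm_gt0 (x : rV) : (0 < enorm x) = (x != 0).
Proof.
rewrite lt_neqAle enorm_ge0 andbT eq_sym; congr (~~ _).
by apply/eqP/eqP => [/enorm_eq0//|->]; rewrite enorm0.
Qed.

Lemma dir0 : dir (0 : rV) = 0.
Proof. by rewrite /dir scaler0. Qed.

Lemma enorm_dir (x : rV) : x != 0 -> enorm (dir x) = 1.
Proof.
by rewrite -enorm_gt0 => x0; rewrite enormZ ger0_norm ?invr_ge0 ?enorm_ge0// mulVf// gt_eqF.
Qed.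

Lemma dirZ (c : R) (x : rV) : 0 < c -> dir (c *: x) = dir x.
Proof.
move=> c0; rewrite /dir enormZ gtr0_norm// scalerA invfM mulrAC mulVf ?mul1r//.
by rewrite gt_eqF.
Qed.

Lemma dirN (x : rV) : dir (- x) = - dir x.
Proof. by rewrite /dir -scaleN1r enormZ normrN1 mul1r scalerA mulrN1 scaleNr. Qed.

Lemma enormN (x : rV) : enorm (- x) = enorm x.
Proof. by rewrite -scaleN1r enormZ normrN1 mul1r. Qed.

Lemma enorm_dir_le1 (x : rV) : enorm (dir x) <= 1.
Proof. by have [->|/enorm_dir->] := eqVneq x 0; rewrite ?dir0 ?enorm0. Qed.

Lemma enorm_dirE (x : rV) : enorm x *: dir x = x.
Proof.
have [->|x0] := eqVneq x 0; first by rewrite dir0 scaler0.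
by rewrite /dir scalerA mulfV ?scale1r// gt_eqF// enorm_gt0.
Qed.

Lemma dir_dir (x : rV) : dir (dir x) = dir x.
Proof.
have [->|x0] := eqVneq x 0; first by rewrite !dir0.
by rewrite [LHS]/dir enorm_dir// invr1 scale1r.
Qed.

Lemma enorm_scale_dir (r : R) (x : rV) : 0 <= r -> x != 0 ->
  enorm (r *: dir x) = r.
Proof. by move=> r0 x0; rewrite enormZ enorm_dir// mulr1 ger0_norm. Qed.

Lemma dir_scale_dir (r : R) (x : rV) : 0 < r -> dir (r *: dir x) = dir x.
Proof. by move=> r0; rewrite dirZ// dir_dir. Qed.

Lemma coor_enorm (x : rV) (i : 'I_n) : `|x 0 i| <= enorm x.
Proof.
rewrite -sqrtr_sqr /enorm ler_wsqrtr// (bigD1 i)//= lerDl sumr_ge0// => j _.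
exact: sqr_ge0.
Qed.

Lemma coor_dir (x : rV) (i : 'I_n) : `|dir x 0 i| <= 1.
Proof. exact: le_trans (coor_enorm _ _) (enorm_dir_le1 _). Qed.

End rV_measurability.

(** Induction on n: the volume is a product, and each coordinate is rescaled by
the same factor. *)
Section lebesgue_rV_affine.
Context {R : realType}.

Lemma measurable_rV_affine n (c : R) (b : 'rV[R]_n) :
  measurable_fun setT (fun x : 'rV[R]_n => c *: x + b).
Proof.
apply: measurable_fun_rV => i.
rewrite (_ : (fun t => _) = (fun t : 'rV[R]_n => c * t 0 i + b 0 i)); last first.
  by apply/funext => t; rewrite !mxE.
apply: measurable_funD => //; apply: measurable_funM => //.
exact: measurable_coor.
Qed.

Lemma lebesgue_rV_affine n (c : R) (b : 'rV[R]_n) (S : set 'rV[R]_n) :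
  c != 0 -> measurable S ->
  lebesgue_rV n ((fun x => c *: x + b) @^-1` S) =
  (((`|c|^-1) ^+ n)%:E * lebesgue_rV n S)%E.
Proof.
move=> c0; elim: n b S => [|n IHn] b S mS.
  rewrite expr0 mul1e /=; congr (\d_ _ _).
  by apply/seteqP; split => x /=; rewrite [c *: x + b]thinmx0 [x]thinmx0.
have nc0 : 0 < `|c| by rewrite normr_gt0.
pose b' : 'rV[R]_n := \row_j b 0 (lift ord0 j).
pose f1 := fun s : measurableTypeR R => c * s + b 0 ord0 : measurableTypeR R.
pose fn := fun x : 'rV[R]_n => c *: x + b'.
pose F := fun p : measurableTypeR R * 'rV[R]_n => (f1 p.1, fn p.2).
have mF : measurable_fun setT F.
  apply/measurable_fun_pairP; split.
    rewrite (_ : fst \o F = f1 \o fst)//; apply: measurableT_comp => //.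
    exact: measurable_affine.
  rewrite (_ : snd \o F = fn \o snd)//; apply: measurableT_comp => //.
  exact: measurable_rV_affine.
pose K : {nonneg R} := NngNum (exprn_ge0 n.+1 (ltW nc0)).
pose P := ((@lebesgue_measure R) \x lebesgue_rV n)%E.
pose p := measure_function_pushforward__canonical__measure_function_Measure P mF.
pose m' : {measure set (measurableTypeR R * 'rV[R]_n) -> \bar R} := mscale K p.
have m'E A : m' A = ((`|c| ^+ n.+1)%:E * P (F @^-1` A))%E by [].
have m'P A : measurable A -> P A = m' A.
  move=> mA; apply: product_measure_unique => //= A1 A2 mA1 mA2.
  rewrite m'E (_ : F @^-1` _ = (f1 @^-1` A1) `*` (fn @^-1` A2))//.
  have mf1 : measurable (f1 @^-1` A1).
    rewrite -[X in measurable X]setTI; exact: (measurable_affine c (b 0 ord0)).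
  have mfn : measurable (fn @^-1` A2).
    rewrite -[X in measurable X]setTI; exact: (measurable_rV_affine c b').
  have E1 : lebesgue_measure (f1 @^-1` A1) = ((`|c|^-1)%:E * lebesgue_measure A1)%E.
    exact: lebesgue_affine.
  have E2 : lebesgue_rV n (fn @^-1` A2) = ((`|c|^-1 ^+ n)%:E * lebesgue_rV n A2)%E.
    exact: IHn.
  transitivity ((`|c| ^+ n.+1)%:E * (lebesgue_measure (f1 @^-1` A1) *
      lebesgue_rV n (fn @^-1` A2)))%E.
    by congr (_ * _)%E; exact: product_measure1E.
  rewrite E1 E2.
  have cV : `|c| ^+ n.+1 * (`|c|^-1 * `|c|^-1 ^+ n) = 1.
    by rewrite exprS exprVn -invfM mulfV// mulf_neq0 ?expf_neq0 ?gt_eqF.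
  have gen (k a e : R) (x y : \bar R) :
      (k%:E * ((a%:E * x) * (e%:E * y)) = (k * (a * e))%:E * (x * y))%E.
    by rewrite !EFinM -(muleA k%:E) (muleACA a%:E e%:E).
  by rewrite gen cV mul1e.
rewrite /= /lebesgue_rV_step /pushforward.
have consF q : c *: cons_rV q + b = cons_rV (F q).
  apply/rowP => j; rewrite !mxE; case: unliftP => [k ->|->] //=.
  by rewrite !mxE.
rewrite (_ : _ @^-1` (_ @^-1` S) = F @^-1` (@cons_rV R n @^-1` S)); last first.
  by apply/seteqP; split => q /=; rewrite consF.
pose B := @cons_rV R n @^-1` S.
have mB : measurable B.
  by rewrite -[X in measurable X]setTI; exact: measurable_cons_rV.
change (P (F @^-1` B) = (((`|c|^-1) ^+ n.+1)%:E * P B)%E).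
rewrite (m'P _ mB) m'E muleA -EFinM -exprMn mulVf ?gt_eqF// expr1n mul1e//.
Qed.

Lemma lebesgue_rV_cube n (k : R) : 0 <= k ->
  lebesgue_rV n [set x | forall i, - k <= x 0 i <= k] = ((2 * k) ^+ n)%:E.
Proof.
move=> k0; elim: n => [|n IHn].
  rewrite expr0 /= diracE mem_set//= => -[].
  by case.
rewrite /= /lebesgue_rV_step /pushforward.
rewrite (_ : _ @^-1` _ = `[- k, k] `*` [set x : 'rV[R]_n | forall i, - k <= x 0 i <= k]); last first.
  apply/seteqP; split => -[s x] /=.
    move=> h; split; first by have := h ord0; rewrite mxE unlift_none /= in_itv.
    by move=> i; have := h (lift ord0 i); rewrite mxE liftK.
  move=> [s1 h] i; rewrite mxE; case: unliftP => [j _|_] /=; first exact: h.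
  by move: s1; rewrite in_itv.
rewrite product_measure1E//; last first.
  rewrite (_ : [set x | _] = \bigcap_(i in [set: 'I_n]) ((fun x : 'rV[R]_n => x 0 i) @^-1` `[- k, k])).
    apply: fin_bigcap_measurable => // i _; rewrite -[X in measurable X]setTI.
    exact: measurable_coor.
  apply/seteqP; split => x /= h i.
    by move=> _ /=; rewrite in_itv/=; exact: h.
  by have := h i I; rewrite /= in_itv.
have Eitv : lebesgue_measure `[- k, k]%classic = (2 * k)%:E.
  rewrite lebesgue_measure_itv/= lte_fin.
  by case: ltP => [_|kk]; rewrite -?EFinD; congr EFin; lra.
rewrite IHn; transitivity ((2 * k)%:E * ((2 * k) ^+ n)%:E)%E.
  by congr (_ * _)%E; exact: Eitv.
by rewrite -EFinM exprS.
Qed.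

End lebesgue_rV_affine.

(** * Polar coordinates *)

Section cdf_unique.
Context {R : realType}.

Lemma cdf_measure_unique
    (m1 m2 : {measure set (measurableTypeR R) -> \bar R}) :
  (forall b : R, m1 `]-oo, b]%classic = m2 `]-oo, b]%classic) ->
  (forall b : R, m1 `]-oo, b]%classic < +oo)%E ->
  forall A, measurable A -> m1 A = m2 A.
Proof.
move=> m12 fin1.
have split_itv (m : {measure set (measurableTypeR R) -> \bar R}) (a b : R) :
    a <= b -> m `]-oo, b]%classic = (m `]-oo, a]%classic + m `]a, b]%classic)%E.
  move=> ab; rewrite -measureU//.
    by congr (m _); rewrite -itv_bndbnd_setU.
  apply/seteqP; split => x //= []; rewrite !in_itv/= => xa /andP[ax _].
  by have := le_lt_trans xa ax; rewrite ltxx.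
apply: (@measure_unique _ R (measurableTypeR R) (@ocitv R)
  (fun k => `]- k%:R, k%:R]%classic)) => //.
- exact: ocitvI.
- by move=> k; exact: is_ocitv.
- rewrite -subTset => x _; exists (Num.bound `|x|) => //=.
  have xb : `|x| < (Num.bound `|x|)%:R by exact: archi_boundP.
  by rewrite in_itv/= ltrNl (ltW (le_lt_trans (ler_norm _) xb))
    (le_lt_trans _ xb)// -normrN ler_norm.
- move=> _ [[a b]] _ <- /=; have [ab|/ltW ba] := leP a b; last first.
    by rewrite set_itv_ge ?measure0// bnd_simp -leNgt.
  have := m12 b; rewrite (split_itv m1 _ _ ab) (split_itv m2 _ _ ab) -m12.
  move/(congr1 (fun z => z - m1 `]-oo, a]%classic)%E).
  by rewrite !(addeC (m1 `]-oo, a]%classic)) !addeK// ge0_fin_numE.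
- move=> k; apply: le_lt_trans (fin1 k%:R).
  by apply: le_measure; rewrite ?inE//; apply: subset_itvr.
Qed.

End cdf_unique.

(** The surface measure of the unit sphere, read through dir: it lives on the
punctured unit ball, where the volume is available, and S on the sphere is
represented by the cone over S. *)
Section cone_measure.
Context {R : realType} (n : nat).
Notation vol := (@lebesgue_rV R n).

Definition punctured_ball : set 'rV[R]_n := [set x | 0 < enorm x <= 1].

Lemma measurable_enorm_itv (i : interval R) :
  measurable [set x : 'rV[R]_n | enorm x \in i].
Proof.
rewrite (_ : [set x | _] = setT `&` @enorm R n @^-1` [set` i]); last by rewrite setTI.
by apply: measurable_enorm => //; exact: measurable_itv.
Qed.

Lemma measurable_punctured_ball : measurable punctured_ball.
Proof.
rewrite /punctured_ball (_ : [set x | _] = [set x | enorm x \in `]0, 1]]).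
  exact: measurable_enorm_itv.
by apply/seteqP; split => x /=; rewrite in_itv.
Qed.

Lemma measurable_eball (B : R) : measurable (@eball R n B).
Proof.
rewrite /eball (_ : [set x | _] = [set x | enorm x \in `]-oo, B]]).
  exact: measurable_enorm_itv.
by apply/seteqP; split => x /=; rewrite in_itv.
Qed.

Lemma measurable_set0 : measurable [set (0 : 'rV[R]_n)].
Proof.
rewrite (_ : [set 0] = [set x | enorm x \in `[0, 0]]).
  exact: measurable_enorm_itv.
apply/seteqP; split => x /=; first by move=> ->; rewrite enorm0 in_itv/= lexx.
rewrite in_itv/= => /andP[? ?]; apply: enorm_eq0.
by apply/eqP; rewrite eq_le; apply/andP.
Qed.

Lemma eball_finite (B : R) : (vol (eball B) < +oo)%E.
Proof.
have [B0|B0] := leP 0 B; last first.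
  rewrite (_ : eball B = set0) ?measure0 ?ltry//; apply/seteqP; split => // x.
  by rewrite /eball /= leNgt (lt_le_trans B0 (enorm_ge0 _)).
apply: (@le_lt_trans _ _ (vol [set x : 'rV[R]_n | forall i, - B <= x 0 i <= B])).
  apply: le_measure; rewrite ?inE.
  - exact: measurable_eball.
  - rewrite (_ : [set x | _] = \bigcap_(i in [set: 'I_n]) ((fun x : 'rV[R]_n => x 0 i) @^-1` `[- B, B])).
      apply: fin_bigcap_measurable => // i _; rewrite -[X in measurable X]setTI.
      exact: measurable_coor.
    apply/seteqP; split => x /= h i.
      by move=> _ /=; rewrite in_itv/=; exact: h.
    by have := h i I; rewrite /= in_itv.
  - move=> x xB i; rewrite -ler_norml; exact: le_trans (coor_enorm _ _) xB.
by rewrite lebesgue_rV_cube// ltry.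
Qed.

Definition cone_base : {measure set 'rV[R]_n -> \bar R} :=
  mscale (NngNum (ler0n R n)) vol.

Lemma cone_base_finite : (cone_base punctured_ball < +oo)%E.
Proof.
rewrite /cone_base /= /mscale; apply: lte_mul_pinfty => //.
apply: le_lt_trans (eball_finite 1); apply: le_measure; rewrite ?inE.
- exact: measurable_punctured_ball.
- exact: measurable_eball.
- by move=> x /= /andP[].
Qed.

Definition cone_measure : {finite_measure set 'rV[R]_n -> \bar R} :=
  mfrestr measurable_punctured_ball cone_base_finite.

Lemma cone_measureE (A : set 'rV[R]_n) :
  cone_measure A = (n%:R%:E * vol (A `&` punctured_ball))%E.
Proof. by []. Qed.

Lemma sphere_measureE (S : set 'rV[R]_n) :
  sphere_measure S = cone_measure (@dir R n @^-1` S).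
Proof.
rewrite cone_measureE /sphere_measure; congr (_ * vol _)%E.
by apply/seteqP; split => x /= [].
Qed.

Lemma cone_measure_opp (A : set 'rV[R]_n) : measurable A ->
  cone_measure (-%R @^-1` A) = cone_measure A.
Proof.
move=> mA; rewrite !cone_measureE; congr (_ * _)%E.
have mAp : measurable (A `&` punctured_ball).
  by apply: measurableI => //; exact: measurable_punctured_ball.
have := @lebesgue_rV_affine R n (-1) 0 _ _ mAp.
rewrite normrN1 invr1 expr1n mul1e => <-; last by rewrite oppr_eq0 oner_eq0.
congr (vol _); apply/seteqP; split => x /=; rewrite scaleN1r addr0.
  by move=> [Ax]; rewrite /punctured_ball /= enormN.
by move=> [Ax]; rewrite /punctured_ball /= enormN.
Qed.

End cone_measure.

Section polar.
Context {R : realType} (m : nat).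
Notation n := m.+1.
Notation vol := (@lebesgue_rV R n).
Notation cone := (@cone_measure R n).
Notation mu := (@lebesgue_measure R).

(** The density r^(n-1) of the radial measure, with n = m.+1. *)
Definition radial_weight (r : R) : R := if 0 < r then r ^+ m else 0.

Lemma radial_weight_ge0 r : 0 <= radial_weight r.
Proof. by rewrite /radial_weight; case: ifP => // r0; rewrite exprn_ge0// ltW. Qed.

Lemma measurable_radial_weight :
  measurable_fun setT (radial_weight : measurableTypeR R -> R).
Proof.
apply: measurable_fun_if => //.
  by apply: measurable_fun_ltr.
Qed.

Definition radial_measure :=
  density_measure measurable_radial_weight radial_weight_ge0.

Lemma radial_measure_cdf (b : R) :
  radial_measure `]-oo, b]%classic = ((Num.max b 0) ^+ n / n%:R)%:E.
Proof.
rewrite /radial_measure density_measureE.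
have [b0|b0] := leP b 0.
  rewrite expr0n mul0r integral0_eq// => x /=; rewrite in_itv/= => xb.
  by rewrite /radial_weight ltNge (le_trans xb b0).
have -> : (\int[mu]_(x in `]-oo, b]) (radial_weight x)%:E =
    \int[mu]_(x in `[0%R, b]) (x ^+ m)%:E)%E.
  rewrite integral_mkcond [RHS]integral_mkcond.
  apply: ae_eq_integral => //.
  - apply/(measurable_restrictT _ _).1 => //; apply/measurable_EFinP.
    by apply: measurable_funTS; exact: measurable_radial_weight.
  - apply/(measurable_restrictT _ _).1 => //; apply/measurable_EFinP.
    by apply: measurable_funTS; exact: measurable_funX.
  - exists [set 0]; split => //; first exact: lebesgue_measure_set1.
    move=> x /= h; apply: contrapT => x0; apply: h => _.
    rewrite !patchE !mem_setE !in_itv/= /radial_weight.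
    have [xp|xn] := ltP 0 x; first by rewrite (ltW xp).
    by case: ifP => // _; case: ifP => // /andP[x0' _]; case: x0; apply/eqP; rewrite eq_le xn x0'.
rewrite (@continuous_FTC2 _ _ (fun x => x ^+ n / n%:R))//.
- by rewrite expr0n mul0r sube0.
- by apply: continuous_subspaceT => x; exact: exprn_continuous.
- split.
  + by move=> x _; apply: derivableM => //; exact: exprn_derivable.
  + by apply: cvg_at_right_filter; apply: cvgM; [exact: exprn_continuous|exact: cvg_cst].
  + by apply: cvg_at_left_filter; apply: cvgM; [exact: exprn_continuous|exact: cvg_cst].
- move=> x _; rewrite derive1E.
  rewrite (_ : (fun x => _) = n%:R^-1 *: (fun x => x ^+ n)); last first.
    by apply/funext => z; rewrite fctE /GRing.scale/= mulrC.
  rewrite deriveZ; last exact: exprn_derivable.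
  by rewrite exp_derive /GRing.scale/= mulr1 mulrA mulVf ?mul1r// pnatr_eq0.
Qed.

Let cone_cut (S : set 'rV[R]_n) (b : R) : set 'rV[R]_n :=
  [set x | 0 < enorm x <= b /\ S (dir x)].

Let measurable_dir_preimage (S : set 'rV[R]_n) : measurable S ->
  measurable (@dir R n @^-1` S).
Proof. by move=> mS; rewrite -[X in measurable X]setTI; exact: measurable_dir. Qed.

Let measurable_cone_cut S b : measurable S -> measurable (cone_cut S b).
Proof.
move=> mS; rewrite (_ : cone_cut S b = [set x | enorm x \in `]0, b]] `&` @dir R n @^-1` S).
  by apply: measurableI; [exact: measurable_enorm_itv|exact: measurable_dir_preimage].
by apply/seteqP; split => x /=; rewrite /cone_cut/= in_itv.
Qed.

Let vol_cone_cut S b : measurable S ->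
  vol (cone_cut S b) = (((Num.max b 0) ^+ n)%:E * vol (cone_cut S 1))%E.
Proof.
move=> mS; have [b0|b0] := leP b 0.
  rewrite expr0n mul0e (_ : cone_cut S b = set0) ?measure0//.
  apply/seteqP; split => // x [/andP[x0 xb]] _.
  by have := lt_le_trans x0 (le_trans xb b0); rewrite ltxx.
rewrite (_ : cone_cut S b = (fun x => b^-1 *: x + 0) @^-1` cone_cut S 1).
  rewrite lebesgue_rV_affine ?invr_neq0 ?gt_eqF//; last exact: measurable_cone_cut.
  by rewrite gtr0_norm ?invr_gt0// invrK.
apply/seteqP; split => x; rewrite /cone_cut /= addr0 enormZ dirZ ?invr_gt0//.
  by rewrite gtr0_norm ?invr_gt0// pmulr_rgt0 ?invr_gt0// ler_pdivrMl// mulr1.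
by rewrite gtr0_norm ?invr_gt0// pmulr_rgt0 ?invr_gt0// ler_pdivrMl// mulr1.
Qed.

(** Doubling maps the origin to itself and multiplies volumes by 2^n. *)
Lemma vol_set0 : vol ([set 0] : set 'rV[R]_n) = 0%E.
Proof.
have m0 := @measurable_set0 R n.
have fin0 : (vol [set (0 : 'rV[R]_n)%R] < +oo)%E.
  apply: le_lt_trans (@eball_finite R n 0); apply: le_measure; rewrite ?inE//.
    exact: measurable_eball.
  by move=> x ->; rewrite /eball/= enorm0.
have := @lebesgue_rV_affine R n 2 0 _ _ m0.
rewrite (_ : _ @^-1` _ = [set 0]); last first.
  apply/seteqP; split => x /=; rewrite addr0.
    by move/eqP; rewrite scaler_eq0 pnatr_eq0/= => /eqP.
  by move=> ->; rewrite scaler0.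
have : vol ([set 0] : set 'rV[R]_n) \is a fin_num by rewrite ge0_fin_numE.
move=> /fineK <-; rewrite pnatr_eq0 => /(_ isT) h; congr EFin.
move: h => [] h; apply/eqP; move/eqP: h.
rewrite -{1}[fine _]mul1r -subr_eq0 -mulrBl mulf_eq0 => /orP[|//].
rewrite subr_eq0 => /eqP h; have : (`|2|^-1 : R) ^+ n < 1.
  by rewrite exprn_ilt1// ?invr_ge0// ger0_norm// invf_lt1 ?ltr1n.
by rewrite -h ltxx.
Qed.

(** The cone over S truncated at height b has b^n times the volume of the one
truncated at height 1, so that for a fixed S the two sides have the same
distribution function in the radius; a measure that is a product on rectangles
is the product measure. *)
Lemma polar_coordinates (A : set 'rV[R]_n) : measurable A ->
  vol A = (radial_measure \x cone)%E ((fun p => p.1 *: dir p.2) @^-1` A).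
Proof.
move=> mA.
pose N : set 'rV[R]_n := ~` [set 0].
have m0 := @measurable_set0 R n.
have mN : measurable N by exact: measurableC.
pose phi := fun x : 'rV[R]_n => (enorm x : measurableTypeR R, dir x).
have mphi : measurable_fun setT phi.
  by apply/measurable_fun_pairP; split; [exact: measurable_enorm|exact: measurable_dir].
pose nu := measure_function_pushforward__canonical__measure_function_Measure
  (mrestr vol mN) mphi.
have nuE B : nu B = vol (phi @^-1` B `&` N) by [].
pose omega := measure_function_pushforward__canonical__measure_function_Measure
  cone (@measurable_dir R n).
have omegaT : (omega setT < +oo)%E.
  rewrite /= /pushforward preimage_setT -ge0_fin_numE//; exact: fin_num_measure.
pose Om : {finite_measure set 'rV[R]_n -> \bar R} := mfrestr measurableT omegaT.
have OmE B : Om B = cone (@dir R n @^-1` B).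
  by rewrite /Om/=/mfrestr/mrestr setIT.
have OmS S : measurable S -> Om S = (n%:R%:E * vol (cone_cut S 1))%E.
  move=> mS; rewrite OmE cone_measureE; congr (_ * vol _)%E.
  by apply/seteqP; split => x /= [].
have nuP B : measurable B -> (radial_measure \x Om)%E B = nu B.
  move=> mB; apply: product_measure_unique => //= A1 S mA1 mS.
  have OmSfin : Om S \is a fin_num by exact: fin_num_measure.
  pose n1 := measure_function_pushforward__canonical__measure_function_Measure
    (mrestr vol (measurableI _ _ mN (measurable_dir_preimage mS))) (@measurable_enorm R n).
  have n1E B1 : n1 B1 = nu (B1 `*` S).
    by rewrite nuE /n1/=/pushforward/mrestr; congr (vol _); apply/seteqP; split => x /=; tauto.
  pose K : {nonneg R} := NngNum (fine_ge0 (measure_ge0 Om S)).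
  pose n2 : {measure set (measurableTypeR R) -> \bar R} := mscale K radial_measure.
  have n2E B1 : n2 B1 = (Om S * radial_measure B1)%E.
    by rewrite /n2 /= /mscale /= fineK.
  rewrite muleC -n2E -n1E; apply: cdf_measure_unique => // b.
    rewrite n1E nuE n2E.
    rewrite (_ : _ `&` N = cone_cut S b); last first.
      apply/seteqP; split => x; rewrite /cone_cut/N/phi /= in_itv/=.
        by move=> [[xb Sx] /eqP x0]; rewrite enorm_gt0 x0.
      by move=> [/andP[x0 xb] Sx]; split=> //; apply/eqP; rewrite -enorm_gt0.
    rewrite vol_cone_cut// OmS// radial_measure_cdf.
    have : vol (cone_cut S 1) \is a fin_num.
      rewrite ge0_fin_numE//; apply: le_lt_trans (@eball_finite R n 1).
      apply: le_measure; rewrite ?inE; [exact: measurable_cone_cut|exact: measurable_eball|].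
      by move=> x [/andP[]].
    move=> /fineK <-; rewrite -!EFinM; congr EFin.
    rewrite [RHS]mulrC -mulrA; congr (_ * _).
    by rewrite mulrA mulVf ?mul1r// pnatr_eq0.
  rewrite n1E nuE (_ : _ `&` N = cone_cut S b); last first.
    apply/seteqP; split => x; rewrite /cone_cut/N/phi /= in_itv/=.
      by move=> [[xb Sx] /eqP x0]; rewrite enorm_gt0 x0.
    by move=> [/andP[x0 xb] Sx]; split=> //; apply/eqP; rewrite -enorm_gt0.
  apply: le_lt_trans (@eball_finite R n b); apply: le_measure; rewrite ?inE.
  - exact: measurable_cone_cut.
  - exact: measurable_eball.
  - by move=> x [/andP[]].
pose T1 := fun p : measurableTypeR R * 'rV[R]_n => p.1 *: p.2.
have mT1 : measurable_fun setT T1.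
  by apply: measurable_scale; [exact: measurable_fst|exact: measurable_snd].
have mTA : measurable (T1 @^-1` A) by rewrite -[X in measurable X]setTI; exact: mT1.
have -> : vol A = nu (T1 @^-1` A).
  rewrite nuE (_ : phi @^-1` _ = A); last first.
    by apply/seteqP; split => x /=; rewrite /T1/phi/= enorm_dirE.
  apply/eqP; rewrite eq_le; apply/andP; split; last first.
    apply: le_measure; rewrite ?inE; [exact: measurableI|exact: mA|exact: subIsetl].
  apply: (@le_trans _ _ (vol ((A `&` N) `|` [set 0]))).
    apply: le_measure; rewrite ?inE//; first by apply: measurableU => //; exact: measurableI.
    by move=> x Ax; have [->|/eqP x0] := eqVneq x 0; [right|left].
  apply: (le_trans (measureU2 _ _ _)) => //; first exact: measurableI.
  rewrite -[leRHS]adde0 leeD2l// le_eqVlt; apply/orP; left; apply/eqP.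
  exact: vol_set0.
rewrite -(nuP _ mTA); apply: eq_integral => r _.
transitivity (Om (xsection (T1 @^-1` A) r)); first by [].
by rewrite OmE; congr (cone _); apply/seteqP.
Qed.

Lemma cone_measure_set0 : cone ([set 0] : set 'rV[R]_n) = 0%E.
Proof.
rewrite cone_measureE (_ : vol _ = 0%E) ?mule0//.
apply/eqP; rewrite eq_le measure_ge0 andbT -vol_set0.
apply: le_measure; rewrite ?inE; last exact: subIsetl.
  by apply: measurableI; [exact: measurable_set0|exact: measurable_punctured_ball].
exact: measurable_set0.
Qed.

End polar.

(** * The variational problem for the labels *)

Section variational.
Context {R : realType} (mu : {finite_measure set (measurableTypeR R) -> \bar R}).
Context (kappa : R) (u : R -> R).
Context (mu_set1 : forall x : R, mu [set x] = 0%E).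
Context (mu_neg : mu `]-oo, (0 : R)[%classic = 0%E).
Context (u_continuous : continuous u).

Definition total_mass : R := fine (mu setT).
Definition enclosed_mass (s : R) : R := fine (mu `[0, s]%classic).
(** Velocity and position of the label s as long as it collides with nobody. *)
Definition label_velocity (t s : R) : R := u s + kappa * enclosed_mass s * t.
Definition free_position (t s : R) : R :=
  s + t * u s + 2^-1 * kappa * enclosed_mass s * t ^+ 2.
Definition label_potential (r t y : R) : R :=
  \int[mu]_(s in `[0, y]) (free_position t s - r).
Definition minimizers (r t : R) : set R :=
  [set y | 0 <= y /\ forall z, 0 <= z -> label_potential r t y <= label_potential r t z].

Local Notation E := enclosed_mass.
Local Notation v := label_velocity.
Local Notation Y := free_position.
Local Notation F := label_potential.
Local Notation mass a b := (fine (mu `]a, b]%classic)).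

Context (minimizers_exist : forall r t : R, 0 < r -> 0 <= t -> minimizers r t !=set0).

Lemma total_mass_ge0 : 0 <= total_mass.
Proof. by rewrite /total_mass fine_ge0. Qed.

Lemma enclosed_mass_ge0 s : 0 <= E s.
Proof. by rewrite /E fine_ge0. Qed.

Lemma fine_measure_le (A B : set (measurableTypeR R)) : measurable A -> measurable B ->
  A `<=` B -> fine (mu A) <= fine (mu B).
Proof.
move=> mA mB AB; apply: fine_le; rewrite ?fin_num_measure//.
by apply: le_measure; rewrite ?inE.
Qed.

Lemma enclosed_mass_le s : E s <= total_mass.
Proof. by apply: fine_measure_le => //; exact: measurable_itv. Qed.

Lemma enclosed_mass_nd : {homo E : a b / a <= b}.
Proof.
move=> a b ab; apply: fine_measure_le; try exact: measurable_itv.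
exact: subset_itvl.
Qed.

Lemma measurable_enclosed_mass : measurable_fun setT (E : measurableTypeR R -> R).
Proof. by apply: nondecreasing_measurable => //; exact: enclosed_mass_nd. Qed.

Lemma measurable_u : measurable_fun setT (u : measurableTypeR R -> R).
Proof. exact: continuous_measurable_fun. Qed.

Lemma measurable_label_velocity t : measurable_fun setT (v t : measurableTypeR R -> R).
Proof.
apply: measurable_funD; first exact: measurable_u.
apply: measurable_funM => //; apply: measurable_funM => //.
exact: measurable_enclosed_mass.
Qed.

Lemma measurable_free_position t : measurable_fun setT (Y t : measurableTypeR R -> R).
Proof.
apply: measurable_funD; first apply: measurable_funD => //.
  by apply: measurable_funM => //; exact: measurable_u.
apply: measurable_funM => //; apply: measurable_funM => //.
exact: measurable_enclosed_mass.
Qed.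

Lemma u_bounded (a b : R) : exists2 C, 0 <= C & forall s, a <= s <= b -> `|u s| <= C.
Proof.
have : compact (u @` `[a, b]).
  by apply: continuous_compact; [exact: continuous_subspaceT|exact: segment_compact].
move=> /compact_bounded [C [_ hC]]; exists (Num.max 0 (C + 1)); first by rewrite le_max lexx.
move=> s sab; rewrite le_max; apply/orP; right; apply: hC; first by rewrite ltrDl.
by exists s.
Qed.

Lemma free_position_bounded (a b t : R) :
  exists2 C, 0 <= C & forall s, a <= s <= b -> `|Y t s| <= C.
Proof.
have [C C0 hC] := u_bounded a b.
exists (`|a| + `|b| + `|t| * C + `|2^-1 * kappa| * total_mass * t ^+ 2).
  apply: addr_ge0; first by apply: addr_ge0; [exact: addr_ge0|exact: mulr_ge0].
  apply: mulr_ge0 (sqr_ge0 t); exact: mulr_ge0 (normr_ge0 _) total_mass_ge0.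
move=> s /[dup] sab /hC us; rewrite /Y; apply: le_trans (ler_normD _ _) _.
apply: lerD; last first.
  rewrite normrM (ger0_norm (sqr_ge0 t)) ler_wpM2r ?sqr_ge0// normrM.
  by rewrite ler_wpM2l// ger0_norm ?enclosed_mass_ge0// enclosed_mass_le.
apply: le_trans (ler_normD _ _) _; apply: lerD.
  move: sab => /andP[sa sb]; rewrite ler_norml; apply/andP; split.
    by have := ler_norm (- a); rewrite normrN; have := normr_ge0 b; lra.
  by have := ler_norm b; have := normr_ge0 a; lra.
by rewrite normrM ler_wpM2l.
Qed.

Lemma mu_finite (A : set (measurableTypeR R)) : measurable A -> (mu A < +oo)%E.
Proof. by move=> mA; rewrite -ge0_fin_numE// fin_num_measure. Qed.

Lemma integrable_free_position (a b t r : R) (A : set (measurableTypeR R)) :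
  measurable A -> A `<=` `[a, b] ->
  mu.-integrable A (EFin \o (fun s => Y t s - r)).
Proof.
move=> mA Aab; have [C C0 hC] := free_position_bounded a b t.
apply: (@integrable_le_cst _ _ _ mu _ _ (C + `|r|)) => //.
- exact: mu_finite.
- apply: measurable_funTS; apply: measurable_funB => //.
  exact: measurable_free_position.
- move=> x /Aab; rewrite /= in_itv/= => xab.
  by apply: (le_trans (ler_normB _ _)); rewrite lerD2r hC.
Qed.

Lemma potential_diff (r t y y' : R) : 0 <= y -> y <= y' ->
  F r t y' - F r t y = \int[mu]_(s in `]y, y']) (Y t s - r).
Proof.
move=> y0 yy'; rewrite /F.
have -> : `[0, y']%classic = `[0, y] `|` `]y, y'] :> set R.
  by rewrite -itv_bndbnd_setU// bnd_simp.
rewrite Rintegral_setU//.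
- by rewrite addrC addKr.
- apply: (@integrable_free_position 0 y'); first exact: measurableU.
  by rewrite -itv_bndbnd_setU// bnd_simp.
- apply/disj_setPS => x /= []; rewrite !in_itv/= => /andP[_ xy] /andP[yx _].
  by have := le_lt_trans xy yx; rewrite ltxx.
Qed.

Lemma potential_null (r t y y' : R) : 0 <= y -> y <= y' ->
  mu `]y, y']%classic = 0%E -> F r t y' = F r t y.
Proof.
move=> y0 yy' m0; apply/eqP; rewrite -subr_eq0 potential_diff//.
rewrite /Rintegral null_set_integral//.
by apply: (measurable_int mu); apply: (@integrable_free_position y y') => //; exact: subset_itv_oc_cc.
Qed.

Lemma integral_cst_itv (c a b : R) :
  \int[mu]_(s in `]a, b]) c = c * mass a b.
Proof. by rewrite Rintegral_cst. Qed.

Lemma integrable_cst_fin (A : set (measurableTypeR R)) (c : R) : measurable A ->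
  mu.-integrable A (EFin \o (fun=> c)).
Proof.
move=> mA; apply: (@integrable_le_cst _ _ _ mu _ _ `|c|) => //; exact: mu_finite.
Qed.

(** Optimality of y0 and of y1, each tested with the other, bounds the integral of
Y(t0, .) - r0 over the labels in between from below by 0 and that of
Y(t1, .) - r1 from above by 0. *)
Lemma two_point (r0 t0 r1 t1 y0 y1 : R) : minimizers r0 t0 y0 -> minimizers r1 t1 y1 ->
  \int[mu]_(s in `]y0, y1]) (Y t1 s - Y t0 s - (r1 - r0)) <= 0.
Proof.
move=> [y00 m0] [y10 m1]; have [y01|/ltW y10'] := leP y0 y1; last first.
  by rewrite set_itv_ge ?Rintegral_set0// bnd_simp -leNgt.
have i r t : mu.-integrable `]y0, y1] (EFin \o (fun s => Y t s - r)).
  by apply: (@integrable_free_position y0 y1) => //; exact: subset_itv_oc_cc.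
have -> : \int[mu]_(s in `]y0, y1]) (Y t1 s - Y t0 s - (r1 - r0)) =
    \int[mu]_(s in `]y0, y1]) ((Y t1 s - r1) - (Y t0 s - r0)).
  by apply: eq_Rintegral => s _; lra.
rewrite RintegralB// -!potential_diff//.
by have := m0 _ y10; have := m1 _ y00; lra.
Qed.

(** The label s has entered the ball of radius r by time t. *)
Definition reaches (s r t : R) : Prop := exists2 y, minimizers r t y & s <= y.

(** On the labels between y' and y the integrand for (r', t') is at most the one
for (r, t), so moving from y' to y pays off in the problem (r', t') because it does
in (r, t).  The cut z allows a comparison on bounded labels only: beyond z there is
no mass. *)
Lemma minimizers_transfer (r t r' t' y y' z : R) : minimizers r t y -> minimizers r' t' y' ->
  0 <= z -> (y <= z \/ mu `]z, y]%classic = 0%E) -> y' <= y ->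
  (forall s, y' < s -> s <= z -> Y t' s - r' <= Y t s - r) -> minimizers r' t' y.
Proof.
move=> my my' z0 zy y'y YY.
have y0 : 0 <= y by case: my.
have y'0 : 0 <= y' by case: my'.
suff h : F r' t' y <= F r' t' y'.
  by split => // x x0; apply: (le_trans h); case: my' => _; exact.
(* y cut at z: no mass is lost, so it is still a minimizer *)
pose y2 := Num.min y z.
have y20 : 0 <= y2 by rewrite le_min y0.
have y2y : y2 <= y by rewrite ge_min lexx.
have m2 : mu `]y2, y]%classic = 0%E.
  rewrite /y2; have [yz|zy'] := leP y z.
    by rewrite set_itv_ge ?measure0// bnd_simp ltxx.
  by case: zy => // yz; have := lt_le_trans zy' yz; rewrite ltxx.
rewrite (potential_null _ _ y20 y2y m2).
have [y'y2|y2y'] := leP y' y2; last first.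
  rewrite le_eqVlt; apply/orP; left; apply/eqP/esym/potential_null => //.
    exact: ltW.
  apply/eqP; rewrite eq_le measure_ge0 andbT -m2.
  by apply: le_measure; rewrite ?inE; try exact: measurable_itv; apply: subset_itvl; rewrite bnd_simp.
rewrite -subr_le0 potential_diff//.
apply: (@le_trans _ _ (\int[mu]_(s in `]y', y2]) (Y t s - r))).
  apply: le_Rintegral => //.
  - by apply: (@integrable_free_position y' y2) => //; exact: subset_itv_oc_cc.
  - by apply: (@integrable_free_position y' y2) => //; exact: subset_itv_oc_cc.
  - move=> s /=; rewrite in_itv/= => /andP[y's sy2]; apply: YY => //.
    by rewrite (le_trans sy2)// ge_min lexx orbT.
rewrite -potential_diff// -(potential_null r t y20 y2y m2) subr_le0.
by case: my => _; exact.
Qed.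

Lemma reaches_le_radius (s r r' t : R) : 0 < r -> r <= r' -> 0 <= t ->
  reaches s r t -> reaches s r' t.
Proof.
move=> r0 rr' t0 [y my sy].
have [y' my'] := minimizers_exist (lt_le_trans r0 rr') t0.
have [sy'|y's] := leP s y'; first by exists y'.
exists y => //; apply: (minimizers_transfer my my' (z := y)).
- by case: my.
- by left.
- exact: le_trans (ltW y's) sy.
- by move=> x _ _; lra.
Qed.

Lemma reaches_large (s r t : R) : 0 < r -> 0 <= t ->
  (forall x, 0 <= x <= s -> Y t x <= r) -> reaches s r t.
Proof.
move=> r0 t0 Yr; have [y my] := minimizers_exist r0 t0.
have [sy|ys] := leP s y; first by exists y.
have [y0 ymin] := my.
exists s => //; split; first exact: le_trans (ltW ys).
move=> z z0; apply: le_trans (ymin z z0).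
rewrite -subr_le0 potential_diff//; last exact: ltW.
rewrite -oppr_ge0 -(mulN1r (Rintegral _ _ _)) -RintegralZl//; last first.
  by apply: (@integrable_free_position y s) => //; exact: subset_itv_oc_cc.
apply: Rintegral_ge0 => x /=; rewrite in_itv/= => /andP[yx xs].
by have := Yr x; rewrite xs (le_trans y0 (ltW yx)) => /(_ isT); lra.
Qed.

(** Up to time T only the labels below some z can have entered the ball of radius
B.  The witness z is a minimizer at time T for a radius r2 so large that z > B + 1.
For a minimizer y > z at time t, the mean of Y(t, .) over ]z, y] is at most B; as Y
is quadratic in t with Y(0, s) = s > B + 1, moving on to time T multiplies the
deficit by T / t, and the mean of Y(T, .) falls below r2, against the minimality
of z. *)
Lemma finite_propagation (B T : R) : 0 < B -> 0 < T -> exists2 z, 0 <= z &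
  forall r t y, 0 < r -> r <= B -> 0 <= t -> t <= T -> minimizers r t y ->
    y <= z \/ mu `]z, y]%classic = 0%E.
Proof.
move=> B0 T0.
pose C := 2^-1 * `|kappa| * total_mass * T ^+ 2.
have C0 : 0 <= C.
  apply: mulr_ge0 (sqr_ge0 T); apply: mulr_ge0 total_mass_ge0.
  by rewrite mulr_ge0// invr_ge0.
pose K := B + 1.
have [D D0 hD] := free_position_bounded 0 K T.
pose r2 := D + K + C + 1.
have r20 : 0 < r2 by rewrite /r2 /K; lra.
have [z mz Kz] : reaches K r2 T.
  apply: reaches_large => //; first exact: ltW.
  by move=> x /hD; rewrite ler_norml => /andP[_]; rewrite /r2/K; lra.
have z0 : 0 <= z by case: mz.
exists z => // r t y r0 rB t0 tT my.
have [yz|zy] := leP y z; [by left|right].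
have y0 : 0 <= y by case: my.
have zy' := ltW zy.
have i r' t' : mu.-integrable `]z, y] (EFin \o (fun s => Y t' s - r')).
  by apply: (@integrable_free_position z y) => //; exact: subset_itv_oc_cc.
have ic c : mu.-integrable `]z, y] (EFin \o (fun=> c)) by exact: integrable_cst_fin.
have h1 : \int[mu]_(s in `]z, y]) (Y t s - r) <= 0.
  by rewrite -potential_diff// subr_le0; case: my => _; exact.
have h2 : 0 <= \int[mu]_(s in `]z, y]) (Y T s - r2).
  by rewrite -potential_diff// subr_ge0; case: mz => _; exact.
suff h3 : mass z y <= 0.
  have : mass z y = 0 by apply/eqP; rewrite eq_le h3 fine_ge0.
  by move=> /eqP; rewrite fine_eq0 ?fin_num_measure// => /eqP.
have [t00|tp] := leP t 0.
  have -> : mass z y = \int[mu]_(s in `]z, y]) 1 by rewrite integral_cst_itv mul1r.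
  apply: le_trans h1; apply: le_Rintegral => // s /=; rewrite in_itv/= => /andP[zs _].
  have -> : t = 0 by apply/eqP; rewrite eq_le t00.
  rewrite /Y expr0n/= mulr0 mul0r !addr0.
  by move: Kz zs rB; rewrite /K; lra.
have iZ : mu.-integrable `]z, y] (EFin \o (fun s => T / t * (Y t s - r))).
  by apply: (integrableZl _ (T / t) (i r t)).
have h4 : \int[mu]_(s in `]z, y]) (Y T s - r2) <=
    \int[mu]_(s in `]z, y]) (T / t * (Y t s - r) - 1).
  apply: le_Rintegral => //.
    rewrite (_ : _ \o _ = (fun s => (T / t * (Y t s - r))%:E - (cst 1 s)%:E)%E)//.
    by apply: integrableB => //; exact: ic.
  move=> s /=; rewrite in_itv/= => /andP[zs _].
  have tne : t != 0 by rewrite gt_eqF.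
  set a := T / t; have a1 : 1 <= a by rewrite /a ler_pdivlMr// mul1r.
  have Ta : T = a * t by rewrite /a mulfVK.
  have Es := enclosed_mass_ge0 s; have Es' := enclosed_mass_le s.
  have kE : 2^-1 * kappa * E s * (T * (T - t)) <= C.
    apply: le_trans (ler_norm _) _; rewrite /C expr2 !normrM.
    rewrite (ger0_norm Es) (gtr0_norm T0) (ger0_norm (_ : 0 <= 2^-1)) ?invr_ge0//.
    apply: ler_pM.
    - by rewrite !mulr_ge0// invr_ge0.
    - by rewrite mulr_ge0// (ltW T0).
    - by rewrite ler_wpM2l// mulr_ge0// invr_ge0.
    - by rewrite ler_pM2l// ger0_norm ?subr_ge0// gerBl.
  have as_ : (a - 1) * K <= (a - 1) * s.
    by rewrite ler_wpM2l ?subr_ge0// (le_trans Kz)// ltW.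
  have aB : a * r <= a * B by rewrite ler_wpM2l// (le_trans _ a1).
  have -> : a * (Y t s - r) - 1 = a * s + T * u s + 2^-1 * kappa * E s * (T * t) - a * r - 1.
    by rewrite /Y Ta; ring.
  have -> : Y T s - r2 = s + T * u s + (2^-1 * kappa * E s * (T * t) + 2^-1 * kappa * E s * (T * (T - t))) - r2.
    by rewrite /Y; ring.
  by move: as_ aB kE D0; rewrite /r2 /K; lra.
have h5 : \int[mu]_(s in `]z, y]) (T / t * (Y t s - r) - 1) =
    T / t * \int[mu]_(s in `]z, y]) (Y t s - r) - mass z y.
  by rewrite RintegralB// RintegralZl// integral_cst_itv mul1r.
have h6 : T / t * \int[mu]_(s in `]z, y]) (Y t s - r) <= 0.
  by rewrite mulr_ge0_le0// divr_ge0// ltW.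
by move: h2 h4 h6; rewrite h5; lra.
Qed.

(** * Positions *)

(** Freezing negative times keeps the position defined and measurable on the whole
line of times. *)
Definition position (s t : R) : R :=
  inf [set r | 0 < r /\ reaches s r (Num.max t 0)].
Local Notation X := position.

Lemma maxt0 (t : R) : 0 <= Num.max t 0.
Proof. by rewrite le_max lexx orbT. Qed.

Lemma position_set_inf (s t : R) :
  has_inf [set r | 0 < r /\ reaches s r (Num.max t 0)].
Proof.
split; last by exists 0 => r /= [/ltW].
have [D D0 hD] := free_position_bounded 0 s (Num.max t 0).
exists (D + 1); split; first by rewrite ltr_wpDl.
apply: reaches_large; [by rewrite ltr_wpDl|exact: maxt0|].
by move=> x /hD; rewrite ler_norml => /andP[_]; lra.
Qed.

Lemma position_ge0 (s t : R) : 0 <= X s t.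
Proof.
apply: lb_le_inf; first by case: (position_set_inf s t).
by move=> r /= [/ltW].
Qed.

Lemma position_neg_time (s t : R) : X s t = X s (Num.max t 0).
Proof. by rewrite /X [Num.max (Num.max t 0) 0]max_l ?maxt0. Qed.

Lemma position_lt (s r t : R) : 0 <= t -> X s t < r -> reaches s r t.
Proof.
move=> t0 Xr; have /(inf_adherent)/(_ (position_set_inf s t)) : 0 < r - X s t.
  by rewrite subr_gt0.
move=> [r0 /= [r00 P]]; rewrite -/(X s t) addrC subrK => r0r.
by apply: (reaches_le_radius r00 (ltW r0r) t0); move: P; rewrite max_l.
Qed.

Lemma position_le (s r t : R) : 0 < r -> 0 <= t -> reaches s r t -> X s t <= r.
Proof.
move=> r0 t0 P; apply: ge_inf; first by case: (position_set_inf s t).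
by split => //; rewrite max_l.
Qed.

Lemma position_nd (t s s' : R) : s <= s' -> X s t <= X s' t.
Proof.
move=> ss'; rewrite position_neg_time (position_neg_time s').
have t0 := maxt0 t; move: (Num.max t 0) t0 => {}t t0.
apply/ler_addgt0Pr => e e0; apply: position_le => //.
  by rewrite ltr_wpDl// position_ge0.
have [y my sy] : reaches s' (X s' t + e) t by apply: position_lt => //; rewrite ltrDl.
by exists y => //; exact: le_trans sy.
Qed.

(** What the labels that can matter in the ball of radius B up to time T have in
common: they are bounded, and so are their velocities. *)
Lemma local_bounds (B T : R) : 0 < B -> 0 < T -> exists z U, [/\ 0 <= z, 0 <= U,
  (forall r t y, 0 < r -> r <= B -> 0 <= t -> t <= T -> minimizers r t y ->
    y <= z \/ mu `]z, y]%classic = 0%E),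
  (forall s t, 0 <= s -> s <= z -> 0 <= t -> t <= T -> `|v t s| <= U) &
  (forall s t t', 0 <= s -> s <= z -> 0 <= t -> t <= T -> 0 <= t' -> t' <= T ->
    `|Y t' s - Y t s| <= U * `|t' - t|)].
Proof.
move=> B0 T0; have [z z0 hz] := finite_propagation B0 T0.
have [C C0 hC] := u_bounded 0 z.
pose U := C + `|kappa| * total_mass * T.
exists z, U; split => //.
- by rewrite /U addr_ge0// !mulr_ge0// ?total_mass_ge0// ltW.
- move=> s t s0 sz t0 tT; rewrite /v /U; apply: (le_trans (ler_normD _ _)).
  apply: lerD; first by apply: hC; rewrite s0.
  rewrite !normrM (ger0_norm t0) (ger0_norm (enclosed_mass_ge0 s)).
  apply: ler_pM => //; first by rewrite mulr_ge0// enclosed_mass_ge0.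
  by rewrite ler_wpM2l// enclosed_mass_le.
- move=> s t t' s0 sz t0 tT t'0 t'T.
  have -> : Y t' s - Y t s = (u s + kappa * E s * (2^-1 * (t' + t))) * (t' - t).
    by rewrite /Y; field.
  rewrite normrM ler_wpM2r//; apply: (le_trans (ler_normD _ _)); apply: lerD.
    by apply: hC; rewrite s0.
  rewrite !normrM (ger0_norm (enclosed_mass_ge0 s)) -normrM.
  apply: ler_pM => //; first by rewrite mulr_ge0// enclosed_mass_ge0.
    by rewrite ler_wpM2l// enclosed_mass_le.
  by rewrite ger0_norm; lra.
Qed.

(** If s has entered the ball of radius r at time t, then it has entered the ball
of radius r + U |t' - t| at time t': no free position moves faster than U. *)
Lemma position_lipschitz_step (B T z U s t t' : R) : 0 <= z -> 0 <= U ->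
  (forall r t y, 0 < r -> r <= B -> 0 <= t -> t <= T -> minimizers r t y ->
    y <= z \/ mu `]z, y]%classic = 0%E) ->
  (forall s t t', 0 <= s -> s <= z -> 0 <= t -> t <= T -> 0 <= t' -> t' <= T ->
    `|Y t' s - Y t s| <= U * `|t' - t|) ->
  0 <= t -> t <= T -> 0 <= t' -> t' <= T -> X s t < B ->
  X s t' <= X s t + U * `|t' - t|.
Proof.
move=> z0 U0 hz hY t0 tT t'0 t'T XB.
apply/ler_addgt0Pr => e e0.
pose r := Num.min (X s t + e) B.
have X0 := position_ge0 s t.
have Xr : X s t < r by rewrite /r lt_min XB andbT ltrDl.
have r0 : 0 < r by exact: le_lt_trans Xr.
have rB : r <= B by rewrite /r ge_min lexx orbT.
have re : r <= X s t + e by rewrite /r ge_min lexx.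
pose r' := r + U * `|t' - t|.
have r'0 : 0 < r' by rewrite /r' ltr_wpDr// mulr_ge0.
apply: (@le_trans _ _ r'); last by rewrite /r'; lra.
apply: position_le => //.
have [y my sy] := position_lt t0 Xr.
have [y' my'] := minimizers_exist r'0 t'0.
have [sy'|y's] := leP s y'; first by exists y'.
exists y => //; apply: (minimizers_transfer my my' z0).
- exact: hz my.
- exact: le_trans (ltW y's) sy.
- move=> x y'x xz; have x0 : 0 <= x by case: my' => y'0 _; exact: le_trans (ltW y'x).
  have := hY x t t' x0 xz t0 tT t'0 t'T; rewrite ler_norml => /andP[_].
  by rewrite /r'; lra.
Qed.

Lemma position_locally_lipschitz (B T : R) : 0 < B -> 0 < T ->
  exists2 U, 0 <= U & forall s t t', 0 <= t -> t <= T -> 0 <= t' -> t' <= T ->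
    X s t < B -> X s t' <= X s t + U * `|t' - t|.
Proof.
move=> B0 T0; have [z [U [z0 U0 hz _ hY]]] := local_bounds B0 T0.
exists U => // s t t' t0 tT t'0 t'T XB.
exact: (position_lipschitz_step z0 U0 hz hY).
Qed.

Lemma position_bounded (s T : R) : 0 < T -> exists2 B, 0 < B &
  forall t, 0 <= t -> t <= T -> X s t < B.
Proof.
move=> T0; have [C C0 hC] := u_bounded 0 s.
pose D := `|s| + T * C + 2^-1 * `|kappa| * total_mass * T ^+ 2 + 1.
have D0 : 0 < D.
  rewrite /D ltr_wpDl// addr_ge0//; last first.
    by apply: mulr_ge0 (sqr_ge0 T); rewrite !mulr_ge0 ?invr_ge0// total_mass_ge0.
  by rewrite addr_ge0// mulr_ge0// ltW.
exists (D + 1); first by lra.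
move=> t t0 tT; apply: (@le_lt_trans _ _ D); last by rewrite ltrDl.
apply: position_le => //; apply: reaches_large => // x /[dup] /andP[x0 xs] /hC ux.
rewrite /Y /D; have xs' : x <= `|s| by rewrite (le_trans xs)// ler_norm.
have h1 : t * u x <= T * C.
  apply: (@le_trans _ _ (t * C)); last by rewrite ler_wpM2r.
  by rewrite ler_wpM2l//; exact: le_trans (ler_norm _) ux.
have h2 : 2^-1 * kappa * E x * t ^+ 2 <= 2^-1 * `|kappa| * total_mass * T ^+ 2.
  apply: (@le_trans _ _ (2^-1 * `|kappa| * total_mass * t ^+ 2)).
    rewrite ler_wpM2r ?sqr_ge0//.
    apply: (@le_trans _ _ (2^-1 * `|kappa| * E x)).
      by rewrite ler_wpM2r ?enclosed_mass_ge0// ler_wpM2l ?invr_ge0// ler_norm.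
    by rewrite ler_wpM2l ?enclosed_mass_le// mulr_ge0// invr_ge0.
  apply: ler_wpM2l; first by rewrite !mulr_ge0 ?invr_ge0// total_mass_ge0.
  by rewrite lerXn2r// nnegrE ?(ltW T0).
by move: h1 h2 xs'; lra.
Qed.

Lemma position_lipschitz_time (s T : R) : 0 < T -> exists2 U, 0 <= U &
  forall t t', 0 <= t -> t <= T -> 0 <= t' -> t' <= T ->
    `|X s t' - X s t| <= U * `|t' - t|.
Proof.
move=> T0; have [B B0 XB] := position_bounded s T0.
have [U U0 hU] := position_locally_lipschitz B0 T0.
exists U => // t t' t0 tT t'0 t'T; rewrite ler_norml; apply/andP; split.
  have := hU s t' t t'0 t'T t0 tT (XB _ t'0 t'T); rewrite distrC; lra.
have := hU s t t' t0 tT t'0 t'T (XB _ t0 tT); lra.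
Qed.

(** On such a label the position is decided by strict inequalities between masses,
and almost every label is one. *)
Definition support_label (s : R) : Prop :=
  [/\ 0 <= s, forall a, 0 <= a -> a < s -> (0 < mu `]a, s]%classic)%E &
  forall b, s < b -> (0 < mu `]s, b]%classic)%E].

Lemma reaches_minimizer (s r t y : R) : 0 < r -> 0 <= t -> support_label s ->
  X s t < r -> minimizers r t y -> s <= y.
Proof.
move=> r0 t0 [s0 Sl _] Xr my; rewrite leNgt; apply/negP => ys.
have y0 : 0 <= y by case: my.
pose r' := (X s t + r) / 2.
have X0 := position_ge0 s t.
have [r'X r'r] : X s t < r' /\ r' < r by rewrite /r'; split; lra.
have [y' my' sy'] := position_lt t0 r'X.
have := two_point my my'.
have -> : \int[mu]_(x in `]y, y']) (Y t x - Y t x - (r' - r)) = (r - r') * mass y y'.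
  by rewrite -integral_cst_itv; apply: eq_Rintegral => x _; lra.
rewrite pmulr_rle0 ?subr_gt0// leNgt => /negP; apply.
rewrite fine_gt0// mu_finite//; rewrite andbT.
apply: lt_le_trans (Sl _ y0 ys) _; apply: le_measure; rewrite ?inE//.
exact: subset_itvl.
Qed.

Lemma minimizer_lt (s r t y : R) : 0 < r -> 0 <= t -> r < X s t ->
  minimizers r t y -> y < s.
Proof.
move=> r0 t0 rX my; rewrite ltNge; apply/negP => sy.
have := position_le r0 t0 (ex_intro2 _ _ y my sy).
by rewrite leNgt rX.
Qed.

(** At time 0 the integrand of F is s - r, which changes sign at r only. *)
Lemma position0 (s : R) : support_label s -> X s 0 = s.
Proof.
move=> Ss; have [s0 Sl Sr] := Ss.
have Y0 x : Y 0 x = x by rewrite /Y expr0n/= mulr0 mul0r !addr0.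
apply/eqP; rewrite eq_le; apply/andP; split.
  apply/ler_addgt0Pr => e e0; apply: position_le => //; first by rewrite ltr_wpDl.
  apply: reaches_large => //; first by rewrite ltr_wpDl.
  by move=> x /andP[_ xs]; rewrite Y0; lra.
rewrite leNgt; apply/negP => Xs.
pose r := (X s 0 + s) / 2.
have X0 := position_ge0 s 0.
have [Xr rs] : X s 0 < r /\ r < s by rewrite /r; split; lra.
have r0 : 0 < r by exact: le_lt_trans Xr.
have [y my sy] := position_lt (lexx 0) Xr.
have y0 : 0 <= y by exact: le_trans sy.
have : F r 0 y - F r 0 r <= 0 by rewrite subr_le0; case: my => _; apply; exact: ltW.
have ry : r <= y by rewrite (le_trans (ltW rs)).
rewrite potential_diff ?(ltW r0)//.
pose r1 := (r + s) / 2.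
have [rr1 r1s] : r < r1 /\ r1 < s by rewrite /r1; split; lra.
have r1y : r1 <= y by rewrite (le_trans (ltW r1s)).
have h : (r1 - r) * mass r1 y <= \int[mu]_(x in `]r, y]) (Y 0 x - r).
  have -> : `]r, y]%classic = `]r, r1] `|` `]r1, y] :> set R.
    by rewrite -itv_bndbnd_setU// bnd_simp ltW.
  rewrite Rintegral_setU//.
  - rewrite -[leLHS]add0r; apply: lerD.
      apply: Rintegral_ge0 => x /=; rewrite in_itv/= Y0 => /andP[rx _].
      by rewrite subr_ge0 ltW.
    rewrite -integral_cst_itv; apply: le_Rintegral => //.
    + exact: integrable_cst_fin.
    + by apply: (@integrable_free_position r1 y) => //; exact: subset_itv_oc_cc.
    + by move=> x /=; rewrite in_itv/= Y0 => /andP[r1x _]; lra.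
  - apply: (@integrable_free_position r y); first exact: measurableU.
    by rewrite -itv_bndbnd_setU// ?bnd_simp ?(ltW rr1)//; exact: subset_itv_oc_cc.
  - apply/disj_setPS => x /= []; rewrite !in_itv/= => /andP[_ xy] /andP[yx _].
    by have := le_lt_trans xy yx; rewrite ltxx.
move=> h2; have := le_trans h h2; rewrite pmulr_rle0 ?subr_gt0// leNgt => /negP; apply.
rewrite fine_gt0// mu_finite//; rewrite andbT.
apply: lt_le_trans (Sl _ _ r1s) _; first by rewrite (le_trans (ltW r0))// ltW.
by apply: le_measure; rewrite ?inE//; exact: subset_itvl.
Qed.

Lemma mu_itv_null (a b a' b' : R) : a <= a' -> b' <= b ->
  mu `]a, b]%classic = 0%E -> mu `]a', b']%classic = 0%E.
Proof.
move=> aa' bb' m0; apply/eqP; rewrite eq_le measure_ge0 andbT -m0.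
by apply: le_measure; rewrite ?inE//; apply: subset_itv; rewrite bnd_simp.
Qed.

Lemma mu_itv_gt0 (a b a' b' : R) : a' <= a -> b <= b' ->
  (0 < mu `]a, b]%classic)%E -> (0 < mu `]a', b']%classic)%E.
Proof.
move=> aa' bb' m0; apply: (lt_le_trans m0).
by apply: le_measure; rewrite ?inE//; apply: subset_itv; rewrite bnd_simp.
Qed.

Lemma ae_forall_rat (P : rat -> measurableTypeR R -> Prop) :
  (forall q, {ae mu, forall s, P q s}) -> {ae mu, forall s, forall q, P q s}.
Proof.
move=> hP; pose Q k s := if @unpickle rat k is Some q then P q s else True.
have hQ k : {ae mu, forall s, Q k s}.
  by rewrite /Q; case: unpickle => [q|]; [exact: hP|exact: aeW].
have := ae_foralln hQ; apply: aeS => s hs q.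
by have := hs (pickle q); rewrite /Q pickleK.
Qed.

Lemma ae_not_null (A : set (measurableTypeR R)) : measurable A -> mu A = 0%E ->
  {ae mu, forall s, ~ A s}.
Proof. by move=> mA A0; exists A; split => // s /= /contrapT. Qed.

Lemma rat_between (a b : R) : a < b -> exists q : rat, a < ratr q < b.
Proof. by move=> /rat_in_itvoo[q]; rewrite in_itv/=; exists q. Qed.

(** A label in the interior of a null interval lies in one with rational ends;
an end of a null interval is the supremum or the infimum of a set attached to a
rational number.  This leaves countably many null sets. *)
Lemma support_label_ae : {ae mu, forall s, support_label s}.
Proof.
pose A (q : R) : set R := [set s | q < s /\ mu `]q, s]%classic = 0%E].
pose B (q : R) : set R := [set s | s < q /\ mu `]s, q]%classic = 0%E].
have h1 : {ae mu, forall s : measurableTypeR R, ~ (s < 0)}.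
  have := ae_not_null (measurable_itv `]-oo, 0[) mu_neg.
  by apply: aeS => s; rewrite /= in_itv.
have h2 : {ae mu, forall s : measurableTypeR R, forall q : rat, s <> sup (A (ratr q))}.
  by apply: ae_forall_rat => q; exact: (ae_not_null (measurable_set1 _) (mu_set1 _)).
have h3 : {ae mu, forall s : measurableTypeR R, forall q : rat, s <> inf (B (ratr q))}.
  by apply: ae_forall_rat => q; exact: (ae_not_null (measurable_set1 _) (mu_set1 _)).
have h4 : {ae mu, forall s : measurableTypeR R, forall q p : rat,
    mu `]ratr q, ratr p]%classic = 0%E -> ~ (ratr q < s <= ratr p)}.
  apply: ae_forall_rat => q; apply: ae_forall_rat => p.
  have [m0|/eqP m0] := eqVneq (mu `]ratr q, ratr p]%classic) 0%E; last exact: aeW.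
  have := ae_not_null (measurable_itv `]ratr q, ratr p]) m0.
  by apply: aeS => s hs _; move: hs; rewrite /= in_itv.
have h := aeS2 (fun s a b => conj a b) (aeS2 (fun s a b => conj a b) h1 h2)
  (aeS2 (fun s a b => conj a b) h3 h4).
apply: aeS h => s [[s0 sA] [sB sAB]]; split.
- by rewrite leNgt; apply/negP.
- move=> a a0 as_; rewrite lt_neqAle measure_ge0 andbT eq_sym; apply/eqP => m0.
  have [q /andP[aq qs]] := rat_between as_.
  have Aqs : A (ratr q) s by split => //; apply: mu_itv_null m0 => //; exact: ltW.
  have [ub|nub] := pselect (ubound (A (ratr q)) s).
    apply: (sA q); apply/eqP; rewrite eq_le; apply/andP; split.
      by apply: ub_le_sup => //; exists s.
    by apply: ge_sup => //; exists s.
  have [s' As' ss'] : exists2 s', A (ratr q) s' & s < s'.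
    apply: contrapT => h; apply: nub => x Ax; rewrite leNgt; apply/negP => sx.
    by apply: h; exists x.
  have [p /andP[sp ps']] := rat_between ss'.
  apply: (sAB q p); last by rewrite qs ltW.
  by case: As' => _; apply: mu_itv_null => //; exact: ltW.
- move=> b sb; rewrite lt_neqAle measure_ge0 andbT eq_sym; apply/eqP => m0.
  have [q /andP[sq qb]] := rat_between sb.
  have Bqs : B (ratr q) s by split => //; apply: mu_itv_null m0 => //; exact: ltW.
  have [lb|nlb] := pselect (lbound (B (ratr q)) s).
    apply: (sB q); apply/eqP; rewrite eq_le; apply/andP; split.
      by apply: lb_le_inf => //; exists s.
    by apply: ge_inf => //; exists s.
  have [s' Bs' ss'] : exists2 s', B (ratr q) s' & s' < s.
    apply: contrapT => h; apply: nlb => x Bx; rewrite leNgt; apply/negP => sx.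
    by apply: h; exists x.
  have [p /andP[sp ps']] := rat_between ss'.
  apply: (sAB p q); last by rewrite ps' ltW.
  by case: Bs' => _; apply: mu_itv_null => //; exact: ltW.
Qed.

(** The position is monotone in the label and continuous in time, so that rounding
the time down to multiples of 1/(k+1) approximates it by measurable functions. *)
Lemma measurable_position_label t : measurable_fun setT (X^~ t : measurableTypeR R -> R).
Proof. by apply: nondecreasing_measurable => // a b; exact: position_nd. Qed.

Lemma measurable_position :
  measurable_fun setT (fun p : measurableTypeR R * measurableTypeR R => X p.1 p.2 : R).
Proof.
pose tau k (t : R) : nat := Num.truncn (k.+1%:R * Num.max t 0).
pose h k (p : measurableTypeR R * measurableTypeR R) : R := X p.1 ((tau k p.2)%:R / k.+1%:R).
have tauP k t : (tau k t)%:R <= k.+1%:R * Num.max t 0 < (tau k t).+1%:R.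
  by apply: Num.Theory.truncn_itv; rewrite mulr_ge0// maxt0.
apply: (@measurable_fun_cvg _ _ _ _ h).
- move=> k _ A mA; rewrite setTI.
  have -> : h k @^-1` A = \bigcup_m ((X^~ (m%:R / k.+1%:R) @^-1` A) `*`
      [set t : R | m%:R <= k.+1%:R * Num.max t 0 < m.+1%:R]).
    apply/seteqP; split => [[s t]|[s t]] /=.
      by move=> hA; exists (tau k t) => //; split => //=; exact: tauP.
    move=> [m _ [/= XA mt]]; rewrite /h /=.
    suff -> : tau k t = m by [].
    by apply/eqP; rewrite /tau Num.Theory.truncn_eq ?mulr_ge0// maxt0.
  apply: bigcupT_measurable => m; apply: measurableX.
    by rewrite -[X in measurable X]setTI; exact: measurable_position_label.
  have mg : measurable_fun setT (fun t : measurableTypeR R => k.+1%:R * Num.max t 0 : R).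
    by apply: measurable_funM => //; exact: measurable_maxr.
  rewrite (_ : [set t | _] = setT `&` (fun t => k.+1%:R * Num.max t 0) @^-1` `[m%:R, m.+1%:R[).
    by apply: mg => //; exact: measurable_itv.
  by rewrite setTI; apply/seteqP; split => t /=; rewrite in_itv.
- move=> [s t] _ /=; rewrite /h /= position_neg_time.
  have t0 := maxt0 t.
  have tauP' k : (tau k t)%:R / k.+1%:R <= Num.max t 0 /\
      `|(tau k t)%:R / k.+1%:R - Num.max t 0| <= k.+1%:R^-1.
    have /andP[h1 h2] := tauP k t; split.
      by rewrite ler_pdivrMr// mulrC.
    have h3 : Num.max t 0 <= (tau k t)%:R / k.+1%:R + k.+1%:R^-1.
      by rewrite -[X in _ + X]mul1r -mulrDl natr1 ler_pdivlMr// mulrC ltW.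
    rewrite distrC ger0_norm; first by rewrite lerBlDl.
    by rewrite subr_ge0 ler_pdivrMr// mulrC.
  have T0 : 0 < Num.max t 0 + 1 by rewrite ltr_wpDl.
  have [U U0 hU] := position_lipschitz_time s T0.
  apply/cvgrPdist_le => e e0.
  have : (U * k.+1%:R^-1) @[k --> \oo] --> U * 0.
    by apply: cvgMr; exact: cvg_harmonic.
  rewrite mulr0 => /cvgrPdist_le /(_ e e0); apply: filterS => k.
  rewrite sub0r normrN ger0_norm ?mulr_ge0 ?invr_ge0// => Uk.
  have [h1 h2] := tauP' k.
  apply: le_trans Uk; apply: le_trans (ler_wpM2l U0 h2); rewrite distrC.
  apply: hU => //.
  + by rewrite lerDl.
  + by rewrite (le_trans h1)// lerDl.
Qed.

(** * The velocity field *)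

Definition block (r t : R) : set R := [set s | X s t = r].
Definition block_mass (r t : R) : R := fine (mu (block r t)).
Definition block_momentum (r t : R) : R := \int[mu]_(s in block r t) v t s.
(** The label whose position is r, recovered as the infimum of the rational labels
with a position beyond r, so that it depends measurably on (r, t). *)
Definition label_at (r t : R) : R :=
  fine (ereal_inf [set (if r < X (ratr q) t then (ratr q)%:E else +oo%E) | q in [set: rat]]).
(** A block of positive mass moves with the mean velocity of its labels: collisions
are perfectly inelastic. *)
Definition velocity_field (r t : R) : R :=
  if block_mass r t == 0 then v t (label_at r t)
  else block_momentum r t / block_mass r t.
Local Notation w := velocity_field.

Lemma measurable_block r t : measurable (block r t).
Proof.
rewrite (_ : block r t = setT `&` X^~ t @^-1` [set r]); last by rewrite setTI.
by apply: measurable_position_label => //; exact: measurable_set1.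
Qed.

Let RxR := (measurableTypeR R * measurableTypeR R)%type.

Let measurable_position_r d (T : measurableType d) (f : T -> measurableTypeR R)
    (g : T -> measurableTypeR R) :
  measurable_fun setT f -> measurable_fun setT g ->
  measurable_fun setT (fun x => X (f x) (g x) : R).
Proof.
move=> mf mg; apply: (measurableT_comp measurable_position (g := fun x => (f x, g x))).
exact: measurable_fun_pair.
Qed.

Let block_graph : set (RxR * measurableTypeR R) := [set p | X p.2 p.1.2 = p.1.1].

Let measurable_block_graph : measurable block_graph.
Proof.
have mX : measurable_fun setT (fun p : RxR * measurableTypeR R => X p.2 p.1.2 - p.1.1 : R).
  apply: measurable_funB.
    by apply: measurable_position_r => //; apply: measurableT_comp.
  by apply: measurableT_comp.
rewrite (_ : block_graph = setT `&` (fun p => X p.2 p.1.2 - p.1.1) @^-1` [set 0]).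
  by apply: mX => //; exact: measurable_set1.
rewrite setTI; apply/seteqP; split => p /=; rewrite /block_graph/=.
  by move=> ->; rewrite subrr.
by move/eqP; rewrite subr_eq0 => /eqP.
Qed.

Lemma measurable_block_mass : measurable_fun setT (fun p : RxR => block_mass p.1 p.2).
Proof.
rewrite (_ : (fun p => _) = fine \o (mu \o xsection block_graph)).
  by apply: measurableT_comp => //; exact: measurable_fun_xsection.
apply/funext => p; rewrite /block_mass /=; congr (fine (mu _)).
by apply/seteqP; split => s; rewrite /block /xsection /= inE.
Qed.

Let measurable_velocity2 d (T : measurableType d) (f : T -> measurableTypeR R)
    (g : T -> measurableTypeR R) :
  measurable_fun setT f -> measurable_fun setT g ->
  measurable_fun setT (fun x => v (f x) (g x) : R).
Proof.
move=> mf mg; apply: measurable_funD.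
  by apply: (measurableT_comp measurable_u mg).
apply: measurable_funM => //; apply: measurable_funM => //.
exact: (measurableT_comp measurable_enclosed_mass mg).
Qed.

Lemma measurable_block_momentum :
  measurable_fun setT (fun p : RxR => block_momentum p.1 p.2).
Proof.
pose f (q : RxR * measurableTypeR R) : \bar R := (v q.1.2 q.2 * \1_block_graph q)%:E.
have mf : measurable_fun setT f.
  apply/measurable_EFinP; apply: measurable_funM; last exact: measurable_indic.
  by apply: measurable_velocity2 => //; apply: measurableT_comp.
rewrite (_ : (fun p => _) = fine \o (fun p => \int[mu]_s f^\+ (p, s) - \int[mu]_s f^\- (p, s))%E).
  apply: measurableT_comp => //; apply: emeasurable_funB.
    apply: (@measurable_fun_fubini_tonelli_F _ _ _ _ _ mu f^\+%E) => //.
    exact: measurable_funepos.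
  apply: (@measurable_fun_fubini_tonelli_F _ _ _ _ _ mu f^\-%E) => //.
  exact: measurable_funeneg.
apply/funext => p; rewrite /block_momentum /Rintegral /=; congr fine.
rewrite integral_mkcond [LHS]integralE; congr (_ - _)%E.
  apply: eq_integral => s _; rewrite !funeposE; congr (maxe _ _).
  rewrite patchE /f indicE; case: ifPn => /=.
    by rewrite inE /block /= => h; rewrite mem_set ?mulr1.
  by move=> /negP h; rewrite memNset ?mulr0//= => h'; apply: h; rewrite inE.
apply: eq_integral => s _; rewrite !funenegE; congr (maxe _ _); congr (- _)%E.
rewrite patchE /f indicE; case: ifPn => /=.
  by rewrite inE /block /= => h; rewrite mem_set ?mulr1.
by move=> /negP h; rewrite memNset ?mulr0//= => h'; apply: h; rewrite inE.
Qed.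

Let label_seq k (p : RxR) : \bar R :=
  if @unpickle rat k is Some q then
    (if p.1 < X (ratr q) p.2 then (ratr q)%:E else +oo%E) else +oo%E.

Lemma measurable_label_at : measurable_fun setT (fun p : RxR => label_at p.1 p.2).
Proof.
have ml k : measurable_fun setT (label_seq k).
  rewrite /label_seq; case: unpickle => [q|//].
  apply: measurable_fun_if => //; apply: measurable_fun_ltr => //.
  by apply: measurable_position_r.
rewrite (_ : (fun p => _) = fine \o (fun p : RxR => einfs (label_seq^~ p) 0%N)).
  by apply: measurableT_comp => //; exact: measurable_fun_einfs.
apply/funext => p; rewrite /label_at /=; congr fine.
rewrite /einfs; apply/eqP; rewrite eq_le; apply/andP; split.
  apply: le_ereal_inf_tmp => _ [k _ <-]; rewrite /label_seq.
  case: unpickle => [q|]; last exact: leey.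
  by apply: ereal_inf_lbound; exists q.
apply: le_ereal_inf_tmp => _ [q _ <-]; apply: ereal_inf_lbound.
by exists (pickle q) => //=; rewrite /label_seq pickleK.
Qed.

Lemma measurable_velocity_field :
  measurable_fun setT (fun p : RxR => w p.1 p.2).
Proof.
apply: measurable_fun_if => //.
- by apply: measurable_fun_eqr => //; exact: measurable_block_mass.
- apply: measurable_funTS; apply: measurable_velocity2 => //.
  exact: measurable_label_at.
- apply: measurable_funTS; apply: measurable_funM; first exact: measurable_block_momentum.
  by apply: (measurableT_comp (measurable_inv)); exact: measurable_block_mass.
Qed.

(** * Slopes of the positions in time *)

Lemma dist_itv (s x d k : R) : s - k < x -> x <= s + k -> k <= d -> `|x - s| <= d.
Proof. by move=> h1 h2 kd; rewrite ler_norml; apply/andP; split; lra. Qed.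

Lemma mass_small (s e : R) : 0 < e -> exists2 d, 0 < d & mass (s - d) (s + d) < e.
Proof.
move=> e0; pose A (k : nat) : set (measurableTypeR R) := `]s - k.+1%:R^-1, s + k.+1%:R^-1]%classic.
have mA k : measurable (A k) by exact: measurable_itv.
have AE : \bigcap_k A k = [set s].
  apply/seteqP; split => [x hx|_ -> k _]; last first.
    by rewrite /A /= in_itv/= ltrBlDr ltrDl lerDl invr_gt0 ltr0n/= ltW// invr_gt0.
  suff : forall d : R, 0 < d -> `|(x : R) - s| <= d.
      move=> h; apply/eqP; rewrite -subr_eq0 -normr_le0.
      by apply/ler_addgt0Pr => d d0; rewrite add0r; exact: h.
    move=> d d0; have [k kd] : exists k : nat, k.+1%:R^-1 < d.
    exists (Num.bound d^-1); rewrite -[ltRHS]invrK ltf_pV2 ?posrE ?invr_gt0//.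
    apply: (lt_le_trans (archi_boundP _)); first by rewrite invr_ge0 ltW.
    by rewrite ler_nat.
    have := hx k Logic.I; rewrite /A /= in_itv/= => /andP[h1 h2].
    exact: dist_itv h1 h2 (ltW kd).
have : mu (A k) @[k --> \oo] --> mu [set s].
  rewrite -AE; apply: nonincreasing_cvg_mu => //.
  - exact: mu_finite.
  - exact: bigcap_measurable.
  - apply/nonincreasing_seqP => k; apply/subsetPset; apply: subset_itv; rewrite bnd_simp.
      by rewrite lerD2l lerN2 lef_pV2 ?posrE// ler_nat.
    by rewrite lerD2l lef_pV2 ?posrE// ler_nat.
rewrite mu_set1 => /fine_cvgP[_] /cvgrPdist_lt /(_ e e0) [K _ hK].
exists K.+1%:R^-1; first by rewrite invr_gt0.
have := hK K (leqnn K); rewrite /= sub0r normrN ger0_norm//.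
exact: fine_ge0.
Qed.

Lemma enclosed_mass_diff (a b : R) : 0 <= a -> a <= b -> E b - E a = mass a b.
Proof.
move=> a0 ab; rewrite /E.
have -> : `[0, b]%classic = `[0, a] `|` `]a, b] :> set R.
  by rewrite -itv_bndbnd_setU// bnd_simp.
rewrite measureU//; first by rewrite fineD ?fin_num_measure// addrC addKr.
apply/seteqP; split => x //= []; rewrite !in_itv/= => /andP[_ h1] /andP[h2 _].
by have := le_lt_trans h1 h2; rewrite ltxx.
Qed.

Lemma enclosed_mass_neg (a : R) : a < 0 -> E a = 0.
Proof.
move=> a0; rewrite /E (_ : [set` _] = set0) ?measure0//.
by apply/seteqP; split => x //=; rewrite in_itv/= => /andP[h1 h2]; lra.
Qed.

Lemma enclosed_mass_0 : E 0 = 0.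
Proof. by rewrite /E set_itv1 mu_set1. Qed.

Lemma enclosed_mass_diff_le (a b : R) : a <= b -> E b - E a <= mass a b.
Proof.
move=> ab; have [a0|a0] := leP 0 a; first by rewrite enclosed_mass_diff.
rewrite (enclosed_mass_neg a0) subr0.
have [b0|b0] := leP 0 b; last by rewrite enclosed_mass_neg// fine_ge0.
rewrite -[leLHS]subr0 -enclosed_mass_0 enclosed_mass_diff//.
apply: fine_measure_le => //; apply: subset_itv; rewrite bnd_simp//; exact: ltW.
Qed.

Lemma enclosed_mass_continuous (s e : R) : 0 < e ->
  exists2 d, 0 < d & forall x, `|x - s| < d -> `|E x - E s| <= e.
Proof.
move=> e0; have [d d0 hd] := mass_small s e0.
exists d => // x; rewrite ltr_norml => /andP[h1 h2].
have hm a b : s - d <= a -> b <= s + d -> a <= b -> `|E b - E a| <= e.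
  move=> sa bs ab; rewrite ger0_norm ?subr_ge0 ?enclosed_mass_nd//.
  apply: (le_trans (enclosed_mass_diff_le ab)); apply: le_trans (ltW hd).
  by apply: fine_measure_le => //; apply: subset_itv; rewrite bnd_simp.
have [xs|/ltW xs] := leP x s; first by rewrite distrC; apply: hm => //; lra.
by apply: hm => //; lra.
Qed.

Lemma free_position_increment (s t e : R) : 0 < e -> 0 <= t ->
  exists2 d, 0 < d & forall x h, `|x - s| < d -> 0 <= h -> h <= d ->
    `|Y (t + h) x - Y t x - h * v t s| <= h * e.
Proof.
move=> e0 t0; have e3 : 0 < e / 3 by rewrite divr_gt0.
have [d1 d10 h1] : exists2 d, 0 < d & forall x, `|x - s| < d -> `|u x - u s| <= e / 3.
  have /cvgrPdist_le/(_ _ e3)/nbhs_ballP[d d0 hd] : u x @[x --> s] --> u s by exact: u_continuous.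
  exists d => // x xs; rewrite distrC; apply: hd.
  by rewrite /ball /= distrC.
pose K := `|kappa| * t + 1; have K0 : 0 < K by rewrite ltr_wpDl// mulr_ge0.
have [d2 d20 h2] := enclosed_mass_continuous s (divr_gt0 e3 K0).
pose L := `|kappa| * total_mass + 1.
have L0 : 0 < L by rewrite ltr_wpDl// mulr_ge0// total_mass_ge0.
pose d3 := e / 3 / L; have d30 : 0 < d3 by rewrite divr_gt0.
exists (Num.min d1 (Num.min d2 d3)); first by rewrite !lt_min d10 d20.
move=> x h; rewrite !lt_min => /andP[x1 /andP[x2 _]] h0.
rewrite !le_min => /andP[_ /andP[_ hd3]].
have -> : Y (t + h) x - Y t x - h * v t s =
  h * ((u x - u s) + kappa * t * (E x - E s) + 2^-1 * kappa * E x * h).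
  by rewrite /Y /v; field.
rewrite normrM (ger0_norm h0) ler_wpM2l//.
apply: (le_trans (ler_normD _ _)).
apply: (@le_trans _ _ (e / 3 + e / 3 + e / 3)); last by lra.
apply: lerD; first (apply: (le_trans (ler_normD _ _)); apply: lerD).
- exact: h1.
- rewrite !normrM (ger0_norm t0); apply: (@le_trans _ _ (K * (e / 3 / K))).
    apply: ler_pM => //; first by rewrite mulr_ge0.
    - by rewrite /K lerDl.
    - exact: h2.
  by rewrite mulrC divfK// gt_eqF.
- rewrite !normrM (ger0_norm h0) (ger0_norm (enclosed_mass_ge0 x)) gtr0_norm ?invr_gt0//.
  apply: (@le_trans _ _ (L * d3)); last by rewrite /d3 mulrC divfK// gt_eqF.
  apply: ler_pM => //.
    by rewrite !mulr_ge0// ?enclosed_mass_ge0// invr_ge0.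
  have hE : `|kappa| * E x <= `|kappa| * total_mass.
    by rewrite ler_wpM2l// enclosed_mass_le.
  have := mulr_ge0 (normr_ge0 kappa) (enclosed_mass_ge0 x).
  by move: hE; rewrite /L -mulrA; lra.
Qed.

(** Differentiability with derivative c, in the form used by the comparisons below. *)
Definition has_slope (f : R -> R) (t c : R) : Prop := forall e, 0 < e ->
  exists2 d, 0 < d & forall h, `|h| <= d -> `|f (t + h) - f t - h * c| <= `|h| * e.

Lemma derivable_slope (f : R -> R) (t : R) : derivable f t 1 -> exists c, has_slope f t c.
Proof.
move=> /cvg_ex[l /cvgrPdist_le hl]; exists l => e e0.
have /nbhs_ballP[d /= d0 hd] := hl e e0.
exists (d / 2); first by rewrite divr_gt0.
move=> h hh; have [->|h0] := eqVneq h 0.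
  by rewrite addr0 subrr mul0r subr0 normr0 mul0r.
have hd0 : ball (0 : R) d h.
  by rewrite /ball /= sub0r normrN; apply: (le_lt_trans hh); lra.
have := hd h hd0 h0; rewrite /= => hx.
have -> : f (t + h) - f t - h * l = - (h * (l - h^-1 * (f (h + t) - f t))).
  rewrite mulrBr mulrA divff// mul1r opprB addrC [h + t]addrC.
  by ring.
rewrite normrN normrM ler_wpM2l//.
by move: hx; rewrite /GRing.scale /= mulr1.
Qed.

(** Two functions that touch at t, one below the other, are tangent there. *)
Lemma slope_touch (f g : R -> R) (t c c' : R) : (forall x, f x <= g x) -> f t = g t ->
  has_slope f t c -> has_slope g t c' -> c = c'.
Proof.
move=> fg fgt hf hg; apply/eqP; rewrite -subr_eq0 -normr_le0.
apply/ler_addgt0Pr => e e0; rewrite add0r.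
have e2 : 0 < e / 2 by rewrite divr_gt0.
have [d d0 hd] := hf _ e2; have [d' d'0 hd'] := hg _ e2.
pose h := Num.min d d'; have h0 : 0 < h by rewrite /h lt_min d0.
have hn := gtr0_norm h0.
have hhd : `|h| <= d by rewrite hn ge_min lexx.
have hhd' : `|h| <= d' by rewrite hn ge_min lexx orbT.
have := hd h hhd; have := hd (- h); rewrite normrN => /(_ hhd).
have := hd' h hhd'; have := hd' (- h); rewrite normrN => /(_ hhd').
rewrite hn !ler_norml => /andP[a1 a2] /andP[a3 a4] /andP[a5 a6] /andP[a7 a8].
have b1 := fg (t + h); have b2 := fg (t - h).
apply/andP; split; rewrite -(ler_pM2l h0).
  by move: a1 a2 a3 a4 a5 a6 a7 a8 b1 b2; rewrite fgt; lra.
by move: a1 a2 a3 a4 a5 a6 a7 a8 b1 b2; rewrite fgt; lra.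
Qed.

Lemma slope_sandwich (f g k : R -> R) (t c : R) : (forall x, f x <= g x) ->
  (forall x, g x <= k x) -> f t = g t -> k t = g t ->
  has_slope f t c -> has_slope k t c -> has_slope g t c.
Proof.
move=> fg gk ft kt hf hk e e0.
have [d d0 hd] := hf _ e0; have [d' d'0 hd'] := hk _ e0.
exists (Num.min d d'); first by rewrite lt_min d0.
move=> h; rewrite le_min => /andP[/hd h1 /hd' h2].
move: h1 h2; rewrite !ler_norml => /andP[a1 a2] /andP[a3 a4].
have b1 := fg (t + h); have b2 := gk (t + h).
by apply/andP; split; move: a1 a2 a3 a4 b1 b2; rewrite ft kt; lra.
Qed.

(** For the countably many rational labels, differentiability holds at almost every
time; monotonicity in the label extends it to the others. *)
Definition good_time (t : R) : Prop :=
  0 < t /\ forall q : rat, exists c, has_slope (X (ratr q)) t c.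

Lemma good_time_ae : {ae @lebesgue_measure R, forall t, 0 < t -> good_time t}.
Proof.
have h q N : {ae @lebesgue_measure R, forall t, 0 < t -> t < N.+1%:R ->
    exists c, has_slope (X (ratr q)) t c}.
  have N0 : (0 : R) < N.+1%:R by rewrite ltr0n.
  have [U U0 hU] := position_lipschitz_time (ratr q) N0.
  pose g (t : R) := X (ratr q) (Num.min (Num.max t 0) N.+1%:R).
  have := @lipschitz_ae_derivable _ g U; move=> /(_ _)/wrap[].
    move=> x y; rewrite /g; pose c (t : R) := Num.min (Num.max t 0) N.+1%:R.
    have c0 t : 0 <= c t by rewrite /c le_min maxt0 ltW.
    have cN t : c t <= N.+1%:R by rewrite /c ge_min lexx orbT.
    apply: (le_trans (hU (c y) (c x) (c0 _) (cN _) (c0 _) (cN _))).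
    apply: ler_wpM2l => //; rewrite /c /Num.min /Num.max.
    have := N0; move: (N.+1%:R : R) => M M0.
    by rewrite !ler_norml; apply/andP; split;
      have := ler_norm (x - y); have := ler_norm (- (x - y)); rewrite normrN;
      repeat case: ifPn; rewrite -?leNgt => *; lra.
  apply: aeS => t /derivable_slope[c hc] t0 tN; exists c => e e0.
  have [d d0 hd] := hc e e0.
  exists (Num.min d (Num.min t (N.+1%:R - t))); first by rewrite !lt_min d0 t0 subr_gt0.
  move=> h'; rewrite !le_min => /andP[/hd h1 /andP[ht hNt]].
  have gE x : 0 <= x -> x <= N.+1%:R -> g x = X (ratr q) x.
    by move=> x0 xN; rewrite /g max_l// min_l.
  move: ht hNt; rewrite !ler_norml => /andP[a1 a2] /andP[a3 a4].
  rewrite !gE ?(ltW t0) ?(ltW tN)// in h1; first (by rewrite -ler_norml); lra.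
have {}h q : {ae @lebesgue_measure R, forall t, 0 < t ->
    exists c, has_slope (X (ratr q)) t c}.
  have := ae_foralln (h q); apply: aeS => t ht t0.
  apply: (ht (Num.bound t) t0); apply: lt_trans (archi_boundP (ltW t0)) _.
  by rewrite ltr_nat.
have h' k : {ae @lebesgue_measure R, forall t, 0 < t ->
    if @unpickle rat k is Some q then exists c, has_slope (X (ratr q)) t c else True}.
  by case: unpickle => [q|]; [exact: h|exact: aeW].
have := ae_foralln h'; apply: aeS => t ht t0; split => // q.
by have := ht (pickle q) t0; rewrite pickleK.
Qed.

(** A label whose position is shared by a rational label lies strictly between two
rational labels of the same position.  The exceptions are ends of blocks. *)
Definition interior_label (t s : R) : Prop := support_label s /\
  ((exists q : rat, X (ratr q) t = X s t) ->
   exists q1 q2 : rat, [/\ ratr q1 < s, s < ratr q2, X (ratr q1) t = X s t &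
     X (ratr q2) t = X s t]).

Lemma interior_label_ae t : {ae mu, forall s, interior_label t s}.
Proof.
pose A (q : rat) : set R := [set x | X x t <= X (ratr q) t].
pose B (q : rat) : set R := [set x | X (ratr q) t <= X x t].
have h1 : {ae mu, forall s : measurableTypeR R, forall q : rat, s <> sup (A q)}.
  by apply: ae_forall_rat => q; exact: (ae_not_null (measurable_set1 _) (mu_set1 _)).
have h2 : {ae mu, forall s : measurableTypeR R, forall q : rat, s <> inf (B q)}.
  by apply: ae_forall_rat => q; exact: (ae_not_null (measurable_set1 _) (mu_set1 _)).
have h := aeS2 (fun s a b => conj a b) support_label_ae (aeS2 (fun s a b => conj a b) h1 h2).
apply: aeS h => s [Ss [sA sB]]; split => // -[q Xq].
have [x sx Ax] : exists2 x, s < x & A q x.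
  apply: contrapT => nex; apply: (sA q).
  have ub : ubound (A q) s.
    move=> x Ax; rewrite leNgt; apply/negP => sx; apply: nex; by exists x.
  have As : A q s by rewrite /A /= Xq.
  apply/eqP; rewrite eq_le; apply/andP; split.
    by apply: ub_le_sup => //; exists s.
  by apply: ge_sup => //; exists s.
have [x' xs Bx] : exists2 x, x < s & B q x.
  apply: contrapT => nex; apply: (sB q).
  have lb : lbound (B q) s.
    move=> y By; rewrite leNgt; apply/negP => ys; apply: nex; by exists y.
  have Bs : B q s by rewrite /B /= Xq.
  apply/eqP; rewrite eq_le; apply/andP; split.
    by apply: lb_le_inf => //; exists s.
  by apply: ge_inf => //; exists s.
have [q1 /andP[xq1 q1s]] := rat_between xs.
have [q2 /andP[sq2 q2x]] := rat_between sx.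
exists q1, q2; split => //; apply/eqP; rewrite eq_le -{1 2}Xq; apply/andP; split.
- by rewrite Xq; apply: position_nd; exact: ltW.
- by apply: (le_trans Bx); apply: position_nd; exact: ltW.
- by apply: le_trans Ax; apply: position_nd; exact: ltW.
- by rewrite Xq; apply: position_nd; exact: ltW.
Qed.

Lemma slope_at_min (f : R -> R) (t c : R) : (forall x, 0 <= f x) -> f t = 0 ->
  has_slope f t c -> c = 0.
Proof.
move=> f0 ft hf; apply/esym/(@slope_touch (fun=> 0) f t _ c) => //.
  by move=> e e0; exists 1 => // h _; rewrite subrr mulr0 subrr normr0 mulr_ge0// ltW.
Qed.

(** A nonnegative function that vanishes at t and has a slope there has slope 0. *)
Lemma slope_center t s : good_time t -> interior_label t s -> X s t = 0 -> 0 < s ->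
  has_slope (X s) t 0.
Proof.
move=> [t0 gt] [Ss hs] Xs s0.
have [q1 [q2 [q1s sq2 Xq1 Xq2]]] : exists q1 q2 : rat,
    [/\ ratr q1 < s, s < ratr q2, X (ratr q1) t = X s t & X (ratr q2) t = X s t].
  apply: hs; have [q /andP[_ qs]] := rat_between s0; exists q.
  apply/eqP; rewrite eq_le position_nd ?(ltW qs)//= Xs; exact: position_ge0.
have [c hc] := gt q2; have [c' hc'] := gt q1.
have cE : c = 0 by apply: slope_at_min hc => [x|]; [exact: position_ge0|rewrite Xq2].
have cE' : c' = 0 by apply: slope_at_min hc' => [x|]; [exact: position_ge0|rewrite Xq1].
move: hc hc'; rewrite cE cE' => hc hc'.
by apply: slope_sandwich hc' hc => // x; apply: position_nd; exact: ltW.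
Qed.

(** Two labels with the same position have a rational one between them; a block
without two labels has no mass. *)
Lemma block_rat r t : block_mass r t != 0 -> exists q : rat, X (ratr q) t = r.
Proof.
move=> m0; apply: contrapT => nex; move/eqP: m0; apply.
have bE a b : block r t a -> block r t b -> a < b -> False.
  rewrite /block /= => Xa Xb ab; have [q /andP[aq qb]] := rat_between ab.
  apply: nex; exists q; apply/eqP; rewrite eq_le.
  by rewrite -{1}Xb -Xa !position_nd// ltW.
have [[x Bx]|/set0P/negP/negPn/eqP B0] := pselect (block r t !=set0); last first.
  by rewrite /block_mass B0 measure0.
rewrite /block_mass (_ : block r t = [set x]) ?mu_set1//.
apply/seteqP; split => [y By|y ->//] /=.
have [xy|yx|//] := ltgtP x y; first by have := bE _ _ Bx By xy.
by have := bE _ _ By Bx yx.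
Qed.

(** The positions of two labels of a block are ordered and touch at time t, so they
have the same slope; an interior label is squeezed between two rational ones. *)
Lemma block_slope t r : good_time t -> block_mass r t != 0 ->
  exists c, forall s, interior_label t s -> X s t = r -> has_slope (X s) t c.
Proof.
move=> [t0 gt] m0.
have [q Xq] := block_rat m0.
have [c hc] := gt q; exists c => s [Ss hs] Xs.
have [q1 [q2 [q1s sq2 Xq1 Xq2]]] : exists q1 q2 : rat,
    [/\ ratr q1 < s, s < ratr q2, X (ratr q1) t = X s t & X (ratr q2) t = X s t].
  by apply: hs; exists q; rewrite Xq Xs.
have same q' : X (ratr q') t = X s t -> has_slope (X (ratr q')) t c.
  move=> Xq'; have [c' hc'] := gt q'; have := hc'.
  suff -> : c' = c by [].
  have XE : X (ratr q) t = X (ratr q') t by rewrite Xq Xq' Xs.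
  have [qq'|/ltW qq'] := leP (ratr q : R) (ratr q').
    by apply/esym/(slope_touch _ XE hc hc') => x; exact: position_nd.
  by apply: (slope_touch _ (esym XE) hc' hc) => x; exact: position_nd.
by apply: slope_sandwich (same _ Xq1) (same _ Xq2) => // x; apply: position_nd; exact: ltW.
Qed.

(** The way [two_point] is used: if the integrand is bounded below by some c > 0,
then the enclosed interval carries no mass, although it reaches a support label. *)
Lemma two_point_contra (s r0 t0 r1 t1 y0 y1 c : R) : support_label s ->
  minimizers r0 t0 y0 -> minimizers r1 t1 y1 -> y0 < s -> s <= y1 -> 0 < c ->
  (forall x, y0 < x -> x <= y1 -> c <= Y t1 x - Y t0 x - (r1 - r0)) -> False.
Proof.
move=> [s0 Sl _] m0 m1 y0s sy1 c0 hc.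
have y00 : 0 <= y0 by case: m0.
have i r t : mu.-integrable `]y0, y1] (EFin \o (fun s => Y t s - r)).
  by apply: (@integrable_free_position y0 y1) => //; exact: subset_itv_oc_cc.
have : c * mass y0 y1 <= 0.
  apply: le_trans (two_point m0 m1); rewrite -integral_cst_itv.
  apply: le_Rintegral => //; first exact: integrable_cst_fin.
    rewrite (_ : _ \o _ = (fun s => (Y t1 s - r1)%:E - (Y t0 s - r0)%:E)%E).
      by apply: integrableB => //; exact: i.
    by apply/funext => x /=; rewrite -EFinB; congr EFin; ring.
  by move=> x /=; rewrite in_itv/= => /andP[xy0 xy1]; exact: hc.
rewrite pmulr_rle0// leNgt => /negP; apply.
rewrite fine_gt0// mu_finite//; rewrite andbT.
exact: mu_itv_gt0 (Sl _ y00 y0s).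
Qed.

(** Off the blocks the position is strictly increasing through a support label:
otherwise the mass next to the label would sit in its block. *)
Lemma nonatom_lt (s t a b : R) : support_label s -> block_mass (X s t) t = 0 ->
  a < s -> s < b -> 0 <= s -> (a < s -> 0 < s -> X a t < X s t) /\ X s t < X b t.
Proof.
move=> [_ Sl Sr] m0 as_ sb s0; have bl c d : c < d -> 
    X c t = X s t -> X d t = X s t -> mu `]c, d]%classic = 0%E.
  move=> cd Xc Xd; apply/eqP; rewrite eq_le measure_ge0 andbT.
  move/eqP: m0; rewrite /block_mass fine_eq0 ?fin_num_measure//; last exact: measurable_block.
  move/eqP=> <-; apply: le_measure; rewrite ?inE//; first exact: measurable_block.
  move=> x /=; rewrite in_itv/= /block /= => /andP[cx xd].
  apply/eqP; rewrite eq_le; apply/andP; split; [rewrite -Xd|rewrite -Xc];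
    apply: position_nd => //; exact: ltW.
split.
  move=> _ s0'; rewrite lt_neqAle position_nd ?(ltW as_)// andbT; apply/eqP => Xa.
  have a's : Num.max a 0 < s by rewrite gt_max as_.
  have := Sl (Num.max a 0); rewrite le_max lexx orbT => /(_ isT a's).
  rewrite bl// ?ltxx//; apply/eqP; rewrite eq_le position_nd ?(ltW a's)//=.
  by rewrite -Xa position_nd// le_max lexx.
rewrite lt_neqAle position_nd ?(ltW sb)// andbT; apply/eqP => Xb.
by have := Sr b sb; rewrite bl// ltxx.
Qed.

Lemma label_at_support (s t : R) : support_label s -> block_mass (X s t) t = 0 ->
  label_at (X s t) t = s.
Proof.
move=> Ss m0; have s0 : 0 <= s by case: Ss.
rewrite /label_at (_ : ereal_inf _ = s%:E)//.
apply/eqP; rewrite eq_le; apply/andP; split.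
  apply/lee_addgt0Pr => e e0; have /rat_between[q /andP[sq qe]] : s < s + e by rewrite ltrDl.
  apply: (@le_trans _ _ (ratr q)%:E); last by rewrite -EFinD lee_fin ltW.
  apply: ereal_inf_lbound; exists q => //.
  by have [|_ ->] := nonatom_lt (a := s - 1) Ss m0 _ sq s0; first by rewrite ltrBlDr ltrDl.
apply: le_ereal_inf_tmp => _ [q _ <-]; case: ifPn => [Xq|_]; last exact: leey.
by rewrite lee_fin leNgt; apply/negP => /ltW/(position_nd t); rewrite leNgt Xq.
Qed.

(** Linear arithmetic with a large context is slow; the section variables must stay
because hypotheses of the section mention them. *)
Ltac only_section_vars := clear -mu kappa u mu_set1 mu_neg u_continuous minimizers_exist
  RxR measurable_position_r block_graph measurable_block_graph measurable_velocity2 label_seq.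

(** Suppose that X s (t + h) < r1 with r1 = X s t + h (v - e).  A minimizer for
(r1, t + h) lies beyond s, and one for time t and a radius just below X s t lies
before s; the labels between them are close to s, because X(., t) is strictly
increasing there and positions are Lipschitz in time.  Their free positions move
with velocities close to v, against [two_point].  The other bound is symmetric. *)
Lemma slope_nonatom (s t : R) : 0 <= t -> support_label s -> block_mass (X s t) t = 0 ->
  0 < X s t -> 0 < s -> forall e, 0 < e -> exists2 d, 0 < d & forall h, 0 < h -> h <= d ->
    `|X s (t + h) - X s t - h * v t s| <= h * e.
Proof.
move=> t0 Ss m0 r00 s0 e e0; set r0 := X s t.
have [d1 d10 hd1] := free_position_increment s (divr_gt0 e0 (ltr0n R 2)) t0.
pose a := s - d1 / 2; pose b := s + d1 / 2.
have [as_ sb] : a < s /\ s < b by rewrite /a /b; split; lra.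
have [/(_ as_ s0) Xa Xb] := nonatom_lt Ss m0 as_ sb (ltW s0).
have T0 : 0 < t + 1 by lra.
have [Ua Ua0 hUa] := position_lipschitz_time a T0.
have [Ub Ub0 hUb] := position_lipschitz_time b T0.
pose g := Num.min (r0 - X a t) (X b t - r0).
have g0 : 0 < g by rewrite /g lt_min !subr_gt0 Xa.
have [ga gb] : g <= r0 - X a t /\ g <= X b t - r0 by rewrite /g !ge_min !lexx orbT.
pose K := Ua + Ub + `|v t s| + e + 1.
have K0 : 0 < K by rewrite /K ltr_wpDl// !addr_ge0// ltW.
pose d := Num.min 1 (Num.min d1 (g / 2 / K)).
have d0 : 0 < d by rewrite /d !lt_min d10 ltr01 !divr_gt0.
exists d => // h h0; rewrite /d !le_min => /andP[hle1 /andP[hd1' hg]].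
have hK : h * K <= g / 2 by rewrite -ler_pdivlMr.
have th0 : 0 <= t + h by move: t0 h0; only_section_vars; lra.
have thT : t + h <= t + 1 by rewrite lerD2l.
have tT : t <= t + 1 by rewrite lerDl.
have hKE : h * K = h * Ua + h * Ub + h * `|v t s| + h * e + h by rewrite /K; ring.
have hv : `|h * v t s| = h * `|v t s| by rewrite normrM gtr0_norm.
have he : 0 < h * e by rewrite mulr_gt0.
have hUa' : 0 <= h * Ua by rewrite mulr_ge0// ltW.
have hUb' : 0 <= h * Ub by rewrite mulr_ge0// ltW.
have La := hUa t (t + h) t0 tT th0 thT.
have Lb := hUb t (t + h) t0 tT th0 thT.
have thh : t + h - t = h by rewrite addrC addKr.
rewrite thh (gtr0_norm h0) in La; rewrite thh (gtr0_norm h0) in Lb.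
have hv1 := ler_norm (h * v t s); have hv2 := ler_norm (- (h * v t s)).
rewrite normrN hv in hv2; rewrite hv in hv1.
move: La Lb; rewrite !ler_norml => /andP[La1 La2] /andP[Lb1 Lb2].
rewrite [Ua * h]mulrC in La1 La2; rewrite [Ub * h]mulrC in Lb1 Lb2.
have near y0 y1 : a <= y0 -> y1 < b -> forall x, y0 < x -> x <= y1 ->
    `|Y (t + h) x - Y t x - h * v t s| <= h * (e / 2).
  move=> ay y1b x xy0 xy1; apply: hd1 => //; last exact: ltW.
  by rewrite ltr_norml; apply/andP; split; move: ay y1b xy0 xy1; rewrite /a /b; only_section_vars; lra.
have hg2 : 0 < h * e / 4 by rewrite divr_gt0.
apply/andP; split.
- rewrite leNgt; apply/negP => lt1.
  pose r1 := r0 + h * (v t s - e).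
  have r1E : r1 = r0 + h * v t s - h * e by rewrite /r1; ring.
  have Xr1 : X s (t + h) < r1 by rewrite r1E; move: lt1; only_section_vars; lra.
  have r10 : 0 < r1 := le_lt_trans (position_ge0 _ _) Xr1.
  have [y1 my1 sy1] := position_lt th0 Xr1.
  have y1b : y1 < b by apply: (minimizer_lt r10 th0 _ my1); rewrite r1E; move: gb hK hKE Lb1 Lb2 hv1 hv2 he hUa' hUb' h0 g0; only_section_vars; lra.
  pose ep := Num.min (h * e / 4) (g / 2).
  have [ep0 ep1 ep2] : [/\ 0 < ep, ep <= h * e / 4 & ep <= g / 2].
    by rewrite /ep lt_min hg2 !ge_min !lexx orbT divr_gt0.
  have Xa' : X a t < r0 - ep by move: ep2 ga g0; only_section_vars; lra.
  have r0' : 0 < r0 - ep := le_lt_trans (position_ge0 _ _) Xa'.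
  have [y0 my0 ay0] := position_lt t0 Xa'.
  have y0s : y0 < s by apply: (minimizer_lt r0' t0 _ my0); rewrite -/r0 ltrBlDr ltrDl.
  apply: (two_point_contra Ss my0 my1 y0s sy1 hg2) => x xy0 xy1.
  have := near _ _ ay0 y1b x xy0 xy1; rewrite ler_norml => /andP[n1 n2].
  by move: n1 n2 ep0 ep1; rewrite r1E; only_section_vars; lra.
- rewrite leNgt; apply/negP => lt1.
  pose r1 := r0 + h * (v t s + e).
  have r1E : r1 = r0 + h * v t s + h * e by rewrite /r1; ring.
  have Xr1 : r1 < X s (t + h) by rewrite r1E; move: lt1; only_section_vars; lra.
  have Xar1 : X a (t + h) < r1 by rewrite r1E; move: ga hK hKE La1 La2 hv1 hv2 he hUa' hUb' h0 g0; only_section_vars; lra.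
  have r10 : 0 < r1 := le_lt_trans (position_ge0 _ _) Xar1.
  have [y0 my0 ay0] := position_lt th0 Xar1.
  have y0s : y0 < s by apply: (minimizer_lt r10 th0 _ my0).
  pose ep := Num.min (h * e / 4) (g / 2).
  have [ep0 ep1 ep2] : [/\ 0 < ep, ep <= h * e / 4 & ep <= g / 2].
    by rewrite /ep lt_min hg2 !ge_min !lexx orbT divr_gt0.
  have Xs' : X s t < r0 + ep by rewrite -/r0 ltrDl.
  have r0' : 0 < r0 + ep := le_lt_trans (position_ge0 _ _) Xs'.
  have [y1 my1 sy1] := position_lt t0 Xs'.
  have y1b : y1 < b by apply: (minimizer_lt r0' t0 _ my1); move: ep2 gb g0; only_section_vars; lra.
  apply: (two_point_contra Ss my0 my1 y0s sy1 hg2) => x xy0 xy1.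
  have := near _ _ ay0 y1b x xy0 xy1; rewrite ler_norml => /andP[n1 n2].
  by move: n1 n2 ep0 ep1; rewrite r1E; only_section_vars; lra.
Qed.

Lemma support_label_bound (B T z : R) : 0 <= z ->
  (forall r t y, 0 < r -> r <= B -> 0 <= t -> t <= T -> minimizers r t y ->
    y <= z \/ mu `]z, y]%classic = 0%E) ->
  forall s t, support_label s -> 0 <= t -> t <= T -> X s t < B -> s <= z.
Proof.
move=> z0 hz s t [_ Sl _] t0 tT XB.
pose r := (X s t + B) / 2; have [Xr rB] : X s t < r /\ r < B by rewrite /r; split; lra.
have r0 : 0 < r := le_lt_trans (position_ge0 _ _) Xr.
have [y my sy] := position_lt t0 Xr.
have [yz|m0] := hz r t y r0 (ltW rB) t0 tT my; first exact: le_trans yz.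
rewrite leNgt; apply/negP => zs; have := Sl z z0 zs.
by rewrite (mu_itv_null (lexx z) sy m0) ltxx.
Qed.

Lemma label_velocity_bound (B T : R) : 0 < B -> 0 < T -> exists2 U, 0 <= U &
  forall s t, support_label s -> 0 <= t -> t <= T -> X s t < B -> `|v t s| <= U.
Proof.
move=> B0 T0; have [z [U [z0 U0 hz hv _]]] := local_bounds B0 T0.
exists U => // s t Ss t0 tT XB; apply: hv => //; first by case: Ss.
exact: (support_label_bound z0 hz Ss t0 tT XB).
Qed.

Lemma integrable_block_velocity (r t : R) : 0 <= t ->
  mu.-integrable (block r t) (EFin \o v t).
Proof.
move=> t0; pose B := `|r| + 1.
have B0 : 0 < B by rewrite ltr_wpDl.
have T0 : 0 < t + 1 by rewrite ltr_wpDl.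
have [U U0 hU] := label_velocity_bound B0 T0.
have mb := measurable_block r t.
apply: (@integrable_ae_bounded _ _ _ mu _ _ U) => //; first exact: mu_finite.
  exact: measurable_funTS (measurable_label_velocity t).
apply: aeS support_label_ae => s Ss Xs; apply: hU => //; first by rewrite lerDl.
by rewrite Xs /B; have := ler_norm r; lra.
Qed.

Lemma step_small (eta : R) : 0 <= eta ->
  forall d, 0 < d -> \forall k \near \oo, eta / k.+1%:R <= d.
Proof.
move=> eta0 d d0; have : eta * k.+1%:R^-1 @[k --> \oo] --> eta * 0.
  by apply: cvgMr; exact: cvg_harmonic.
rewrite mulr0 => /cvgrPdist_le /(_ d d0); apply: filterS => k.
by rewrite sub0r normrN ger0_norm// mulr_ge0// invr_ge0.
Qed.

(** Here sg = 1 and sg = -1 are the times after and before t.  Compare a minimizer y0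
at time t, for a radius just below r, with a minimizer y1 at time t + h, for a
radius beyond r + h c by the margin de |h|: the labels in ]y0, y1] converge to the
block at r.  Divided by |h|, the inequality of [two_point] becomes the claim. *)
Lemma one_sided_average (t r c sg de : R) : 0 < t -> 0 < r -> `|sg| = 1 -> 0 < de ->
  (forall s, interior_label t s -> X s t = r -> has_slope (X s) t c) ->
  \int[mu]_(s in block r t) (sg * (v t s - c) - de) <= 0.
Proof.
move=> t0 r0 sg1 de0 hc.
pose C := `|c| + de + r.
have C0 : 0 < C by rewrite /C ltr_wpDl// addr_ge0// ltW.
pose eta := Num.min (Num.min t 1) (r / 4 / C).
have eta0 : 0 < eta by rewrite /eta !lt_min t0 ltr01 !divr_gt0.
pose a (k : nat) := eta / k.+1%:R; pose h k := sg * a k.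
have a0 k : 0 < a k by rewrite divr_gt0.
have ah k : `|h k| = a k by rewrite normrM sg1 mul1r gtr0_norm.
have a_eta k : a k <= eta by rewrite ler_pdivrMr// ler_peMr ?(ltW eta0)// ler1n.
have [e1 [e2 e3]] : eta <= t /\ (eta <= 1 /\ eta <= r / 4 / C).
  by rewrite /eta !ge_min !lexx !orbT.
have aC k : a k * C <= r / 4 by rewrite -ler_pdivlMr// (le_trans (a_eta k)).
have hh k : h k ^+ 2 = a k ^+ 2 by rewrite -ah real_normK// num_real.
pose r0_ k := r - r / 2 * a k ^+ 2.
pose r1_ k := r + h k * c + a k * de.
have hc_le k : `|h k * c| <= a k * `|c| by rewrite normrM ah.
have a2 k : a k ^+ 2 <= a k.
  by rewrite expr2 ler_piMr ?(ltW (a0 k))// (le_trans (a_eta k)).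
have hCE k : a k * C = a k * `|c| + a k * de + a k * r by rewrite /C; ring.
have r0p k : 0 < r0_ k.
  have a21 : a k ^+ 2 <= 1 by rewrite (le_trans (a2 k))// (le_trans (a_eta k)).
  have : r / 2 * a k ^+ 2 <= r / 2 * 1 by rewrite ler_wpM2l// divr_ge0// ltW.
  by rewrite /r0_; move: r0; only_section_vars; lra.
have ade k : 0 < a k * de by rewrite mulr_gt0.
have ar k : 0 < a k * r by rewrite mulr_gt0.
have r1p k : 0 < r1_ k.
  have := hc_le k; rewrite ler_norml => /andP[+ _].
  by rewrite /r1_; move: (aC k) (hCE k) r0 (ade k) (ar k); only_section_vars; lra.
have r1B k : r1_ k <= 2 * r.
  have := hc_le k; rewrite ler_norml => /andP[_ +].
  by rewrite /r1_; move: (aC k) (hCE k) r0 (ade k) (ar k); only_section_vars; lra.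
have hat k : - a k <= h k /\ h k <= a k.
  by have := lexx (a k); rewrite -{1}ah ler_norml => /andP.
have th0 k : 0 <= t + h k.
  by have [+ _] := hat k; move: (a_eta k) e1; only_section_vars; lra.
have thT k : t + h k <= t + 1.
  by have [_] := hat k; move: (a_eta k) e2; only_section_vars; lra.
have y0P k : {y | minimizers (r0_ k) t y} by apply: cid; apply: minimizers_exist => //; exact: ltW.
have y1P k : {y | minimizers (r1_ k) (t + h k) y} by apply: cid; exact: minimizers_exist.
pose y0 k := sval (y0P k); pose y1 k := sval (y1P k).
have my0 k : minimizers (r0_ k) t (y0 k) := svalP (y0P k).
have my1 k : minimizers (r1_ k) (t + h k) (y1 k) := svalP (y1P k).
pose I k : set (measurableTypeR R) := `]y0 k, y1 k]%classic.
have mI k : measurable (I k) by exact: measurable_itv.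
pose f_ k (s : measurableTypeR R) : R :=
  \1_(I k) s * ((a k)^-1 * (Y (t + h k) s - Y t s - (r1_ k - r0_ k))).
pose f (s : measurableTypeR R) : R := \1_(block r t) s * (sg * (v t s - c) - de).
have valE k s : (a k)^-1 * (Y (t + h k) s - Y t s - (r1_ k - r0_ k)) =
    sg * (v t s - c) - de + a k * (2^-1 * kappa * E s - r / 2).
  have hE : Y (t + h k) s - Y t s = h k * v t s + 2^-1 * kappa * E s * h k ^+ 2.
    by rewrite /Y /v; field.
  rewrite hE hh /r1_ /r0_ /h.
  have := a0 k; move: (a k) => x x0; field; exact: lt0r_neq0.
have r20 : 0 < 2 * r by rewrite mulr_gt0.
have T0 : 0 < t + 1 by rewrite ltr_wpDl// ltW.
have [z [U [z0 U0 hz _ hY]]] := local_bounds r20 T0.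
pose M := U + (`|c| + de + r / 2).
have mf_ k : measurable_fun setT (f_ k).
  apply: measurable_funM; first exact: measurable_indic.
  apply: measurable_funM => //; apply: measurable_funB => //.
  by apply: measurable_funB; exact: measurable_free_position.
have mf : measurable_fun setT f.
  apply: measurable_funM; first by apply: measurable_indic; exact: measurable_block.
  apply: measurable_funB => //; apply: measurable_funM => //; apply: measurable_funB => //.
  exact: measurable_label_velocity.
have bnd : {ae mu, forall s, forall k, setT s -> `|f_ k s| <= M}.
  have h1 k : {ae mu, forall s, I k s -> s <= z}.
    have [yz|m0] := hz _ _ _ (r1p k) (r1B k) (th0 k) (thT k) (my1 k).
      by apply: aeW => s; rewrite /I /= in_itv/= => /andP[_ sy]; exact: le_trans yz.
    have := ae_not_null (measurable_itv `]z, y1 k]) m0.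
    apply: aeS => s; rewrite /I /= !in_itv/= => hs /andP[_ sy].
    by rewrite leNgt; apply/negP => zs; apply: hs; rewrite zs sy.
  have := ae_foralln h1; apply: aeS => s hs k _.
  have M0 : 0 <= M by rewrite !addr_ge0// ?divr_ge0// ltW.
  rewrite /f_ indicE; case: (boolP (s \in I k)) => [|_]; last by rewrite mul0r normr0.
  rewrite inE => sI; have sz := hs k sI; move: sI; rewrite /I /= in_itv/= => /andP[ys sy].
  rewrite mul1r normrM normfV (gtr0_norm (a0 k)) ler_pdivrMl//.
  have s0 : 0 <= s by apply: le_trans (ltW ys); case: (my0 k).
  have tT : t <= t + 1 by rewrite lerDl.
  have := hY s t (t + h k) s0 sz (ltW t0) tT (th0 k) (thT k).
  rewrite (_ : t + h k - t = h k); last by rewrite addrC addKr.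
  rewrite ah => hYk; apply: (le_trans (ler_normB _ _)); rewrite /M mulrDr.
  apply: lerD; first by rewrite mulrC.
  have -> : r1_ k - r0_ k = h k * c + a k * de + r / 2 * a k ^+ 2 by rewrite /r1_ /r0_; ring.
  rewrite !mulrDr; apply: (le_trans (ler_normD _ _)); apply: lerD.
    apply: (le_trans (ler_normD _ _)); apply: lerD; first exact: hc_le.
    by rewrite ger0_norm// ltW.
  have r2 : 0 <= r / 2 by rewrite divr_ge0// ltW.
  rewrite ger0_norm; last by apply: mulr_ge0 => //; exact: sqr_ge0.
  by rewrite mulrC ler_wpM2r.
have cvgf : {ae mu, forall s, setT s -> f_ k s @[k --> \oo] --> f s}.
  apply: aeS (interior_label_ae t) => s is_ _; have [Ss _] := is_.
  have small := step_small (ltW eta0).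
  have lim0 (g : nat -> R) : (\forall k \near \oo, f_ k s = 0) -> X s t <> r ->
      f_ k s @[k --> \oo] --> f s.
    move=> f0 Xs; rewrite /f indicE memNset ?mul0r//.
    by apply: cvg_near_cst; exact: f0.
  have [Xr|rX|Xr] := ltgtP (X s t) r.
  - apply: lim0 => //; last by move=> Xs; move: Xr; rewrite Xs ltxx.
    pose g := (r - X s t) / r; have g0 : 0 < g by rewrite divr_gt0// subr_gt0.
    apply: filterS (small g g0) => k; rewrite -/(a k) => hk.
    rewrite /f_ indicE memNset ?mul0r// /I /= in_itv/= => /andP[ys _].
    move: ys; rewrite ltNge => /negP; apply.
    apply: reaches_minimizer (my0 k) => //; first exact: ltW.
    have : a k * r <= r - X s t by rewrite -ler_pdivlMr.
    have : a k ^+ 2 * r <= a k * r by rewrite ler_wpM2r// ltW.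
    have := ar k; have a2r : 0 < a k ^+ 2 * r by rewrite mulr_gt0// exprn_gt0.
    by rewrite /r0_; move: Xr a2r; only_section_vars; lra.
  - apply: lim0 => //; last by move=> Xs; move: rX; rewrite Xs ltxx.
    have [Us Us0 hUs] := position_lipschitz_time s T0.
    pose D := Us + `|c| + de + 1; have D0 : 0 < D by rewrite ltr_wpDl// !addr_ge0// ltW.
    pose g := (X s t - r) / D; have g0 : 0 < g by rewrite divr_gt0// subr_gt0.
    apply: filterS (small g g0) => k; rewrite -/(a k) => hk.
    rewrite /f_ indicE memNset ?mul0r// /I /= in_itv/= => /andP[_ sy].
    move: sy; rewrite leNgt => /negP; apply.
    apply: (minimizer_lt (r1p k) (th0 k) _ (my1 k)).
    have : a k * D <= X s t - r by rewrite -ler_pdivlMr.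
    rewrite (_ : a k * D = a k * Us + a k * `|c| + a k * de + a k); last by rewrite /D; ring.
    have tT : t <= t + 1 by rewrite lerDl.
    have := hUs t (t + h k) (ltW t0) tT (th0 k) (thT k).
    rewrite (_ : t + h k - t = h k); last by rewrite addrC addKr.
    rewrite ah [Us * _]mulrC ler_norml => /andP[b1 _] b2.
    have := hc_le k; rewrite ler_norml => /andP[_ b3].
    by rewrite /r1_; move: b1 b2 b3 (a0 k); only_section_vars; lra.
  - have f_E : \forall k \near \oo, f_ k s =
        sg * (v t s - c) - de + a k * (2^-1 * kappa * E s - r / 2).
      have [d d0 hd] := hc s is_ Xr _ (divr_gt0 de0 (ltr0n R 2)).
      apply: filterS (small d d0) => k; rewrite -/(a k) => hk.
      rewrite /f_ indicE mem_set ?mul1r ?valE//.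
      rewrite /I /= in_itv/=; apply/andP; split.
        apply: (minimizer_lt (r0p k) (ltW t0) _ (my0 k)).
        by rewrite Xr /r0_ ltrBlDr ltrDl mulr_gt0 ?divr_gt0// exprn_gt0.
      apply: (reaches_minimizer (r1p k) (th0 k) Ss _ (my1 k)).
      have := hd (h k); rewrite ah => /(_ hk); rewrite ler_norml => /andP[_ b1].
      by rewrite /r1_; move: b1 (ade k); rewrite Xr; only_section_vars; lra.
    rewrite /f indicE mem_set// mul1r.
    have : sg * (v t s - c) - de + a k * (2^-1 * kappa * E s - r / 2) @[k --> \oo] -->
        sg * (v t s - c) - de + 0 * (2^-1 * kappa * E s - r / 2).
      apply: cvgD; first exact: cvg_cst.
      apply: cvgMl; rewrite -[X in _ --> X](mulr0 eta).
      by apply: cvgMr; exact: cvg_harmonic.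
    rewrite mul0r addr0; apply: cvg_trans; apply: near_eq_cvg.
    by apply: filterS f_E => k ->.
have [_ cvgI] := @Rdominated_convergence _ _ _ mu setT f_ f (fun=> M) measurableT mf_ mf cvgf
  (integrable_cst_fin M measurableT) bnd.
rewrite -Rintegral_indicl -(cvg_lim (@Rhausdorff R) cvgI).
apply: limr_le; first by apply/cvg_ex; exists (\int[mu]_x f x).
apply: nearW => k; rewrite /f_ Rintegral_indicl RintegralZl//.
  rewrite mulr_ge0_le0// ?invr_ge0 ?(ltW (a0 k))//.
  exact: two_point (my0 k) (my1 k).
have i rr tt : mu.-integrable (I k) (EFin \o (fun s => Y tt s - rr)).
  by apply: (@integrable_free_position (y0 k) (y1 k)) => //; exact: subset_itv_oc_cc.
rewrite (_ : _ \o _ = (fun s => (Y (t + h k) s - r1_ k)%:E - (Y t s - r0_ k)%:E)%E).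
  by apply: integrableB => //; exact: i.
by apply/funext => x /=; rewrite -EFinB; congr EFin; ring.
Qed.

(** The bounds from the future and from the past leave no choice for c. *)
Lemma block_average (t r c : R) : 0 < t -> 0 < r -> block_mass r t != 0 ->
  (forall s, interior_label t s -> X s t = r -> has_slope (X s) t c) ->
  c = w r t.
Proof.
move=> t0 r0 m0 hc; have mb := measurable_block r t.
rewrite /w (negbTE m0); apply: (mulIf m0); rewrite divfK//.
have iv := integrable_block_velocity r (ltW t0).
have ic x := integrable_cst_fin x mb.
have iE sg de : \int[mu]_(s in block r t) (sg * (v t s - c) - de) =
    sg * (block_momentum r t - c * block_mass r t) - de * block_mass r t.
  have ivc : mu.-integrable (block r t) (EFin \o (fun s => v t s - c)).
    rewrite (_ : _ \o _ = (fun s => (v t s)%:E - (cst c s)%:E)%E)//.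
    by apply: integrableB => //; exact: ic.
  rewrite RintegralB//; last first.
    rewrite (_ : _ \o _ = (fun s => sg%:E * (v t s - c)%:E)%E)//.
    exact: integrableZl.
  by rewrite RintegralZl// RintegralB// !Rintegral_cst.
have mp : 0 < block_mass r t by rewrite lt_neqAle eq_sym m0 fine_ge0.
apply/eqP; rewrite eq_sym -subr_eq0 -normr_le0; apply/ler_addgt0Pr => e e0; rewrite add0r.
have em : 0 < e / block_mass r t by rewrite divr_gt0.
have h1 := one_sided_average t0 r0 (normr1 R) em hc.
have h2 := one_sided_average t0 r0 (normrN1 R) em hc.
rewrite !iE divfK// in h1 h2.
by rewrite ler_norml; apply/andP; split; move: h1 h2; only_section_vars; lra.
Qed.

(** The equation of motion of almost every label: three cases, according to whether
the label is at the centre, outside the blocks, or inside a block. *)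
Lemma position_derivative (t : R) : good_time t -> {ae mu, forall s, forall e, 0 < e ->
  exists2 d, 0 < d & forall h, 0 < h -> h <= d ->
    `|X s (t + h) - X s t - h * (if X s t == 0 then 0 else w (X s t) t)| <= h * e}.
Proof.
move=> gt; have [t0 _] := gt.
apply: aeS2 (interior_label_ae t) (ae_not_null (measurable_set1 (0 : R)) (mu_set1 0)) => s is_ /= s0' e e0.
have [Ss _] := is_.
have s0 : 0 < s by case: Ss => + _ _; rewrite le_eqVlt => /orP[/eqP/esym//|].
have of_slope c : has_slope (X s) t c -> exists2 d, 0 < d & forall h, 0 < h -> h <= d ->
    `|X s (t + h) - X s t - h * c| <= h * e.
  move=> /(_ e e0)[d d0 hd]; exists d => // h h0 hd'.
  by have := hd h; rewrite (gtr0_norm h0); exact.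
case: eqVneq => [Xs|Xs]; first exact/of_slope/slope_center.
have Xs0 : 0 < X s t by rewrite lt_neqAle eq_sym Xs position_ge0.
have [m0|m0] := eqVneq (block_mass (X s t) t) 0.
  rewrite /w m0 eqxx label_at_support//.
  exact: slope_nonatom (ltW t0) Ss m0 Xs0 s0 e e0.
have [c hc] := block_slope gt m0.
by rewrite -(block_average t0 Xs0 m0 hc); apply/of_slope/hc.
Qed.

Lemma velocity_field_bound (B T : R) : 0 < B -> 0 < T -> exists2 U, 0 <= U &
  forall s t, support_label s -> 0 <= t -> t <= T -> X s t < B ->
    `|v t s| <= U /\ `|w (X s t) t| <= U.
Proof.
move=> B0 T0; have [U U0 hU] := label_velocity_bound B0 T0.
exists U => // s t Ss t0 tT XB; split; first exact: hU.
rewrite /w; case: eqVneq => [m0|m0]; first by rewrite label_at_support//; exact: hU.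
have mb := measurable_block (X s t) t.
have mp : 0 < block_mass (X s t) t by rewrite lt_neqAle eq_sym m0 fine_ge0.
rewrite normrM normfV (gtr0_norm mp) ler_pdivrMr//.
apply: Rintegral_ae_bounded => //; first exact: mu_finite.
  exact: measurable_funTS (measurable_label_velocity t).
by apply: aeS support_label_ae => x Sx Xx; apply: hU => //; rewrite Xx.
Qed.

(** * Averages over the blocks *)

(** The blocks of positive mass are among the countably many blocks of rational
labels; their unions A k exhaust what g can see. *)
Lemma blockwise_null (t : R) (g : measurableTypeR R -> R) :
  mu.-integrable setT (EFin \o g) ->
  (forall r, block_mass r t != 0 -> \int[mu]_(s in block r t) g s = 0) ->
  {ae mu, forall s, block_mass (X s t) t = 0 -> g s = 0} ->
  \int[mu]_s g s = 0.
Proof.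
move=> gi gB g0.
have mg : measurable_fun setT g by apply/measurable_EFinP; exact: measurable_int gi.
pose B k : set (measurableTypeR R) := if @unpickle rat k is Some q then
  (if block_mass (X (ratr q) t) t == 0 then set0 else block (X (ratr q) t) t) else set0.
have mB k : measurable (B k).
  by rewrite /B; case: unpickle => // q; case: ifP => // _; exact: measurable_block.
pose A := fix A k := if k is j.+1 then A j `|` B j else set0.
have mA k : measurable (A k).
  by elim: k => //= k IH; exact: measurableU.
(* a union of blocks contains a block as soon as it meets it *)
have saturated k s s' : A k s -> X s' t = X s t -> A k s'.
  elim: k => //= k IH [/IH h /h|]; first by left.
  rewrite /B; case: unpickle => // q; case: ifP => // _.
  by rewrite /block /= => Xs Xs'; right; rewrite Xs'.
have gi' (D : set (measurableTypeR R)) : measurable D -> mu.-integrable D (EFin \o g).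
  by move=> mD; apply: integrableS gi.
have IA k : \int[mu]_(s in A k) g s = 0.
  elim: k => /= [|k IH]; first by rewrite Rintegral_set0.
  have [[s [As Bs]]|nAB] := pselect (A k `&` B k !=set0).
    suff -> : A k `|` B k = A k by [].
    apply/setUidPl => s'; move: Bs; rewrite /B; case: unpickle => // q; case: ifP => // _.
    by rewrite /block /= => Xs Xs'; apply: saturated As _; rewrite Xs.
  have [B0|[q [mq Bq]]] : B k = set0 \/
      exists q, block_mass (X (ratr q) t) t != 0 /\ B k = block (X (ratr q) t) t.
    rewrite /B; case: unpickle => [q|]; last by left.
    by case: ifPn => h; [left|right; exists q].
  - by rewrite B0 setU0.
  - rewrite Rintegral_setU//; last 2 first.
    + exact/gi'/measurableU.
    + by apply/disj_setPS => s [As Bs]; apply: nAB; exists s.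
    by rewrite IH Bq gB// addr0.
pose f_ k s := \1_(A k) s * g s.
have [] := @Rdominated_convergence _ _ _ mu setT f_ g (fun s => `|g s|) measurableT.
- by move=> k; apply: measurable_funM => //; exact: measurable_indic.
- exact: mg.
- apply: aeS g0 => s gs _.
  have [m0|m0] := eqVneq (block_mass (X s t) t) 0.
    by rewrite gs//; apply: cvg_near_cst; apply: nearW => k; rewrite /f_ gs// mulr0.
  have [q Xq] := block_rat m0.
  apply: cvg_near_cst; exists (pickle q).+1 => // k /= qk.
  rewrite /f_ indicE mem_set ?mul1r//.
  have AS j : A j `<=` A j.+1 by move=> x Ax; left.
  have Aq : A (pickle q).+1 s.
    by right; rewrite /B pickleK Xq (negbTE m0).
  elim: k qk => // k IH; rewrite leq_eqVlt => /orP[/eqP <-//|]; rewrite ltnS => /IH.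
  exact: AS.
- exact: integrable_norm.
- apply: aeW => s k _; rewrite /f_ normrM ler_piMl//= indicE.
  by case: (s \in A k) => /=; rewrite ?normr1 ?normr0.
move=> _; have -> : (fun k => \int[mu]_s f_ k s) = fun=> 0.
  by apply/funext => k; rewrite /f_ Rintegral_indicl IA.
by move=> /(cvg_lim (@Rhausdorff R)); rewrite lim_cst// => ->.
Qed.

Lemma velocity_field_label (s t : R) : support_label s -> block_mass (X s t) t = 0 ->
  w (X s t) t = v t s.
Proof. by move=> Ss m0; rewrite /w m0 eqxx label_at_support. Qed.

Lemma velocity_field_average (r t : R) : 0 <= t -> block_mass r t != 0 ->
  \int[mu]_(s in block r t) (w r t - v t s) = 0.
Proof.
move=> t0 m0; have mb := measurable_block r t.
rewrite RintegralB//; last 2 first.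
- exact: integrable_cst_fin.
- exact: integrable_block_velocity.
by rewrite Rintegral_cst// /w (negbTE m0) divfK// subrr.
Qed.

(** On a block, k(X) is constant and w is the mean of v; off the blocks w(X) = v. *)
Lemma velocity_field_test (t B C : R) (k : R -> R) : 0 <= t -> 0 < B ->
  measurable_fun setT (k : measurableTypeR R -> R) ->
  (forall r, B <= r -> k r = 0) -> 0 <= C -> {ae mu, forall s, `|k (X s t)| <= C} ->
  mu.-integrable setT (EFin \o (fun s => v t s * k (X s t))) /\
  \int[mu]_s (w (X s t) t * k (X s t)) = \int[mu]_s (v t s * k (X s t)).
Proof.
move=> t0 B0 mk kB C0 kC.
have T0 : 0 < t + 1 by rewrite ltr_wpDl.
have [U U0 hU] := velocity_field_bound B0 T0.
have tT : t <= t + 1 by rewrite lerDl.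
have mkX : measurable_fun setT (fun s : measurableTypeR R => k (X s t)).
  exact: (measurableT_comp mk (measurable_position_label t)).
have iv : mu.-integrable setT (EFin \o (fun s => v t s * k (X s t))).
  apply: (@integrable_ae_bounded _ _ _ mu _ _ (U * C)) => //; first exact: mu_finite.
    by apply: measurable_funM => //; exact: measurable_label_velocity.
  apply: aeS2 support_label_ae kC => s Ss kXC _; rewrite normrM.
  have [XB|BX] := ltP (X s t) B; first by apply: ler_pM => //; have [] := hU s t Ss t0 tT XB.
  by rewrite kB// normr0 mulr0 mulr_ge0.
have iw : mu.-integrable setT (EFin \o (fun s => w (X s t) t * k (X s t))).
  apply: (@integrable_ae_bounded _ _ _ mu _ _ (U * C)) => //; first exact: mu_finite.
    apply: measurable_funM => //.
    apply: (measurableT_comp measurable_velocity_field (g := fun s : measurableTypeR R => (X s t, t))).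
    by apply: measurable_fun_pair => //; exact: measurable_position_label.
  apply: aeS2 support_label_ae kC => s Ss kXC _; rewrite normrM.
  have [XB|BX] := ltP (X s t) B; first by apply: ler_pM => //; have [] := hU s t Ss t0 tT XB.
  by rewrite kB// normr0 mulr0 mulr_ge0.
split => //; apply/eqP; rewrite -subr_eq0 -RintegralB//; apply/eqP.
apply: (@blockwise_null t).
- rewrite (_ : _ \o _ = (fun s => (w (X s t) t * k (X s t))%:E - (v t s * k (X s t))%:E)%E)//.
  exact: integrableB.
- move=> r m0; transitivity (\int[mu]_(s in block r t) (k r * (w r t - v t s))).
    by apply: eq_Rintegral => s; rewrite inE /block /= => ->; ring.
  rewrite RintegralZl//.
  + by rewrite velocity_field_average// mulr0.
  + exact: measurable_block.
  + rewrite (_ : _ \o _ = (fun s => (cst (w r t) s)%:E - (v t s)%:E)%E)//.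
    have mb := measurable_block r t.
    by apply: integrableB => //; [exact: integrable_cst_fin|exact: integrable_block_velocity].
- apply: aeS support_label_ae => s Ss m0.
  by rewrite velocity_field_label// subrr.
Qed.

(** * The average rule for the field *)

Definition average_mass (r t : R) : R :=
  (fine (mu [set s | X s t < r]) + fine (mu [set s | X s t <= r])) / 2.

Lemma enclosed_massE s : E s = fine (mu `]-oo, s]%classic).
Proof.
have [s0|s0] := leP 0 s; last first.
  rewrite enclosed_mass_neg//; suff -> : mu `]-oo, s]%classic = 0%E by [].
  apply/eqP; rewrite eq_le measure_ge0 andbT.
  rewrite -mu_neg; apply: le_measure; rewrite ?inE//.
  by apply: subset_itvl; rewrite bnd_simp.
have -> : `]-oo, s]%classic = `]-oo, 0[ `|` `[0, s] :> set R.
  by rewrite -itv_bndbnd_setU// bnd_simp.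
rewrite measureU//; first by rewrite [X in (X + _)%E](_ : _ = 0%E) ?add0e.
apply/seteqP; split => x //= []; rewrite !in_itv/= => h1 /andP[h2 _].
by have := le_lt_trans h2 h1; rewrite ltxx.
Qed.

Lemma measurable_position_lt r t : measurable ([set s | X s t < r] : set (measurableTypeR R)).
Proof.
rewrite (_ : [set s | _] = setT `&` X^~ t @^-1` `]-oo, r[).
  by apply: measurable_position_label => //; exact: measurable_itv.
by rewrite setTI; apply/seteqP; split => s /=; rewrite in_itv.
Qed.

Lemma measurable_position_le r t : measurable ([set s | X s t <= r] : set (measurableTypeR R)).
Proof.
rewrite (_ : [set s | _] = setT `&` X^~ t @^-1` `]-oo, r]).
  by apply: measurable_position_label => //; exact: measurable_itv.
by rewrite setTI; apply/seteqP; split => s /=; rewrite in_itv.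
Qed.

Lemma mass_le_split r t : fine (mu [set s | X s t <= r]) =
  fine (mu [set s | X s t < r]) + block_mass r t.
Proof.
have -> : [set s | X s t <= r] = [set s | X s t < r] `|` block r t.
  apply/seteqP; split => s /=; rewrite /block/=.
    by rewrite le_eqVlt => /orP[/eqP|]; [right|left].
  by case=> [/ltW//|->].
have ml := measurable_position_lt r t; have mb := measurable_block r t.
rewrite measureU ?fineD ?fin_num_measure//.
by apply/seteqP; split => s //= []; rewrite /block/= => + Xs; rewrite Xs ltxx.
Qed.

(** The square B x B is cut by its diagonal, a null set, into two halves of equal
mass. *)
Lemma symmetric_mass (B : set (measurableTypeR R)) : measurable B ->
  \int[mu]_(s in B) fine (mu (B `&` `]-oo, s]%classic)) = fine (mu B) ^+ 2 / 2.
Proof.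
move=> mB; pose b s := fine (mu (B `&` `]-oo, s]%classic)).
have mBi (i : interval R) : measurable (B `&` [set` i] : set (measurableTypeR R)).
  by apply: measurableI => //; exact: measurable_itv.
have mb : measurable_fun setT (b : measurableTypeR R -> R).
  apply: nondecreasing_measurable => // x y xy; apply: fine_measure_le => //.
  by apply: setIS; apply: subset_itvl; rewrite bnd_simp.
have b0 s : 0 <= b s by rewrite fine_ge0.
have bm s : b s <= fine (mu B) by apply: fine_measure_le => //; exact: subIsetl.
pose A : set (measurableTypeR R * measurableTypeR R) :=
  [set p | [/\ B p.1, B p.2 & p.1 <= p.2]].
have mle : measurable ([set p | p.1 <= p.2] : set (measurableTypeR R * measurableTypeR R)).
  have : measurable_fun setT (fun p : measurableTypeR R * measurableTypeR R => p.1 <= p.2).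
    by apply: measurable_fun_ler.
  by move=> /(_ measurableT [set true] I); rewrite setTI; congr measurable;
    apply/seteqP; split => p.
have mA : measurable A.
  rewrite (_ : A = (B `*` B) `&` [set p | p.1 <= p.2]).
    by apply: measurableI => //; exact: measurableX.
  by apply/seteqP; split => p; rewrite /A /= => -[]; [split|case].
pose f (p : measurableTypeR R * measurableTypeR R) : \bar R := (\1_A p)%:E.
have mf : measurable_fun setT f by apply/measurable_EFinP; exact: measurable_indic.
have f0 p : (0 <= f p)%E by rewrite lee_fin indicE.
have := @fubini_tonelli _ _ _ _ _ mu mu f mf f0.
have in1 s : (\int[mu]_y f (s, y) = (\1_B s * (fine (mu B) - b s))%:E)%E.
  have [Bs|nBs] := pselect (B s); last first.
    rewrite [in RHS]indicE memNset// mul0r integral0_eq// => y _.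
    by rewrite /f indicE memNset// => -[].
  transitivity (\int[mu]_y (\1_(B `&` `[s, +oo[) y)%:E)%E.
    apply: eq_integral => y _; rewrite /f !indicE; congr ((_ : bool)%:R%:E).
    apply/idP/idP; rewrite !inE /A /= in_itv/= andbT; first by case.
    by case.
  rewrite integral_indic// setIT [in RHS]indicE mem_set// mul1r.
  have mBs : measurable (B `&` `[s, +oo[ : set (measurableTypeR R)) by [].
  rewrite -[LHS]fineK ?fin_num_measure//; congr EFin.
  have -> : b s = fine (mu (B `&` `]-oo, s[%classic)).
    rewrite /b; have -> : B `&` `]-oo, s] = (B `&` `]-oo, s[) `|` (B `&` [set s]).
      rewrite -setIUr; congr (_ `&` _); apply/seteqP; split => y /=; rewrite !in_itv/=.
        by rewrite le_eqVlt => /orP[/eqP|]; [right|left].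
      by case=> [/ltW//|->].
    have mBs1 : measurable (B `&` [set s] : set (measurableTypeR R)).
      by apply: measurableI => //; exact: measurable_set1.
    have z1 : mu (B `&` [set s]) = 0%E.
      apply/eqP; rewrite eq_le measure_ge0 andbT -(mu_set1 s).
      by apply: le_measure; rewrite ?inE//; exact: subIsetr.
    rewrite measureU//; first by rewrite [X in (_ + X)%E](_ : _ = 0%E) ?adde0.
    by apply/seteqP; split => y //= []; rewrite in_itv/= => -[_ ys] [_ yE]; rewrite yE ltxx in ys.
  have BE : B = (B `&` `]-oo, s[) `|` (B `&` `[s, +oo[).
    rewrite -setIUr -[LHS]setIT; congr (_ `&` _); apply/seteqP; split => y //= _.
    by rewrite !in_itv/= andbT; case: (ltP y s) => _; [left|right].
  rewrite [X in _ = fine (mu X) - _]BE.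
  rewrite measureU//; first by rewrite fineD ?fin_num_measure// addrC addKr.
  apply/seteqP; split => y //= []; rewrite !in_itv/= andbT => -[_ ys] [_ sy].
  by have := lt_le_trans ys sy; rewrite ltxx.
have in2 y : (\int[mu]_x f (x, y) = (\1_B y * b y)%:E)%E.
  have [By|nBy] := pselect (B y); last first.
    rewrite [in RHS]indicE memNset// mul0r integral0_eq// => x _.
    by rewrite /f indicE memNset// => -[].
  transitivity (\int[mu]_x (\1_(B `&` `]-oo, y]) x)%:E)%E.
    apply: eq_integral => x _; rewrite /f !indicE; congr ((_ : bool)%:R%:E).
    apply/idP/idP; rewrite !inE /A /= in_itv/=; first by case.
    by case.
  rewrite integral_indic// setIT [in RHS]indicE mem_set// mul1r.
  by rewrite fineK ?fin_num_measure.
under eq_integral do rewrite in1; under [in X in _ = X -> _]eq_integral do rewrite in2.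
move=> /(congr1 fine); rewrite -!/(Rintegral _ _ _) !Rintegral_indicl.
have ib : mu.-integrable B (EFin \o b).
  apply: (@integrable_le_cst _ _ _ mu _ _ (fine (mu B))) => //; first exact: mu_finite.
    exact: measurable_funTS.
  by move=> s _; rewrite ger0_norm.
rewrite RintegralB//; last exact: integrable_cst_fin.
rewrite Rintegral_cst// -/(b _) expr2 => h.
have {}h : fine (mu B) * fine (mu B) = 2 * \int[mu]_(s in B) b s.
  by rewrite mulr_natl mulr2n -[X in _ = X + _]h subrK.
by rewrite h mulrC mulKf.
Qed.

(** The mass enclosed by a label of a block is the mass in front of the block plus
the mass of the block up to the label, whose mean is half of the mass of the block
by symmetry. *)
Lemma average_mass_block (r t : R) :
  \int[mu]_(s in block r t) (average_mass r t - E s) = 0.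
Proof.
have mb := measurable_block r t; set B := block r t in mb *.
pose L := fine (mu [set s | X s t < r]).
have ES s : s \in B -> E s = L + fine (mu (B `&` `]-oo, s]%classic)).
  rewrite inE /B /block /= => Xs; rewrite enclosed_massE.
  have AE : `]-oo, s]%classic = [set s | X s t < r] `|` (B `&` `]-oo, s]).
    apply/seteqP; split => x /=; rewrite in_itv/=.
      move=> xs; have : X x t <= r by rewrite -Xs; exact: position_nd.
      by case: (ltgtP (X x t) r) => // Xx _; [left|right].
    case=> [Xx|[]//]; rewrite leNgt; apply/negP => /ltW /(position_nd t).
    by rewrite Xs leNgt Xx.
  have ml := measurable_position_lt r t.
  have mi : measurable (B `&` `]-oo, s] : set (measurableTypeR R)).
    by apply: measurableI => //; exact: measurable_itv.
  transitivity (fine (mu ([set s | X s t < r] `|` (B `&` `]-oo, s])))).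
    by congr (fine (mu _)).
  rewrite measureU//; first by rewrite fineD ?fin_num_measure.
  by apply/seteqP; split => x //= []; rewrite /B /block/= => + [Xx _]; rewrite Xx ltxx.
transitivity (\int[mu]_(s in B) ((average_mass r t - L) - fine (mu (B `&` `]-oo, s]%classic)))).
  by apply: eq_Rintegral => s /ES ->; ring.
rewrite RintegralB//; last 2 first.
- exact: integrable_cst_fin.
- apply: (@integrable_le_cst _ _ _ mu _ _ (fine (mu B))) => //; first exact: mu_finite.
    apply: measurable_funTS; apply: nondecreasing_measurable => // x y xy.
    apply: fine_measure_le; last by apply: setIS; apply: subset_itvl; rewrite bnd_simp.
      by apply: measurableI => //; exact: measurable_itv.
    by apply: measurableI => //; exact: measurable_itv.
  move=> s _; rewrite ger0_norm ?fine_ge0//; apply: fine_measure_le => //.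
    by apply: measurableI => //; exact: measurable_itv.
rewrite symmetric_mass// Rintegral_cst// /average_mass mass_le_split -/L /block_mass -/B.
by field.
Qed.

Lemma average_mass_label (s t : R) : support_label s -> block_mass (X s t) t = 0 ->
  average_mass (X s t) t = E s.
Proof.
move=> _ m0; rewrite /average_mass mass_le_split m0 addr0.
have -> : forall x : R, (x + x) / 2 = x by move=> x; field.
have ml := measurable_position_lt (X s t) t; have mle := measurable_position_le (X s t) t.
apply/eqP; rewrite enclosed_massE eq_le; apply/andP; split.
  apply: fine_measure_le => // x /= Xx; rewrite in_itv/= leNgt; apply/negP => /ltW /(position_nd t).
  by rewrite leNgt Xx.
rewrite -[leRHS]addr0 -m0 -mass_le_split; apply: fine_measure_le => // x /=; rewrite in_itv/=.
exact: position_nd.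
Qed.

Lemma average_mass_bound r t : `|average_mass r t| <= total_mass.
Proof.
have ml := measurable_position_lt r t; have mle := measurable_position_le r t.
have h1 : fine (mu [set s | X s t < r]) <= total_mass by apply: fine_measure_le.
have h2 : fine (mu [set s | X s t <= r]) <= total_mass by apply: fine_measure_le.
have h3 : 0 <= fine (mu [set s | X s t < r]) by rewrite fine_ge0.
have h4 : 0 <= fine (mu [set s | X s t <= r]) by rewrite fine_ge0.
rewrite /average_mass ger0_norm; last by rewrite divr_ge0// addr_ge0.
by move: h1 h2; only_section_vars; lra.
Qed.

Lemma average_mass_nd t : {homo average_mass^~ t : r r' / r <= r'}.
Proof.
move=> r r' rr'; rewrite /average_mass ler_pM2r// lerD//.
  apply: fine_measure_le; try exact: measurable_position_lt.
  by move=> x /= /lt_le_trans; apply.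
apply: fine_measure_le; try exact: measurable_position_le.
by move=> x /= /le_trans; apply.
Qed.

Lemma average_mass_test (t C : R) (k : R -> R) : 0 <= t ->
  measurable_fun setT (k : measurableTypeR R -> R) ->
  (forall r, `|k r| <= C) ->
  \int[mu]_s (average_mass (X s t) t * k (X s t)) = \int[mu]_s (E s * k (X s t)).
Proof.
move=> t0 mk kC.
have C0 : 0 <= C by apply: le_trans (kC 0).
have mkX : measurable_fun setT (fun s : measurableTypeR R => k (X s t)).
  exact: (measurableT_comp mk (measurable_position_label t)).
have ia (g : measurableTypeR R -> R) : measurable_fun setT g -> (forall s, `|g s| <= total_mass) ->
    mu.-integrable setT (EFin \o (fun s => g s * k (X s t))).
  move=> mg gm; apply: (@integrable_le_cst _ _ _ mu _ _ (total_mass * C)) => //.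
  - exact: mu_finite.
  - exact: measurable_funM.
  - by move=> s _; rewrite normrM ler_pM.
have i1 := ia _ measurable_enclosed_mass.
have i2 := ia (fun s => average_mass (X s t) t).
have {}i1 : mu.-integrable setT (EFin \o (fun s => E s * k (X s t))).
  by apply: i1 => s; rewrite ger0_norm ?enclosed_mass_ge0// enclosed_mass_le.
have {}i2 : mu.-integrable setT (EFin \o (fun s => average_mass (X s t) t * k (X s t))).
  apply: i2 => [|s]; last exact: average_mass_bound.
  apply: nondecreasing_measurable => // a b ab; apply: average_mass_nd; exact: position_nd.
apply/eqP; rewrite -subr_eq0 -RintegralB//; apply/eqP.
apply: (@blockwise_null t).
- rewrite (_ : _ \o _ = (fun s => (average_mass (X s t) t * k (X s t))%:E - (E s * k (X s t))%:E)%E)//.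
  exact: integrableB.
- move=> r m0; transitivity (\int[mu]_(s in block r t) (k r * (average_mass r t - E s))).
    by apply: eq_Rintegral => s; rewrite inE /block /= => ->; ring.
  rewrite RintegralZl//.
  + by rewrite average_mass_block// mulr0.
  + exact: measurable_block.
  + have mb := measurable_block r t.
    rewrite (_ : _ \o _ = (fun s => (cst (average_mass r t) s)%:E - (E s)%:E)%E)//.
    apply: integrableB => //; first exact: integrable_cst_fin.
    apply: (@integrable_le_cst _ _ _ mu _ _ total_mass) => //; first exact: mu_finite.
      exact: measurable_funTS measurable_enclosed_mass.
    by move=> s _; rewrite ger0_norm ?enclosed_mass_ge0// enclosed_mass_le.
- apply: aeS support_label_ae => s Ss m0.
  by rewrite average_mass_label// subrr.
Qed.

End variational.

(** * Test functions *)

Section directional.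
Context {R : realType} {V : normedModType R}.
Implicit Types (f : V -> R) (p u v : V).

(** Directional derivatives, all continuous: enough for the chain rule along the
lines and curves that occur here. *)
Definition C1 f : Prop :=
  [/\ continuous f, forall p v, derivable f p v & forall v, continuous ('D_v f)].

Lemma is_derive_line f p v (x : R) : derivable f (p + x *: v) v ->
  is_derive x 1 (fun y : R => f (p + y *: v)) ('D_v f (p + x *: v)).
Proof.
have E : (fun h : R => h^-1 *: (((fun y : R => f (p + y *: v)) \o shift x) (h *: (1 : R)) -
      f (p + x *: v))) =
    (fun h : R => h^-1 *: ((f \o shift (p + x *: v)) (h *: v) - f (p + x *: v))).
  apply/funext => h /=; congr (_ *: (f _ - _)).
  have -> : h%:A = h by exact: mulr1.
  by rewrite scalerDl [RHS]addrCA.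
move=> df; apply: DeriveDef; first by rewrite /derivable E.
by rewrite /derive E.
Qed.

Lemma line_MVT f p v (h : R) : C1 f ->
  exists2 c : R, `|c| <= `|h| & f (p + h *: v) - f p = h * 'D_v f (p + c *: v).
Proof.
move=> [_ df _]; pose g y := f (p + y *: v); pose dg y := 'D_v f (p + y *: v).
have dgP (x : R) : is_derive x 1 g (dg x) by exact: is_derive_line.
have cg (a b : R) : {within `[a, b], continuous g}.
  apply: continuous_subspaceT => x; apply: differentiable_continuous.
  by apply/derivable1_diffP; have [] := dgP x.
have g0 : g 0 = f p by rewrite /g scale0r addr0.
rewrite -g0 -[f _]/(g h); have [h0|h0] := leP 0 h.
  have [c + ->] := MVT_segment h0 (fun x _ => dgP x) (cg 0 h).
  rewrite in_itv/= => /andP[c0 ch]; exists c; first by rewrite !ger0_norm.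
  by rewrite subr0 mulrC.
have [c + E] := MVT_segment (ltW h0) (fun x _ => dgP x) (cg h 0).
rewrite in_itv/= => /andP[hc c0]; exists c.
  by rewrite !ler0_norm ?(ltW h0)// lerN2.
by rewrite -[LHS]opprB E sub0r mulrN opprK mulrC.
Qed.

(** First order expansion in the plane spanned by u and v, from the mean value
theorem along u and then along v. *)
Lemma C1_increment f p u v (e : R) : C1 f -> 0 < e -> exists2 d : R, 0 < d &
  forall a b : R, `|a| <= d -> `|b| <= d ->
    `|f (p + a *: u + b *: v) - f p - (a * 'D_u f p + b * 'D_v f p)| <= (`|a| + `|b|) * e.
Proof.
move=> cf e0; have [_ _ cD] := cf.
have near w : exists2 d : R, 0 < d & forall a b : R, `|a| <= d -> `|b| <= d ->
    `|'D_w f (p + a *: u + b *: v) - 'D_w f p| <= e.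
  have /cvgrPdist_le/(_ e e0)/nbhs_ballP[d /= d0 hd] : 'D_w f x @[x --> p] --> 'D_w f p.
    exact: cD.
  pose K := `|u| + `|v| + 1; have K0 : 0 < K by rewrite ltr_wpDl// addr_ge0.
  exists (d / 2 / K); first by rewrite !divr_gt0.
  move=> a b ha hb; rewrite distrC; apply: hd; rewrite -ball_normE /= -addrA opprD addrA subrr sub0r normrN.
  apply: (le_lt_trans (ler_normD _ _)); rewrite !normrZ.
  apply: (@le_lt_trans _ _ (d / 2 / K * K)); last by rewrite divfK ?gt_eqF//; lra.
  have dK : 0 <= d / 2 / K by rewrite ltW// !divr_gt0.
  have h1 : `|a| * `|u| <= d / 2 / K * `|u| by rewrite ler_wpM2r.
  have h2 : `|b| * `|v| <= d / 2 / K * `|v| by rewrite ler_wpM2r.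
  by move: h1 h2 dK; rewrite {2 4}/K; move: (d / 2 / K) => x; rewrite /K; nra.
have [d1 d10 h1] := near u; have [d2 d20 h2] := near v.
exists (Num.min d1 d2); first by rewrite lt_min d10.
move=> a b; rewrite !le_min => /andP[a1 a2] /andP[b1 b2].
have [c ca Ec] := line_MVT (p + a *: u) v b cf.
have [c' c'a Ec'] := line_MVT p u a cf.
have -> : f (p + a *: u + b *: v) - f p - (a * 'D_u f p + b * 'D_v f p) =
    a * ('D_u f (p + c' *: u) - 'D_u f p) + b * ('D_v f (p + a *: u + c *: v) - 'D_v f p).
  by rewrite !mulrBr -Ec -Ec'; ring.
apply: (le_trans (ler_normD _ _)); rewrite mulrDl !normrM.
apply: lerD; rewrite ler_wpM2l//.
  have := h1 c' 0; rewrite scale0r addr0 normr0; apply; last exact: ltW.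
  exact: le_trans a1.
by apply: h2 => //; exact: le_trans b2.
Qed.

(** Along a u + b v, the first order expansion in the plane of u and v applies. *)
Lemma derive_lin f p u v (a b : R) : C1 f ->
  'D_(a *: u + b *: v) f p = a * 'D_u f p + b * 'D_v f p.
Proof.
move=> cf; have [_ df _] := cf.
apply: (@cvg_unique R (@Rhausdorff R) ((fun h : R => h^-1 *: ((f \o shift p) (h *: (a *: u + b *: v)) - f p)) @ 0^')).
  exact: df.
apply/cvgrPdist_le => e e0.
have K0 : 0 < `|a| + `|b| + 1 by rewrite ltr_wpDl// addr_ge0.
have [d d0 hd] := C1_increment p u v cf (divr_gt0 e0 K0).
apply/nbhs_ballP; exists (d / (`|a| + `|b| + 1)) => /=; first by rewrite divr_gt0.
move=> h; rewrite /ball/= sub0r normrN => hdK h0.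
have hK : `|h| * (`|a| + `|b| + 1) <= d by rewrite -ler_pdivlMr// ltW.
have hp : 0 < `|h| by rewrite normr_gt0.
have h1 : `|h * a| <= d.
  by rewrite normrM; apply: le_trans hK; rewrite ler_wpM2l// -addrA lerDl addr_ge0.
have h2 : `|h * b| <= d.
  by rewrite normrM; apply: le_trans hK; rewrite ler_wpM2l// addrAC lerDr addr_ge0.
have := hd _ _ h1 h2; rewrite distrC => hh.
have -> : a * 'D_u f p + b * 'D_v f p - h^-1 *: (f (h *: (a *: u + b *: v) + p) - f p) =
    h^-1 * ((h * a) * 'D_u f p + (h * b) * 'D_v f p - (f (p + (h * a) *: u + (h * b) *: v) - f p)).
  rewrite -!mulrA -mulrDr mulrBr mulKf//; congr (_ - _ * (f _ - _)).
  by rewrite scalerDr !scalerA addrC addrA.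
rewrite normrM normfV ler_pdivrMl//; apply: (le_trans hh).
rewrite !normrM -mulrDr -mulrA ler_wpM2l// mulrCA ler_piMr ?(ltW e0)//.
by rewrite ler_pdivrMr// mul1r lerDl.
Qed.

Definition vanishes_off (S : set V) f : Prop := forall p, ~ S p -> f p = 0.

Lemma derive_vanishes_off (S : set V) f v : closed S -> vanishes_off S f ->
  vanishes_off S ('D_v f).
Proof.
move=> cS f0 p nSp.
have oS : open (~` S) by exact: closed_openC.
have np : nbhs p (~` S) by exact: open_nbhs_nbhs.
have /nbhs_ballP[d /= d0 hd] := np.
apply: cvg_lim; first exact: Rhausdorff.
apply: cvg_near_cst; apply/nbhs_ballP; exists (d / (`|v| + 1)) => /=.
  by rewrite divr_gt0// ltr_wpDl.
move=> h; rewrite /ball/= sub0r normrN ltr_pdivlMr ?ltr_wpDl// => hdv h0.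
rewrite /= f0 ?(f0 p)//; first by rewrite subrr scaler0.
apply: hd; rewrite -ball_normE /= opprD addrCA subrr addr0 normrN normrZ.
by apply: le_lt_trans hdv; rewrite ler_wpM2l// lerDl.
Qed.

Lemma vanishes_off_bounded (S : set V) f : compact S -> vanishes_off S f -> continuous f ->
  exists2 C, 0 <= C & forall p, `|f p| <= C.
Proof.
move=> cS f0 cf; have : compact (f @` S).
  by apply: continuous_compact => //; exact: continuous_subspaceT.
move=> /compact_bounded [C [_ hC]]; exists (Num.max 0 (C + 1)); first by rewrite le_max lexx.
move=> p; have [Sp|nSp] := pselect (S p); last by rewrite f0// normr0 le_max lexx.
by rewrite le_max; apply/orP; right; apply: hC; [rewrite ltrDl|exists p].
Qed.

Lemma C1_lipschitz f v C : C1 f -> (forall p, `|'D_v f p| <= C) ->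
  forall p (h : R), `|f (p + h *: v) - f p| <= `|h| * C.
Proof.
move=> cf hC p h; have [c _ ->] := line_MVT p v h cf.
by rewrite normrM ler_wpM2l.
Qed.

Lemma Ck_C1 k f : Ck k.+1 f -> C1 f.
Proof.
case=> cf df Df; split; [exact: cf|exact: df|move=> v]; have := Df v.
by case: k {Df} => [//|k] /= [].
Qed.

Lemma Ck_derive k f v : Ck k.+1 f -> Ck k ('D_v f).
Proof. by move=> /= [_ _]. Qed.

Definition support f : set V := closure [set x | f x != 0].

Lemma vanishes_off_support f : vanishes_off (support f) f.
Proof.
move=> p np; apply: contrapT => /eqP fp; apply: np; exact: subset_closure.
Qed.

Lemma closed_support f : closed (support f).
Proof. exact: closed_closure. Qed.

Lemma test_function_C1 f : test_function f -> C1 f.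
Proof. by move=> [/(_ 1%N)/Ck_C1]. Qed.

Lemma test_function_bounded f : test_function f -> exists2 C, 0 <= C & forall p, `|f p| <= C.
Proof.
move=> tf; have [_ cS] := tf; have [cf _ _] := test_function_C1 tf.
by apply: (@vanishes_off_bounded (support f)) => //; exact: vanishes_off_support.
Qed.

Lemma derive_bounded f v : test_function f -> exists2 C, 0 <= C & forall p, `|'D_v f p| <= C.
Proof.
move=> tf; have [_ cS] := tf; have [cf df cD] := test_function_C1 tf.
have dv : vanishes_off (support f) ('D_v f).
  by apply: derive_vanishes_off; [exact: closed_support|exact: vanishes_off_support].
exact: (vanishes_off_bounded cS dv (cD v)).
Qed.

Lemma support_bounded f : test_function f -> exists2 B, 0 < B &
  forall p, B < `|p| -> ~ support f p.
Proof.
move=> [_ /compact_bounded[B [_ hB]]]; exists (Num.max 1 (B + 1)); first by rewrite lt_max ltr01.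
move=> p Bp Sp; have := hB (B + 1); rewrite ltrDl => /(_ ltr01 p Sp) /=.
by rewrite leNgt (le_lt_trans _ Bp)// le_max lexx orbT.
Qed.

End directional.

Section measurable_continuous.
Context {R : realType} (n : nat).
Local Notation rV := 'rV[R]_n.

Let grid (k : nat) (x : rV) : 'rV[int]_n := \row_i Num.floor (k.+1%:R * x 0 i).
Let ungrid (k : nat) (z : 'rV[int]_n) : rV := \row_i ((z 0 i)%:~R / k.+1%:R).
Let gridR (k : nat) (t : R) : int := Num.floor (k.+1%:R * t).
Let ungridR (k : nat) (z : int) : R := z%:~R / k.+1%:R.

Let ungridRP k (t : R) : `|t - ungridR k (gridR k t)| <= k.+1%:R^-1.
Proof.
rewrite /ungridR /gridR; have := Num.Theory.floor_itv (k.+1%:R * t).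
move=> /andP[h1 h2].
have k0 : (0 : R) < k.+1%:R by rewrite ltr0n.
rewrite -(ler_pM2l k0) -{1}(gtr0_norm k0) -normrM mulrBr mulrCA divff ?gt_eqF// mulr1.
rewrite ger0_norm ?subr_ge0//.
by rewrite lerBlDl (le_trans (ltW h2))// intrD.
Qed.

Let measurable_gridR k (z : int) : measurable ([set t | gridR k t = z] : set (measurableTypeR R)).
Proof.
have mg : measurable_fun setT (fun t : measurableTypeR R => k.+1%:R * t : R).
  exact: measurable_funM.
rewrite (_ : [set t | _] = setT `&` (fun t => k.+1%:R * t) @^-1` `[z%:~R, (z + 1)%:~R[).
  by apply: mg => //; exact: measurable_itv.
rewrite setTI; apply/seteqP; split => t /=; rewrite in_itv/= /gridR.
  by move=> <-; exact: Num.Theory.floor_itv.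
by move=> /Num.Theory.floor_def.
Qed.

Let measurable_grid k (z : 'rV[int]_n) : measurable [set x : rV | grid k x = z].
Proof.
rewrite (_ : [set x | _] = \bigcap_(i in [set: 'I_n]) [set x : rV | gridR k (x 0 i) = z 0 i]).
  apply: fin_bigcap_measurable => // i _.
  rewrite (_ : [set x | _] = setT `&` (fun x : rV => x 0 i : measurableTypeR R) @^-1` [set t | gridR k t = z 0 i]).
    by apply: (measurable_coor i) => //; exact: measurable_gridR.
  by rewrite setTI.
apply/seteqP; split => x /=.
  by move=> <- i _ /=; rewrite mxE.
by move=> h; apply/rowP => i; rewrite mxE; exact: h.
Qed.

(** A continuous function is the limit of its values at the points of finer and
finer grids. *)
Lemma measurable_continuous_rVR (f : rV * R -> R) : continuous f ->
  measurable_fun setT (fun p : rV * measurableTypeR R => f p : measurableTypeR R).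
Proof.
move=> cf; pose h k (p : rV * measurableTypeR R) : measurableTypeR R :=
  f (ungrid k (grid k p.1), ungridR k (gridR k p.2)).
apply: (@measurable_realfun.measurable_fun_cvg _ _ _ _ h).
- move=> k _ A mA; rewrite setTI.
  pose B (j : nat) : set (rV * measurableTypeR R) :=
    if @unpickle ('rV[int]_n * int)%type j is Some z then
      (if f (ungrid k z.1, ungridR k z.2) \in A then
        [set x | grid k x = z.1] `*` [set t | gridR k t = z.2] else set0) else set0.
  have -> : h k @^-1` A = \bigcup_j B j.
    apply/seteqP; split => [[x t]|[x t] [j _]] /=.
      move=> hA; exists (pickle (grid k x, gridR k t)) => //.
      by rewrite /B pickleK mem_set.
    rewrite /B; case: unpickle => // z; case: ifP => //; rewrite inE => zA [/= xz tz].
    by rewrite /h /= xz tz.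
  apply: bigcupT_measurable => j; rewrite /B; case: unpickle => // z; case: ifP => // _.
  by apply: measurableX; [exact: measurable_grid|exact: measurable_gridR].
- move=> [x t] _ /=; apply: continuous_cvg; first exact: cf.
  apply/cvg_ballP => e e0.
  have : (k.+1%:R^-1 : R) @[k --> \oo] --> (0 : R) by exact: cvg_harmonic.
  move=> /cvgrPdist_lt /(_ e e0); apply: filterS => k.
  rewrite sub0r normrN ger0_norm// => ke; split => /=.
    split=> // i j; rewrite /ball/= !mxE ord1.
    by apply: le_lt_trans ke; exact: ungridRP.
  by apply: le_lt_trans ke; exact: ungridRP.
Qed.

Lemma measurable_continuous_rV (f : rV -> R) : continuous f ->
  measurable_fun setT (f : rV -> measurableTypeR R).
Proof.
move=> cf; have := @measurable_continuous_rVR (f \o fst).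
move=> /(_ _)/wrap[]; first by move=> p; apply: continuous_comp; [exact: cvg_fst|exact: cf].
move=> mf; apply: (measurableT_comp mf (g := fun x : rV => (x, 0 : measurableTypeR R))).
exact: measurable_fun_pair.
Qed.

End measurable_continuous.

Section spacetime.
Context {R : realType} (n : nat).
Local Notation rV := 'rV[R]_n.

Lemma derive_sum (V : normedModType R) (f : V -> R) (p : V) (e : 'I_n -> V) (a : 'I_n -> R) :
  C1 f -> 'D_(\sum_(j < n) a j *: e j) f p = \sum_(j < n) a j * 'D_(e j) f p.
Proof.
move=> cf; have D0 : 'D_0 f p = 0.
  by have := derive_lin p 0 0 0 0 cf; rewrite !scale0r addr0 !mul0r addr0.
apply: (big_rec2 (fun x y => 'D_x f p = y)) => // j x y _ h.
by have := derive_lin p (e j) x (a j) 1 cf; rewrite scale1r mul1r h.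
Qed.

Lemma derive_space_dir (phi : rV * R -> R) (x y : rV) (t : R) : C1 phi ->
  'D_(y, 0) phi (x, t) = \sum_(j < n) spartial j phi x t * y 0 j.
Proof.
move=> cf; have -> : (y, 0 : R) = \sum_(j < n) y 0 j *: (delta_mx 0 j, 0 : R).
  rewrite {1}[y]row_sum_delta.
  apply: (big_rec2 (fun (a : rV) (b : rV * R) => (a, 0) = b)) => // j a b _ <-.
  by congr pair => /=; rewrite scaler0 addr0.
by rewrite derive_sum//; apply: eq_bigr => j _; rewrite mulrC.
Qed.

Lemma derive_rV_dir (phi : rV -> R) (x y : rV) : C1 phi ->
  'D_y phi x = \sum_(j < n) partial j phi x * y 0 j.
Proof.
move=> cf; rewrite {1}[y]row_sum_delta derive_sum//.
by apply: eq_bigr => j _; rewrite mulrC.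
Qed.

Lemma enorm_le_norm (x : rV) : enorm x <= n%:R * `|x|.
Proof.
have h i : x 0 i ^+ 2 <= `|x| ^+ 2.
  have : `|x 0 i| <= `|x|.
    rewrite [leRHS]mx_normrE.
    exact: (le_bigmax _ (fun ij : 'I_1 * 'I_n => `|x ij.1 ij.2|) (0, i)).
  by rewrite -[x 0 i ^+ 2]real_normK ?num_real// ler_pXn2r// nnegrE.
have -> : n%:R * `|x| = Num.sqrt ((n%:R * `|x|) ^+ 2) by rewrite sqrtr_sqr ger0_norm ?mulr_ge0.
rewrite /enorm ler_sqrt; last exact: sqr_ge0.
apply: (@le_trans _ _ (\sum_(i < n) `|x| ^+ 2)); first by apply: ler_sum => i _.
rewrite sumr_const card_ord -[leLHS]mulr_natl exprMn.
apply: ler_wpM2r; first exact: sqr_ge0.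
by rewrite -natrX ler_nat; case: (n) => // k; rewrite expnS leq_pmulr// expn_gt0.
Qed.

Lemma test_function_region (phi : rV * R -> R) : test_function phi ->
  exists2 B, 0 < B & forall x t, B <= enorm x \/ B <= t -> ~ support phi (x, t).
Proof.
move=> /support_bounded[B B0 hB]; exists ((n%:R + 1) * B + 1).
  by rewrite ltr_wpDl// mulr_ge0// ?addr_ge0// ltW.
move=> x t h; apply: hB; rewrite ltNge; apply/negP => xtB.
have [xB tB] : `|x| <= B /\ `|t| <= B.
  by split; apply: le_trans xtB; rewrite prod_normE /= le_max lexx ?orbT.
have n0 : 0 <= n%:R * B :> R by rewrite mulr_ge0// ltW.
case: h => h.
  have : enorm x <= n%:R * B.
    by apply: (le_trans (enorm_le_norm x)); rewrite ler_wpM2l.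
  by move: h B0 n0; rewrite mulrDl mul1r; lra.
have := ler_norm t.
by move: h B0 n0 tB; rewrite mulrDl mul1r; lra.
Qed.

Lemma test_function_region_rV (phi : rV -> R) : test_function phi ->
  exists2 B, 0 < B & forall x, B <= enorm x -> ~ support phi x.
Proof.
move=> /support_bounded[B B0 hB]; exists (n%:R * B + 1).
  by rewrite ltr_wpDl// mulr_ge0// ltW.
move=> x h; apply: hB; rewrite ltNge; apply/negP => xB.
have : enorm x <= n%:R * B.
  by apply: (le_trans (enorm_le_norm x)); rewrite ler_wpM2l.
by move: h; lra.
Qed.

End spacetime.

(** * The balance laws along a flow on rays *)

Section flow.
Context {R : realType} (m : nat).
Local Notation n := m.+1.
Local Notation rV := 'rV[R]_n.
Local Notation RR := (measurableTypeR R).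
Local Notation cone := (@cone_measure R n).
Context (mu : {finite_measure set RR -> \bar R}) (X w : R -> R -> R).
Local Notation P := (mu \x cone)%E.

Context (measurable_X : measurable_fun setT (fun p : RR * RR => X p.1 p.2 : RR)).
Context (X_ge0 : forall s t, 0 <= X s t).
Context (measurable_w : measurable_fun setT (fun p : RR * RR => w p.1 p.2 : RR)).
Context (X_lipschitz : forall B T, 0 < B -> 0 < T -> exists2 U, 0 <= U &
  forall s t t', 0 <= t -> t <= T -> 0 <= t' -> t' <= T -> X s t < B ->
    X s t' <= X s t + U * `|t' - t|).
Context (X_derivative : {ae @lebesgue_measure R, forall t : R, 0 < t -> {ae mu, forall s : RR,
  forall e : R, 0 < e -> exists2 d : R, 0 < d & forall h : R, 0 < h -> h <= d ->
    `|X s (t + h) - X s t - h * (if X s t == 0 then 0 else w (X s t) t)| <= h * e}}).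

Lemma total_finite : (P setT < +oo)%E.
Proof. exact: (finite_product_lty mu cone measurableT). Qed.

Lemma cone_nonzero : {ae cone, forall x : rV, x != 0}.
Proof.
exists [set 0]; split.
- exact: measurable_set0.
- exact: cone_measure_set0.
- by move=> x /= /negP; rewrite negbK => /eqP.
Qed.

(** Particles are labelled by a radial label p.1 and by a point p.2 of the punctured
ball, of which only the direction counts. *)
Definition place (t : R) (p : RR * rV) : rV := X p.1 t *: dir p.2.

Lemma measurable_place : measurable_fun setT (fun q : RR * (RR * rV) => place q.1 q.2).
Proof.
apply: measurable_scale.
  apply: (measurableT_comp measurable_X (g := fun q : RR * (RR * rV) => (q.2.1, q.1))).
  by apply: measurable_fun_pair => //; apply: measurableT_comp.
apply: (measurableT_comp (@measurable_dir R n)); exact: measurableT_comp.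
Qed.

Lemma measurable_place_at t : measurable_fun setT (place t).
Proof.
apply: (measurableT_comp measurable_place (g := fun p : RR * rV => (t : RR, p))).
exact: measurable_fun_pair.
Qed.

Lemma enorm_place t p : p.2 != 0 -> enorm (place t p) = X p.1 t.
Proof. by move=> p0; rewrite /place enorm_scale_dir. Qed.

Lemma velocity_place t p : p.2 != 0 ->
  velocity w t (place t p) = (if X p.1 t == 0 then 0 else w (X p.1 t) t) *: dir p.2.
Proof.
move=> p0; rewrite /velocity enorm_place// /place.
have [Xp|Xp] := eqVneq (X p.1 t : R) 0; first by rewrite Xp scale0r dir0 scaler0.
by rewrite dir_scale_dir// lt_neqAle eq_sym Xp X_ge0.
Qed.

Lemma measurable_velocity i :
  measurable_fun setT (fun q : RR * rV => velocity w q.1 q.2 0 i : RR).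
Proof.
rewrite (_ : (fun q => _) = fun q : RR * rV => w (enorm q.2) q.1 * dir q.2 0 i : RR); last first.
  by apply/funext => q; rewrite /velocity mxE.
apply: measurable_funM.
  apply: (measurableT_comp measurable_w (g := fun q : RR * rV => (enorm q.2 : RR, q.1))).
  apply: measurable_fun_pair => //.
  by apply: (measurableT_comp (@measurable_enorm R n)).
apply: (measurableT_comp (measurable_coor i)).
by apply: (measurableT_comp (@measurable_dir R n)).
Qed.

(** The derivative of phi along the flow, and the integrand of the mass equation. *)
Definition transport (phi : rV * R -> R) (t : R) (x : rV) : R :=
  tpartial phi x t + \sum_(j < n) spartial j phi x t * velocity w t x 0 j.

Lemma measurable_test_at (phi : rV * R -> R) : continuous phi ->
  measurable_fun setT (fun q : RR * rV => phi (q.2, q.1) : RR).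
Proof.
move=> cf; apply: (measurableT_comp (measurable_continuous_rVR cf)
  (g := fun q : RR * rV => (q.2, q.1))).
exact: measurable_fun_pair.
Qed.

Lemma measurable_transport phi : C1 phi ->
  measurable_fun setT (fun q : RR * rV => transport phi q.1 q.2 : RR).
Proof.
move=> [_ _ cD]; apply: measurable_funD; first exact: measurable_test_at (cD _).
apply: measurable_sum => j; apply: measurable_funM; last exact: measurable_velocity.
exact: measurable_test_at (cD _).
Qed.

Lemma measurable_transport_at phi t : C1 phi ->
  measurable_fun setT (fun x : rV => transport phi t x : RR).
Proof.
move=> cp; apply: (measurableT_comp (measurable_transport cp) (g := fun x : rV => (t : RR, x))).
exact: measurable_fun_pair.
Qed.

Lemma transport_place phi t p : C1 phi -> p.2 != 0 ->
  transport phi t (place t p) = 'D_(0, 1) phi (place t p, t) +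
    (if X p.1 t == 0 then 0 else w (X p.1 t) t) * 'D_(dir p.2, 0) phi (place t p, t).
Proof.
move=> cf p0; rewrite /transport derive_space_dir// velocity_place// mulr_sumr.
by congr (_ + _); apply: eq_bigr => j _; rewrite mxE mulrCA.
Qed.

(** The mass equation and the momentum equation are two cases of one identity, for
the integral of eta(omega) (a0 + a1 t) phi(X omega, t): a0 = 1, a1 = 0, eta = 1 for
mass, and a0 + a1 t = v, eta = omega_i for momentum. *)
Section evolution.
Context (a0 a1 : R -> R) (eta : rV -> R) (phi : rV * R -> R).
Context (measurable_a0 : measurable_fun setT (a0 : RR -> RR)).
Context (measurable_a1 : measurable_fun setT (a1 : RR -> RR)).
Context (measurable_eta : measurable_fun setT (eta : rV -> RR)).
Context (eta_le1 : forall x, `|eta x| <= 1).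
Context (A1 : R) (A1_ge0 : 0 <= A1) (a1_le : forall s, `|a1 s| <= A1).
Context (bounds : forall B T, 0 < B -> 0 < T -> exists2 U, 0 <= U &
  {ae mu, forall s : RR, forall t, 0 <= t -> t <= T -> X s t < B ->
    `|a0 s + a1 s * t| <= U /\ `|w (X s t) t| <= U}).
Context (test_phi : test_function phi).

Let c1_phi : C1 phi := test_function_C1 test_phi.

Let amount (p : RR * rV) (t : R) : R :=
  eta p.2 * ((a0 p.1 + a1 p.1 * t) * phi (place t p, t)).
Let rate (p : RR * rV) (t : R) : R :=
  eta p.2 * (a1 p.1 * phi (place t p, t) + (a0 p.1 + a1 p.1 * t) * transport phi t (place t p)).

Let fst_q : measurable_fun setT (fun q : RR * (RR * rV) => q.2.1).
Proof. exact: measurableT_comp. Qed.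
Let snd_q : measurable_fun setT (fun q : RR * (RR * rV) => q.2.2).
Proof. exact: measurableT_comp. Qed.

Let measurable_phi_place :
  measurable_fun setT (fun q : RR * (RR * rV) => phi (place q.1 q.2, q.1) : RR).
Proof.
have [cf _ _] := c1_phi.
apply: (measurableT_comp (measurable_test_at cf) (g := fun q : RR * (RR * rV) => (q.1, place q.1 q.2))).
by apply: measurable_fun_pair => //; exact: measurable_place.
Qed.

Let measurable_act : measurable_fun setT (fun q : RR * (RR * rV) => a0 q.2.1 + a1 q.2.1 * q.1 : RR).
Proof.
apply: measurable_funD; first exact: (measurableT_comp measurable_a0).
by apply: measurable_funM => //; exact: (measurableT_comp measurable_a1).
Qed.

Let measurable_amount : measurable_fun setT (fun q : RR * (RR * rV) => amount q.2 q.1 : RR).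
Proof.
apply: measurable_funM; first exact: (measurableT_comp measurable_eta).
by apply: measurable_funM.
Qed.

Let measurable_rate : measurable_fun setT (fun q : RR * (RR * rV) => rate q.2 q.1 : RR).
Proof.
apply: measurable_funM; first exact: (measurableT_comp measurable_eta).
apply: measurable_funD.
  by apply: measurable_funM => //; exact: (measurableT_comp measurable_a1).
apply: measurable_funM => //.
apply: (measurableT_comp (measurable_transport c1_phi) (g := fun q : RR * (RR * rV) => (q.1, place q.1 q.2))).
by apply: measurable_fun_pair => //; exact: measurable_place.
Qed.

Let slice (f : RR * (RR * rV) -> RR) t : measurable_fun setT f ->
  measurable_fun setT (fun p => f (t, p)).
Proof. by move=> mf; apply: (measurableT_comp mf); exact: measurable_fun_pair. Qed.

Lemma test_region : exists B U V C : R, [/\ 0 < B, 0 <= U, 0 <= V, 0 <= C &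
  [/\ forall x t, B <= enorm x \/ B <= t -> phi (x, t) = 0 /\ forall v, 'D_v phi (x, t) = 0,
   forall s t t', 0 <= t -> t <= B + 1 -> 0 <= t' -> t' <= B + 1 -> X s t < B ->
     X s t' <= X s t + V * `|t' - t|,
   forall q, [/\ `|phi q| <= C, `|'D_(0, 1) phi q| <= C &
     forall y : rV, enorm y <= 1 -> `|'D_(y, 0) phi q| <= C] &
   {ae mu, forall s : RR, forall t, 0 <= t -> t <= B + 1 -> X s t < B ->
    `|a0 s + a1 s * t| <= U /\ `|w (X s t) t| <= U}]].
Proof.
have [B B0 hB] := test_function_region test_phi.
have T0 : 0 < B + 1 by rewrite ltr_wpDl// ltW.
have [U U0 hU] := bounds B0 T0; have [V V0 hV] := X_lipschitz B0 T0.
have [C1_ C10 hC1] := test_function_bounded test_phi.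
have [C2 C20 hC2] := derive_bounded ((0, 1) : rV * R) test_phi.
have hC3 j : {C : R | 0 <= C /\ forall q, `|spartial j phi q.1 q.2| <= C}.
  by apply: cid; have [C C0 hC] := derive_bounded ((delta_mx 0 j, 0) : rV * R) test_phi; exists C; split => // q; exact: hC.
pose C3 := \sum_(j < n) sval (hC3 j).
have C30 : 0 <= C3 by apply: sumr_ge0 => j _; have [] := svalP (hC3 j).
exists B, U, V, (C1_ + C2 + C3); split => //; first by rewrite !addr_ge0.
split => //.
- move=> x t h; have np := hB x t h; split; first exact: vanishes_off_support np.
  by move=> v; apply: (derive_vanishes_off v (@closed_support _ _ phi) (@vanishes_off_support _ _ phi)).
- move=> [x t]; split.
  + by apply: (le_trans (hC1 _)); rewrite -addrA lerDl addr_ge0.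
  + by apply: (le_trans (hC2 _)); rewrite addrAC lerDr addr_ge0.
  + move=> y y1; rewrite derive_space_dir//; apply: (@le_trans _ _ C3); last by rewrite lerDr addr_ge0.
    apply: (le_trans (ler_norm_sum _ _ _)); apply: ler_sum => j _.
    have [_ hj] := svalP (hC3 j); rewrite normrM -[leRHS]mulr1.
    by apply: ler_pM => //; [exact: (hj (x, t))|exact: le_trans (coor_enorm y j) y1].
Qed.

(** The integral G of amount is Lipschitz in t and vanishes for t >= B; by the
equation of motion and dominated convergence its difference quotients converge at
almost every t to the integral of rate, and [lipschitz_halfline_FTC] applies. *)
Lemma evolution_identity :
  \int[@lebesgue_measure R]_(t in `[0, +oo[) \int[P]_p rate p t = - \int[P]_p amount p 0.
Proof.
have [B [U [V [C [B0 U0 V0 C0 [hB hV hC hU]]]]]] := test_region.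
have aeP : {ae P, forall p : RR * rV, p.2 != 0 /\ forall t, 0 <= t -> t <= B + 1 -> X p.1 t < B ->
    `|a0 p.1 + a1 p.1 * t| <= U /\ `|w (X p.1 t) t| <= U}.
  exact: aeS2 (fun p a b => conj a b) (ae_snd mu cone_nonzero) (ae_fst cone hU).
have B1 : B <= B + 1 by rewrite lerDl.
have moveX s t t' : 0 <= t -> t <= B + 1 -> 0 <= t' -> t' <= B + 1 -> X s t < B ->
    `|X s t' - X s t| <= V * `|t' - t|.
  move=> t0 tB t'0 t'B XB; have [h|h] := leP (X s t) (X s t').
    by rewrite ger0_norm ?subr_ge0// lerBlDl hV.
  rewrite ltr0_norm ?subr_lt0// opprB lerBlDl distrC hV//.
  exact: lt_trans XB.
have movephi (p : RR * rV) t t' : `|phi (place t' p, t') - phi (place t p, t)| <=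
    (`|X p.1 t' - X p.1 t| + `|t' - t|) * C.
  have -> : phi (place t' p, t') - phi (place t p, t) =
      (phi ((place t p, t') + (X p.1 t' - X p.1 t) *: (dir p.2, 0)) - phi (place t p, t')) +
      (phi ((place t p, t) + (t' - t) *: (0, 1)) - phi (place t p, t)).
    have -> : (place t p, t') + (X p.1 t' - X p.1 t) *: (dir p.2, 0) = (place t' p, t').
      by congr pair => /=; rewrite ?scaler0 ?addr0// /place -scalerDl addrC subrK.
    have -> : (place t p, t) + (t' - t) *: (0, 1) = (place t p, t').
      congr pair => /=; first by rewrite scaler0 addr0.
      by rewrite /GRing.scale/= mulr1 addrC subrK.
    by rewrite addrA subrK.
  apply: (le_trans (ler_normD _ _)); rewrite mulrDl; apply: lerD.
    apply: C1_lipschitz => // q; have [_ _] := hC q; apply.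
    exact: enorm_dir_le1.
  by apply: C1_lipschitz => // q; have [] := hC q.
pose L := A1 * C + U * ((V + 1) * C).
have L0 : 0 <= L by rewrite addr_ge0// !mulr_ge0// addr_ge0.
have lip1 (p : RR * rV) t t' : (forall t, 0 <= t -> t <= B + 1 -> X p.1 t < B ->
    `|a0 p.1 + a1 p.1 * t| <= U /\ `|w (X p.1 t) t| <= U) ->
    0 <= t -> t <= B + 1 -> 0 <= t' -> t' <= B + 1 -> X p.1 t < B ->
    `|amount p t' - amount p t| <= L * `|t' - t|.
  move=> Up t0 tB t'0 t'B XB; rewrite /amount -mulrBr normrM.
  rewrite -[leRHS]mul1r; apply: ler_pM => //.
  have -> : (a0 p.1 + a1 p.1 * t') * phi (place t' p, t') - (a0 p.1 + a1 p.1 * t) * phi (place t p, t) =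
    (a1 p.1 * (t' - t)) * phi (place t' p, t') +
    (a0 p.1 + a1 p.1 * t) * (phi (place t' p, t') - phi (place t p, t)) by ring.
  apply: (le_trans (ler_normD _ _)); rewrite /L [leRHS]mulrDl; apply: lerD.
    rewrite !normrM [leRHS]mulrAC; apply: ler_pM => //.
      by rewrite ler_wpM2r.
    by have [] := hC (place t' p, t').
  rewrite normrM -mulrA; apply: ler_pM => //; first by have [] := Up t t0 tB XB.
  apply: (le_trans (movephi _ _ _)); rewrite mulrAC ler_wpM2r// mulrDl mul1r lerD2r.
  exact: moveX.
have lip2 : {ae P, forall p, forall t t', 0 <= t -> t <= B + 1 -> 0 <= t' -> t' <= B + 1 ->
    `|amount p t' - amount p t| <= L * `|t' - t|}.
  apply: aeS aeP => p [p0 Up] t t' t0 tB t'0 t'B.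
  have [XB|BX] := ltP (X p.1 t) B; first exact: lip1.
  have [XB'|BX'] := ltP (X p.1 t') B; first by rewrite distrC [`|t' - t|]distrC; exact: lip1.
  have z u : B <= X p.1 u -> amount p u = 0.
    move=> Bu; rewrite /amount; have [|-> _] := hB (place u p) u; last by rewrite !mulr0.
    by left; rewrite enorm_place.
  by rewrite !z// subrr normr0 mulr_ge0.
have amount_end p t : B <= t -> amount p t = 0.
  move=> Bt; rewrite /amount; have [|-> _] := hB (place t p) t; last by rewrite !mulr0.
  by right.
have amount_bound t : 0 <= t -> {ae P, forall p, setT p -> `|amount p t| <= L * (B + 1)}.
  move=> t0; apply: aeS lip2 => p h _.
  have [tB|/ltW/amount_end ->] := leP t B; last by rewrite normr0 mulr_ge0// addr_ge0// ltW.
  have := h B t (ltW B0) B1 t0 (le_trans tB B1); rewrite (amount_end p B)// subr0.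
  move=> /le_trans; apply; rewrite ler_wpM2l// ler_norml; apply/andP; split; lra.
have amount_int t : 0 <= t -> P.-integrable setT (EFin \o (amount^~ t)).
  move=> t0; apply: integrable_ae_bounded (amount_bound t t0) => //.
    exact: total_finite.
  exact: (slice t measurable_amount).
pose G t := \int[P]_p amount p t.
have Gdiff t t' : 0 <= t -> 0 <= t' -> G t' - G t = \int[P]_p (amount p t' - amount p t).
  by move=> t0 t'0; rewrite /G RintegralB//; exact: amount_int.
have G_end t : B <= t -> G t = 0.
  move=> Bt; transitivity (\int[P]_p (0 : R)); last by rewrite Rintegral_cst// mul0r.
  by apply: eq_Rintegral => p _; rewrite amount_end.
have Glip t t' : 0 <= t -> t <= t' -> t' <= B -> `|G t' - G t| <= L * fine (P setT) * (t' - t).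
  move=> t0 tt' t'B; have t'0 := le_trans t0 tt'.
  rewrite Gdiff// mulrAC; apply: Rintegral_ae_bounded => //.
  - by rewrite mulr_ge0// subr_ge0.
  - exact: total_finite.
  - apply: measurable_funB; exact: (slice _ measurable_amount).
  - apply: aeS lip2 => p h _; apply: (le_trans (h t t' _ _ _ _)) => //; last 2 first.
    + exact: le_trans t'B B1.
    + by rewrite ger0_norm// subr_ge0.
    by rewrite (le_trans tt')// (le_trans t'B).
rewrite -/(G 0).
apply: (@lipschitz_halfline_FTC R G _ (L * fine (P setT)) B) => //.
- exact: ltW.
- by rewrite mulr_ge0// fine_ge0.
- move=> t h t0 h0; have K0 : 0 <= L * fine (P setT) by rewrite mulr_ge0// fine_ge0.
  have [Bt|tB] := leP B t.
    by rewrite !G_end// ?(le_trans Bt) ?lerDl// subrr normr0 mulr_ge0.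
  have [tB'|Bt'] := leP (t + h) B.
    have := Glip t (t + h) t0; rewrite lerDl => /(_ h0 tB').
    by rewrite (_ : t + h - t = h)// addrC addKr.
  rewrite (G_end (t + h)) ?(ltW Bt')// -(G_end B)//.
  apply: (le_trans (Glip t B t0 (ltW tB) (lexx B))); rewrite ler_wpM2l//.
  by rewrite lerBlDl ltW.
- apply: measurable_funTS.
  exact: (@measurable_fun_Rintegral _ _ _ _ _ (finite_product_measure mu cone) (fun q => rate q.2 q.1) measurable_rate).
apply: aeS X_derivative => t ht t0; have {}ht := ht t0.
have [Bt|tB] := leP B t.
  have -> : \int[P]_p rate p t = \int[P]_p (0 : R).
    apply: eq_Rintegral => p _; rewrite /rate /transport /tpartial.
    have [|-> ->] := hB (place t p) t; first by right.
    rewrite big1; first by rewrite addr0 !mulr0 addr0 mulr0.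
    by move=> j _; rewrite /spartial; have [|_ ->] := hB (place t p) t; [right|rewrite mul0r].
  rewrite Rintegral_cst// mul0r; apply: cvg_near_cst; apply: nearW => k.
  by rewrite !G_end ?subrr ?mulr0// (le_trans Bt)// lerDl.
pose h (k : nat) : R := k.+1%:R^-1; have h0 k : 0 < h k by rewrite /h invr_gt0.
have h1 k : h k <= 1 by rewrite /h invf_le1// ler1n.
have thB k : t + h k <= B + 1 by rewrite lerD// ltW.
have th0 k : 0 <= t + h k by rewrite addr_ge0// ltW.
have [//|||||_] := @Rdominated_convergence _ _ _ P setT
    (fun k p => (h k)^-1 * (amount p (t + h k) - amount p t)) (rate^~ t) (fun=> L) measurableT.
- move=> k; apply: measurable_funM => //.
  apply: measurable_funB; exact: (slice _ measurable_amount).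
- exact: (slice _ measurable_rate).
- apply: aeS2 aeP (ae_fst cone ht) => p [p0 Up] hp _.
  set rho := if X p.1 t == 0 then 0 else w (X p.1 t) t in hp.
  pose act := a0 p.1 + a1 p.1 * t.
  have incr e : 0 < e -> \forall k \near \oo,
      `|phi (place (t + h k) p, t + h k) - phi (place t p, t) - h k * transport phi t (place t p)| <= h k * e.
    move=> e0; pose K := `|rho| + 2 + C; have K0 : 0 < K by rewrite /K ltr_wpDr// ltr_wpDl.
    pose e1 := e / K; have e10 : 0 < e1 by rewrite divr_gt0.
    have [d1 d10 hd1] := C1_increment (place t p, t) (dir p.2, 0) (0, 1) c1_phi e10.
    have e20 : 0 < Num.min 1 e1 by rewrite lt_min ltr01.
    have [d2 d20 hd2] := hp _ e20.
    have rho1 : 0 < `|rho| + 1 by rewrite ltr_wpDl.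
    have d30 : 0 < Num.min (Num.min d1 d2) (d1 / (`|rho| + 1)).
      by rewrite !lt_min d10 d20 divr_gt0.
    have : h k @[k --> \oo] --> (0 : R) by exact: cvg_harmonic.
    move=> /cvgrPdist_le /(_ _ d30); apply: filterS => k; rewrite sub0r normrN (gtr0_norm (h0 k)).
    rewrite !le_min => /andP[/andP[hk1 hk2] hk3].
    have := hd2 (h k) (h0 k) hk2; set DX := X p.1 (t + h k) - X p.1 t => hDX.
    have [m1 m2] : h k * Num.min 1 e1 <= h k /\ h k * Num.min 1 e1 <= h k * e1.
      split; last by rewrite ler_pM2l// ge_min lexx orbT.
      by rewrite -[leRHS]mulr1 ler_pM2l// ge_min lexx.
    have DXle : `|DX| <= h k * (`|rho| + 1).
      rewrite -[DX](subrK (h k * rho)) mulrDr mulr1 addrC.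
      apply: (le_trans (ler_normD _ _)); apply: lerD; last exact: le_trans hDX m1.
      by rewrite normrM gtr0_norm.
    have := hd1 DX (h k).
    have -> : (place t p, t) + DX *: (dir p.2, 0) + h k *: (0, 1) = (place (t + h k) p, t + h k).
      congr pair => /=; first by rewrite scaler0 addr0 /place -scalerDl /DX addrC subrK.
      by rewrite scaler0 addr0 /GRing.scale/= mulr1.
    move=> /(_ _ _)/wrap[].
    - by apply: (le_trans DXle); rewrite -ler_pdivlMr.
    - by rewrite gtr0_norm.
    rewrite (gtr0_norm (h0 k)) => big_.
    rewrite transport_place// -/rho.
    have -> : phi (place (t + h k) p, t + h k) - phi (place t p, t) -
        h k * ('D_(0, 1) phi (place t p, t) + rho * 'D_(dir p.2, 0) phi (place t p, t)) =
      (phi (place (t + h k) p, t + h k) - phi (place t p, t) -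
         (DX * 'D_(dir p.2, 0) phi (place t p, t) + h k * 'D_(0, 1) phi (place t p, t))) +
      (DX - h k * rho) * 'D_(dir p.2, 0) phi (place t p, t) by ring.
    apply: (le_trans (ler_normD _ _)).
    have -> : h k * e = (h k * (`|rho| + 1) + h k) * e1 + h k * e1 * C.
      have eE : e = e1 * (`|rho| + 2 + C) by rewrite /e1 divfK ?gt_eqF.
      by rewrite {1}eE; ring.
    apply: lerD; first by apply: (le_trans big_); rewrite ler_pM2r// lerD2r.
    rewrite normrM; apply: ler_pM => //; first exact: le_trans hDX m2.
    by have [_ _] := hC (place t p, t); apply; exact: enorm_dir_le1.
  have quot : (h k)^-1 * (phi (place (t + h k) p, t + h k) - phi (place t p, t)) @[k --> \oo] -->
      transport phi t (place t p).
    apply/cvgrPdist_le => e e0; apply: filterS (incr e e0) => k hk.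
    have hn : h k != 0 by rewrite gt_eqF.
    rewrite distrC -(ler_pM2l (h0 k)); apply: le_trans hk.
    by rewrite -{1}(gtr0_norm (h0 k)) -normrM mulrBr mulVKf.
  have phicvg : phi (place (t + h k) p, t + h k) @[k --> \oo] --> phi (place t p, t).
    have hcvg : h k @[k --> \oo] --> (0 : R) by exact: cvg_harmonic.
    have hq : h k * ((h k)^-1 * (phi (place (t + h k) p, t + h k) - phi (place t p, t)))
        @[k --> \oo] --> 0 * transport phi t (place t p) by apply: cvgM.
    have : phi (place t p, t) + h k * ((h k)^-1 * (phi (place (t + h k) p, t + h k) - phi (place t p, t)))
        @[k --> \oo] --> phi (place t p, t) + 0 * transport phi t (place t p).
      by apply: cvgD => //; exact: cvg_cst.
    rewrite mul0r addr0; apply: cvg_trans; apply: near_eq_cvg; apply: nearW => k /=.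
    have hn : h k != 0 by rewrite gt_eqF.
    by rewrite mulVKf// addrC subrK.
  have -> : (fun k => (h k)^-1 * (amount p (t + h k) - amount p t)) =
      (fun k => eta p.2 * (a1 p.1 * phi (place (t + h k) p, t + h k) +
         act * ((h k)^-1 * (phi (place (t + h k) p, t + h k) - phi (place t p, t))))).
    apply/funext => k; rewrite /amount /act; have := h0 k; move: (h k) => x x0.
    by field; exact: lt0r_neq0.
  by apply: cvgMr; apply: cvgD; apply: cvgMr.
- by apply: (@integrable_le_cst _ _ _ P _ _ L) => //; [exact: total_finite|move=> x _; rewrite ger0_norm].
- apply: aeS lip2 => p hp k _; rewrite normrM normfV (gtr0_norm (h0 k)) ler_pdivrMl//.
  have := hp t (t + h k) (ltW t0) _ (th0 k) (thB k).
  rewrite (_ : t + h k - t = h k); last by rewrite addrC addKr.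
  by rewrite (gtr0_norm (h0 k)) [L * _]mulrC; apply; rewrite (le_trans (ltW tB)).
apply: cvg_trans; apply: near_eq_cvg; apply: nearW => k.
rewrite RintegralZl//; last first.
  rewrite (_ : _ \o _ = (fun p => (amount p (t + h k))%:E - (amount p t)%:E)%E)//.
  by apply: integrableB => //; [exact: amount_int|exact/amount_int/ltW].
by rewrite -Gdiff ?(ltW t0)// /h invrK.
Qed.

End evolution.

Definition density : R.-ker RR ~> rV :=
  @pushforward_kernel _ _ _ RR (RR * rV)%type rV R (finite_product_measure mu cone) place measurable_place.

Let measurable_X' : measurable_fun setT (fun q : RR * RR => X q.2 q.1 : RR).
Proof.
apply: (measurableT_comp measurable_X (g := fun q : RR * RR => (q.2, q.1))).
exact: measurable_fun_pair.
Qed.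

Definition radial_density : R.-ker RR ~> RR :=
  @pushforward_kernel _ _ _ RR RR RR R mu (fun t s => X s t) measurable_X'.

Let measurable_Xt t : measurable_fun setT (fun s : RR => X s t : RR).
Proof.
apply: (measurableT_comp measurable_X (g := fun s : RR => (s, t : RR))).
exact: measurable_fun_pair.
Qed.

Lemma density_radial t A : measurable A -> density t A = polar_measure (radial_density t) A.
Proof.
move=> mA; pose B : set (RR * rV) := [set p | A (p.1 *: dir p.2)].
have mB : measurable B.
  rewrite -[X in measurable X]setTI; apply: (_ : measurable_fun setT (fun p : RR * rV => p.1 *: dir p.2)) => //.
  apply: measurable_scale => //; exact: (measurableT_comp (@measurable_dir R n)).
have sE r : sphere_measure [set omega : rV | A (r *: omega)] = cone (xsection B r).
  rewrite sphere_measureE; congr (cone _).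
  by apply/seteqP; split => x; rewrite /xsection /B /= inE.
have mcone : measurable_fun setT (cone \o xsection B) by exact: measurable_fun_xsection.
rewrite /polar_measure; under eq_integral do rewrite sE.
transitivity (\int[mu]_(s in (fun s => X s t) @^-1` `[0%R, +oo[) cone (xsection B (X s t)))%E;
  last by apply/esym/ge0_integral_pushforward_kernel.
rewrite (_ : _ @^-1` _ = setT); last first.
  by apply/seteqP; split => s //= _; rewrite in_itv/= X_ge0.
rewrite /density pushforward_kernelE.
transitivity (P (place t @^-1` A)) => //.
Qed.

Lemma density_le t A : measurable A -> (density t A <= (fine (P setT))%:E)%E.
Proof.
move=> mA; rewrite fineK; last by rewrite ge0_fin_numE// total_finite.
rewrite /density pushforward_kernelE.
apply: (@le_measure _ _ _ P); rewrite ?inE//.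
by rewrite -[X in measurable X]setTI; exact: measurable_place_at.
Qed.

Lemma electric_field_radial_density t r : electric_field (radial_density t) r =
  (fine (mu [set s | X s t < r]) + fine (mu [set s | X s t <= r])) / 2.
Proof.
rewrite /electric_field; congr ((fine _ + fine _) / 2); rewrite pushforward_kernelE;
  by congr (mu _); apply/seteqP; split => s /=; rewrite in_itv/= X_ge0.
Qed.

Lemma Rintegral_flow_density t (f : rV -> R) : measurable_fun setT f ->
  \int[density t]_x f x = \int[P]_p f (place t p).
Proof. by move=> mf; rewrite /density Rintegral_pushforward_kernel. Qed.

Lemma mass_balance phi : test_function phi ->
  (forall B T, 0 < B -> 0 < T -> exists2 U, 0 <= U &
    {ae mu, forall s : RR, forall t, 0 <= t -> t <= T -> X s t < B -> `|w (X s t) t| <= U}) ->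
  spacetime_integral density (fun x t => transport phi t x) = - \int[P]_p phi (place 0 p, 0).
Proof.
move=> tp hw; have cp := test_function_C1 tp.
have := @evolution_identity (fun=> 1) (fun=> 0) (fun=> 1) phi.
move=> /(_ _ _ _ _ 0 _ _ _ tp)/wrap[] //.
- by move=> x; rewrite normr1.
- by move=> s; rewrite normr0.
- move=> B T B0 T0; have [U U0 hU] := hw B T B0 T0.
  exists (1 + U); first by rewrite addr_ge0.
  apply: aeS hU => s h t t0 tT XB; rewrite mul0r addr0 normr1 lerDl U0; split => //.
  by apply: (le_trans (h t t0 tT XB)); rewrite lerDr.
move=> h; transitivity (- \int[P]_p (1 * ((1 + 0 * 0) * phi (place 0 p, 0)))); last first.
  by congr (- _); apply: eq_Rintegral => p _; rewrite mul0r addr0 !mul1r.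
rewrite -h /spacetime_integral; apply: eq_Rintegral => t _.
rewrite Rintegral_flow_density; last exact: measurable_transport_at.
by apply: eq_Rintegral => p _; rewrite mul0r add0r mul0r addr0 !mul1r.
Qed.

(** The measure of the sphere is invariant under omega |-> - omega. *)
Lemma cone_dir_integral i : \int[cone]_x dir x 0 i = 0.
Proof.
have mN : measurable_fun setT (-%R : rV -> rV).
  rewrite (_ : -%R = (fun x : rV => (-1) *: x + 0)); first exact: measurable_rV_affine.
  by apply/funext => x; rewrite scaleN1r addr0.
have md : measurable_fun setT (fun x : rV => dir x 0 i : RR).
  by apply: (measurableT_comp (measurable_coor i)); exact: measurable_dir.
have id_ : cone.-integrable setT (EFin \o (fun x : rV => dir x 0 i)).
  apply: (@integrable_le_cst _ _ _ cone _ _ 1) => //.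
    by rewrite -ge0_fin_numE// fin_num_measure.
  by move=> x _; exact: coor_dir.
suff h : \int[cone]_x dir x 0 i = \int[cone]_x (- 1 * dir x 0 i).
  have : \int[cone]_x dir x 0 i = - \int[cone]_x dir x 0 i.
    by rewrite {1}h RintegralZl// mulN1r.
  by move=> e; lra.
have mZ : measurable_fun setT (fun q : RR * rV => - q.2) by exact: (measurableT_comp mN).
pose opp_cone := @pushforward_kernel _ _ _ RR rV rV R cone (fun _ x => - x) mZ (0 : R).
transitivity (\int[opp_cone]_x dir x 0 i).
  have coneE A : measurable A -> A `<=` setT -> cone A = opp_cone A.
    by move=> mA _; rewrite /opp_cone pushforward_kernelE; exact/esym/cone_measure_opp.
  by rewrite /Rintegral (eq_measure_integral opp_cone coneE).
transitivity (\int[cone]_x dir (- x) 0 i); first exact: Rintegral_pushforward_kernel.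
by apply: eq_Rintegral => x _; rewrite dirN mxE mulN1r.
Qed.

(** Integrate over the labels first: what remains is c times the mean of omega_i. *)
Lemma angular_average i (g : RR * rV -> R) c : P.-integrable setT (EFin \o g) ->
  {ae cone, forall x, \int[mu]_s g (s, x) = c} ->
  \int[P]_p (dir p.2 0 i * g p) = 0.
Proof.
move=> ig gc.
have mg : measurable_fun setT g by apply/measurable_EFinP; exact: measurable_int ig.
have md : measurable_fun setT (fun x : rV => dir x 0 i : RR).
  by apply: (measurableT_comp (measurable_coor i)); exact: measurable_dir.
have mdg : measurable_fun setT (fun p : RR * rV => dir p.2 0 i * g p).
  by apply: measurable_funM => //; exact: (measurableT_comp md).
have idg : P.-integrable setT (EFin \o (fun p => dir p.2 0 i * g p)).
  apply: (le_integrable _ _ _ ig) => //; first exact/measurable_EFinP.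
  by move=> p _ /=; rewrite lee_fin normrM ler_piMl// coor_dir.
have [ae1 ->] := Rintegral_prod idg; have [ae2 _] := Rintegral_prod ig.
have mG : measurable_fun setT (fun x : rV => \int[mu]_s (dir x 0 i * g (s, x)) : RR).
  pose g' (q : rV * RR) := dir q.1 0 i * g (q.2, q.1).
  apply: (@measurable_fun_Rintegral _ _ _ _ _ mu g').
  apply: (measurableT_comp mdg (g := fun q : rV * RR => (q.2, q.1))).
  exact: measurable_fun_pair.
transitivity (\int[cone]_x (c * dir x 0 i)).
  apply: ae_eq_Rintegral => //; first by apply: measurable_funM.
  apply: aeS2 gc ae2 => x gx ix _ /=.
  by rewrite RintegralZl// gx mulrC.
have id_ : cone.-integrable setT (EFin \o (fun x : rV => dir x 0 i)).
  apply: (@integrable_le_cst _ _ _ cone _ _ 1) => //.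
    by rewrite -ge0_fin_numE// fin_num_measure.
  by move=> x _; exact: coor_dir.
by rewrite RintegralZl// cone_dir_integral mulr0.
Qed.

Section momentum.
Context (kappa : R) (u E : R -> R) (M : R).
Context (measurable_u : measurable_fun setT (u : RR -> RR)).
Context (measurable_E : measurable_fun setT (E : RR -> RR)).
Context (E_le : forall s, `|E s| <= M).
Context (bounds : forall B T, 0 < B -> 0 < T -> exists2 U, 0 <= U &
  {ae mu, forall s : RR, forall t, 0 <= t -> t <= T -> X s t < B ->
    `|u s + kappa * E s * t| <= U /\ `|w (X s t) t| <= U}).
Let field t r := (fine (mu [set s | X s t < r]) + fine (mu [set s | X s t <= r])) / 2.
Context (velocity_test : forall (t B C : R) (k : R -> R), 0 <= t -> 0 < B ->
  measurable_fun setT (k : RR -> R) -> (forall r, B <= r -> k r = 0) -> 0 <= C ->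
  {ae mu, forall s : RR, `|k (X s t)| <= C} ->
  mu.-integrable setT (EFin \o (fun s => (u s + kappa * E s * t) * k (X s t))) /\
  \int[mu]_s (w (X s t) t * k (X s t)) = \int[mu]_s ((u s + kappa * E s * t) * k (X s t))).
Context (field_test : forall (t C : R) (k : R -> R), 0 <= t ->
  measurable_fun setT (k : RR -> R) -> (forall r, `|k r| <= C) ->
  \int[mu]_s (field t (X s t) * k (X s t)) = \int[mu]_s (E s * k (X s t))).

Let v t s := u s + kappa * E s * t.

Let Pfin : (P setT < +oo)%E := total_finite.

Let measurable_v t : measurable_fun setT (v t : RR -> RR).
Proof.
apply: measurable_funD => //; apply: measurable_funM => //; exact: measurable_funM.
Qed.

Let measurable_field t : measurable_fun setT (field t : RR -> RR).
Proof.
have mlt r : measurable ([set s | X s t < r] : set RR).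
  rewrite (_ : [set s | _] = setT `&` X^~ t @^-1` `]-oo, r[).
    by apply: (measurable_Xt t) => //; exact: measurable_itv.
  by rewrite setTI; apply/seteqP; split => s /=; rewrite in_itv.
have mle r : measurable ([set s | X s t <= r] : set RR).
  rewrite (_ : [set s | _] = setT `&` X^~ t @^-1` `]-oo, r]).
    by apply: (measurable_Xt t) => //; exact: measurable_itv.
  by rewrite setTI; apply/seteqP; split => s /=; rewrite in_itv.
apply: nondecreasing_measurable => // r r' rr'; rewrite /field ler_pM2r// lerD//.
  apply: fine_le; rewrite ?fin_num_measure//; apply: le_measure; rewrite ?inE//.
  by move=> s /= /lt_le_trans; apply.
apply: fine_le; rewrite ?fin_num_measure//; apply: le_measure; rewrite ?inE//.
by move=> s /= /le_trans; apply.
Qed.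

Let mu_finite : (mu setT < +oo)%E.
Proof. by rewrite -ge0_fin_numE// fin_num_measure. Qed.

(** Passage from a quantity q carried by the labels to a field g with the same
means over the blocks.  At the centre g is replaced by 0, because the momentum
there has no direction; the difference, called cut, depends on the label alone and
averages to zero over the sphere. *)
Lemma angular_swap t i (q : RR -> R) (g : R -> R) (f : rV -> R) :
  P.-integrable setT (EFin \o (fun p => q p.1 * f (place t p))) ->
  P.-integrable setT (EFin \o (fun p => g (X p.1 t) * f (place t p))) ->
  (forall x : rV, x != 0 ->
    \int[mu]_s (g (X s t) * f (X s t *: dir x)) = \int[mu]_s (q s * f (X s t *: dir x))) ->
  \int[P]_p (dir p.2 0 i * (q p.1 * f (place t p))) =
  \int[P]_p ((if X p.1 t == 0 then 0 else g (X p.1 t)) * dir p.2 0 i * f (place t p)).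
Proof.
move=> iq ig qg.
pose cut (r : R) : R := if r == 0 then g 0 * f 0 else 0.
have mcut : measurable_fun setT (fun s : RR => cut (X s t)).
  have : measurable_fun setT (cut : RR -> R).
    by apply: measurable_fun_if => //; exact: measurable_fun_eqr.
  by move=> mc; apply: (measurableT_comp mc); exact: measurable_Xt.
have icut : mu.-integrable setT (EFin \o (fun s => cut (X s t))).
  apply: (@integrable_le_cst _ _ _ mu _ _ `|g 0 * f 0|) => //.
  by move=> s _; rewrite /cut; case: ifP; rewrite ?normr0.
have icutP : P.-integrable setT (EFin \o (fun p => cut (X p.1 t))).
  apply: (@integrable_le_cst _ _ _ P _ _ `|g 0 * f 0|) => //.
    by apply: (measurableT_comp mcut).
  by move=> s _; rewrite /cut; case: ifP; rewrite ?normr0.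
pose h (p : RR * rV) := q p.1 * f (place t p) - (g (X p.1 t) * f (place t p) - cut (X p.1 t)).
have igc : P.-integrable setT (EFin \o (fun p => g (X p.1 t) * f (place t p) - cut (X p.1 t))).
  rewrite (_ : _ \o _ = (fun p => (g (X p.1 t) * f (place t p))%:E - (cut (X p.1 t))%:E)%E)//.
  by apply: integrableB => //; exact: icutP.
have ih : P.-integrable setT (EFin \o h).
  rewrite (_ : _ \o _ = (fun p => (q p.1 * f (place t p))%:E -
    (g (X p.1 t) * f (place t p) - cut (X p.1 t))%:E)%E)//.
  by apply: integrableB => //; exact: igc.
have [aeq _] := Rintegral_prod iq; have [aeg _] := Rintegral_prod ig.
have slices : {ae cone, forall x, \int[mu]_s h (s, x) = \int[mu]_s cut (X s t)}.
  apply: aeS2 cone_nonzero (aeS2 (fun x a b => conj a b) aeq aeg) => x x0 [iqx igx].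
  rewrite /h /= RintegralB//; last first.
    rewrite (_ : _ \o _ = (fun s => (g (X s t) * f (place t (s, x)))%:E - (cut (X s t))%:E)%E)//.
    by apply: integrableB => //; exact: icut.
  by rewrite RintegralB// /place /= qg// opprB addrCA subrr addr0.
have idir (k : RR * rV -> R) : P.-integrable setT (EFin \o k) ->
    P.-integrable setT (EFin \o (fun p => dir p.2 0 i * k p)).
  move=> ik; have mk : measurable_fun setT k by apply/measurable_EFinP; exact: measurable_int ik.
  apply: (le_integrable _ _ _ ik) => //.
    apply/measurable_EFinP; apply: measurable_funM => //.
    apply: (measurableT_comp (measurable_coor i)).
    by apply: (measurableT_comp (@measurable_dir R n)).
  by move=> p _ /=; rewrite lee_fin normrM ler_piMl// coor_dir.
have : \int[P]_p (dir p.2 0 i * (q p.1 * f (place t p)) -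
    dir p.2 0 i * (g (X p.1 t) * f (place t p) - cut (X p.1 t))) = 0.
  rewrite -(angular_average i ih slices); apply: eq_Rintegral => p _.
  by rewrite [RHS]mulrBr.
rewrite RintegralB//; [|exact: idir..] => /eqP; rewrite subr_eq0 => /eqP ->.
apply: eq_Rintegral => p _; rewrite /cut /place; case: eqVneq => [->|_].
  by rewrite scale0r subrr !mul0r mulr0.
by rewrite subr0 mulrA [dir _ _ _ * _]mulrC.
Qed.

Lemma transport_outside phi t x : (forall v, 'D_v phi (x, t) = 0) -> transport phi t x = 0.
Proof.
move=> D0; rewrite /transport /tpartial D0 big1 ?addr0// => j _.
by rewrite /spartial D0 mul0r.
Qed.

(** Only labels inside the ball of radius B see phi, and their velocity is bounded
almost surely. *)
Lemma transport_bound phi : test_function phi -> exists B U K : R,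
  [/\ 0 < B, 0 <= U, 0 <= K,
   forall x t, B <= enorm x \/ B <= t -> phi (x, t) = 0 /\ transport phi t x = 0 &
   {ae mu, forall s : RR, forall t, 0 <= t -> t <= B + 1 ->
     (X s t < B -> `|v t s| <= U /\ `|w (X s t) t| <= U) /\
     forall x : rV, x != 0 -> `|transport phi t (X s t *: dir x)| <= K}].
Proof.
move=> tp; have cp := test_function_C1 tp.
have [B [U [V [C [B0 U0 V0 C0 [hB _ hC hU]]]]]] :=
  @test_region u (fun s => kappa * E s) phi bounds tp.
have hB' x t : B <= enorm x \/ B <= t -> phi (x, t) = 0 /\ transport phi t x = 0.
  by move=> /hB[p0 D0]; split => //; exact: transport_outside.
exists B, U, (C + U * C); split => //; first by rewrite addr_ge0// mulr_ge0.
apply: aeS hU => s hs t t0 tB; split; first exact: hs.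
move=> x x0; have [XB|BX] := ltP (X s t) B; last first.
  have [|_ ->] := hB' (X s t *: dir x) t; last by rewrite normr0 addr_ge0// mulr_ge0.
  by left; rewrite enorm_scale_dir.
rewrite -/(place t (s, x)) transport_place//=.
have [_ c1 c2] := hC (place t (s, x), t).
apply: (le_trans (ler_normD _ _)); apply: lerD => //.
rewrite normrM; apply: ler_pM => //; last by apply: c2; exact: enorm_dir_le1.
by have [_] := hs t t0 tB XB; case: ifP; rewrite ?normr0.
Qed.

Let measurable_place_comp t (f : rV -> R) : measurable_fun setT f ->
  measurable_fun setT (fun p : RR * rV => f (place t p)).
Proof. by move=> mf; apply: (measurableT_comp mf); exact: measurable_place_at. Qed.

Let measurable_Xfst t (f : R -> R) : measurable_fun setT (f : RR -> R) ->
  measurable_fun setT (fun p : RR * rV => f (X p.1 t)).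
Proof.
move=> mf; apply: (measurableT_comp mf).
by apply: (measurableT_comp (measurable_Xt t)).
Qed.

Let measurable_wt t : measurable_fun setT (w^~ t : RR -> R).
Proof.
apply: (measurableT_comp measurable_w (g := fun r : RR => (r, t : RR))).
exact: measurable_fun_pair.
Qed.

Lemma label_momentum t i phi : test_function phi -> 0 <= t ->
  P.-integrable setT (EFin \o (fun p => dir p.2 0 i * (v t p.1 * transport phi t (place t p)))) /\
  \int[P]_p (dir p.2 0 i * (v t p.1 * transport phi t (place t p))) =
  \int[P]_p (velocity w t (place t p) 0 i * transport phi t (place t p)).
Proof.
move=> tp t0; have cp := test_function_C1 tp.
have [B [U [K [B0 U0 K0 hB hU]]]] := transport_bound tp.
have mT := measurable_transport_at t cp.
have [Bt|tB] := leP B t.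
  have T0 x : transport phi t x = 0 by have [|_ ->] := hB x t; first by right.
  split.
    rewrite (_ : _ \o _ = (fun=> 0%E)); first exact: integrable0.
    by apply/funext => p /=; rewrite T0 !mulr0.
  by apply: eq_Rintegral => p _; rewrite T0 !mulr0.
have tB1 : t <= B + 1 by rewrite (le_trans (ltW tB))// lerDl.
have aeP := aeS2 (fun p a b => conj a b) (ae_fst cone hU) (ae_snd mu cone_nonzero).
have far p : p.2 != 0 -> B <= X p.1 t -> transport phi t (place t p) = 0.
  by move=> p0 BX; have [|_ ->] := hB (place t p) t; first by left; rewrite enorm_place.
have iv : P.-integrable setT (EFin \o (fun p => v t p.1 * transport phi t (place t p))).
  apply: (@integrable_ae_bounded _ _ _ _ _ _ (U * K)) => //.
    apply: measurable_funM; first exact: (measurableT_comp (measurable_v t)).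
    exact: measurable_place_comp.
  apply: aeS aeP => p [hp p0] _; have [h1 h2] := hp t t0 tB1; rewrite normrM.
  have [XB|BX] := ltP (X p.1 t) B; last by rewrite far// normr0 mulr0 mulr_ge0.
  by apply: ler_pM => //; [have [] := h1 XB|exact: h2].
have iw : P.-integrable setT (EFin \o (fun p => w (X p.1 t) t * transport phi t (place t p))).
  apply: (@integrable_ae_bounded _ _ _ _ _ _ (U * K)) => //.
    apply: measurable_funM; last exact: measurable_place_comp.
    exact: (measurable_Xfst t (measurable_wt t)).
  apply: aeS aeP => p [hp p0] _; have [h1 h2] := hp t t0 tB1; rewrite normrM.
  have [XB|BX] := ltP (X p.1 t) B; last by rewrite far// normr0 mulr0 mulr_ge0.
  by apply: ler_pM => //; [have [] := h1 XB|exact: h2].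
split.
  apply: (le_integrable _ _ _ iv) => //.
    apply/measurable_EFinP; apply: measurable_funM; last first.
      by apply/measurable_EFinP; exact: measurable_int iv.
    apply: (measurableT_comp (measurable_coor i)).
    by apply: (measurableT_comp (@measurable_dir R n)).
  by move=> p _ /=; rewrite lee_fin normrM ler_piMl// coor_dir.
rewrite (@angular_swap t i (v t) (w^~ t) (transport phi t))//.
  have mvel : measurable_fun setT (fun x : rV => velocity w t x 0 i : R).
    apply: (measurableT_comp (measurable_velocity i) (g := fun x : rV => (t : RR, x))).
    exact: measurable_fun_pair.
  apply: ae_eq_Rintegral => //.
  - apply: measurable_funM; last exact: measurable_place_comp.
    apply: measurable_funM.
      apply: measurable_fun_if => //.
        apply: measurable_fun_eqr => //.
        exact: (measurableT_comp (measurable_Xt t)).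
      exact: measurable_funTS (measurable_Xfst t (measurable_wt t)).
    apply: (measurableT_comp (measurable_coor i)).
    by apply: (measurableT_comp (@measurable_dir R n)).
  - apply: measurable_funM; last exact: measurable_place_comp.
    exact: (measurable_place_comp t mvel).
  - apply: aeS (ae_snd mu cone_nonzero) => p p0 _.
    by rewrite velocity_place// [in RHS]mxE.
move=> x x0; pose k (r : R) := transport phi t (r *: dir x).
have mk : measurable_fun setT (k : RR -> R).
  apply: (measurableT_comp mT (g := fun r : RR => r *: dir x)).
  by apply: measurable_scale.
have kB r : B <= r -> k r = 0.
  move=> Br; rewrite /k; have [|_ ->//] := hB (r *: dir x) t.
  by left; rewrite enorm_scale_dir// (le_trans (ltW B0)).
have kK : {ae mu, forall s : RR, `|k (X s t)| <= K}.
  by apply: aeS hU => s hs; have [_] := hs t t0 tB1; exact.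
by have [_] := velocity_test t0 B0 mk kB K0 kK.
Qed.

Lemma label_force t i phi : test_function phi -> 0 <= t ->
  P.-integrable setT (EFin \o (fun p => dir p.2 0 i * (kappa * E p.1 * phi (place t p, t)))) /\
  \int[P]_p (dir p.2 0 i * (kappa * E p.1 * phi (place t p, t))) =
  \int[P]_p (phi (place t p, t) * (kappa * field t (enorm (place t p)) * dir (place t p) 0 i)).
Proof.
move=> tp t0; have [cf _ _] := test_function_C1 tp.
have [C C0 hC] := test_function_bounded tp.
have M0 : 0 <= M := le_trans (normr_ge0 _) (E_le 0).
have mphi : measurable_fun setT (fun x : rV => phi (x, t) : R).
  apply: (measurableT_comp (measurable_test_at cf) (g := fun x : rV => (t : RR, x))).
  exact: measurable_fun_pair.
have field_le r : `|field t r| <= fine (mu setT).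
  have h (A : set RR) : measurable A -> 0 <= fine (mu A) <= fine (mu setT).
    move=> mA; rewrite fine_ge0//=; apply: fine_le; rewrite ?fin_num_measure//.
    by apply: le_measure; rewrite ?inE.
  have /andP[a1 a2] : 0 <= fine (mu [set s | X s t < r]) <= fine (mu setT).
    apply: h; rewrite (_ : [set s | _] = setT `&` X^~ t @^-1` `]-oo, r[).
      by apply: (measurable_Xt t) => //; exact: measurable_itv.
    by rewrite setTI; apply/seteqP; split => s /=; rewrite in_itv.
  have /andP[b1 b2] : 0 <= fine (mu [set s | X s t <= r]) <= fine (mu setT).
    apply: h; rewrite (_ : [set s | _] = setT `&` X^~ t @^-1` `]-oo, r]).
      by apply: (measurable_Xt t) => //; exact: measurable_itv.
    by rewrite setTI; apply/seteqP; split => s /=; rewrite in_itv.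
  by rewrite /field ger0_norm ?divr_ge0 ?addr_ge0// ler_pdivrMr// mulr_natr mulr2n lerD.
have iE : P.-integrable setT (EFin \o (fun p => kappa * E p.1 * phi (place t p, t))).
  apply: (@integrable_le_cst _ _ _ P _ _ (`|kappa| * M * C)) => //.
    apply: measurable_funM; last exact: (measurable_place_comp t mphi).
    by apply: measurable_funM => //; exact: (measurableT_comp measurable_E).
  move=> p _; rewrite !normrM; apply: ler_pM => //; last by rewrite ler_wpM2l.
have iF : P.-integrable setT (EFin \o (fun p => (kappa * field t (X p.1 t)) * phi (place t p, t))).
  apply: (@integrable_le_cst _ _ _ P _ _ (`|kappa| * fine (mu setT) * C)) => //.
    apply: measurable_funM; last exact: (measurable_place_comp t mphi).
    by apply: measurable_funM => //; exact: (measurable_Xfst t (measurable_field t)).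
  move=> p _; rewrite normrM (normrM kappa); apply: ler_pM => //.
  by apply: ler_wpM2l => //; exact: field_le.
split.
  apply: (le_integrable _ _ _ iE) => //.
    apply/measurable_EFinP; apply: measurable_funM; last first.
      by apply/measurable_EFinP; exact: measurable_int iE.
    apply: (measurableT_comp (measurable_coor i)).
    by apply: (measurableT_comp (@measurable_dir R n)).
  by move=> p _ /=; rewrite lee_fin normrM ler_piMl// coor_dir.
rewrite (@angular_swap t i (fun s => kappa * E s) (fun r => kappa * field t r) (fun x => phi (x, t)))//.
  apply: ae_eq_Rintegral => //.
  - apply: measurable_funM; last exact: (measurable_place_comp t mphi).
    apply: measurable_funM.
      apply: measurable_fun_if => //.
        apply: measurable_fun_eqr => //.
        exact: (measurableT_comp (measurable_Xt t)).
      apply: measurable_funTS; apply: measurable_funM => //.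
      exact: (measurable_Xfst t (measurable_field t)).
    apply: (measurableT_comp (measurable_coor i)).
    by apply: (measurableT_comp (@measurable_dir R n)).
  - apply: measurable_funM; first exact: (measurable_place_comp t mphi).
    apply: measurable_funM.
      apply: measurable_funM => //.
      apply: (measurable_place_comp t (f := fun x => field t (enorm x))).
      by apply: (measurableT_comp (measurable_field t)); exact: measurable_enorm.
    apply: (measurable_place_comp t (f := fun x => dir x 0 i)).
    by apply: (measurableT_comp (measurable_coor i)); exact: measurable_dir.
  - apply: aeS (ae_snd mu cone_nonzero) => p p0 _.
    rewrite enorm_place// [RHS]mulrC; congr (_ * _).
    rewrite /place; case: eqVneq => [->|Xp]; first by rewrite scale0r dir0 (_ : (0 : rV) 0 i = 0) ?mulr0 ?mul0r// mxE.
    by rewrite dir_scale_dir// lt_neqAle eq_sym Xp X_ge0.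
move=> x x0; pose k (r : R) := kappa * phi (r *: dir x, t).
have mk : measurable_fun setT (k : RR -> R).
  apply: measurable_funM => //.
  apply: (measurableT_comp mphi (g := fun r : RR => r *: dir x)).
  by apply: measurable_scale.
have kC r : `|k r| <= `|kappa| * C by rewrite normrM ler_wpM2l.
have := field_test t0 mk kC; rewrite /k => h.
transitivity (\int[mu]_s (field t (X s t) * (kappa * phi (X s t *: dir x, t)))).
  by apply: eq_Rintegral => s _; ring.
by rewrite h; apply: eq_Rintegral => s _; ring.
Qed.

Let measurable_time (f : RR * (RR * rV) -> R) : measurable_fun setT f ->
  measurable_fun setT (fun t : RR => \int[P]_p f (t, p) : R).
Proof.
by move=> mf; exact: (@measurable_fun_Rintegral _ _ _ _ _ (finite_product_measure mu cone) f).
Qed.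

Lemma momentum_balance i phi : test_function phi ->
  spacetime_integral density (fun x t =>
      tpartial phi x t * velocity w t x 0 i
      + \sum_(j < n) spartial j phi x t * (velocity w t x 0 i * velocity w t x 0 j))
  + spacetime_integral density (fun x t =>
      phi (x, t) * (kappa * electric_field (radial_density t) (enorm x) * dir x 0 i))
  = - \int[P]_p (dir p.2 0 i * u p.1 * phi (place 0 p, 0)).
Proof.
move=> tp; have cp := test_function_C1 tp; have [cf _ _] := cp.
have [B [U [K [B0 U0 K0 hB hU]]]] := transport_bound tp.
have [C C0 hC] := test_function_bounded tp.
have M0 : 0 <= M := le_trans (normr_ge0 _) (E_le 0).
pose a (t : R) := \int[P]_p (dir p.2 0 i * (v t p.1 * transport phi t (place t p))).
pose b (t : R) := \int[P]_p (dir p.2 0 i * (kappa * E p.1 * phi (place t p, t))).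
have mdir : measurable_fun setT (fun x : rV => dir x 0 i : R).
  by apply: (measurableT_comp (measurable_coor i)); exact: measurable_dir.
have mpl : measurable_fun setT (fun q : RR * (RR * rV) => (q.1, place q.1 q.2)).
  by apply: measurable_fun_pair => //; exact: measurable_place.
have mdir3 : measurable_fun setT (fun q : RR * (RR * rV) => dir q.2.2 0 i : R).
  by apply: (measurableT_comp mdir); exact: measurableT_comp.
have ms3 (f : R -> R) : measurable_fun setT (f : RR -> R) ->
    measurable_fun setT (fun q : RR * (RR * rV) => f q.2.1 : R).
  by move=> mf; apply: (measurableT_comp mf); exact: measurableT_comp.
have ma : measurable_fun setT (a : RR -> R).
  apply: (measurable_time (f := fun q => dir q.2.2 0 i * (v q.1 q.2.1 * transport phi q.1 (place q.1 q.2)))).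
  apply: measurable_funM => //; apply: measurable_funM.
    apply: measurable_funD; first exact: ms3.
    by apply: measurable_funM => //; apply: measurable_funM => //; exact: ms3.
  exact: (measurableT_comp (measurable_transport cp) mpl).
have mb : measurable_fun setT (b : RR -> R).
  apply: (measurable_time (f := fun q => dir q.2.2 0 i * (kappa * E q.2.1 * phi (place q.1 q.2, q.1)))).
  apply: measurable_funM => //; apply: measurable_funM.
    by apply: measurable_funM => //; exact: ms3.
  exact: (measurableT_comp (measurable_test_at cf) mpl).
have a_end t : B <= t -> a t = 0.
  move=> Bt; transitivity (\int[P]_p (0 : R)); last by rewrite Rintegral_cst// mul0r.
  by apply: eq_Rintegral => p _; have [|_ ->] := hB (place t p) t; [right|rewrite !mulr0].
have b_end t : B <= t -> b t = 0.
  move=> Bt; transitivity (\int[P]_p (0 : R)); last by rewrite Rintegral_cst// mul0r.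
  by apply: eq_Rintegral => p _; have [|-> _] := hB (place t p) t; [right|rewrite !mulr0].
have integrable_time (f : R -> R) L : 0 <= L -> measurable_fun setT (f : RR -> R) ->
    (forall t, B <= t -> f t = 0) -> (forall t, 0 <= t -> t <= B -> `|f t| <= L) ->
    (@lebesgue_measure R).-integrable `[0, +oo[ (EFin \o f).
  move=> L0 mf fB fL.
  have i0 : (@lebesgue_measure R).-integrable (`[0, B] : set RR) (EFin \o f).
    apply: (@integrable_le_cst _ _ _ _ _ _ L) => //.
    - exact: lebesgue_itv_lty.
    - exact: measurable_funTS.
    - by move=> t /=; rewrite in_itv/= => /andP[t0 tB]; exact: fL.
  apply/(integrable_mkcond _ _).2 => //.
  have /(integrable_mkcond _ _).1 := i0; move=> /(_ (measurable_itv _)).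
  congr (_.-integrable _ _); apply/funext => t; rewrite !patchE !mem_setE !in_itv/= andbT.
  by have [t0|//] := leP 0 t; have [//|/ltW Bt] := leP t B; rewrite /= fB.
have ia : (@lebesgue_measure R).-integrable `[0, +oo[ (EFin \o a).
  apply: (integrable_time _ (U * K * fine (P setT))) => //.
    by rewrite !mulr_ge0// fine_ge0.
  move=> t t0 tB; have tB1 : t <= B + 1 by rewrite (le_trans tB)// lerDl.
  apply: Rintegral_ae_bounded => //; first by rewrite mulr_ge0.
    apply/measurable_EFinP; apply: measurable_int.
    by have [+ _] := label_momentum i tp t0; exact.
  apply: aeS2 (ae_fst cone hU) (ae_snd mu cone_nonzero) => p hp p0 _.
  have [h1 h2] := hp t t0 tB1.
  rewrite normrM -[leRHS]mul1r; apply: ler_pM => //; first exact: coor_dir.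
  have [XB|BX] := ltP (X p.1 t) B; last first.
    by have [|_ ->] := hB (place t p) t; [left; rewrite enorm_place|rewrite mulr0 normr0 mulr_ge0].
  by rewrite normrM; apply: ler_pM => //; [have [] := h1 XB|exact: h2].
have ib : (@lebesgue_measure R).-integrable `[0, +oo[ (EFin \o b).
  apply: (integrable_time _ (`|kappa| * M * C * fine (P setT))) => //.
    by rewrite !mulr_ge0// fine_ge0.
  move=> t t0 tB; apply: Rintegral_ae_bounded => //; first by rewrite !mulr_ge0.
    apply/measurable_EFinP; apply: measurable_int.
    by have [+ _] := label_force i tp t0; exact.
  apply: aeW => p _; rewrite normrM -[leRHS]mul1r; apply: ler_pM => //; first exact: coor_dir.
  by rewrite !normrM; apply: ler_pM => //; rewrite ler_wpM2l.
have -> : spacetime_integral density (fun x t => phi (x, t) *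
    (kappa * electric_field (radial_density t) (enorm x) * dir x 0 i)) =
    \int[@lebesgue_measure R]_(t in `[0, +oo[) b t.
  rewrite /spacetime_integral; apply: eq_Rintegral => t.
  rewrite inE/= in_itv/= andbT => t0; have [_ bE] := label_force i tp t0.
  rewrite /b bE Rintegral_flow_density.
    by apply: eq_Rintegral => p _; rewrite electric_field_radial_density.
  apply: measurable_funM.
    apply: (measurableT_comp (measurable_test_at cf) (g := fun x : rV => (t : RR, x))).
    exact: measurable_fun_pair.
  apply: measurable_funM => //; apply: measurable_funM => //.
  rewrite (_ : (fun x => _) = fun x : rV => field t (enorm x)).
    by apply: (measurableT_comp (measurable_field t)); exact: measurable_enorm.
  by apply/funext => x; exact: electric_field_radial_density.
have -> : spacetime_integral density (fun x t => tpartial phi x t * velocity w t x 0 i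
      + \sum_(j < n) spartial j phi x t * (velocity w t x 0 i * velocity w t x 0 j)) =
    \int[@lebesgue_measure R]_(t in `[0, +oo[) a t.
  rewrite /spacetime_integral; apply: eq_Rintegral => t.
  rewrite inE/= in_itv/= andbT => t0; have [_ aE] := label_momentum i tp t0.
  have fE x : tpartial phi x t * velocity w t x 0 i + \sum_(j < n) spartial j phi x t *
      (velocity w t x 0 i * velocity w t x 0 j) = velocity w t x 0 i * transport phi t x.
    rewrite /transport mulrDr mulr_sumr [_ * tpartial _ _ _]mulrC; congr (_ + _).
    by apply: eq_bigr => j _; rewrite mulrCA.
  transitivity (\int[density t]_x (velocity w t x 0 i * transport phi t x)).
    by apply: eq_Rintegral => x _; exact: fE.
  rewrite /a aE Rintegral_flow_density//; apply: measurable_funM; last exact: measurable_transport_at.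
  apply: (measurableT_comp (measurable_velocity i) (g := fun x : rV => (t : RR, x))).
  exact: measurable_fun_pair.
rewrite -RintegralD//.
have := @evolution_identity u (fun s => kappa * E s) (fun x => dir x 0 i) phi.
move=> /(_ _ _ _ _ (`|kappa| * M) _ _ bounds tp)/wrap[] //.
- exact: measurable_funM.
- by move=> x; exact: coor_dir.
- by rewrite mulr_ge0.
- by move=> s; rewrite normrM ler_wpM2l.
move=> h; transitivity (- \int[P]_p (dir p.2 0 i * ((u p.1 + kappa * E p.1 * 0) * phi (place 0 p, 0)))).
  rewrite -h; apply: eq_Rintegral => t; rewrite inE/= in_itv/= andbT => t0.
  have [ia' _] := label_momentum i tp t0; have [ib' _] := label_force i tp t0.
  rewrite /a /b -RintegralD//; apply: eq_Rintegral => p _.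
  by rewrite /v -mulrDr [in LHS]addrC.
by congr (- _); apply: eq_Rintegral => p _; rewrite mulr0 addr0 mulrA.
Qed.

End momentum.

Lemma energy_finite :
  (forall B T, 0 < B -> 0 < T -> exists2 U, 0 <= U &
    {ae mu, forall s : RR, forall t, 0 <= t -> t <= T -> X s t < B -> `|w (X s t) t| <= U}) ->
  forall B T : R, (\int[@lebesgue_measure R]_(t in `[0%R, T]) \int[density t]_(x in eball B)
       ((enorm (velocity w t x) ^+ 2)%:E) < +oo)%E.
Proof.
move=> hw B T.
have B1 : 0 < `|B| + 1 by rewrite ltr_wpDl.
have T1 : 0 < `|T| + 1 by rewrite ltr_wpDl.
have [U U0 hU] := hw _ _ B1 T1.
pose f (q : RR * (RR * rV)) : \bar R :=
  ((enorm (velocity w q.1 (place q.1 q.2)) ^+ 2) * \1_(@eball R n B) (place q.1 q.2))%:E.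
have mvel : measurable_fun setT (fun q : RR * rV => velocity w q.1 q.2).
  by apply: measurable_fun_rV => i; exact: measurable_velocity.
have mf : measurable_fun setT f.
  have mpl : measurable_fun setT (fun q : RR * (RR * rV) => (q.1, place q.1 q.2)).
    by apply: measurable_fun_pair => //; exact: measurable_place.
  apply/measurable_EFinP; apply: measurable_funM.
    apply: measurable_funX; apply: (measurableT_comp (@measurable_enorm R n)).
    exact: (measurableT_comp mvel mpl).
  apply: (measurableT_comp (measurable_indic (@measurable_eball R n B))).
  exact: measurable_place.
have f0 q : (0 <= f q)%E by rewrite lee_fin mulr_ge0// ?sqr_ge0// indicE.
have innerE t : (\int[density t]_(x in eball B) ((enorm (velocity w t x) ^+ 2)%:E) =
    \int[P]_p f (t, p))%E.
  rewrite integral_mkcond /density ge0_integral_pushforward_kernel//.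
  - rewrite preimage_setT; apply: eq_integral => p _.
    rewrite patchE /f indicE /=; case: ifP => _; first by rewrite mulr1.
    by rewrite mulr0.
  - apply/(measurable_restrictT _ _).1; first exact: measurable_eball.
    apply: measurable_funTS; apply/measurable_EFinP; apply: measurable_funX.
    apply: (measurableT_comp (@measurable_enorm R n)).
    apply: (measurableT_comp mvel (g := fun x : rV => (t : RR, x))).
    exact: measurable_fun_pair.
  - by move=> x; rewrite patchE; case: ifP => // _; rewrite lee_fin sqr_ge0.
under eq_integral do rewrite innerE.
have mP : measurable_fun setT (fun t : RR => \int[P]_p f (t, p))%E.
  exact: (@measurable_fun_fubini_tonelli_F _ _ _ _ _ (finite_product_measure mu cone) f mf f0).
apply: (@le_lt_trans _ _ (\int[@lebesgue_measure R]_(t in `[0%R, T]) (U ^+ 2 * fine (P setT))%:E)%E).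
  apply: ge0_le_integral => //.
  - by move=> t _; apply: integral_ge0.
  - exact: measurable_funTS.
  move=> t /=; rewrite in_itv/= => /andP[t0 tT].
  have tT1 : t <= `|T| + 1 by rewrite (le_trans tT)// (le_trans (ler_norm T))// lerDl.
  rewrite EFinM fineK; last by rewrite ge0_fin_numE// total_finite.
  rewrite -integral_cst//; apply: ae_ge0_le_integral => //.
  - apply: (measurableT_comp mf (g := fun p : RR * rV => (t : RR, p))).
    exact: measurable_fun_pair.
  - by move=> p _; rewrite lee_fin sqr_ge0.
  apply: aeS2 (ae_fst cone hU) (ae_snd mu cone_nonzero) => p hp p0 _.
  rewrite lee_fin indicE; case: (boolP (_ \in _)) => [|_]; last by rewrite mulr0 sqr_ge0.
  rewrite inE /eball/= enorm_place// => XB; rewrite mulr1 velocity_place// enormZ enorm_dir// mulr1.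
  rewrite lerXn2r// ?nnegrE//; case: ifP => _; first by rewrite normr0.
  apply: hp => //; apply: (le_lt_trans XB); apply: (le_lt_trans (ler_norm B)).
  by rewrite ltrDl.
rewrite integral_cst//=.
rewrite lebesgue_measure_itv/=; case: ifP => _; last by rewrite mule0 ltry.
by rewrite -EFinB -EFinM ltry.
Qed.

End flow.

(** * The fundamental solution of the Laplacian *)

(** A primitive of u^-m, that is, a multiple of the fundamental solution in
dimension m.+1. *)
Section radial_primitive.
Context {R : realType} (m : nat).

Definition radial_primitive (u : R) : R :=
  match m with
  | 0 => u
  | 1 => ln u
  | k.+2 => - ((u ^+ k.+1)^-1 / k.+1%:R)
  end.
Local Notation K := radial_primitive.

Lemma is_derive_radial_primitive (u : R) : 0 < u -> is_derive u 1 K (u ^- m).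
Proof.
move=> u0; rewrite /K; case: m => [|[|k]].
- by rewrite expr0 invr1; exact: is_derive_id.
- by rewrite expr1; exact: is_derive1_ln.
- have uk : u ^+ k.+1 != 0 by rewrite expf_neq0// gt_eqF.
  have hX : is_derive u (1 : R) (fun y : R => y ^+ k.+1) (k.+1%:R * u ^+ k).
    apply: DeriveDef; first exact: exprn_derivable.
    by rewrite exp_derive /GRing.scale/= mulr1.
  have h := @is_deriveV R (fun y => y ^+ k.+1) u _ 1 uk hX.
  have h2 := is_deriveZ (- k.+1%:R^-1) h.
  rewrite (_ : (fun u0 => _) = (- k.+1%:R^-1 : R) *: (fun y : R => (y ^+ k.+1)^-1)); last first.
    by apply/funext => y; rewrite fctE /GRing.scale/= mulNr mulrC.
  apply: is_derive_eq h2 _.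
  rewrite /GRing.scale /= !(mulNr, mulrN) opprK.
  have u0' : u != 0 by rewrite gt_eqF.
  have k0 : k.+1%:R != 0 :> R by rewrite pnatr_eq0.
  rewrite [u ^+ k.+2]exprS [u ^+ k.+1]exprS.
  have y0 : u ^+ k != 0 by rewrite expf_neq0.
  move: (u ^+ k) y0 (k.+1%:R : R) k0 => y y0 z z0.
  by field; rewrite z0 y0 u0'.
Qed.

Lemma measurable_radial_primitive : measurable_fun setT (K : measurableTypeR R -> R).
Proof.
rewrite /K; case: m => [|[|k]] //; first exact: measurable_ln.
apply: measurableT_comp => //; apply: measurable_funM => //.
by apply: (measurableT_comp (@measurable_inv R)); exact: measurable_funX.
Qed.

Lemma radial_primitive_MVT (a b : R) : 0 < a -> a <= b ->
  exists2 c, a <= c <= b & K b - K a = c ^- m * (b - a).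
Proof.
move=> a0 ab; have d (x : R) : x \in `]a, b[ -> is_derive x 1 K (x ^- m).
  by rewrite in_itv/= => /andP[ax _]; apply: is_derive_radial_primitive; exact: lt_trans ax.
have c : {within `[a, b], continuous K}.
  apply: derivable_within_continuous => x; rewrite in_itv/= => /andP[ax _].
  by have [] := is_derive_radial_primitive (lt_le_trans a0 ax).
have [x + ->] := MVT_segment ab d c; rewrite in_itv/= => xab.
by exists x.
Qed.

Lemma radial_primitive_nd (a b : R) : 0 < a -> a <= b -> K a <= K b.
Proof.
move=> a0 ab; have [c /andP[ac _] e] := radial_primitive_MVT a0 ab.
by rewrite -subr_ge0 e mulr_ge0 ?subr_ge0// invr_ge0 exprn_ge0// (le_trans (ltW a0)).
Qed.

Lemma radial_primitive_lipschitz (a r r' : R) : 0 < a -> a <= r -> a <= r' ->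
  `|K r' - K r| <= a ^- m * `|r' - r|.
Proof.
move=> a0; wlog rr' : r r' / r <= r'.
  move=> h ar ar'; have [/h|/ltW/h] := leP r r'; first exact.
  by rewrite distrC [`|r' - _|]distrC; exact.
move=> ar ar'; have [c /andP[rc _] ->] := radial_primitive_MVT (lt_le_trans a0 ar) rr'.
have c0 : 0 < c := lt_le_trans a0 (le_trans ar rc).
rewrite normrM ler_wpM2r// ger0_norm ?invr_ge0 ?exprn_ge0 ?(ltW c0)//.
rewrite lef_pV2 ?posrE ?exprn_gt0// lerXn2r ?nnegrE ?(ltW a0) ?(ltW c0)//.
exact: le_trans rc.
Qed.

Lemma radial_primitive_bound (r : R) : 0 < r -> `|K r - K 1| <= r ^- m + r.
Proof.
move=> r0; have rm : 0 <= r ^- m by rewrite invr_ge0 exprn_ge0// ltW.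
have [r1|/ltW r1] := leP 1 r.
  apply: (le_trans (radial_primitive_lipschitz ltr01 (lexx 1) r1)).
  rewrite expr1n invr1 mul1r ger0_norm ?subr_ge0//; lra.
apply: (le_trans (radial_primitive_lipschitz r0 r1 (lexx r))).
rewrite -[leRHS]addr0; apply: (@le_trans _ _ (r ^- m)); last by rewrite addr0 lerDl ltW.
by rewrite ler_piMr// distrC ger0_norm ?subr_ge0//; lra.
Qed.

Lemma radial_primitive_FTC (a b : R) : 0 < a -> a <= b ->
  \int[@lebesgue_measure R]_(u in `[a, b]) u ^- m = K b - K a.
Proof.
move=> a0; rewrite le_eqVlt => /predU1P[->|ab].
  by rewrite set_itv1 subrr Rintegral_set1.
have cK (x : R) : 0 < x -> {for x, continuous K}.
  move=> x0; apply: differentiable_continuous; apply/derivable1_diffP.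
  by have [] := is_derive_radial_primitive x0.
rewrite /Rintegral (@continuous_FTC2 _ _ K)//.
- apply: continuous_in_subspaceT => x; rewrite inE/= in_itv/= => /andP[ax _].
  have x0 : x != 0 by rewrite gt_eqF// (lt_le_trans a0).
  by apply: cvgV; [rewrite expf_neq0|exact: exprn_continuous].
- split.
  + move=> x; rewrite in_itv/= => /andP[ax _].
    by have [] := is_derive_radial_primitive (lt_trans a0 ax).
  + by apply: cvg_at_right_filter; exact: cK.
  + by apply: cvg_at_left_filter; apply: cK; exact: lt_trans ab.
- move=> x; rewrite in_itv/= => /andP[ax _]; rewrite derive1E.
  by have [] := is_derive_radial_primitive (lt_trans a0 ax).
Qed.

End radial_primitive.

Section enorm_directional.
Context {R : realType} (n : nat).
Local Notation rV := 'rV[R]_n.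

Lemma enorm_sq (x : rV) : enorm x ^+ 2 = \sum_(i < n) x 0 i ^+ 2.
Proof. by rewrite /enorm sqr_sqrtr// sumr_ge0// => i _; exact: sqr_ge0. Qed.

Lemma enorm_shift_sq (x : rV) (j : 'I_n) (h : R) :
  enorm (x + h *: delta_mx 0 j) ^+ 2 = enorm x ^+ 2 + 2 * h * x 0 j + h ^+ 2.
Proof.
rewrite !enorm_sq (bigD1 j)//= [in RHS](bigD1 j)//= !mxE !eqxx/=.
rewrite (eq_bigr (fun i => x 0 i ^+ 2)); first by ring.
by move=> i ij; rewrite !mxE (negbTE ij) andbF mulr0 addr0.
Qed.

Lemma enorm_shift_le (x : rV) (j : 'I_n) (h : R) :
  `|enorm (x + h *: delta_mx 0 j) - enorm x| <= `|h|.
Proof.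
have up (y : rV) (k : R) : enorm (y + k *: delta_mx 0 j) <= enorm y + `|k|.
  rewrite -[leRHS]ger0_norm ?addr_ge0 ?enorm_ge0// -[leLHS]ger0_norm ?enorm_ge0//.
  rewrite -ler_sqr ?nnegrE// !real_normK ?num_real// enorm_shift_sq.
  rewrite sqrrD -[`|k| ^+ 2]real_normK ?num_real// normr_id real_normK ?num_real//.
  rewrite lerD2r lerD2l -[leRHS]mulr_natl -mulrA ler_pM2l//.
  apply: (le_trans (ler_norm _)); rewrite normrM mulrC ler_wpM2r//.
  exact: coor_enorm.
rewrite ler_norml; apply/andP; split; last by rewrite lerBlDl up.
rewrite lerNl opprB lerBlDl; have := up (x + h *: delta_mx 0 j) (- h).
by rewrite scaleNr addrK normrN.
Qed.

(** The difference of the squares of the norms is linear in h up to h^2; division by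
the sum of the norms avoids differentiating the square root. *)
Lemma enorm_derivative (x : rV) (j : 'I_n) (h : nat -> R) : x != 0 ->
  (forall k, h k != 0) -> h k @[k --> \oo] --> (0 : R) ->
  (h k)^-1 * (enorm (x + h k *: delta_mx 0 j) - enorm x) @[k --> \oo] --> dir x 0 j.
Proof.
move=> x0 h0 hcvg; have r0 : 0 < enorm x by rewrite enorm_gt0.
have ecvg : enorm (x + h k *: delta_mx 0 j) @[k --> \oo] --> enorm x.
  apply/cvgrPdist_le => e e0; move/cvgrPdist_le: hcvg => /(_ e e0); apply: filterS => k.
  by rewrite sub0r normrN distrC => /(le_trans _); apply; exact: enorm_shift_le.
have E k : (h k)^-1 * (enorm (x + h k *: delta_mx 0 j) - enorm x) =
    (2 * x 0 j + h k) / (enorm (x + h k *: delta_mx 0 j) + enorm x).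
  have s0 : enorm (x + h k *: delta_mx 0 j) + enorm x != 0.
    by rewrite gt_eqF// ltr_wpDl// enorm_ge0.
  have := enorm_shift_sq x j (h k); move: (enorm (x + _)) s0 => y s0 ye.
  apply: (mulIf s0); rewrite mulfVK// -mulrA -subr_sqr ye.
  by have hk := h0 k; field.
under eq_fun do rewrite E.
rewrite (_ : dir x 0 j = (2 * x 0 j + 0) / (enorm x + enorm x)); last first.
  rewrite /dir mxE; have b0 : enorm x != 0 by rewrite gt_eqF.
  have bb : enorm x + enorm x != 0 by rewrite gt_eqF// addr_gt0.
  apply: (mulIf bb); rewrite divfK//.
  have -> : (enorm x)^-1 * x 0 j * (enorm x + enorm x) = ((enorm x)^-1 * enorm x) * (2 * x 0 j) by ring.
  by rewrite mulVf// mul1r addr0.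
apply: cvgM; first by apply: cvgD => //; exact: cvg_cst.
apply: cvgV; first by rewrite gt_eqF// addr_gt0.
by apply: cvgD => //; exact: cvg_cst.
Qed.

End enorm_directional.

Section translation.
Context {R : realType} (n : nat).
Local Notation rV := 'rV[R]_n.
Local Notation vol := (@lebesgue_rV R n).

Lemma Rintegral_translation (f : rV -> R) (b : rV) : measurable_fun setT f ->
  \int[vol]_x f (x + b) = \int[vol]_x f x.
Proof.
move=> mf; have mb : measurable_fun setT (fun q : measurableTypeR R * rV => q.2 + b).
  have h := @measurable_rV_affine R n 1 b.
  have -> : (fun q : measurableTypeR R * rV => q.2 + b) = (fun x => 1 *: x + b) \o snd.
    by apply/funext => q /=; rewrite scale1r.
  exact: measurableT_comp.
pose shifted := @pushforward_kernel _ _ _ (measurableTypeR R) rV rV R vol (fun _ x => x + b) mb (0 : R).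
have volE A : measurable A -> A `<=` setT -> shifted A = vol A.
  move=> mA _; rewrite /shifted pushforward_kernelE.
  have := @lebesgue_rV_affine R n 1 b A (oner_neq0 _) mA.
  rewrite normr1 invr1 expr1n mul1e => <-; congr (vol _).
  by apply/seteqP; split => x /=; rewrite scale1r.
transitivity (\int[shifted]_x f x); last by rewrite /Rintegral (eq_measure_integral vol volE).
by apply/esym/Rintegral_pushforward_kernel.
Qed.

Lemma integrable_ball (f : rV -> R) (B C : R) : measurable_fun setT f ->
  (forall x, B < enorm x -> f x = 0) -> (forall x, enorm x <= B -> `|f x| <= C) ->
  vol.-integrable setT (EFin \o f).
Proof.
move=> mf f0 fC; have mB := @measurable_eball R n B.
have i : vol.-integrable (eball B) (EFin \o f).
  by apply: (@integrable_le_cst _ _ _ vol _ _ C) => //; [exact: eball_finite|exact: measurable_funTS].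
have /(integrable_mkcond _ mB).1 := i; congr (_.-integrable _ _).
apply/funext => x; rewrite patchE; case: ifPn => //= /negP h.
rewrite f0// ltNge; apply/negP => xB; apply: h; exact: mem_set.
Qed.

(** By translation invariance the difference quotient moves from psi to G, as a
backward quotient; dominated convergence in both integrals gives the formula with
the almost everywhere derivative DG of G. *)
Lemma integration_by_parts_lipschitz (G DG psi : rV -> R) (j : 'I_n) (B L C M : R) :
  0 <= B ->
  measurable_fun setT G -> measurable_fun setT DG -> C1 psi ->
  (forall x, B <= enorm x -> psi x = 0 /\ 'D_(delta_mx 0 j) psi x = 0) ->
  (forall x, `|psi x| <= C /\ `|'D_(delta_mx 0 j) psi x| <= C) ->
  (forall x (h : R), `|G (x + h *: delta_mx 0 j) - G x| <= L * `|h|) ->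
  (forall x, enorm x <= B + 1 -> `|G x| <= M) ->
  {ae vol, forall x : rV,
    k.+1%:R * (G (x + (- k.+1%:R^-1) *: delta_mx 0 j) - G x) @[k --> \oo] --> - DG x} ->
  vol.-integrable setT (EFin \o (fun x => DG x * psi x)) /\
  \int[vol]_x (G x * 'D_(delta_mx 0 j) psi x) = - \int[vol]_x (DG x * psi x).
Proof.
set e := delta_mx 0 j => B0 mG mDG cpsi psi0 psiC GL GM GDG.
have [cp dp cDp] := cpsi.
have C0 : 0 <= C by have [h _] := psiC 0; exact: le_trans h.
have L0 : 0 <= L by have := GL 0 1; rewrite normr1 mulr1; apply: le_trans.
have M0 : 0 <= M by apply: le_trans (GM 0 _) => //; rewrite enorm0 addr_ge0.
have mpsi : measurable_fun setT (psi : rV -> R) by exact: measurable_continuous_rV.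
have mDpsi : measurable_fun setT ('D_e psi : rV -> R) by apply: measurable_continuous_rV; exact: cDp.
have mshift (f : rV -> R) (b : rV) : measurable_fun setT f -> measurable_fun setT (fun x : rV => f (x + b)).
  move=> mf; have h := @measurable_rV_affine R n 1 b.
  rewrite (_ : (fun x => _) = f \o (fun x => 1 *: x + b)); first exact: measurableT_comp.
  by apply/funext => x /=; rewrite scale1r.
pose h (k : nat) : R := k.+1%:R^-1; have h0 k : 0 < h k by rewrite invr_gt0.
have h1 k : h k <= 1 by rewrite invf_le1// ler1n.
have hcvg : h k @[k --> \oo] --> (0 : R) by exact: cvg_harmonic.
have far0 x : B < enorm x -> psi x = 0 by move=> /ltW/psi0[].
have far k x : B + 1 < enorm x -> psi (x + h k *: e) = 0.
  move=> Bx; have [] := psi0 (x + h k *: e) => //.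
  have := enorm_shift_le x j (h k); rewrite -/e (gtr0_norm (h0 k)) ler_norml => /andP[+ _].
  by move: (h1 k) Bx; clear; lra.
have B1 : B <= B + 1 by rewrite lerDl.
have i1 k : vol.-integrable setT (EFin \o (fun x => G x * psi (x + h k *: e))).
  apply: (@integrable_ball _ (B + 1) (M * C)).
  - by apply: measurable_funM => //; exact: mshift.
  - by move=> x Bx; rewrite far// mulr0.
  - by move=> x xB; rewrite normrM; apply: ler_pM => //; [exact: GM|have [] := psiC (x + h k *: e)].
have i2 : vol.-integrable setT (EFin \o (fun x => G x * psi x)).
  apply: (@integrable_ball _ B (M * C)).
  - exact: measurable_funM.
  - by move=> x Bx; rewrite far0// mulr0.
  - move=> x xB; rewrite normrM; apply: ler_pM => //; last by have [] := psiC x.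
    by apply: GM; exact: le_trans xB B1.
have i3 k : vol.-integrable setT (EFin \o (fun x => G (x + (- h k) *: e) * psi x)).
  apply: (@integrable_ball _ B ((M + L) * C)).
  - by apply: measurable_funM => //; exact: mshift.
  - by move=> x Bx; rewrite far0// mulr0.
  - move=> x xB; rewrite normrM; apply: ler_pM => //; last by have [] := psiC x.
    rewrite -[G (_ + _)](subrK (G x)) addrC; apply: (le_trans (ler_normD _ _)); apply: lerD.
      by apply: GM; exact: le_trans xB B1.
    by apply: (le_trans (GL _ _)); rewrite normrN gtr0_norm// ler_piMr.
pose a k x := G x * ((h k)^-1 * (psi (x + h k *: e) - psi x)).
pose b k x := ((h k)^-1 * (G (x + (- h k) *: e) - G x)) * psi x.
have ab k : \int[vol]_x a k x = \int[vol]_x b k x.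
  transitivity ((h k)^-1 * (\int[vol]_x (G x * psi (x + h k *: e)) - \int[vol]_x (G x * psi x))).
    rewrite -RintegralB// -RintegralZl//; last first.
      rewrite (_ : _ \o _ = (fun x => (G x * psi (x + h k *: e))%:E - (G x * psi x)%:E)%E)//.
      by apply: integrableB => //; exact: i1.
    by apply: eq_Rintegral => x _; rewrite /a; ring.
  transitivity ((h k)^-1 * (\int[vol]_x (G (x + (- h k) *: e) * psi x) - \int[vol]_x (G x * psi x))).
    congr (_ * (_ - _)).
    rewrite -(@Rintegral_translation (fun x => G x * psi (x + h k *: e)) ((- h k) *: e)).
      by apply: eq_Rintegral => x _; rewrite -addrA -scalerDl addNr scale0r addr0.
    by apply: measurable_funM => //; exact: mshift.
  rewrite -RintegralB// -RintegralZl//; last first.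
    rewrite (_ : _ \o _ = (fun x => (G (x + (- h k) *: e) * psi x)%:E - (G x * psi x)%:E)%E)//.
    by apply: integrableB => //; exact: i3.
  by apply: eq_Rintegral => x _; rewrite /b; ring.
pose dom (K : R) (x : rV) : R := K * \1_(eball (B + 1)) x.
have idom K : vol.-integrable setT (EFin \o dom K).
  apply: (@integrable_ball _ (B + 1) `|K|).
  - by apply: measurable_funM => //; apply: measurable_indic; exact: measurable_eball.
  - move=> x Bx; rewrite /dom indicE memNset ?mulr0//= /eball/= => xB.
    by have := lt_le_trans Bx xB; rewrite ltxx.
  - move=> x _; rewrite /dom normrM ler_piMr// indicE.
    by case: (_ \in _); rewrite ?normr1 ?normr0.
have [|||||_ acvg] := @Rdominated_convergence _ _ _ vol setT a (fun x => G x * 'D_e psi x) (dom (M * C)) measurableT.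
- move=> k; apply: measurable_funM => //; apply: measurable_funM => //.
  by apply: measurable_funB => //; exact: mshift.
- exact: measurable_funM.
- apply: aeW => x _; apply: cvgMr.
  apply/cvgrPdist_le => ep ep0.
  have [d d0 hd] := C1_increment x e 0 cpsi ep0.
  move/cvgrPdist_le: hcvg => /(_ d d0); apply: filterS => k; rewrite sub0r normrN (gtr0_norm (h0 k)) => hk.
  have := hd (h k) 0; rewrite normr0 (gtr0_norm (h0 k)) => /(_ hk (ltW d0)).
  rewrite scale0r !addr0 mul0r addr0 => hh.
  have hn : h k != 0 by rewrite gt_eqF.
  by rewrite distrC -(ler_pM2l (h0 k)) -{1}(gtr0_norm (h0 k)) -normrM mulrBr mulVKf.
- exact: idom.
- apply: aeW => x k _; have [xB|Bx] := leP (enorm x) (B + 1); last first.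
    rewrite /a far// far0 ?(le_lt_trans B1)// subrr !mulr0 normr0 mulr_ge0 ?mulr_ge0//.
  rewrite /dom indicE mem_set// mulr1 /a normrM; apply: ler_pM => //; first exact: GM.
  rewrite normrM normfV (gtr0_norm (h0 k)) ler_pdivrMl//.
  have := C1_lipschitz (v := e) cpsi (fun p => proj2 (psiC p)) x (h k).
  by rewrite (gtr0_norm (h0 k)).
have [|||||ib bcvg] := @Rdominated_convergence _ _ _ vol setT b (fun x => - DG x * psi x) (dom (L * C)) measurableT.
- move=> k; apply: measurable_funM => //; apply: measurable_funM => //.
  by apply: measurable_funB => //; exact: mshift.
- by apply: measurable_funM => //; exact: measurableT_comp.
- apply: aeS GDG => x hx _; apply: cvgMl; rewrite /b.
  by apply: cvg_trans hx; apply: near_eq_cvg; apply: nearW => k; rewrite /h invrK.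
- exact: idom.
- apply: aeW => x k _; have [xB|Bx] := leP (enorm x) (B + 1); last first.
    by rewrite /b far0 ?(le_lt_trans B1)// mulr0 normr0 mulr_ge0 ?mulr_ge0.
  rewrite /dom indicE mem_set// mulr1 /b normrM; apply: ler_pM => //; last by have [] := psiC x.
  rewrite normrM normfV (gtr0_norm (h0 k)) ler_pdivrMl//.
  by have := GL x (- h k); rewrite normrN (gtr0_norm (h0 k)) mulrC.
have iDG : vol.-integrable setT (EFin \o (fun x => DG x * psi x)).
  have := @integrableZl _ _ _ vol _ measurableT (-1) _ ib.
  by congr (_.-integrable _ _); apply/funext => x /=; rewrite -EFinM !mulNr mul1r opprK.
split => //.
have -> : - (\int[vol]_x (DG x * psi x)) = \int[vol]_x (- DG x * psi x).
  by rewrite -mulN1r -RintegralZl//; apply: eq_Rintegral => x _; rewrite mulN1r mulNr.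
apply: (cvg_unique (@Rhausdorff R) acvg).
by have -> : (fun k => \int[vol]_x a k x) = (fun k => \int[vol]_x b k x) by apply/funext.
Qed.

End translation.

Section green.
Context {R : realType} (m : nat).
Local Notation n := m.+1.
Local Notation rV := 'rV[R]_n.
Local Notation RR := (measurableTypeR R).
Local Notation vol := (@lebesgue_rV R n).
Local Notation cone := (@cone_measure R n).
Local Notation K := (@radial_primitive R m).
Local Notation radial := (@radial_measure R m).

Let measurable_ray : measurable_fun setT (fun p : RR * rV => p.1 *: dir p.2).
Proof. by apply: measurable_scale => //; exact: (measurableT_comp (@measurable_dir R n)). Qed.

Let polar_image := pushforward_measure (radial \x cone)%E measurable_ray.

Let polar_imageE A : measurable A -> A `<=` setT -> polar_image A = vol A.
Proof. by move=> mA _; rewrite (polar_coordinates mA). Qed.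

Lemma Rintegral_polar (f : rV -> R) : measurable_fun setT f ->
  \int[vol]_x f x = \int[(radial \x cone)%E]_p f (p.1 *: dir p.2).
Proof.
move=> mf; rewrite -(Rintegral_pushforward_measure _ measurable_ray)//.
by rewrite /Rintegral (eq_measure_integral vol polar_imageE).
Qed.

Lemma integrable_polar (f : rV -> R) : vol.-integrable setT (EFin \o f) ->
  (radial \x cone)%E.-integrable setT (EFin \o (fun p => f (p.1 *: dir p.2))).
Proof.
move=> /integrableP[mf fi]; apply: (integrable_pushforward_measure (mZ := measurable_ray)).
apply/integrableP; split => //.
by rewrite (eq_measure_integral vol polar_imageE).
Qed.

(** In polar coordinates the sphere is a point times the directions. *)
Lemma sphere_null (a : R) : vol [set x : rV | enorm x = a] = 0%E.
Proof.
have mS : measurable [set x : rV | enorm x = a].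
  rewrite (_ : [set x | _] = [set x : rV | enorm x \in `[a, a]]); first exact: measurable_enorm_itv.
  by apply/seteqP; split => x /=; rewrite in_itv/= -eq_le eq_sym => /eqP.
pose P : {measure set (RR * rV)%type -> \bar R} := (radial \x cone)%E.
have -> : vol [set x : rV | enorm x = a] =
    P ((fun p : RR * rV => p.1 *: dir p.2) @^-1` [set x : rV | enorm x = a]).
  exact: polar_coordinates.
pose N1 (b : R) : set (RR * rV) := [set b] `*` setT.
pose N2 : set (RR * rV) := setT `*` [set 0].
have mN1 b : measurable (N1 b) by apply: measurableX => //; exact: measurable_set1.
have mN2 : measurable N2 by apply: measurableX => //; exact: measurable_set0.
have z1 b : P (N1 b) = 0%E.
  transitivity (radial [set b] * cone setT)%E; first exact: product_measure1E.
  by rewrite /radial_measure density_measure_set1 mul0e.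
have z2 : P N2 = 0%E.
  transitivity (radial setT * cone [set (0 : rV)%R])%E.
    by apply: product_measure1E => //; exact: measurable_set0.
  by rewrite cone_measure_set0 mule0.
have m12 : measurable (N1 a `|` N1 (- a)) by exact: measurableU.
have zero : P ((N1 a `|` N1 (- a)) `|` N2) = 0%E.
  exact: (null_setU m12 mN2 (null_setU (mN1 a) (mN1 (- a)) (z1 a) (z1 (- a))) z2).
apply/eqP; rewrite eq_le measure_ge0 andbT -zero.
apply: le_measure; rewrite ?inE.
- by rewrite -[X in measurable X]setTI; exact: measurable_ray.
- exact: measurableU.
  move=> [r y] /=; have [->|y0] := eqVneq y 0; first by right.
  rewrite enormZ enorm_dir// mulr1 => ra; left.
  have [r0|r0] := leP 0 r; first by left; rewrite /N1 /= -ra ger0_norm.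
  by right; rewrite /N1 /= -ra ltr0_norm// opprK.
Qed.

(** The potential of a unit charge spread over the sphere of radius a, constant
inside it; the constant makes it vanish at max 1 a, for a bound that is uniform
in a. *)
Definition green_kernel (a : R) (r : R) : R := K (Num.max r a) - K (Num.max 1 a).

Lemma green_kernel_lipschitz (a r r' : R) : 0 < a ->
  `|green_kernel a r' - green_kernel a r| <= a ^- m * `|r' - r|.
Proof.
move=> a0; rewrite /green_kernel opprB addrA subrK.
have am x : a <= Num.max x a by rewrite le_max lexx orbT.
apply: (le_trans (radial_primitive_lipschitz m a0 (am r) (am r'))).
rewrite ler_wpM2l ?invr_ge0 ?exprn_ge0 ?(ltW a0)//.
rewrite /Num.max; repeat case: ifPn; rewrite -?leNgt => h1 h2.
- by rewrite subrr normr0.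
- by rewrite distrC [leRHS]distrC !ger0_norm; lra.
- by rewrite !ger0_norm; lra.
- by [].
Qed.

Lemma green_kernel_bound (a r : R) : 0 <= a -> 0 < r -> `|green_kernel a r| <= r ^- m + r.
Proof.
move=> a0 r0; apply: le_trans (radial_primitive_bound m r0); rewrite /green_kernel.
have nd (x y : R) : 0 < x -> x <= y -> K x <= K y by exact: radial_primitive_nd.
have [ra|ar] := leP r a; have [a1|a1] := leP a 1.
- have := nd r a r0 ra; have := nd a 1 (lt_le_trans r0 ra) a1.
  by move=> h1 h2; rewrite !ler0_norm; lra.
- by rewrite subrr normr0.
- by [].
- have := nd 1 a ltr01 (ltW a1); have := nd a r (lt_trans ltr01 a1) (ltW ar).
  by move=> h1 h2; rewrite !ger0_norm; lra.
Qed.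

Lemma measurable_green_kernel : measurable_fun setT (fun p : RR * RR => green_kernel p.1 p.2 : R).
Proof.
have mK (f : RR * RR -> RR) : measurable_fun setT f -> measurable_fun setT (fun p => K (f p)).
  exact: (measurableT_comp (measurable_radial_primitive m)).
by apply: measurable_funB; apply: mK; exact: measurable_maxr.
Qed.

Lemma test_function_laplacian (phi : rV -> R) : test_function phi -> exists B C : R,
  [/\ 0 < B, 0 <= C, forall j, C1 (partial j phi),
   forall x, B <= enorm x -> phi x = 0 /\ forall j, partial j phi x = 0 /\
     forall e, 'D_e (partial j phi) x = 0 &
   forall x j, [/\ `|phi x| <= C, `|partial j phi x| <= C,
     `|partial j (partial j phi) x| <= C & `|laplacian phi x| <= C]].
Proof.
move=> tp; have [B B0 hB] := test_function_region_rV tp; have [hCk cS] := tp.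
have cj j : C1 (partial j phi).
  exact: (@Ck_C1 _ _ 0 _ (@Ck_derive _ _ 1 phi (delta_mx 0 j) (hCk 2%N))).
have vj j : vanishes_off (support phi) (partial j phi).
  by apply: derive_vanishes_off; [exact: closed_support|exact: vanishes_off_support].
have vjj j e : vanishes_off (support phi) ('D_e (partial j phi)).
  by apply: derive_vanishes_off; [exact: closed_support|exact: vj].
have [C0 C00 hC0] := test_function_bounded tp.
have hC1 j : {C | 0 <= C /\ forall x, `|partial j phi x| <= C}.
  by apply: cid; have [C C0' hC] := derive_bounded (delta_mx 0 j) tp; exists C.
have hC2 j : {C | 0 <= C /\ forall x, `|partial j (partial j phi) x| <= C}.
  apply: cid; have [_ _ cD] := cj j.
  by have [C C0' hC] := vanishes_off_bounded cS (vjj j (delta_mx 0 j)) (cD _); exists C.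
pose S1 := \sum_(j < n) sval (hC1 j); pose S2 := \sum_(j < n) sval (hC2 j).
have p1 j : 0 <= sval (hC1 j) by have [] := svalP (hC1 j).
have p2 j : 0 <= sval (hC2 j) by have [] := svalP (hC2 j).
have S10 : 0 <= S1 by apply: sumr_ge0 => j _.
have S20 : 0 <= S2 by apply: sumr_ge0 => j _.
have S1j j : sval (hC1 j) <= S1.
  by rewrite /S1 (bigD1 j)//= lerDl sumr_ge0.
have S2j j : sval (hC2 j) <= S2.
  by rewrite /S2 (bigD1 j)//= lerDl sumr_ge0.
exists B, (C0 + S1 + S2); split => //.
- by rewrite !addr_ge0.
- move=> x /hB nx; split; first exact: vanishes_off_support nx.
  by move=> j; split => [|e]; [exact: vj|exact: vjj].
- move=> x j; have [_ h1] := svalP (hC1 j); have [_ h2] := svalP (hC2 j).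
  split.
  + by apply: (le_trans (hC0 x)); rewrite -addrA lerDl addr_ge0.
  + by apply: (le_trans (h1 x)); apply: (le_trans (S1j j)); rewrite addrAC lerDr addr_ge0.
  + by apply: (le_trans (h2 x)); apply: (le_trans (S2j j)); rewrite lerDr addr_ge0.
  + apply: (@le_trans _ _ S2); last by rewrite lerDr addr_ge0.
    apply: (le_trans (ler_norm_sum _ _ _)); apply: ler_sum => i _.
    by have [_] := svalP (hC2 i); exact.
Qed.

Lemma measurable_laplacian (phi : rV -> R) : (forall j, C1 (partial j phi)) ->
  measurable_fun setT (laplacian phi : rV -> R).
Proof.
move=> cj; apply: measurable_sum => j; have [_ _ cD] := cj j.
by apply: measurable_continuous_rV; exact: cD.
Qed.

Definition green_gradient (a : R) (x : rV) : R := if a < enorm x then (enorm x) ^- m else 0.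

Lemma measurable_green_gradient a : measurable_fun setT (green_gradient a : rV -> R).
Proof.
apply: measurable_fun_if => //.
  by apply: measurable_fun_ltr => //; exact: measurable_enorm.
apply: measurable_funTS; apply: (measurableT_comp (@measurable_inv R)).
by apply: measurable_funX; exact: measurable_enorm.
Qed.

(** In polar coordinates the weight r^m cancels the gradient r^-m, and what remains
on each ray is the integral of the derivative of phi beyond radius a. *)
Lemma radial_FTC (phi : rV -> R) (a : R) : 0 < a -> test_function phi ->
  vol.-integrable setT (EFin \o (fun x => green_gradient a x * 'D_(dir x) phi x)) ->
  \int[vol]_x (green_gradient a x * 'D_(dir x) phi x) = - \int[cone]_y phi (a *: dir y).
Proof.
move=> a0 tp fi; have cp := test_function_C1 tp; have [cphi dphi cD] := cp.
have [B B0 hB] := test_function_region_rV tp.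
have mf : measurable_fun setT (fun x : rV => green_gradient a x * 'D_(dir x) phi x).
  by apply/measurable_EFinP; exact: measurable_int fi.
have := integrable_polar fi.
move=> /(@Rintegral_prod _ _ _ _ R radial cone)[_ fub].
rewrite Rintegral_polar// fub.
have mphi : measurable_fun setT (fun y : rV => phi (a *: dir y) : R).
  apply: (measurableT_comp (measurable_continuous_rV cphi) (g := fun y : rV => a *: dir y)).
  by apply: measurable_scale => //; exact: measurable_dir.
have iphi : cone.-integrable setT (EFin \o (fun y => phi (a *: dir y))).
  have [C C0 hC] := test_function_bounded tp.
  apply: (@integrable_le_cst _ _ _ cone _ _ C) => //.
  by rewrite -ge0_fin_numE// fin_num_measure.
rewrite -mulN1r -RintegralZl//.
apply: ae_eq_Rintegral => //.
- pose f' (q : rV * RR) := green_gradient a (q.2 *: dir q.1) * 'D_(dir (q.2 *: dir q.1)) phi (q.2 *: dir q.1).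
  apply: (@measurable_fun_Rintegral _ _ _ _ _ radial f').
  apply: (measurableT_comp mf (g := fun q : rV * RR => q.2 *: dir q.1)).
  by apply: measurable_scale => //; exact: (measurableT_comp (@measurable_dir R n)).
- exact: measurable_funM.
exists [set 0]; split; [exact: measurable_set0|exact: cone_measure_set0|].
move=> y /= ny; apply: contrapT => y0'; apply: ny => _.
have y0 : y != 0 by apply/eqP.
pose b := Num.max a B + 1.
have [ab Bb] : a < b /\ B <= b.
  by rewrite /b; split; [rewrite ltr_pwDr// le_max lexx|rewrite ler_wpDr// le_max lexx orbT].
pose D r := 'D_(dir y) phi (r *: dir y).
have mD : measurable_fun setT (D : RR -> R).
  have mc := measurable_continuous_rV (cD (dir y)).
  by apply: (measurableT_comp mc (g := fun r : RR => r *: dir y)); exact: measurable_scale.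
have dD (r : R) : is_derive r 1 (fun r : R => phi (r *: dir y)) (D r).
  have := @is_derive_line R rV phi 0 (dir y) r; rewrite add0r => /(_ (dphi _ _)).
  by rewrite (_ : (fun _ => _) = (fun r => phi (r *: dir y)))//; apply/funext => z; rewrite add0r.
have cDr : continuous D.
  move=> r; apply: (@continuous_comp _ _ _ (fun r : R => r *: dir y) ('D_(dir y) phi)); last exact: cD.
  by apply: cvgZr_tmp; exact: cvg_id.
have cphir : continuous (fun r : R => phi (r *: dir y)).
  move=> r; apply: differentiable_continuous; apply/derivable1_diffP.
  by have [] := dD r.
rewrite /radial_measure Rintegral_density; last first.
  apply: (measurableT_comp mf (g := fun r : RR => r *: dir y)).
  by apply: measurable_scale.
transitivity (\int[@lebesgue_measure R]_(r in `]a, b]) D r).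
  rewrite /Rintegral [in RHS]integral_mkcond; congr fine; apply: eq_integral => r _.
  rewrite patchE mem_setE in_itv/= /radial_weight /green_gradient.
  have [r0|r0] := ltP 0 r; last first.
    by rewrite mulr0 ltNge (le_trans r0 (ltW a0)).
  rewrite enorm_scale_dir ?(ltW r0)// dir_scale_dir//.
  have [ar|ra] := ltP a r; last by rewrite !mul0r.
  rewrite /= mulrAC mulVf ?expf_neq0 ?gt_eqF// mul1r.
  have [rb|br] := leP r b => //.
  rewrite (derive_vanishes_off (dir y) (@closed_support _ _ phi) (@vanishes_off_support _ _ phi))//.
  by apply: hB; rewrite enorm_scale_dir ?(ltW r0)// (le_trans Bb)// ltW.
rewrite Rintegral_itv_obnd_cbnd; last first.
  apply: (@integrableS _ _ _ (@lebesgue_measure R) `[a, b] `]a, b]) => //.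
    exact: subset_itv_oc_cc.
  apply: continuous_compact_integrable; first exact: segment_compact.
  exact: continuous_subspaceT.
rewrite /Rintegral (@continuous_FTC2 _ _ (fun r : R => phi (r *: dir y)))//.
- rewrite -EFinB /= (_ : phi (b *: dir y) = 0) ?sub0r ?mulN1r//.
  apply: vanishes_off_support; apply: hB; rewrite enorm_scale_dir//.
  by rewrite (le_trans (ltW a0))// ltW.
- exact: continuous_subspaceT.
- split.
  + by move=> r _; have [] := dD r.
  + by apply: cvg_at_right_filter; exact: cphir.
  + by apply: cvg_at_left_filter; exact: cphir.
- by move=> r _; rewrite derive1E; have [] := dD r.
Qed.

End green.

Section green_formula.
Context {R : realType} (m : nat).
Local Notation n := m.+1.
Local Notation rV := 'rV[R]_n.
Local Notation RR := (measurableTypeR R).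
Local Notation vol := (@lebesgue_rV R n).
Local Notation cone := (@cone_measure R n).
Local Notation K := (@radial_primitive R m).
Local Notation radial := (@radial_measure R m).
Local Notation green_kernel := (@green_kernel R m).

(** Away from the sphere of radius a and from the origin, the kernel is constant or
differentiable in the norm. *)
Lemma green_kernel_derivative (a : R) (j : 'I_n) : 0 < a ->
  {ae vol, forall x : rV,
    k.+1%:R * (green_kernel a (enorm (x + (- k.+1%:R^-1) *: delta_mx 0 j)) -
      green_kernel a (enorm x)) @[k --> \oo] --> - (green_gradient a x * dir x 0 j)}.
Proof.
move=> a0; exists ([set x : rV | enorm x = a] `|` [set 0]).
have mS : measurable [set x : rV | enorm x = a].
  rewrite (_ : [set x | _] = [set x : rV | enorm x \in `[a, a]]); first exact: measurable_enorm_itv.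
  by apply/seteqP; split => x /=; rewrite in_itv/= -eq_le eq_sym => /eqP.
split.
- by apply: measurableU => //; exact: measurable_set0.
- apply: null_setU => //; [exact: measurable_set0|exact: sphere_null|exact: vol_set0].
move=> x /= nx; apply: contrapT => /not_orP[/eqP xa /eqP x0]; apply: nx.
pose h (k : nat) : R := - k.+1%:R^-1.
have h0 k : h k != 0 by rewrite oppr_eq0 invr_neq0// pnatr_eq0.
have hcvg : h k @[k --> \oo] --> (0 : R).
  by rewrite -[X in _ --> X]oppr0; apply: cvgN; exact: cvg_harmonic.
have dcvg := enorm_derivative x0 h0 hcvg.
pose r k := enorm (x + h k *: delta_mx 0 j).
have rcvg : r k @[k --> \oo] --> enorm x.
  apply/cvgrPdist_le => e e0; move/cvgrPdist_le: hcvg => /(_ e e0); apply: filterS => k.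
  by rewrite sub0r normrN distrC => /(le_trans _); apply; exact: enorm_shift_le.
rewrite -/(h _) /green_gradient; case: ltP => ax.
- have r0 : 0 < enorm x := lt_trans a0 ax.
  have /is_derive1_caratheodory[g [gE gc gr]] := is_derive_radial_primitive m r0.
  have near_r : \forall k \near \oo, a < r k by apply: cvgr_gt rcvg _ ax.
  have g1 : g (r k) @[k --> \oo] --> g (enorm x) by apply: continuous_cvg.
  rewrite gr in g1.
  have gcvg : - (g (r k) * ((h k)^-1 * (r k - enorm x))) @[k --> \oo] --> - (enorm x ^- m * dir x 0 j).
    by apply: cvgN; apply: cvgM g1 (dcvg j).
    apply: cvg_trans gcvg; apply: near_eq_cvg; near=> k.
  have ark : a < r k by near: k.
  rewrite /green_kernel -/(r k) opprB addrA subrK (max_l (ltW ax)) (max_l (ltW ark)) gE.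
  by rewrite /h invrN invrK; ring.
- have {xa}ax : enorm x < a by rewrite lt_neqAle xa.
  have near_r : \forall k \near \oo, r k < a by apply: cvgr_lt rcvg _ ax.
  rewrite mul0r oppr0; apply: cvg_near_cst; near=> k.
  have ark : r k < a by near: k.
  by rewrite /green_kernel -/(r k) (max_r (ltW ax)) (max_r (ltW ark)) subrr mulr0.
Unshelve. all: by end_near.
Qed.

(** One integration by parts in each coordinate leaves minus the integral of the
gradient of the kernel, x / |x|^n outside the sphere, times that of phi. *)
Lemma green_identity_truncated (phi : rV -> R) (a : R) : 0 < a -> test_function phi ->
  vol.-integrable setT (EFin \o (fun x => green_kernel a (enorm x) * laplacian phi x)) /\
  \int[vol]_x (green_kernel a (enorm x) * laplacian phi x) = \int[cone]_y phi (a *: dir y).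
Proof.
move=> a0 tp; have [B [C [B0 C0 cj far bd]]] := test_function_laplacian tp.
pose M := `|green_kernel a 0| + a ^- m * (B + 1).
have am : 0 <= a ^- m by rewrite invr_ge0 exprn_ge0 ?ltW.
have hM (x : rV) : enorm x <= B + 1 -> `|green_kernel a (enorm x)| <= M.
  move=> xB; rewrite -[green_kernel a (enorm x)](subrK (green_kernel a 0)) addrC.
  apply: (le_trans (ler_normD _ _)); rewrite lerD2l.
  apply: (le_trans (green_kernel_lipschitz m _ _ a0)); rewrite ler_wpM2l//.
  by rewrite subr0 ger0_norm ?enorm_ge0.
have mG : measurable_fun setT (fun x : rV => green_kernel a (enorm x)).
  apply: (measurableT_comp (@measurable_green_kernel R m) (g := fun x : rV => (a : RR, enorm x : RR))).
  by apply: measurable_fun_pair => //; exact: measurable_enorm.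
have mDG j : measurable_fun setT (fun x : rV => green_gradient a x * dir x 0 j).
  apply: measurable_funM; first exact: measurable_green_gradient.
  by apply: (measurableT_comp (measurable_coor j)); exact: measurable_dir.
have parts j : vol.-integrable setT
      (EFin \o (fun x => green_gradient a x * dir x 0 j * partial j phi x)) /\
    \int[vol]_x (green_kernel a (enorm x) * partial j (partial j phi) x) =
      - \int[vol]_x (green_gradient a x * dir x 0 j * partial j phi x).
  apply: (@integration_by_parts_lipschitz _ _ _ _ (partial j phi) j B (a ^- m) C M) => //.
  - exact: ltW.
  - by move=> x /far[_ /(_ j)[h1 h2]]; split; [|exact: h2].
  - by move=> x; have [_ h1 h2 _] := bd x j.
  - move=> x h; apply: (le_trans (green_kernel_lipschitz m _ _ a0)).
    by rewrite ler_wpM2l// enorm_shift_le.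
  - exact: green_kernel_derivative.
have ipart j : vol.-integrable setT
    (EFin \o (fun x => green_kernel a (enorm x) * partial j (partial j phi) x)).
  apply: (@integrable_ball _ _ _ B (M * C)).
  - apply: measurable_funM => //; have [_ _ cD] := cj j.
    by apply: measurable_continuous_rV; exact: cD.
  - by move=> x /ltW/far[_ /(_ j)[_ far2]]; rewrite [partial j (partial j phi) x]far2 mulr0.
  - move=> x xB; rewrite normrM; apply: ler_pM => //; last by have [] := bd x j.
    by apply: hM; rewrite (le_trans xB)// lerDl.
have [i1 e1] := @Rintegral_sum R _ _ vol _ (index_enum 'I_n) _ ipart.
have [i2 e2] := @Rintegral_sum R _ _ vol _ (index_enum 'I_n) _ (fun j => proj1 (parts j)).
have lapE : (fun x => green_kernel a (enorm x) * laplacian phi x) =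
    (fun x => \sum_(j < n) green_kernel a (enorm x) * partial j (partial j phi) x).
  by apply/funext => x; rewrite /laplacian mulr_sumr.
have gradE : (fun x : rV => \sum_(j < n) green_gradient a x * dir x 0 j * partial j phi x) =
    (fun x => green_gradient a x * 'D_(dir x) phi x).
  apply/funext => x; rewrite derive_rV_dir; last exact: test_function_C1.
  by rewrite mulr_sumr; apply: eq_bigr => j _; rewrite mulrAC mulrA.
rewrite gradE in i2 e2.
rewrite lapE; split => //; rewrite e1 (eq_bigr _ (fun j _ => proj2 (parts j))).
by rewrite sumrN -e2 radial_FTC// opprK.
Qed.

(** The absolute value of r is harmless, as the radial weight lives on r > 0; it
saves a case distinction on the rays of the product. *)
Lemma ge0_integral_enorm (h : R -> R) : measurable_fun setT (h : RR -> R) -> (forall r, 0 <= h r) ->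
  (\int[vol]_x (h (enorm x))%:E =
   \int[@lebesgue_measure R]_r (h `|r| * radial_weight m r)%:E * cone setT)%E.
Proof.
move=> mh h0.
have mray : measurable_fun setT (fun p : RR * rV => p.1 *: dir p.2).
  by apply: measurable_scale => //; exact: (measurableT_comp (@measurable_dir R n)).
pose image := pushforward_measure (radial \x cone)%E mray.
have imageE A : measurable A -> A `<=` setT -> image A = vol A.
  by move=> mA _; rewrite (polar_coordinates mA).
have mhe : measurable_fun setT (fun x : rV => (h (enorm x))%:E).
  by apply/measurable_EFinP; apply: (measurableT_comp mh); exact: measurable_enorm.
have mhn : measurable_fun setT (fun r : RR => h `|r|).
  by apply: (measurableT_comp mh (g := fun r : RR => `|r| : RR)); exact: normr_measurable.
rewrite -(eq_measure_integral vol imageE).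
rewrite (ge0_integral_pushforward mray)//; last by move=> x _; rewrite lee_fin.
rewrite preimage_setT.
pose f (p : RR * rV) : \bar R := (h (enorm (p.1 *: dir p.2)))%:E.
transitivity (\int[radial]_r \int[cone]_y f (r, y))%E.
  apply: (fubini_tonelli1 f); last by move=> p; rewrite lee_fin.
  by apply: (measurableT_comp mhe mray).
transitivity (\int[radial]_r ((h `|r|)%:E * cone setT))%E.
  apply: eq_integral => r _; rewrite -integral_cst//.
  apply: ae_eq_integral => //.
    apply: (measurableT_comp (f := f)); last exact: measurable_pair1.
    by apply: (measurableT_comp mhe mray).
  exists [set 0]; split; [exact: measurable_set0|exact: cone_measure_set0|].
  move=> y /= ny; apply: contrapT => y0; apply: ny => _.
  by rewrite /f/= enormZ enorm_dir ?mulr1//; apply/eqP.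
have cfin : cone setT \is a fin_num by exact: fin_num_measure.
rewrite -(fineK cfin) ge0_integralZr//.
- by congr (_ * _)%E; apply: ge0_integral_density => //; [exact/measurable_EFinP|move=> r; rewrite lee_fin].
- exact/measurable_EFinP.
- by move=> r _; rewrite lee_fin.
- by rewrite lee_fin fine_ge0.
Qed.

Lemma cone_measure_gt0 : (0 < cone setT)%E.
Proof.
rewrite lt0e measure_ge0 andbT; apply/eqP => c0.
pose cube : set rV := [set x | forall i, - 1 <= x 0 i <= 1].
have : (vol cube <= vol setT)%E.
  apply: le_measure; rewrite ?inE//.
  rewrite (_ : cube = \bigcap_(i in [set: 'I_n]) ((fun x : rV => x 0 i) @^-1` `[- 1, 1])).
    apply: fin_bigcap_measurable => // i _; rewrite -[X in measurable X]setTI.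
    exact: measurable_coor.
  apply/seteqP; split => x /= h i; first by move=> _ /=; rewrite in_itv/=; exact: h.
  by have := h i I; rewrite /= in_itv.
have -> : vol setT = 0%E.
  have := @ge0_integral_enorm (fun=> 1) (measurable_cst _) (fun=> ler01).
  by rewrite c0 mule0 integral_cst// mul1e.
rewrite /cube lebesgue_rV_cube// lee_fin leNgt => /negP; apply.
by rewrite exprn_gt0// mulr1.
Qed.

(** The weight r^m of polar coordinates compensates the singularity r^-m. *)
Lemma integrable_radial_bound (B C : R) : 0 <= C ->
  vol.-integrable setT (EFin \o (fun x : rV =>
    (enorm x ^- m + enorm x) * C * \1_(eball B) x)).
Proof.
move=> C0; pose h (r : R) := (`|r| ^- m + `|r|) * C * \1_(`]-oo, B] : set RR) r.
have h0 r : 0 <= h r.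
  by rewrite /h mulr_ge0 ?indic_ge0// mulr_ge0// addr_ge0// invr_ge0 exprn_ge0.
have mh : measurable_fun setT (h : RR -> R).
  apply: measurable_funM; last exact: measurable_indic.
  apply: measurable_funM => //; apply: measurable_funD; last exact: normr_measurable.
  apply: (measurableT_comp (@measurable_inv R)).
  by apply: measurable_funX; exact: normr_measurable.
have E (x : rV) : (enorm x ^- m + enorm x) * C * \1_(eball B) x = h (enorm x).
  by rewrite /h (ger0_norm (enorm_ge0 x)) !indicE; congr (_ * (nat_of_bool _)%:R).
apply/integrableP; split.
  apply/measurable_EFinP; under eq_fun do rewrite E.
  by apply: (measurableT_comp mh); exact: measurable_enorm.
have -> : (\int[vol]_x `|(EFin \o (fun x : rV => (enorm x ^- m + enorm x) * C * \1_(eball B) x)%R) x| =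
    \int[vol]_x (h (enorm x))%:E)%E.
  by apply: eq_integral => x _ /=; rewrite E ger0_norm.
rewrite ge0_integral_enorm//.
rewrite muleC; apply: lte_mul_pinfty => //; first by rewrite fin_num_measure.
pose M := (1 + `|B| ^+ m.+1) * C.
have M0 : 0 <= M by rewrite mulr_ge0// addr_ge0// exprn_ge0.
apply: (@le_lt_trans _ _ (\int[@lebesgue_measure R]_(r in `[0%R, B]) M%:E)%E); last first.
  by rewrite integral_cst//; apply: lte_mul_pinfty => //; exact: lebesgue_itv_lty.
rewrite [leRHS]integral_mkcond; apply: ge0_le_integral => //.
- by move=> r _; rewrite lee_fin mulr_ge0// radial_weight_ge0.
- apply/measurable_EFinP; apply: measurable_funM; last exact: measurable_radial_weight.
  by apply: (measurableT_comp mh (g := fun r : RR => `|r| : RR)); exact: normr_measurable.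
- by apply/(measurable_restrictT _ _).1.
move=> r _; rewrite patchE mem_setE in_itv/= /radial_weight.
have [r0|r0] := ltP 0 r; last by rewrite mulr0; case: ifP.
rewrite (ltW r0)/= /h normr_id (gtr0_norm r0) indicE mem_setE in_itv/=.
have [rB|rB] := leP r B; last by rewrite mulr0 mul0r.
rewrite mulr1 mulrAC lee_fin ler_wpM2r// mulrDl mulVf ?expf_neq0 ?gt_eqF// lerD2l -exprS.
by rewrite lerXn2r ?nnegrE ?(ltW r0)// (le_trans rB)// ler_norm.
Qed.

(** The case a = 0 is the limit of small spheres; the bound on the kernel is uniform
in a. *)
Lemma green_identity (phi : rV -> R) (a : R) : 0 <= a -> test_function phi ->
  vol.-integrable setT (EFin \o (fun x => green_kernel a (enorm x) * laplacian phi x)) /\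
  \int[vol]_x (green_kernel a (enorm x) * laplacian phi x) = \int[cone]_y phi (a *: dir y).
Proof.
rewrite le_eqVlt => /predU1P[<-|]; last exact: green_identity_truncated.
move=> tp; have [B [C [B0 C0 cj far bd]]] := test_function_laplacian tp.
have [cphi _ _] := test_function_C1 tp; have [C' C'0 hC'] := test_function_bounded tp.
pose h (k : nat) : R := k.+1%:R^-1; have h0 k : 0 < h k by rewrite invr_gt0.
have hcvg : h k @[k --> \oo] --> (0 : R) by exact: cvg_harmonic.
have mf a1 : measurable_fun setT (fun x : rV => green_kernel a1 (enorm x) * laplacian phi x).
  apply: measurable_funM; last exact: measurable_laplacian.
  apply: (measurableT_comp (@measurable_green_kernel R m) (g := fun x : rV => (a1 : RR, enorm x : RR))).
  by apply: measurable_fun_pair => //; exact: measurable_enorm.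
have nz : {ae vol, forall x : rV, x != 0}.
  exists [set 0]; split; [exact: measurable_set0|exact: vol_set0|].
  by move=> x /= /negP; rewrite negbK => /eqP.
have [|||||i lhs] := @Rdominated_convergence _ _ _ vol setT
  (fun k x => green_kernel (h k) (enorm x) * laplacian phi x)
  (fun x => green_kernel 0 (enorm x) * laplacian phi x)
  (fun x => (enorm x ^- m + enorm x) * C * \1_(eball B) x) measurableT.
- by move=> k; exact: mf.
- exact: mf.
- apply: aeS nz => x x0 _; have r0 : 0 < enorm x by rewrite enorm_gt0.
  have small : \forall k \near \oo, h k < enorm x by apply: cvgr_lt hcvg _ r0.
  have small1 : \forall k \near \oo, h k < 1 by apply: cvgr_lt hcvg _ ltr01.
  apply: cvg_near_cst; near=> k.
  have hk : h k < enorm x by near: k.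
  have hk1 : h k < 1 by near: k.
  by rewrite /green_kernel (max_l (ltW hk)) (max_l (ltW hk1)) (max_l (ltW r0)) (max_l ler01).
- exact: integrable_radial_bound.
- apply: aeS nz => x x0 k _; have r0 : 0 < enorm x by rewrite enorm_gt0.
  have [xB|Bx] := leP (enorm x) B; last first.
    rewrite /laplacian big1 ?mulr0 ?normr0; last first.
      by move=> j _; have [_ /(_ j)[_ far2]] := far x (ltW Bx); exact: far2.
    by rewrite !mulr_ge0// addr_ge0 ?(ltW r0)// invr_ge0 exprn_ge0// ltW.
  rewrite indicE mem_set// mulr1 normrM; apply: ler_pM => //.
    by apply: green_kernel_bound => //; exact: ltW.
  by have [] := bd x ord0.
have [|||||_ rhs] := @Rdominated_convergence _ _ _ cone setT
  (fun k y => phi (h k *: dir y)) (fun y => phi (0 *: dir y)) (fun=> C') measurableT.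
- move=> k; apply: (measurableT_comp (measurable_continuous_rV cphi) (g := fun y : rV => h k *: dir y)).
  by apply: measurable_scale => //; exact: measurable_dir.
- apply: (measurableT_comp (measurable_continuous_rV cphi) (g := fun y : rV => (0 : R) *: dir y)).
  by apply: measurable_scale => //; exact: measurable_dir.
- apply: aeW => y _; apply: continuous_cvg; first exact: cphi.
  exact: cvgZr_tmp.
- apply: (@integrable_le_cst _ _ _ cone _ _ C') => //.
    by rewrite -ge0_fin_numE// fin_num_measure.
  by move=> y _; rewrite ger0_norm.
- by apply: aeW => y k _.
split => //; apply: (cvg_unique (@Rhausdorff R) lhs).
rewrite /=; apply: cvg_trans rhs; apply: near_eq_cvg; apply: nearW => k.
by rewrite (proj2 (green_identity_truncated (h0 k) tp)).
Unshelve. all: by end_near.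
Qed.

End green_formula.

(** * Poisson's equation *)

Section poisson.
Context {R : realType} (m : nat).
Local Notation n := m.+1.
Local Notation rV := 'rV[R]_n.
Local Notation RR := (measurableTypeR R).
Local Notation vol := (@lebesgue_rV R n).
Local Notation leb := (@lebesgue_measure R).
Local Notation cone := (@cone_measure R n).
Local Notation K := (@radial_primitive R m).
Local Notation green_kernel := (@green_kernel R m).
Context (mu : {finite_measure set RR -> \bar R}) (X : R -> R).
Context (measurable_X : measurable_fun setT (X : RR -> RR)) (X_ge0 : forall s, 0 <= X s).

(* the field at u of a unit charge at c, by the average rule *)
Let unit_field (c u : R) : R := (\1_[set x | c < x] u + \1_[set x | c <= x] u) / 2.

Lemma unit_field_primitive (c a b : R) : 0 < a -> a <= b ->
  \int[leb]_(u in `[a, b]) (unit_field c u / u ^+ m) = green_kernel c b - green_kernel c a.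
Proof.
move=> a0 ab; rewrite /green_kernel opprB addrA subrK.
pose a' := Num.max a c.
have a'0 : 0 < a' by rewrite lt_max a0.
transitivity (\int[leb]_(u in `[a', b]) u ^- m); last first.
  have [a'b|ba'] := leP a' b.
    rewrite radial_primitive_FTC//; congr (K _ - _).
    by apply/esym/max_l; apply: le_trans a'b; rewrite le_max lexx orbT.
  have bc : b < c by move: ba'; rewrite /a' lt_max ltNge ab.
  rewrite (max_r (ltW bc)) (max_r (le_trans ab (ltW bc))) subrr.
  by rewrite set_itv_ge ?Rintegral_set0// bnd_simp -ltNge.
have mV : measurable_fun setT (fun u : RR => u ^- m : R).
  by apply: (measurableT_comp (@measurable_inv R)); exact: measurable_funX.
have m1 : measurable ([set x | c < x] : set RR).
  rewrite (_ : [set x | _] = `]c, +oo[%classic); first exact: measurable_itv.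
  by apply/seteqP; split => x /=; rewrite in_itv/= andbT.
have m2 : measurable ([set x | c <= x] : set RR).
  rewrite (_ : [set x | _] = `[c, +oo[%classic); first exact: measurable_itv.
  by apply/seteqP; split => x /=; rewrite in_itv/= andbT.
rewrite Rintegral_mkcond [RHS]Rintegral_mkcond; apply: ae_eq_Rintegral => //.
- apply/(measurable_restrictT _ _).1 => //; apply: measurable_funTS.
  apply: measurable_funM => //; apply: measurable_funM => //.
  by apply: measurable_funD; exact: measurable_indic.
- by apply/(measurable_restrictT _ _).1 => //; exact: measurable_funTS.
exists [set c]; split; [exact: measurable_set1|exact: lebesgue_measure_set1|].
move=> u /= nu; apply: contrapT => /eqP uc; apply: nu => _.
rewrite !patchE !mem_setE !in_itv/= /a' ge_max /unit_field !indicE.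
have [cu|cu|e] := ltgtP c u; last by move: uc; rewrite e eqxx.
- have half : (1 + 1) / 2 = 1 :> R by field.
  by rewrite !mem_set /= ?(ltW cu)// andbT half mul1r.
- have n1 : ~ [set x | c < x] u by move=> /=; rewrite ltNge (ltW cu).
  have n2 : ~ [set x | c <= x] u by move=> /=; rewrite leNgt cu.
  by rewrite !memNset// andbF addr0 !mul0r; case: ifP.
Qed.

Let field (u : R) : R := (fine (mu [set s | X s < u]) + fine (mu [set s | X s <= u])) / 2.
Let potential (r : R) : R := \int[mu]_s green_kernel (X s) r.

Let mXlt u : measurable ([set s | X s < u] : set RR).
Proof.
rewrite (_ : [set s | _] = X @^-1` `]-oo, u[); last by apply/seteqP; split => x /=; rewrite in_itv.
by rewrite -[Y in measurable Y]setTI; apply: measurable_X => //; exact: measurable_itv.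
Qed.

Let mXle u : measurable ([set s | X s <= u] : set RR).
Proof.
rewrite (_ : [set s | _] = X @^-1` `]-oo, u]); last by apply/seteqP; split => x /=; rewrite in_itv.
by rewrite -[Y in measurable Y]setTI; apply: measurable_X => //; exact: measurable_itv.
Qed.

Let unit_field_le c u : `|unit_field c u| <= 1.
Proof.
rewrite /unit_field !indicE; case: (_ \in _); case: (_ \in _); rewrite /= ger0_norm; lra.
Qed.

Let unit_field_label (s u : R) :
  unit_field (X s) u = (\1_[set s | X s < u] s + \1_[set s | X s <= u] s) / 2.
Proof.
by rewrite /unit_field !indicE; congr ((_ + _) / 2);
  congr ((nat_of_bool _)%:R); apply/idP/idP => /set_mem h; apply/mem_set.
Qed.

Let field_average u : \int[mu]_s unit_field (X s) u = field u.
Proof.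
have i A : measurable A -> mu.-integrable setT (EFin \o (\1_A : RR -> R)).
  move=> mA; apply: (@integrable_le_cst _ _ _ mu _ _ 1) => //.
    by rewrite -ge0_fin_numE// fin_num_measure.
  by move=> s _; rewrite indicE; case: (_ \in _); rewrite ?normr1 ?normr0.
transitivity (\int[mu]_s (2^-1 * (\1_[set s | X s < u] s + \1_[set s | X s <= u] s))).
  by apply: eq_Rintegral => s _; rewrite unit_field_label mulrC.
rewrite RintegralZl//; last first.
  rewrite (_ : _ \o _ = (fun s => (\1_[set s | X s < u] s)%:E + (\1_[set s | X s <= u] s)%:E)%E)//.
  by apply: integrableD => //; exact: i.
rewrite RintegralD//; [|exact: i|exact: i].
by rewrite /Rintegral !integral_indic// !setIT mulrC.
Qed.

Let measurable_unit_field : measurable_fun setT (fun p : RR * RR => unit_field (X p.1) p.2 : R).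
Proof.
have mX1 : measurable_fun setT (fun p : RR * RR => X p.1 : RR) by exact: measurableT_comp.
rewrite (_ : (fun p => _) = fun p : RR * RR =>
  ((if X p.1 < p.2 then 1 else 0) + (if X p.1 <= p.2 then 1 else 0)) / 2).
  apply: measurable_funM => //; apply: measurable_funD; apply: measurable_fun_if => //.
    by apply: measurable_fun_ltr.
  by apply: measurable_fun_ler.
apply/funext => p; rewrite /unit_field !indicE; congr ((_ + _) / 2).
  by case: ifP => h; [rewrite mem_set|rewrite memNset//= h].
by case: ifP => h; [rewrite mem_set|rewrite memNset//= h].
Qed.

Let kernel_integrable r : 0 < r -> mu.-integrable setT (EFin \o (fun s : RR => green_kernel (X s) r)).
Proof.
move=> r0; apply: (@integrable_le_cst _ _ _ mu _ _ (r ^- m + r)) => //.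
- by rewrite -ge0_fin_numE// fin_num_measure.
- apply: (measurableT_comp (@measurable_green_kernel R m) (g := fun s : RR => (X s : RR, r : RR))).
  exact: measurable_fun_pair.
- by move=> s _; exact: green_kernel_bound.
Qed.

(** Fubini: the field is the superposition of the fields of unit charges at X s, and
the convention at the charge itself is invisible to the integral in r. *)
Lemma potential_increment (a b : R) : 0 < a -> a <= b ->
  potential b - potential a = \int[leb]_(r in `[a, b]) (field r / r ^+ m).
Proof.
move=> a0 ab; have b0 : 0 < b := lt_le_trans a0 ab.
rewrite /potential -RintegralB//; [|exact: kernel_integrable|exact: kernel_integrable].
pose f (p : RR * RR) : R := if p.2 \in `[a, b] then unit_field (X p.1) p.2 / p.2 ^+ m else 0.
have mf : measurable_fun setT f.
  apply: measurable_fun_if => //.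
    rewrite (_ : (fun p => _) = fun p : RR * RR => (a <= p.2) && (p.2 <= b)).
      by apply: measurable_and; apply: measurable_fun_ler.
    by apply/funext => p; rewrite in_itv.
  apply: measurable_funTS; apply: measurable_funM => //.
  apply: (measurableT_comp (@measurable_inv R)).
  by apply: measurable_funX.
have fi : (mu \x leb)%E.-integrable setT (EFin \o f).
  have mD : measurable ([set: RR] `*` (`[a, b]%classic : set RR)) by apply: measurableX.
  have i : (mu \x leb)%E.-integrable ([set: RR] `*` (`[a, b]%classic : set RR)) (EFin \o f).
    apply: (@integrable_le_cst _ _ _ (mu \x leb)%E _ _ (a ^- m)) => //.
    - rewrite [ltLHS](_ : _ = (mu setT * leb (`[a, b]%classic : set RR))%E); last exact: product_measure1E.
      by apply: lte_mul_pinfty => //; [rewrite fin_num_measure|exact: lebesgue_itv_lty].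
    - exact: measurable_funTS.
    move=> [s r] [_] /=; rewrite in_itv/= => /andP[ar rb]; rewrite /f/= in_itv/= ar rb/=.
    have r0 : 0 < r := lt_le_trans a0 ar.
    have := unit_field_le (X s) r; move: (unit_field (X s) r) => z z1.
    rewrite normrM -[leRHS]mul1r; apply: ler_pM => //.
    rewrite ger0_norm ?invr_ge0 ?exprn_ge0 ?(ltW r0)//.
    by rewrite lef_pV2 ?posrE ?exprn_gt0// lerXn2r ?nnegrE ?(ltW a0) ?(ltW r0).
  have := (integrable_mkcond _ mD).1 i; congr (_.-integrable _ _).
  apply/funext => -[s r]; rewrite patchE /f/=.
  by case: ifPn => // /negP h; case: ifP => // h2; case: h; apply/mem_set; split.
have [_ e1] := Rintegral_prod_fst fi; have [_ e2] := Rintegral_prod fi.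
have unmk (g : R -> R) : \int[leb]_r (if r \in `[a, b] then g r else 0) = \int[leb]_(r in `[a, b]) g r.
  rewrite [RHS]Rintegral_mkcond; apply: eq_Rintegral => r _.
  by rewrite patchE mem_setE.
transitivity (\int[mu]_s \int[leb]_r f (s, r)).
  apply: eq_Rintegral => s _; rewrite -(unit_field_primitive _ a0 ab) -unmk.
  by apply: eq_Rintegral => r _.
rewrite -e1 e2 -unmk; apply: eq_Rintegral => r _.
rewrite /f/=; case: ifP => _; last by rewrite /Rintegral integral0.
rewrite -field_average -RintegralZr//.
apply: (@integrable_le_cst _ _ _ mu _ _ 1) => //.
- by rewrite -ge0_fin_numE// fin_num_measure.
- apply: (measurableT_comp measurable_unit_field (g := fun s : RR => (s, r : RR))).
  exact: measurable_fun_pair.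
Qed.

(** Fubini again, from Green's identity for each label. *)
Lemma potential_laplacian (phi : rV -> R) : test_function phi ->
  vol.-integrable setT (EFin \o (fun x => potential (enorm x) * laplacian phi x)) /\
  \int[vol]_x (potential (enorm x) * laplacian phi x) =
  \int[(mu \x cone)%E]_p phi (X p.1 *: dir p.2).
Proof.
move=> tp; have [B [C [B0 C0 cj far bd]]] := test_function_laplacian tp.
have [cphi _ _] := test_function_C1 tp; have [C' C'0 hC'] := test_function_bounded tp.
have mlap := measurable_laplacian cj.
pose f (p : RR * rV) : R := green_kernel (X p.1) (enorm p.2) * laplacian phi p.2.
have mf : measurable_fun setT f.
  apply: measurable_funM; last by apply: (measurableT_comp mlap).
  apply: (measurableT_comp (@measurable_green_kernel R m)
    (g := fun p : RR * rV => (X p.1 : RR, enorm p.2 : RR))).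
  apply: measurable_fun_pair; first by apply: (measurableT_comp measurable_X).
  by apply: (measurableT_comp (@measurable_enorm R n)).
have mfx x : measurable_fun setT (fun s : RR => f (s, x)).
  by apply: (measurableT_comp mf (g := fun s : RR => (s, x))); exact: measurable_fun_pair.
have muT : (mu setT < +oo)%E by rewrite -ge0_fin_numE// fin_num_measure.
have nz : {ae vol, forall x : rV, x != 0}.
  exists [set 0]; split; [exact: measurable_set0|exact: vol_set0|].
  by move=> x /= /negP; rewrite negbK => /eqP.
pose dom (x : rV) : R := (enorm x ^- m + enorm x) * C * \1_(eball B) x.
have fdom (s : R) (x : rV) : x != 0 -> `|f (s, x)| <= dom x.
  move=> x0; have r0 : 0 < enorm x by rewrite enorm_gt0.
  have [xB|Bx] := leP (enorm x) B; last first.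
    rewrite /f/= /laplacian big1 ?mulr0 ?normr0; last first.
      by move=> j _; have [_ /(_ j)[_ far2]] := far x (ltW Bx); exact: far2.
    by rewrite /dom !mulr_ge0// addr_ge0 ?(ltW r0)// invr_ge0 exprn_ge0// ltW.
  rewrite /dom indicE mem_set// mulr1 normrM; apply: ler_pM => //.
    exact: green_kernel_bound.
  by have [] := bd x ord0.
have domi : vol.-integrable setT (EFin \o dom) by exact: integrable_radial_bound.
have dom0 x : 0 <= dom x.
  by rewrite /dom mulr_ge0 ?indic_ge0// mulr_ge0// addr_ge0 ?enorm_ge0// invr_ge0 exprn_ge0// enorm_ge0.
pose c := fine (mu setT); have c0 : 0 <= c by exact: fine_ge0.
have fi : (mu \x vol)%E.-integrable setT (EFin \o f).
  have mf' : measurable_fun setT (EFin \o f) by exact/measurable_EFinP.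
  apply: (@integrable21ltyP _ _ _ _ R mu vol (EFin \o f) mf').2.
  apply: (@le_lt_trans _ _ (\int[vol]_x (c * dom x)%:E)%E); last first.
    have := integrableZl measurableT c domi.
    move=> /integrable_fin_num => /(_ measurableT); rewrite fin_numElt => /andP[_].
    by under eq_integral do rewrite /= -EFinM.
  apply: ae_ge0_le_integral => //.
  - by move=> x _; exact: integral_ge0.
  - apply: (@measurable_fun_fubini_tonelli_G _ _ _ _ _ mu (abse \o (EFin \o f))) => //.
      exact: measurableT_comp.
    by move=> q; rewrite lee_fin.
  - by move=> x _; rewrite lee_fin mulr_ge0.
  - by apply/measurable_EFinP; apply: measurable_funM => //; apply/measurable_EFinP; exact: measurable_int domi.
  apply: aeS nz => x x0 _.
  rewrite mulrC EFinM /c fineK ?fin_num_measure// -integral_cst//.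
  apply: ge0_le_integral => //.
  - by apply/measurable_EFinP; apply: (measurableT_comp (@normr_measurable R setT) (mfx x)).
  - by move=> s _; rewrite /= lee_fin; exact: fdom.
have [_ e1] := Rintegral_prod_fst fi; have [ae2 e2] := Rintegral_prod fi.
have potE : {ae vol, forall x, setT x -> potential (enorm x) * laplacian phi x = \int[mu]_s f (s, x)}.
  apply: aeS nz => x x0 _; rewrite /potential -RintegralZr//.
  by apply: kernel_integrable; rewrite enorm_gt0.
have mslice : measurable_fun setT (fun x : rV => \int[mu]_s f (s, x)).
  apply: (@measurable_fun_Rintegral _ _ _ _ _ mu (fun q : rV * RR => f (q.2, q.1))).
  by apply: (measurableT_comp mf (g := fun q : rV * RR => (q.2, q.1))); exact: measurable_fun_pair.
have mpot : measurable_fun setT (fun x : rV => potential (enorm x) * laplacian phi x).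
  apply: measurable_funM => //.
  apply: (@measurable_fun_Rintegral _ _ _ _ _ mu (fun q : rV * RR => green_kernel (X q.2) (enorm q.1))).
  apply: (measurableT_comp (@measurable_green_kernel R m)
    (g := fun q : rV * RR => (X q.2 : RR, enorm q.1 : RR))).
  apply: measurable_fun_pair; first by apply: (measurableT_comp measurable_X).
  by apply: (measurableT_comp (@measurable_enorm R n)).
split.
  have [|||||i _] := @Rdominated_convergence _ _ _ vol setT
    (fun _ x => potential (enorm x) * laplacian phi x)
    (fun x => potential (enorm x) * laplacian phi x) (fun x => c * dom x) measurableT => //.
  - by apply: aeW => x _; exact: cvg_cst.
  - have := integrableZl measurableT c domi; congr (_.-integrable _ _).
  - apply: aeS2 nz potE => x x0 e k _; rewrite e//.
    have slice_le : {ae mu, forall s, setT s -> `|f (s, x)| <= dom x}.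
      by apply: aeW => s _; exact: fdom.
    rewrite mulrC; exact: (Rintegral_ae_bounded (dom0 x) measurableT muT (mfx x) slice_le).
transitivity (\int[vol]_x \int[mu]_s f (s, x)); first exact: ae_eq_Rintegral.
rewrite -e2 e1.
have ip : (mu \x cone)%E.-integrable setT (EFin \o (fun p : RR * rV => phi (X p.1 *: dir p.2))).
  apply: (@integrable_le_cst _ _ _ (mu \x cone)%E _ _ C') => //.
    exact: (finite_product_lty mu cone measurableT).
  apply: (measurableT_comp (measurable_continuous_rV cphi) (g := fun p : RR * rV => X p.1 *: dir p.2)).
  apply: measurable_scale; first by apply: (measurableT_comp measurable_X).
  by apply: (measurableT_comp (@measurable_dir R n)).
have [_ ->] := Rintegral_prod_fst ip.
by apply: eq_Rintegral => s _; have [_] := green_identity (X_ge0 s) tp.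
Qed.

End poisson.

(** * The distribution of the labels in space *)

Section cumulative.
Context {R : realType}.
Local Notation RR := (measurableTypeR R).
Local Notation leb := (@lebesgue_measure R).
Context (mu : {finite_measure set RR -> \bar R}) (X f : R -> R).
Context (measurable_X : measurable_fun setT (X : RR -> RR)) (X_ge0 : forall s, 0 <= X s).
Context (measurable_f : measurable_fun setT (f : RR -> RR)).
Context (f_bounded : forall B, 0 < B -> exists2 U, 0 <= U &
  {ae mu, forall s : RR, X s < B -> `|f s| <= U}).

Definition cumulative (r : R) : R := \int[mu]_(s in [set s | X s <= r]) f s.

Let cut (p : RR * RR) : R := if X p.1 <= p.2 then f p.1 else 0.

Let measurable_cut : measurable_fun setT cut.
Proof.
apply: measurable_fun_if => //.
- by apply: measurable_fun_ler => //; apply: (measurableT_comp measurable_X).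
- by apply: measurable_funTS; apply: (measurableT_comp measurable_f).
Qed.

Let cumulativeE r : cumulative r = \int[mu]_s cut (s, r).
Proof.
rewrite /cumulative Rintegral_mkcond; apply: eq_Rintegral => s _.
rewrite patchE /cut/=; case: ifPn => [/set_mem/= ->//|/negP h].
by case: ifPn => // h2; case: h; exact/mem_set.
Qed.

Lemma measurable_cumulative : measurable_fun setT (cumulative : RR -> R).
Proof.
rewrite (_ : (cumulative : RR -> R) = fun r => \int[mu]_s cut (s, r)).
  apply: (@measurable_fun_Rintegral _ _ _ _ _ mu (fun q : RR * RR => cut (q.2, q.1))).
  by apply: (measurableT_comp measurable_cut (g := fun q : RR * RR => (q.2, q.1))); exact: measurable_fun_pair.
by apply/funext => r; exact: cumulativeE.
Qed.

Let cut_le B : exists2 U, 0 <= U &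
  forall r, r <= B -> {ae mu, forall s : RR, setT s -> `|cut (s, r)| <= U}.
Proof.
have B1 : 0 < Num.max B 0 + 1 by rewrite ltr_wpDl// le_max lexx orbT.
have [U U0 hU] := f_bounded B1; exists U => // r rB.
apply: aeS hU => s hs _; rewrite /cut/=; case: ifPn => [Xr|_]; last by rewrite normr0.
apply: hs; apply: (le_lt_trans (le_trans Xr rB)).
by rewrite ltr_pwDr// le_max lexx.
Qed.

Let measurable_cut_at r : measurable_fun setT (fun s : RR => cut (s, r)).
Proof.
by apply: (measurableT_comp measurable_cut (g := fun s : RR => (s, r : RR))); exact: measurable_fun_pair.
Qed.

Let mu_finite : (mu setT < +oo)%E.
Proof. by rewrite -ge0_fin_numE// fin_num_measure. Qed.

Let integrable_cut r : mu.-integrable setT (EFin \o (fun s : RR => cut (s, r))).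
Proof.
have [U _ /(_ r (lexx r)) hU] := cut_le r.
exact: (integrable_ae_bounded measurableT mu_finite (measurable_cut_at r) hU).
Qed.

Lemma cumulative_bounded B : exists2 C, 0 <= C & forall r, r <= B -> `|cumulative r| <= C.
Proof.
have [U U0 hU] := cut_le B; exists (U * fine (mu setT)); first by rewrite mulr_ge0// fine_ge0.
move=> r rB; rewrite cumulativeE.
exact: (Rintegral_ae_bounded U0 measurableT mu_finite (measurable_cut_at r) (hU r rB)).
Qed.

Section by_parts.
Context (psi : R -> R) (B C : R).
Context (psi_C1 : C1 psi) (B_gt0 : 0 < B) (psi0 : forall r, B <= r -> psi r = 0 /\ derive1 psi r = 0)
  (psi_le : forall r, `|psi r| <= C) (dpsi_le : forall r, `|derive1 psi r| <= C).

Let measurable_psi : measurable_fun setT (psi : RR -> R).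
Proof. by have [c _ _] := psi_C1; exact: continuous_measurable_fun. Qed.

Let continuous_dpsi : continuous (derive1 psi).
Proof.
have [_ _ c] := psi_C1; rewrite (_ : derive1 psi = 'D_1 psi); first exact: c.
by apply/funext => r; rewrite derive1E.
Qed.

Let measurable_dpsi : measurable_fun setT (derive1 psi : RR -> R).
Proof. exact: continuous_measurable_fun. Qed.

Lemma integrable_test_position : mu.-integrable setT (EFin \o (fun s => psi (X s) * f s)).
Proof.
have C0 : 0 <= C := le_trans (normr_ge0 _) (psi_le 0).
have [U U0 hU] := f_bounded B_gt0.
apply: (@integrable_ae_bounded _ _ _ mu _ _ (C * U)) => //.
- by apply: measurable_funM => //; apply: (measurableT_comp measurable_psi).
apply: aeS hU => s hs _; have [XB|BX] := ltP (X s) B.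
  by rewrite normrM; apply: ler_pM => //; exact: hs.
by have [-> _] := psi0 BX; rewrite mul0r normr0 mulr_ge0.
Qed.

Lemma integrable_cumulative :
  leb.-integrable `[0, +oo[ (EFin \o (fun r => derive1 psi r * cumulative r)).
Proof.
have C0 : 0 <= C := le_trans (normr_ge0 _) (psi_le 0).
have [K K0 hK] := cumulative_bounded B.
have i : leb.-integrable `[0, B] (EFin \o (fun r => derive1 psi r * cumulative r)).
  apply: (@integrable_le_cst _ _ _ leb _ _ (C * K)) => //; first exact: lebesgue_itv_lty.
    by apply: measurable_funTS; apply: measurable_funM => //; exact: measurable_cumulative.
  move=> r /=; rewrite in_itv/= => /andP[_ rB]; rewrite normrM; apply: ler_pM => //; exact: hK.
have mB : measurable (`[0, B]%classic : set RR) by [].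
have mI : measurable (`[0, +oo[%classic : set RR) by [].
have /(integrable_mkcond _ mB).1 i' := i; apply/(integrable_mkcond _ mI).
move: i'; congr (_.-integrable _ _); apply/funext => r.
rewrite !patchE !mem_setE !in_itv/= andbT; case: leP => //= _.
by case: leP => // Br; have [_ ->] := psi0 (ltW Br); rewrite mul0r.
Qed.

(** Write psi(X s) as minus the integral of psi' over r >= X s, and exchange the
integrals. *)
Lemma cumulative_by_parts : \int[mu]_s (psi (X s) * f s) =
  - \int[leb]_(r in `[0, +oo[) (derive1 psi r * cumulative r).
Proof.
have C0 : 0 <= C := le_trans (normr_ge0 _) (psi_le 0).
pose h (p : RR * RR) : R := (if 0 <= p.2 then derive1 psi p.2 else 0) * cut p.
have mh : measurable_fun setT h.
  apply: measurable_funM => //; apply: measurable_fun_if => //.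
    by apply: measurable_fun_ler.
  by apply: measurable_funTS; apply: (measurableT_comp measurable_dpsi).
have B1 : 0 < B + 1 by rewrite addr_gt0.
have [U U0 hU] := f_bounded B1.
have hi : (mu \x leb)%E.-integrable setT (EFin \o h).
  have mD : measurable ([set: RR] `*` (`[0, B]%classic : set RR)) by apply: measurableX.
  have i : (mu \x leb)%E.-integrable ([set: RR] `*` (`[0, B]%classic : set RR)) (EFin \o h).
    apply: (@integrable_ae_bounded _ _ _ (mu \x leb)%E _ _ (C * U)) => //.
    - rewrite [ltLHS](_ : _ = (mu setT * leb (`[0%R, B]%classic : set RR))%E); last exact: product_measure1E.
      by apply: lte_mul_pinfty => //; [rewrite fin_num_measure|exact: lebesgue_itv_lty].
    - exact: measurable_funTS.
    apply: aeS (ae_fst leb hU) => -[s r] /= hs [_] /=; rewrite in_itv/= => /andP[r0 rB].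
    rewrite /h/= r0 normrM; apply: ler_pM => //; rewrite /cut/=.
    case: ifPn => [Xr|_]; last by rewrite normr0.
    by apply: hs; apply: (le_lt_trans (le_trans Xr rB)); rewrite ltrDl.
  have := (integrable_mkcond _ mD).1 i; congr (_.-integrable _ _).
  apply/funext => -[s r]; rewrite patchE; case: ifPn => // /negP nD; rewrite /h/=.
  case: ifPn => r0; last by rewrite mul0r.
  have [rB|Br] := leP r B; first by case: nD; apply/mem_set; split => //=; rewrite in_itv/= r0.
  by have [_ ->] := psi0 (ltW Br); rewrite mul0r.
have [_ e1] := Rintegral_prod_fst hi; have [_ e2] := Rintegral_prod hi.
transitivity (- \int[mu]_s \int[leb]_r h (s, r)).
  apply: oppr_inj; rewrite opprK -mulN1r -RintegralZl//; last exact: integrable_test_position.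
  apply: eq_Rintegral => s _.
  pose b := Num.max B (X s) + 1.
  have [Xb Bb] : X s < b /\ B <= b.
    by rewrite /b; split; [rewrite ltr_pwDr// le_max lexx orbT|rewrite ler_wpDr// le_max lexx].
  transitivity (\int[leb]_(r in `[X s, b]) (derive1 psi r * f s)); last first.
    rewrite Rintegral_mkcond; apply: eq_Rintegral => r _.
    rewrite patchE mem_setE in_itv/= /h /cut/=.
    have [Xr|rX] := leP (X s) r; last by rewrite mulr0.
    rewrite (le_trans (X_ge0 s) Xr); have [//|br] := leP r b.
    by have [_ ->] := psi0 (le_trans Bb (ltW br)); rewrite mul0r.
  rewrite RintegralZr//; last first.
    apply: continuous_compact_integrable; first exact: segment_compact.
    exact: continuous_subspaceT.
  have [cpsi dpsi _] := psi_C1.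
  rewrite mulrA; congr (_ * _).
  rewrite /Rintegral (@continuous_FTC2 _ _ psi)//.
  - by rewrite -EFinB /=; have [-> _] := psi0 Bb; rewrite sub0r mulN1r.
  - exact: continuous_subspaceT.
  - by split; [move=> r _; exact: dpsi|apply: cvg_at_right_filter; exact: cpsi|apply: cvg_at_left_filter; exact: cpsi].
rewrite -e1 e2; congr (- _); rewrite [RHS]Rintegral_mkcond; apply: eq_Rintegral => r _.
rewrite patchE mem_setE in_itv/= andbT /h/=.
case: ifP => _; last by rewrite /Rintegral; under eq_integral do rewrite mul0r; rewrite integral0.
by rewrite cumulativeE RintegralZl//; exact: integrable_cut.
Qed.

End by_parts.

End cumulative.

Section label_distribution.
Context {R : realType}.
Local Notation RR := (measurableTypeR R).
Local Notation leb := (@lebesgue_measure R).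
Context (mu : {finite_measure set RR -> \bar R}).
Context (kappa : R) (u : R -> R).
Context (mu_set1 : forall x : R, mu [set x] = 0%E).
Context (mu_neg : mu `]-oo, (0 : R)[%classic = 0%E).
Context (u_continuous : continuous u).
Context (minimizers_exist : forall r t : R, 0 < r -> 0 <= t -> minimizers mu kappa u r t !=set0).
Local Notation X := (position mu kappa u).
Local Notation minimizers := (minimizers mu kappa u).

Definition label_sup (r t : R) : \bar R := ereal_sup (EFin @` minimizers r t).
Definition label_set (r t : R) : set R := [set s | 0 <= s /\ (s%:E <= label_sup r t)%E].

Lemma measurable_label_set (r t : R) : measurable (label_set r t : set RR).
Proof.
rewrite /label_set; case: (label_sup r t) => [y| |].
- rewrite (_ : [set s | _] = `[0, y]%classic); first exact: measurable_itv.
  by apply/seteqP; split => s /=; rewrite in_itv/= lee_fin => /andP.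
- rewrite (_ : [set s | _] = `[0, +oo[%classic); first exact: measurable_itv.
  by apply/seteqP; split => s /=; rewrite in_itv/= andbT leey => // -[].
- rewrite (_ : [set s | _] = set0); first exact: measurable0.
  by apply/seteqP; split => s //= -[].
Qed.

(** A label that has entered a ball has entered every larger one. *)
Lemma label_sup_nd (r r' t : R) : 0 < r -> r <= r' -> 0 <= t -> (label_sup r t <= label_sup r' t)%E.
Proof.
move=> r0 rr' t0; apply: ge_ereal_sup => _ [y my <-].
have [y' my' yy'] : reaches mu kappa u y r' t.
  by apply: (reaches_le_radius u_continuous minimizers_exist r0 rr' t0); exists y.
by apply: (@le_trans _ _ y'%:E); [rewrite lee_fin|apply: ereal_sup_ubound; exists y'].
Qed.

(** A support label with X s < r lies below every minimizer, and a label with X s > r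
beyond all of them; only the supremum of the minimizers itself, a single label, can
be below itself without being below a minimizer. *)
Lemma label_set_position (r t : R) : 0 < r -> 0 <= t ->
  {ae mu, forall s : RR, (X s t < r -> label_set r t s) /\ (label_set r t s -> X s t <= r)}.
Proof.
move=> r0 t0.
have not_sup : {ae mu, forall s : RR, s <> fine (label_sup r t)}.
  exists [set fine (label_sup r t)]; split; [exact: measurable_set1|exact: mu_set1|].
  by move=> s /= /contrapT.
apply: aeS2 (support_label_ae mu_set1 mu_neg) not_sup => s ss ns; split.
  have [y my] := minimizers_exist r0 t0 => Xr; split; first by have [] := ss.
  apply: (@le_trans _ _ y%:E); last by apply: ereal_sup_ubound; exists y.
  by rewrite lee_fin; exact: (reaches_minimizer u_continuous minimizers_exist r0 t0 ss Xr my).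
move=> [s0 ssup]; rewrite leNgt; apply/negP => rX.
have sup_le : (label_sup r t <= s%:E)%E.
  apply: ge_ereal_sup => _ [y my <-]; rewrite lee_fin ltW//.
  exact: (minimizer_lt u_continuous minimizers_exist r0 t0 rX my).
by apply: ns; rewrite (_ : label_sup r t = s%:E)//; apply/eqP; rewrite eq_le sup_le.
Qed.

(** There are countably many blocks of positive mass. *)
Lemma block_null_ae (t : R) : {ae leb, forall r : R, block_mass mu kappa u r t = 0}.
Proof.
pose A : set R := range (fun q : rat => X (ratr q) t).
have cA : countable A by apply: card_le_trans (card_image_le _ _) _; exact: countableP.
exists A; split.
- by apply: countable_measurable => // x; exact: measurable_set1.
- exact: countable_lebesgue_measure0.
move=> r /= /eqP nr; have [q <-] := block_rat mu_set1 u_continuous minimizers_exist nr.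
by exists q.
Qed.

Let le_code (a b : \bar R) : (contract a <= contract b) = (a <= b)%E.
Proof. exact: le_contract. Qed.

Section density_on_labels.
Context (t : R) (t_ge0 : 0 <= t) (f : R -> R).
Context (measurable_f : measurable_fun setT (f : RR -> RR)).
Context (f_bounded : forall B, 0 < B -> exists2 U, 0 <= U &
  {ae mu, forall s : RR, X s t < B -> `|f s| <= U}).

Let F (r : R) : R := \int[mu]_(s in label_set r t) f s.

Let measurable_Xt : measurable_fun setT ((fun s => X s t) : RR -> RR).
Proof.
apply: (measurableT_comp (measurable_position u_continuous minimizers_exist) (g := fun s : RR => (s, t : RR))).
exact: measurable_fun_pair.
Qed.

Let sup_code (r : R) : R := if 0 < r then contract (label_sup r t) else -1.

Let measurable_sup_code : measurable_fun setT (sup_code : RR -> R).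
Proof.
apply: nondecreasing_measurable => // r r' rr'; rewrite /sup_code.
have [r0|r0] := ltP 0 r.
  by rewrite (lt_le_trans r0 rr') le_code; exact: label_sup_nd.
case: ifP => // _; have := contract_le1 (label_sup r' t).
by rewrite ler_norml => /andP[].
Qed.

(** The supremum of the minimizers is monotone in r, but may be infinite; its
contraction to [-1, 1] is a monotone real function. *)
Lemma measurable_label_integral : measurable_fun (`[0, +oo[ : set RR) (F : RR -> R).
Proof.
pose cut (q : RR * RR) : R := if (0 <= q.2) && (contract q.2%:E <= sup_code q.1) then f q.2 else 0.
have mcut : measurable_fun setT cut.
  apply: measurable_fun_if => //; last by apply: measurable_funTS; apply: (measurableT_comp measurable_f).
  apply: measurable_and; apply: measurable_fun_ler => //.
    have mc : measurable_fun setT ((fun s => contract s%:E) : RR -> R).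
      by apply: nondecreasing_measurable => // s s' ss'; rewrite le_code lee_fin.
    by apply: (measurableT_comp mc).
  by apply: (measurableT_comp measurable_sup_code).
have mF := @measurable_fun_Rintegral _ _ _ _ _ mu cut mcut.
have mF0 : measurable_fun setT ((fun r => if 0 < r then \int[mu]_s cut (r, s) else F 0) : RR -> R).
  apply: measurable_fun_if => //; first by apply: measurable_fun_ltr.
  exact: measurable_funTS.
apply: eq_measurable_fun (measurable_funTS mF0) => r; rewrite inE/= in_itv/= andbT le_eqVlt.
move=> /predU1P[<-|r0]; rewrite ?ltxx// r0.
rewrite /F Rintegral_mkcond; apply: eq_Rintegral => s _.
have code : (contract s%:E <= sup_code r) = (s%:E <= label_sup r t)%E.
  by rewrite /sup_code r0; exact: le_code.
rewrite patchE /cut/= code.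
case: ifPn => [/andP[h1 h2]|h]; first by rewrite mem_set.
by rewrite memNset// => -[h1 h2]; move: h; rewrite h1 h2.
Qed.

Lemma label_integral_cumulative : {ae leb, forall r : R, 0 < r -> F r = cumulative mu (fun s => X s t) f r}.
Proof.
apply: aeS (block_null_ae t) => r br r0; rewrite /F /cumulative Rintegral_mkcond [RHS]Rintegral_mkcond.
have ml := measurable_label_set r t.
have mX : measurable ([set s | X s t <= r] : set RR).
  exact: (measurable_position_le u_continuous minimizers_exist).
apply: ae_eq_Rintegral => //.
- by apply/(measurable_restrictT _ _).1 => //; exact: measurable_funTS.
- by apply/(measurable_restrictT _ _).1 => //; exact: measurable_funTS.
have nb : {ae mu, forall s : RR, X s t <> r}.
  exists (block mu kappa u r t); split.
  - exact: (measurable_block u_continuous minimizers_exist).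
  - have mb : measurable (block mu kappa u r t : set RR).
      exact: (measurable_block u_continuous minimizers_exist).
    by rewrite -(fineK (fin_num_measure mu _ mb)); congr EFin.
  - by move=> s /= /contrapT.
apply: aeS2 (label_set_position r0 t_ge0) nb => s [h1 h2] ns _.
rewrite !patchE; congr (if _ then _ else _); apply/idP/idP => /set_mem h; apply/mem_set; first exact: h2.
by apply: h1; rewrite lt_neqAle; apply/andP; split => //; exact/eqP.
Qed.

Lemma label_distribution (psi : R -> R) : test_function psi ->
  [/\ mu.-integrable setT (EFin \o (fun s => psi (X s t) * f s)),
    leb.-integrable `[0, +oo[ (fun r => (derive1 psi r * F r)%:E) &
    \int[mu]_s (psi (X s t) * f s) = - \int[leb]_(r in `[0, +oo[) (derive1 psi r * F r)].
Proof.
move=> tp; have psi_C1 := test_function_C1 tp.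
have [B B0 hB] := support_bounded tp; have [C C0 hC] := test_function_bounded tp.
have [C' C'0 hC'] := derive_bounded (1 : R) tp.
have far r : B + 1 <= r -> psi r = 0 /\ derive1 psi r = 0.
  move=> Br; have nr : ~ support psi r.
    apply: hB; rewrite ger0_norm; first by apply: lt_le_trans Br; rewrite ltrDl.
    by apply: le_trans Br; rewrite addr_ge0// ltW.
  split; first exact: vanishes_off_support nr.
  by rewrite derive1E; apply: (derive_vanishes_off (1 : R) (@closed_support _ _ psi) (@vanishes_off_support _ _ psi)).
have B10 : 0 < B + 1 by rewrite addr_gt0.
have CC : C <= C + C' by rewrite lerDl.
have CC' : C' <= C + C' by rewrite lerDr.
have psi_le r : `|psi r| <= C + C' by exact: le_trans CC.
have dpsi_le r : `|derive1 psi r| <= C + C' by rewrite derive1E; exact: le_trans CC'.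
have X_ge0 s : 0 <= X s t by exact: (position_ge0 u_continuous minimizers_exist).
have i1 := integrable_test_position measurable_Xt measurable_f f_bounded psi_C1 B10 far psi_le.
have i2 := integrable_cumulative measurable_Xt measurable_f f_bounded psi_C1 far psi_le dpsi_le.
have e := cumulative_by_parts measurable_Xt X_ge0 measurable_f f_bounded psi_C1 B10 far psi_le dpsi_le.
have ae_eq : {ae leb, forall r : R, `[0, +oo[%classic r ->
    derive1 psi r * cumulative mu (fun s => X s t) f r = derive1 psi r * F r}.
  have n0 : {ae leb, forall r : R, r <> 0}.
    exists [set 0]; split; [exact: measurable_set1|exact: lebesgue_measure_set1|].
    by move=> r /= /contrapT.
  apply: aeS2 n0 label_integral_cumulative => r /eqP n0 e' /=; rewrite in_itv/= andbT => r0.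
  by rewrite e'// lt_neqAle eq_sym n0.
have mdpsi : measurable_fun setT (derive1 psi : RR -> R).
  have [_ _ c] := psi_C1; rewrite (_ : derive1 psi = 'D_1 psi); last by apply/funext => r; rewrite derive1E.
  exact: continuous_measurable_fun.
have mdF : measurable_fun (`[0, +oo[ : set RR) ((fun r => derive1 psi r * F r) : RR -> R).
  by apply: measurable_funM; [exact: measurable_funTS|exact: measurable_label_integral].
have mdc : measurable_fun (`[0, +oo[ : set RR)
    ((fun r => derive1 psi r * cumulative mu (fun s => X s t) f r) : RR -> R).
  by apply/measurable_EFinP; exact: measurable_int i2.
split; [exact: i1| |].
- exact: (@ae_eq_integrable _ RR R leb `[0, +oo[%classic _ (fun r => derive1 psi r * F r) (measurable_itv _) mdF ae_eq i2).
- by rewrite e; congr (- _); exact: ae_eq_Rintegral.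
Qed.

End density_on_labels.

End label_distribution.

(** * The initial mass *)

Section initial_mass.
Context {R : realType} (m : nat) (kappa : R) (rho0 u0 : R -> R).
Local Notation n := m.+1.
Local Notation rV := 'rV[R]_n.
Local Notation RR := (measurableTypeR R).
Local Notation vol := (@lebesgue_rV R n).
Local Notation leb := (@lebesgue_measure R).
Local Notation cone := (@cone_measure R n).
Context (rho0_ge0 : forall r : R, 0 <= r -> 0 <= rho0 r).
Context (rho0_L1 : vol.-integrable setT (fun x : rV => (rho0 (enorm x))%:E)).
Context (u0_C1 : C1_halfline u0).

(** The restriction of a measurable function on R^n to a line is measurable. *)
Lemma measurable_rho0 : measurable_fun setT ((fun r => rho0 `|r|) : RR -> R).
Proof.
have mrho : measurable_fun setT (fun x : rV => rho0 (enorm x)).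
  by apply/measurable_EFinP; exact: measurable_int rho0_L1.
pose e : rV := delta_mx 0 0.
have e1 : enorm e = 1.
  rewrite /enorm (bigD1 0)//= big1 ?addr0 ?mxE ?eqxx ?expr1n ?sqrtr1//.
  by move=> j j0; rewrite mxE (negbTE j0) andbF expr0n.
have mray : measurable_fun setT (fun r : RR => r *: e) by apply: measurable_scale.
have := measurableT_comp mrho mray; apply: eq_measurable_fun => r _ /=.
by rewrite enormZ e1 mulr1.
Qed.

(** Extending rho0 evenly makes the density measurable and nonnegative on the whole
line. *)
Definition mass_density (r : R) : R := rho0 `|r| * radial_weight m r.

Lemma mass_density_ge0 r : 0 <= mass_density r.
Proof. by rewrite mulr_ge0 ?radial_weight_ge0// rho0_ge0. Qed.

Lemma measurable_mass_density : measurable_fun setT (mass_density : RR -> R).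
Proof. by apply: measurable_funM; [exact: measurable_rho0|exact: measurable_radial_weight]. Qed.

Let base := density_measure measurable_mass_density mass_density_ge0.

Let base_finite : (base setT < +oo)%E.
Proof.
have h0 (r : R) : 0 <= rho0 `|r| by exact: rho0_ge0.
have := ge0_integral_enorm m measurable_rho0 h0.
have /integrableP[_] := rho0_L1.
have -> : (\int[vol]_x `|(rho0 (enorm x))%:E| = \int[vol]_x (rho0 `|enorm x|)%:E)%E.
  by apply: eq_integral => x _; rewrite ger0_norm ?enorm_ge0//= ger0_norm// rho0_ge0// enorm_ge0.
move=> /[swap] -> fin.
rewrite /base density_measureE.
have <- : (\int[leb]_r (rho0 `|(`|r|)| * radial_weight m r)%:E = \int[leb]_r (mass_density r)%:E)%E.
  by apply: eq_integral => r _; rewrite normr_id.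
rewrite ltNge leye_eq; apply/negP => /eqP e; move: fin; rewrite e.
by rewrite gt0_mulye ?cone_measure_gt0// ltxx.
Qed.

Definition mass_measure : {finite_measure set RR -> \bar R} := mfrestr measurableT base_finite.

Lemma mass_measureE A : mass_measure A = (\int[leb]_(r in A) (mass_density r)%:E)%E.
Proof. by rewrite /mass_measure/=/mfrestr/mrestr setIT /base density_measureE. Qed.

Lemma mass_measure_set1 x : mass_measure [set x] = 0%E.
Proof. by rewrite mass_measureE integral_set1. Qed.

Lemma mass_measure_neg : mass_measure `]-oo, (0 : R)[%classic = 0%E.
Proof.
rewrite mass_measureE integral0_eq// => r /=; rewrite in_itv/= => r0.
by rewrite /mass_density /radial_weight ltNge (ltW r0) mulr0.
Qed.

Lemma mass_measure_gt0_ae : {ae mass_measure, forall s : RR, 0 < s}.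
Proof.
exists (`]-oo, (0 : R)[%classic `|` [set 0]); split.
- by apply: measurableU.
- by apply: null_setU => //; [exact: mass_measure_neg|exact: mass_measure_set1].
move=> s /= /negP; rewrite -leNgt le_eqVlt => /predU1P[->|s0]; first by right.
by left; rewrite in_itv.
Qed.

Lemma Rintegral_mass (f : RR -> R) : measurable_fun setT f ->
  \int[mass_measure]_s f s = \int[leb]_s (f s * mass_density s).
Proof.
move=> mf; have E A : measurable A -> A `<=` setT -> mass_measure A = base A.
  by move=> mA _; rewrite /mass_measure/=/mfrestr/mrestr setIT.
by transitivity (\int[base]_s f s); [exact: eq_measure_Rintegral|exact: Rintegral_density].
Qed.

(** On the half-line the density is rho0(s) s^m, except at s = 0 for m = 0. *)
Lemma Rintegral_mass_halfline (A : set RR) (f g : RR -> R) : measurable A ->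
  measurable_fun setT f -> (forall s, A s -> 0 <= s /\ g s = f s * (rho0 s * s ^+ m)) ->
  \int[mass_measure]_(s in A) f s = \int[leb]_(s in A) g s.
Proof.
move=> mA mf gE; rewrite Rintegral_mkcond [RHS]Rintegral_mkcond.
have mfA : measurable_fun setT (f \_ A) by apply/(measurable_restrictT _ _).1 => //; exact: measurable_funTS.
have mP : measurable_fun setT ((fun s => rho0 `|s| * s ^+ m) : RR -> R).
  by apply: measurable_funM; [exact: measurable_rho0|exact: measurable_funX].
rewrite Rintegral_mass//.
transitivity (\int[leb]_s ((f \_ A) s * (rho0 `|s| * s ^+ m))).
  apply: ae_eq_Rintegral => //.
  - by apply: measurable_funM => //; exact: measurable_mass_density.
  - exact: measurable_funM.
  exists [set 0]; split; [exact: measurable_set1|exact: lebesgue_measure_set1|].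
  move=> s /= ns; apply: contrapT => s0; apply: ns => _.
  rewrite patchE; case: ifPn => [/set_mem/gE[s_ge0 _]|_]; last by rewrite !mul0r.
  rewrite /mass_density /radial_weight lt_neqAle s_ge0 eq_sym andbT.
  by case: eqP s0.
apply: eq_Rintegral => s _; rewrite !patchE; case: ifPn => [/set_mem/gE[s0 ->]|_]; last by rewrite mul0r.
by rewrite ger0_norm.
Qed.

(** Only the values on the half-line are given; a constant extension keeps u0
continuous. *)
Definition velocity0 (s : R) : R := u0 (Num.max s 0).

Lemma continuous_velocity0 : continuous velocity0.
Proof.
have [/subspace_continuousP cu _] := u0_C1.
have max_ge0 (y : R) : 0 <= Num.max y 0 by rewrite le_max lexx orbT.
have itv_max (y : R) : `[0, +oo[%classic (Num.max y 0) by rewrite /= in_itv/= andbT max_ge0.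
move=> x; apply: (@cvg_comp _ _ _ (fun s : R => Num.max s 0) u0 _ (within `[0, +oo[ (nbhs (Num.max x 0)))).
  have cmax : Num.max y 0 @[y --> x] --> Num.max x 0.
    by apply: continuous_max; [exact: cvg_id|exact: cvg_cst].
  move=> P hP; have := cmax _ hP; rewrite !nbhs_simpl /=; apply: filterS => y h.
  exact: h (itv_max y).
by apply: cu; exact: itv_max.
Qed.

Local Notation mu := mass_measure.
Local Notation u := velocity0.

Lemma enclosed_mass_E0 s : enclosed_mass mu s = E0 n rho0 s.
Proof.
rewrite /enclosed_mass /E0 -[LHS]mul1r -Rintegral_cst//.
apply: (@Rintegral_mass_halfline `[0, s]%classic (fun=> 1)) => //.
by move=> x /=; rewrite in_itv/= => /andP[x0 _]; rewrite mul1r mulrC.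
Qed.

Lemma label_potentialE r t y : label_potential mu kappa u r t y = Q_primitive n kappa rho0 u0 r t y.
Proof.
rewrite /label_potential /Q_primitive.
apply: (@Rintegral_mass_halfline `[0, y]%classic (fun s => free_position mu kappa u t s - r)) => //.
  apply: measurable_funB => //.
  by apply: measurable_free_position; exact: continuous_velocity0.
move=> s /=; rewrite in_itv/= => /andP[s0 _]; split => //.
by rewrite /Q /free_position enclosed_mass_E0 /velocity0 (max_l s0) [s ^+ m * _]mulrC.
Qed.

Lemma minimizersE r t : minimizers mu kappa u r t = Q_minimizers n kappa rho0 u0 r t.
Proof.
apply/seteqP; split => y [y0 hy]; split => // z z0.
  by rewrite -!label_potentialE; exact: hy.
by rewrite !label_potentialE; exact: hy.
Qed.

Lemma label_setE r t : label_set mu kappa u r t = labels n kappa rho0 u0 r t.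
Proof. by rewrite /label_set /labels /label_sup /y_sup minimizersE. Qed.

Lemma R_funE t r : R_fun n kappa rho0 u0 t r = \int[mu]_(s in label_set mu kappa u r t) 1.
Proof.
rewrite /R_fun -label_setE; apply/esym/Rintegral_mass_halfline => //.
  exact: measurable_label_set.
by move=> s [s0 _]; rewrite mul1r.
Qed.

Lemma M_funE t r : M_fun n kappa rho0 u0 t r =
  \int[mu]_(s in label_set mu kappa u r t) label_velocity mu kappa u t s.
Proof.
rewrite /M_fun -label_setE; apply/esym/Rintegral_mass_halfline.
- exact: measurable_label_set.
- by apply: measurable_label_velocity; exact: continuous_velocity0.
move=> s [s0 _]; split=> //.
by rewrite /label_velocity enclosed_mass_E0 /velocity0 (max_l s0) [RHS]mulrA [_ * rho0 s]mulrC.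
Qed.

(** Polar coordinates, with the radial factor rho0(r) r^m absorbed into the mass of
the labels. *)
Lemma initial_integral (g : rV -> R) (C : R) : measurable_fun setT g -> (forall x, `|g x| <= C) ->
  \int[vol]_x (g x * rho0 (enorm x)) = \int[(mu \x cone)%E]_p g (p.1 *: dir p.2).
Proof.
move=> mg gC; have C0 : 0 <= C := le_trans (normr_ge0 _) (gC 0).
have mrho : measurable_fun setT (fun x : rV => rho0 (enorm x)).
  by apply/measurable_EFinP; exact: measurable_int rho0_L1.
have mf : measurable_fun setT (fun x : rV => g x * rho0 (enorm x)) by exact: measurable_funM.
have fi : vol.-integrable setT (EFin \o (fun x : rV => g x * rho0 (enorm x))).
  apply: (le_integrable _ _ _ (integrableZl measurableT C rho0_L1)) => //; first exact/measurable_EFinP.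
  by move=> x _; rewrite /= lee_fin !normrM ler_wpM2r// (ger0_norm C0).
pose f (x : rV) := g x * rho0 (enorm x).
have mray' : measurable_fun setT (fun q : rV * RR => q.2 *: dir q.1).
  by apply: measurable_scale => //; exact: (measurableT_comp (@measurable_dir R n)).
have [_ e1] := @Rintegral_prod _ _ _ _ R (radial_measure m) cone _ (integrable_polar (f := f) fi).
have e0 := Rintegral_polar (f := f) mf.
have mray : measurable_fun setT (fun p : RR * rV => g (p.1 *: dir p.2)).
  apply: (measurableT_comp mg (g := fun p : RR * rV => p.1 *: dir p.2)).
  by apply: measurable_scale => //; exact: (measurableT_comp (@measurable_dir R n)).
have gi : (mu \x cone)%E.-integrable setT (EFin \o (fun p : RR * rV => g (p.1 *: dir p.2))).
  apply: (@integrable_le_cst _ _ _ (mu \x cone)%E _ _ C) => //.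
  exact: (finite_product_lty mu cone measurableT).
have [_ e2] := Rintegral_prod gi.
transitivity (\int[cone]_y \int[radial_measure m]_r f (r *: dir y)).
  exact: (etrans e0 e1).
transitivity (\int[cone]_y \int[mu]_s g (s *: dir y)); last exact/esym/e2.
apply: ae_eq_Rintegral.
- by [].
- apply: (@measurable_fun_Rintegral _ _ _ _ _ (radial_measure m) (fun q : rV * RR => f (q.2 *: dir q.1))).
  exact: (measurableT_comp mf mray').
- apply: (@measurable_fun_Rintegral _ _ _ _ _ mu (fun q : rV * RR => g (q.2 *: dir q.1))).
  exact: (measurableT_comp mg mray').
exists [set 0]; split; [exact: measurable_set0|exact: cone_measure_set0|].
move=> y /= ny; apply: contrapT => y0'; apply: ny => _.
have y0 : y != 0 by apply/eqP.
have mline : measurable_fun setT (fun r : RR => r *: dir y) by apply: measurable_scale.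
transitivity (\int[leb]_r (f (r *: dir y) * radial_weight m r)).
  exact: (Rintegral_density _ _ (measurableT_comp mf mline)).
transitivity (\int[leb]_r (g (r *: dir y) * mass_density r)); last first.
  exact/esym/(Rintegral_mass (measurableT_comp mg mline)).
apply: eq_Rintegral => r _; rewrite /f /mass_density mulrA; congr (_ * rho0 _ * _).
by rewrite enormZ enorm_dir// mulr1.
Qed.

End initial_mass.

(** * The weak solution *)

Section solution.
Context {R : realType} (m : nat) (kappa : R) (rho0 u0 : R -> R).
Local Notation n := m.+1.
Local Notation rV := 'rV[R]_n.
Local Notation RR := (measurableTypeR R).
Local Notation vol := (@lebesgue_rV R n).
Local Notation leb := (@lebesgue_measure R).
Local Notation cone := (@cone_measure R n).
Context (rho0_ge0 : forall r : R, 0 <= r -> 0 <= rho0 r).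
Context (rho0_L1 : vol.-integrable setT (fun x : rV => (rho0 (enorm x))%:E)).
Context (u0_C1 : C1_halfline u0).
Context (y_defined : forall r t : R, 0 < r -> 0 <= t -> Q_minimizers n kappa rho0 u0 r t !=set0).

Local Notation mu := (mass_measure rho0_ge0 rho0_L1).
Local Notation u := (velocity0 u0).
Local Notation X := (position mu kappa u).
Local Notation w := (velocity_field mu kappa u).
Local Notation v := (label_velocity mu kappa u).

Let mu_set1 := mass_measure_set1 rho0_ge0 rho0_L1.
Let mu_neg := mass_measure_neg rho0_ge0 rho0_L1.
Let u_continuous := continuous_velocity0 u0_C1.

Let minimizers_exist (r t : R) : 0 < r -> 0 <= t -> minimizers mu kappa u r t !=set0.
Proof. by move=> r0 t0; rewrite minimizersE//; exact: y_defined. Qed.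

Let measurable_X : measurable_fun setT (fun p : RR * RR => X p.1 p.2 : RR).
Proof. exact: (measurable_position u_continuous minimizers_exist). Qed.

Let X_ge0 s t : 0 <= X s t.
Proof. exact: (position_ge0 u_continuous minimizers_exist). Qed.

Let measurable_w : measurable_fun setT (fun p : RR * RR => w p.1 p.2 : RR).
Proof. exact: (measurable_velocity_field u_continuous minimizers_exist). Qed.

Let measurable_X_at t : measurable_fun setT (fun s : RR => X s t : RR).
Proof.
by apply: (measurableT_comp measurable_X (g := fun s : RR => (s, t : RR))); exact: measurable_fun_pair.
Qed.

Let X_lipschitz (B T : R) : 0 < B -> 0 < T -> exists2 U, 0 <= U &
  forall s t t', 0 <= t -> t <= T -> 0 <= t' -> t' <= T -> X s t < B ->
    X s t' <= X s t + U * `|t' - t|.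
Proof. exact: (position_locally_lipschitz u_continuous minimizers_exist). Qed.

Let X_derivative : {ae leb, forall t : R, 0 < t -> {ae mu, forall s : RR,
  forall e : R, 0 < e -> exists2 d : R, 0 < d & forall h : R, 0 < h -> h <= d ->
    `|X s (t + h) - X s t - h * (if X s t == 0 then 0 else w (X s t) t)| <= h * e}}.
Proof.
apply: aeS (good_time_ae u_continuous minimizers_exist) => t good /good gt.
exact: (position_derivative mu_set1 mu_neg u_continuous minimizers_exist gt).
Qed.

Let velocity_bounds (B T : R) : 0 < B -> 0 < T -> exists2 U, 0 <= U &
  {ae mu, forall s : RR, forall t, 0 <= t -> t <= T -> X s t < B ->
    `|v t s| <= U /\ `|w (X s t) t| <= U}.
Proof.
move=> B0 T0.
have [U U0 hU] := velocity_field_bound mu_set1 mu_neg u_continuous minimizers_exist B0 T0.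
exists U => //; apply: aeS (support_label_ae mu_set1 mu_neg) => s ss t t0 tT XB.
exact: hU.
Qed.

Let field_bounds (B T : R) : 0 < B -> 0 < T -> exists2 U, 0 <= U &
  {ae mu, forall s : RR, forall t, 0 <= t -> t <= T -> X s t < B -> `|w (X s t) t| <= U}.
Proof.
move=> B0 T0; have [U U0 hU] := velocity_bounds B0 T0; exists U => //.
by apply: aeS hU => s h t t0 tT XB; have [] := h t t0 tT XB.
Qed.

Let velocity_at_bounds t B : 0 <= t -> 0 < B -> exists2 U, 0 <= U &
  {ae mu, forall s : RR, X s t < B -> `|v t s| <= U /\ `|w (X s t) t| <= U}.
Proof.
move=> t0 B0; have t1 : 0 < t + 1 by rewrite ltr_wpDl.
have [U U0 hU] := velocity_bounds B0 t1; exists U => //.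
by apply: aeS hU => s h; apply: h => //; rewrite lerDl.
Qed.

Definition solution_density : R.-ker RR ~> rV := density m mu measurable_X.
Definition solution_radial : R.-ker RR ~> RR := radial_density mu measurable_X.

(** Both distribution functions are of this form: the field g carried by the
positions and the quantity f carried by the labels have the same means over the
blocks. *)
Lemma solution_distribution (f g : R -> R) t : 0 <= t ->
  measurable_fun setT (g : RR -> RR) -> measurable_fun setT (f : RR -> RR) ->
  (forall B, 0 < B -> exists2 U, 0 <= U & {ae mu, forall s : RR, X s t < B -> `|f s| <= U}) ->
  (forall B, 0 < B -> exists2 U, 0 <= U & {ae mu, forall s : RR, X s t < B -> `|g (X s t)| <= U}) ->
  (forall psi : R -> R, test_function psi ->
    \int[mu]_s (psi (X s t) * g (X s t)) = \int[mu]_s (psi (X s t) * f s)) ->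
  distr_derivative (solution_radial t) g
    (fun r => \int[mu]_(s in label_set mu kappa u r t) f s).
Proof.
move=> t0 mg mf fb gb gf psi tp; have {}gf := gf psi tp.
have [_ i2 e] := label_distribution mu_set1 mu_neg u_continuous minimizers_exist t0 mf fb tp.
have mgX : measurable_fun setT ((fun s => g (X s t)) : RR -> RR) by exact: (measurableT_comp mg (measurable_X_at t)).
have [i1 _ _] := label_distribution mu_set1 mu_neg u_continuous minimizers_exist t0 mgX gb tp.
have [cpsi _ _] := test_function_C1 tp.
have mpg : measurable_fun setT ((fun r => psi r * g r) : RR -> R).
  by apply: measurable_funM => //; exact: continuous_measurable_fun.
have halfline : (fun s => X s t) @^-1` `[0, +oo[ = setT.
  by apply/seteqP; split => s //= _; rewrite in_itv/= X_ge0.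
split => //.
- apply: integrable_pushforward_kernel => //.
  by rewrite halfline.
- rewrite -e -gf.
  transitivity (\int[mu]_(s in (fun s => X s t) @^-1` `[0, +oo[) (psi (X s t) * g (X s t))).
    exact: Rintegral_pushforward_kernel.
  by rewrite halfline.
Qed.

Lemma distr_derivative_R t : 0 <= t ->
  distr_derivative (solution_radial t) (fun=> 1) (R_fun n kappa rho0 u0 t).
Proof.
move=> t0; rewrite (_ : R_fun n kappa rho0 u0 t = fun r => \int[mu]_(s in label_set mu kappa u r t) 1).
  apply: solution_distribution => //.
  - by move=> B B0; exists 1 => //; apply: aeW => s _; rewrite normr1.
  - by move=> B B0; exists 1 => //; apply: aeW => s _; rewrite normr1.
by apply/funext => r; exact: R_funE.
Qed.

Lemma distr_derivative_M t : 0 <= t ->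
  distr_derivative (solution_radial t) (w ^~ t) (M_fun n kappa rho0 u0 t).
Proof.
move=> t0; rewrite (_ : M_fun n kappa rho0 u0 t = fun r => \int[mu]_(s in label_set mu kappa u r t) v t s).
  apply: solution_distribution => //.
  - apply: (measurableT_comp measurable_w (g := fun r : RR => (r, t : RR))).
    exact: measurable_fun_pair.
  - by apply: measurable_label_velocity; exact: u_continuous.
  - move=> B B0; have [U U0 hU] := velocity_at_bounds t0 B0; exists U => //.
    by apply: aeS hU => s h XB; have [] := h XB.
  - move=> B B0; have [U U0 hU] := velocity_at_bounds t0 B0; exists U => //.
    by apply: aeS hU => s h XB; have [] := h XB.
  move=> psi tp; have [cpsi _ _] := test_function_C1 tp.
  have [B B0 hB] := support_bounded tp; have [C C0 hC] := test_function_bounded tp.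
  have B10 : 0 < B + 1 by rewrite addr_gt0.
  have far r : B + 1 <= r -> psi r = 0.
    move=> Br; apply: vanishes_off_support; apply: hB.
    rewrite ger0_norm; first by apply: lt_le_trans Br; rewrite ltrDl.
    by apply: le_trans Br; rewrite addr_ge0// ltW.
  have mpsi : measurable_fun setT (psi : RR -> R) by exact: continuous_measurable_fun.
  have psiX : {ae mu, forall s : R, `|psi (X s t)| <= C} by apply: aeW => s; exact: hC.
  have [_ e] := velocity_field_test mu_set1 mu_neg u_continuous minimizers_exist t0 B10 mpsi far C0 psiX.
  transitivity (\int[mu]_s (w (X s t) t * psi (X s t))).
    by apply: eq_Rintegral => s _; rewrite mulrC.
  by rewrite e; apply: eq_Rintegral => s _; rewrite mulrC.
by apply/funext => r; exact: M_funE.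
Qed.

Lemma initial_place_ae : {ae (mu \x cone)%E, forall p : RR * rV,
  p.2 != 0 /\ 0 < p.1 /\ place X 0 p = p.1 *: dir p.2}.
Proof.
have good : {ae mu, forall s : RR, 0 < s /\ X s 0 = s}.
  apply: aeS2 (mass_measure_gt0_ae rho0_ge0 rho0_L1) (support_label_ae mu_set1 mu_neg) => s s0 ss.
  by split => //; exact: (position0 u_continuous minimizers_exist).
apply: aeS2 (ae_fst cone good) (ae_snd mu (cone_nonzero m)) => p [p1 e] p2.
by split=> //; split => //; rewrite /place e.
Qed.

Let measurable_trace (phi : rV * R -> R) : continuous phi ->
  measurable_fun setT (fun x : rV => phi (x, 0) : R).
Proof.
move=> c; apply: (measurableT_comp (measurable_continuous_rVR c) (g := fun x : rV => (x, 0 : RR))).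
exact: measurable_fun_pair.
Qed.

Let measurable_polar : measurable_fun setT (fun p : RR * rV => p.1 *: dir p.2).
Proof. by apply: measurable_scale => //; exact: (measurableT_comp (@measurable_dir R n)). Qed.

Let measurable_initial_trace (phi : rV * R -> R) : continuous phi ->
  measurable_fun setT (fun p : RR * rV => phi (place X 0 p, 0) : R).
Proof.
move=> c; exact: (measurableT_comp (measurable_trace c) (measurable_place_at measurable_X 0)).
Qed.

Lemma initial_mass (phi : rV * R -> R) : test_function phi ->
  \int[vol]_x (phi (x, 0) * rho0 (enorm x)) = \int[(mu \x cone)%E]_p phi (place X 0 p, 0).
Proof.
move=> tp; have [c _ _] := test_function_C1 tp; have [C C0 hC] := test_function_bounded tp.
transitivity (\int[(mu \x cone)%E]_p phi (p.1 *: dir p.2, 0)).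
  exact: (initial_integral rho0_ge0 rho0_L1 (g := fun x => phi (x, 0)) (measurable_trace c) (fun x => hC (x, 0))).
apply: ae_eq_Rintegral; first by [].
- exact: (measurableT_comp (measurable_trace c) measurable_polar).
- exact: measurable_initial_trace.
by apply: aeS initial_place_ae => p [_ [_ ->]] _.
Qed.

Lemma initial_momentum (phi : rV * R -> R) (i : 'I_n) : test_function phi ->
  \int[vol]_x (phi (x, 0) * (rho0 (enorm x) * u0 (enorm x) * dir x 0 i)) =
  \int[(mu \x cone)%E]_p (dir p.2 0 i * u p.1 * phi (place X 0 p, 0)).
Proof.
move=> tp; have [c _ _] := test_function_C1 tp; have [C C0 hC] := test_function_bounded tp.
have [B B0 hB] := test_function_region tp.
have [U U0 hU] := u_bounded u_continuous 0 B.
have mu_ : measurable_fun setT (u : RR -> R) by exact: continuous_measurable_fun.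
have mdir : measurable_fun setT (fun x : rV => dir x 0 i : R).
  by apply: (measurableT_comp (measurable_coor i)); exact: measurable_dir.
pose g (x : rV) : R := phi (x, 0) * (u (enorm x) * dir x 0 i).
have mg : measurable_fun setT g.
  apply: measurable_funM; first exact: measurable_trace.
  by apply: measurable_funM => //; apply: (measurableT_comp mu_); exact: measurable_enorm.
have gC x : `|g x| <= C * U.
  have [xB|Bx] := leP (enorm x) B; last first.
    rewrite /g (_ : phi (x, 0) = 0) ?mul0r ?normr0 ?mulr_ge0//.
    by apply: vanishes_off_support; apply: hB; left; exact: ltW.
  rewrite normrM; apply: ler_pM => //; rewrite normrM -[leRHS]mulr1; apply: ler_pM => //.
    by apply: hU; rewrite enorm_ge0.
  exact: coor_dir.
transitivity (\int[vol]_x (g x * rho0 (enorm x))).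
  apply: eq_Rintegral => x _; rewrite /g /velocity0 (max_l (enorm_ge0 x)); ring.
transitivity (\int[(mu \x cone)%E]_p g (p.1 *: dir p.2)).
  exact: (initial_integral rho0_ge0 rho0_L1 mg gC).
apply: ae_eq_Rintegral; first by [].
- exact: (measurableT_comp mg measurable_polar).
- apply: measurable_funM; last exact: measurable_initial_trace.
  apply: measurable_funM; first by apply: (measurableT_comp mdir).
  by apply: (measurableT_comp mu_).
apply: aeS initial_place_ae => p [p2 [p1 ->]] _.
rewrite /g enorm_scale_dir ?(ltW p1)// dir_scale_dir//; ring.
Qed.

Lemma weak_solution : weak_radial_solution kappa rho0 u0 solution_density solution_radial w.
Proof.
split.
- by move=> t _ A mA; exact: density_radial.
- exact: measurable_w.
- move=> B T; exists (fine ((mu \x cone)%E setT)) => t _.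
  by apply: density_le; exact: measurable_eball.
- exact: (energy_finite m measurable_X X_ge0 measurable_w field_bounds).
- move=> phi tp; rewrite (initial_mass tp).
  have := mass_balance measurable_X X_ge0 measurable_w X_lipschitz X_derivative tp field_bounds.
  by move=> e; apply/eqP; rewrite addr_eq0; apply/eqP.
- move=> i phi tp; rewrite (initial_momentum i tp).
  have measurable_E : measurable_fun setT (enclosed_mass mu : RR -> RR) by exact: measurable_enclosed_mass.
  have E_le s : `|enclosed_mass mu s| <= total_mass mu.
    by rewrite ger0_norm ?enclosed_mass_ge0// enclosed_mass_le.
  have measurable_u' : measurable_fun setT (u : RR -> RR) by exact: continuous_measurable_fun.
  have e := momentum_balance measurable_X X_ge0 measurable_w X_lipschitz X_derivative
    measurable_u' measurable_E E_le velocity_bounds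
    (velocity_field_test mu_set1 mu_neg u_continuous minimizers_exist)
    (average_mass_test mu_set1 mu_neg u_continuous minimizers_exist) i tp.
  by apply/eqP; rewrite -subr_eq0 opprK addrAC -[_ + _ in X in X + _]/(_ + _) e addNr.
- move=> t t0; exists (fun r => \int[mu]_s green_kernel m (X s t) r); split.
  + move=> a b a0 ab; rewrite (potential_increment m mu (measurable_X_at t) (X_ge0^~ t) a0 ab).
    by apply: eq_Rintegral => r _; rewrite electric_field_radial_density.
  + move=> phi tp; have [c _ _] := test_function_C1 tp.
    have [i e] := potential_laplacian mu (measurable_X_at t) (X_ge0^~ t) tp.
    split; first exact: i.
    rewrite e; apply/esym/Rintegral_flow_density.
    exact: measurable_continuous_rV.
Qed.

End solution.

Theorem theorem1p3 (R : realType) (n : nat) (n_ge1 : (1 <= n)%N) (kappa : R)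
  (rho0 u0 : R -> R)
  (rho0_ge0 : forall r : R, 0 <= r -> 0 <= rho0 r)
  (rho0_L1 : (lebesgue_rV n).-integrable setT
     (fun x : 'rV[R]_n => (rho0 (enorm x))%:E))
  (u0_C1 : C1_halfline u0)
  (y_defined : forall r t : R, 0 < r -> 0 <= t ->
     Q_minimizers n kappa rho0 u0 r t !=set0) :
  exists (rho : R.-ker (measurableTypeR R) ~> 'rV[R]_n)
         (sigma : R.-ker (measurableTypeR R) ~> (measurableTypeR R))
         (w : R -> R -> R),
    weak_radial_solution kappa rho0 u0 rho sigma w /\
    forall t : R, 0 <= t ->
      distr_derivative (sigma t) (fun=> 1) (R_fun n kappa rho0 u0 t) /\
      distr_derivative (sigma t) (w ^~ t) (M_fun n kappa rho0 u0 t).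
Proof.
move: n_ge1 rho0_L1 y_defined; case: n => [//|m] _ rho0_L1 y_defined.
exists (solution_density rho0_ge0 rho0_L1 u0_C1 y_defined).
exists (solution_radial rho0_ge0 rho0_L1 u0_C1 y_defined).
exists (velocity_field (mass_measure rho0_ge0 rho0_L1) kappa (velocity0 u0)).
split; first exact: weak_solution.
by move=> t t0; split; [exact: distr_derivative_R|exact: distr_derivative_M].
Qed.
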